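(* Let $K$ be a totally real number field of degree $g$ over $\mathbb{Q}$ with ring of integers $\mathcal{O}_K$, and let $\sigma_1,\dots,\sigma_g$ be the embeddings of $K$ into $\mathbb{R}$. Let $p$ and $q$ be nonnegative integers whose sum is less than or equal to $g$. Let $\mathbf{z}=(z_1,\dots,z_g)\in\mathfrak{h}^g$, and let $X_{\mathbf{z}}=\mathbb{C}^g/\Lambda_{\mathbf{z}}$, where $$\Lambda_{\mathbf{z}}=\{(z_1\sigma_1(\alpha)+\sigma_1(\beta),\dots,z_g\sigma_g(\alpha)+\sigma_g(\beta)) : \alpha,\beta\in\mathcal{O}_K\}\subseteq\mathbb{C}^g.$$ Then the complex torus $X_{\mathbf{z}}$ admits line bundles $L$ and $M$ such that $L$, $M$, and $L\otimes M$ are non-degenerate, $\mathrm{i}(L)=p$, $\mathrm{i}(M)=q$, and $\mathrm{i}(L\otimes M)=p+q$.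
   Context: $\mathfrak{h}$ denotes the upper half plane. $\Lambda_{\mathbf{z}}$ is a lattice in $\mathbb{C}^g$, so $X_{\mathbf{z}}$ is a complex torus. A line bundle $L$ is non-degenerate if its Euler characteristic $\chi(L)$ is nonzero. A non-degenerate line bundle $L$ on an abelian variety $X$ has exactly one nonzero cohomology group (Mumford); the index $\mathrm{i}(L)$ denotes the unique integer $j$ for which $H^j(X,L)\neq 0$. *)

(* Defs.v *)
From HB Require Import structures.
From mathcomp Require Import all_boot all_order all_algebra all_field.
From mathcomp Require Import all_classical all_reals all_analysis.
From mathcomp Require Import complex.

Set Implicit Arguments.
Unset Strict Implicit.
Unset Printing Implicit Defensive.

Import Order.TTheory GRing.Theory Num.Theory.
Import numFieldNormedType.Exports.

Local Open Scope classical_set_scope.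
Local Open Scope ring_scope.
Local Open Scope quotient_scope.

(* R[i] behind a constant of type numClosedFieldType, so that the topology and
   the normed module structure of mathcomp-analysis are inferred on C and C^g. *)
Definition Cplx (R : realType) : numClosedFieldType := R[i].

Section Torus.
Variables (R : realType) (g : nat).
Local Notation C := (Cplx R).

(* Defined for any subgroup Lam of C^g; a complex torus when Lam is a lattice. *)
Definition torus (Lam : zmodClosed 'rV[C]_g) : Type :=
  quotient_topology (Quotient.quot Lam).

HB.instance Definition _ (Lam : zmodClosed 'rV[C]_g) :=
  Topological.on (torus Lam).

Variable Lam : zmodClosed 'rV[C]_g.
Local Notation X := (torus Lam).

Definition torus_proj (v : 'rV[C]_g) : X := \pi_(Quotient.quot Lam) v.

(* [differentiable] is Frechet differentiability over the field C, so on an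
   open set W this is holomorphy for the complex structure that X inherits
   from C^g. *)
Definition holomorphic_on (W : set X) (f : X -> C) : Prop :=
  forall v : 'rV[C]_g, W (torus_proj v) -> differentiable (f \o torus_proj) v.

(* A holomorphic line bundle presented by local trivializations over an open
   covering, glued by a holomorphic cocycle of transition functions. A
   function attached to an open set is a total function on X of which only the
   values on that open set are meaningful. *)
Record line_bundle := LineBundle {
  lb_index : Type;
  lb_open : lb_index -> set X;
  lb_trans : lb_index -> lb_index -> X -> C;
  lb_open_open : forall i, open (lb_open i);
  lb_cover : forall x, exists i, lb_open i x;
  lb_trans_holo : forall i j,
    holomorphic_on (lb_open i `&` lb_open j) (lb_trans i j);
  lb_trans_neq0 : forall i j x,
    lb_open i x -> lb_open j x -> lb_trans i j x != 0;
  lb_cocycle : forall i j k x, lb_open i x -> lb_open j x -> lb_open k x ->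
    lb_trans i k x = lb_trans i j x * lb_trans j k x }.

Section Tensor.
Variables L M : line_bundle.

Let I := (lb_index L * lb_index M)%type.
Let O (a : I) := lb_open a.1 `&` lb_open a.2.
Let t (a b : I) (x : X) := lb_trans a.1 b.1 x * lb_trans a.2 b.2 x.

Fact tensor_open a : open (O a).
Proof. by apply: openI; exact: lb_open_open. Qed.

Fact tensor_cover x : exists a, O a x.
Proof.
by have [i Li] := lb_cover L x; have [j Mj] := lb_cover M x; exists (i, j).
Qed.

Fact tensor_holo a b : holomorphic_on (O a `&` O b) (t a b).
Proof.
move=> v [[La Ma] [Lb Mb]].
have dL : differentiable (lb_trans a.1 b.1 \o torus_proj) v.
  exact: lb_trans_holo.
have dM : differentiable (lb_trans a.2 b.2 \o torus_proj) v.
  exact: lb_trans_holo.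
exact: differentiableM dL dM.
Qed.

Fact tensor_neq0 a b x : O a x -> O b x -> t a b x != 0.
Proof.
by move=> [La Ma] [Lb Mb]; rewrite mulf_neq0// lb_trans_neq0.
Qed.

Fact tensor_cocycle a b c x : O a x -> O b x -> O c x ->
  t a c x = t a b x * t b c x.
Proof.
move=> [La Ma] [Lb Mb] [Lc Mc]; rewrite /t mulrACA.
by rewrite -lb_cocycle// -lb_cocycle.
Qed.

Definition tensor : line_bundle :=
  LineBundle tensor_open tensor_cover tensor_holo tensor_neq0 tensor_cocycle.

End Tensor.

Section Cohomology.
Variable L : line_bundle.

(* Holomorphic sections of L over W, in the trivializations of L. *)
Definition is_section (W : set X) (s : lb_index L -> X -> C) : Prop :=
  (forall i, holomorphic_on (W `&` lb_open i) (s i)) /\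
  (forall i j x, W x -> lb_open i x -> lb_open j x ->
     s i x = lb_trans i j x * s j x).

(* The cohomology of the sheaf of sections of L is the direct limit of Cech
   cohomology over open coverings. As in Godement, coverings are indexed by
   the points of X, with x in U x: these are cofinal among all coverings, and
   V refines U when V x is included in U x for all x, so that the refinement
   maps are plain restrictions. *)
Definition is_covering (U : X -> set X) : Prop :=
  forall x, open (U x) /\ U x x.

Definition refines (V U : X -> set X) : Prop := forall x, V x `<=` U x.

Definition cochain (p : nat) : Type :=
  ('I_p.+1 -> X) -> lb_index L -> X -> C.

Definition overlap p (U : X -> set X) (s : 'I_p.+1 -> X) : set X :=
  [set x | forall k, U (s k) x].

Definition is_cochain p (U : X -> set X) (c : cochain p) : Prop :=
  forall s, is_section (overlap U s) (c s).

Definition cochain_eq p (U : X -> set X) (b c : cochain p) : Prop :=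
  forall s i x, overlap U s x -> lb_open i x -> b s i x = c s i x.

Definition cochain0 p : cochain p := fun _ _ _ => 0.

Definition cech_d p (c : cochain p) : cochain p.+1 := fun s i x =>
  \sum_(k < p.+2) (-1) ^+ k * c (fun l => s (lift k l)) i x.

Definition is_cocycle p (U : X -> set X) (c : cochain p) : Prop :=
  is_cochain U c /\ cochain_eq U (cech_d c) (@cochain0 p.+1).

Definition is_coboundary p (U : X -> set X) : cochain p -> Prop :=
  match p with
  | 0 => fun c => cochain_eq U c (@cochain0 0)
  | q.+1 => fun c => exists2 b : cochain q,
      is_cochain U b & cochain_eq U c (cech_d b)
  end.

Definition null_class p (U : X -> set X) (c : cochain p) : Prop :=
  exists V, [/\ is_covering V, refines V U & is_coboundary V c].

(* H^p(X, L) <> 0 *)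
Definition H_neq0 (p : nat) : Prop :=
  exists U (c : cochain p),
    [/\ is_covering U, is_cocycle U c & ~ null_class U c].

Definition lincomb p n (a : 'I_n -> C) (b : 'I_n -> cochain p) : cochain p :=
  fun s i x => \sum_(k < n) a k * b k s i x.

(* dim H^p(X, L) = n: the classes of n cocycles, which may be taken over a
   common covering, form a basis. *)
Definition H_dim (p n : nat) : Prop :=
  exists U (b : 'I_n -> cochain p),
    [/\ is_covering U,
        forall k, is_cocycle U (b k),
        forall a, null_class U (lincomb a b) -> forall k, a k = 0 &
        forall V (c : cochain p), is_covering V -> is_cocycle V c ->
          exists a, null_class (fun x => U x `&` V x)
            (fun s i x => c s i x - lincomb a b s i x)].

(* chi(L) = sum_j (-1)^j dim H^j(X, L), as a relation: it holds of no chi unless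
   all the H^j are finite dimensional and vanish for large j. *)
Definition euler_char (chi : int) : Prop :=
  exists (h : nat -> nat) (N : nat),
    [/\ forall j, H_dim j (h j),
        forall j, (N <= j)%N -> h j = 0%N &
        chi = \sum_(j < N) (-1) ^+ j * (h j)%:Z].

Definition non_degenerate : Prop :=
  exists2 chi, euler_char chi & chi != 0.

(* j is the unique degree with H^j(X, L) <> 0. *)
Definition has_index (j : nat) : Prop := unique H_neq0 j.

End Cohomology.

End Torus.

Definition totally_real (R : realType) (K : fieldExtType rat) : Prop :=
  forall (tau : {rmorphism K -> R[i]}) (x : K), complex.Im (tau x) = 0.

Definition in_ring_of_integers (K : fieldExtType rat) (x : K) : Prop :=
  integralOver (intr : int -> K) x.

Section Lattice.
Variables (R : realType) (K : fieldExtType rat) (g : nat).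
Variables (sigma : 'I_g -> {rmorphism K -> R}) (z : 'I_g -> Cplx R).

Definition Lambda_vec (alpha beta : K) : 'rV[Cplx R]_g :=
  \row_i (z i * (sigma i alpha)%:C%C + (sigma i beta)%:C%C).

Definition in_Lambda (v : 'rV[Cplx R]_g) : bool :=
  `[< exists alpha beta : K, [/\ in_ring_of_integers alpha,
        in_ring_of_integers beta & v = Lambda_vec alpha beta] >].

Fact in_Lambda_zmod_closed : zmod_closed in_Lambda.
Proof.
pose toK : {rmorphism int -> K} := intr.
split=> [|u v /asboolP[a [b [ia ib ->]]] /asboolP[c [d [ic id ->]]]].
  apply/asboolP; exists 0, 0; split; [exact: (mxpoly.integral0 toK)..|].
  by apply/rowP => i; rewrite !mxE !rmorph0 mulr0 addr0.
apply/asboolP; exists (a - c), (b - d).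
split; [exact: (integral_sub (RtoK := toK))..|].
apply/rowP => i; rewrite !mxE !rmorphB /= mulrBr.
by rewrite opprD addrACA.
Qed.

HB.instance Definition _ :=
  GRing.isZmodClosed.Build 'rV[Cplx R]_g in_Lambda in_Lambda_zmod_closed.

Definition Lambda : zmodClosed 'rV[Cplx R]_g :=
  GRing.ZmodClosed.clone 'rV[Cplx R]_g in_Lambda _.

End Lattice.

(* Main.v *)
(* For a in O_K put c_i = pi sigma_i(a) / Im z_i, assumed nonzero. The exponentials
   e_lam(v) = exp(- i sum_i c_i l_i (2 v_i + l_i z_i / Im z_i)), l = Im lam, form a factor of
   automorphy because traces of algebraic integers are integers, and
   |e_lam(v)| = exp(phi(v + lam) - phi(v)) with phi(v) = sum_i c_i (Im v_i)^2. The tensor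
   product of the line bundles of a and b is the line bundle of a + b, and the index of
   the line bundle of a is the number of i with c_i < 0; so it suffices to choose a and b
   negative at disjoint sets of p and q places with a + b negative exactly at their union.

   The operators D_i = d/dconj(v_i) commute and are locally onto on the soft sheaf of smooth
   sections. On global sections, convolution along the i-th coordinate with a twisted
   Cauchy kernel of Gaussian decay gives G_i with D_i G_i = 1 if c_i > 0 and G_i D_i = 1 if
   c_i < 0. Adding the equations D_i = 0 one at a time, those with c_i > 0 preserve
   acyclicity and those with c_i < 0 raise the only nonzero degree by one. What remains is
   the space of global sections killed by D_i for c_i > 0, modulo the images of the D_i for
   c_i < 0. It is represented by the harmonic sections, those also killed by the covariant
   derivatives d/dv_i + 2 i c_i Im v_i for c_i < 0. Derivative estimates and compactness
   make their space finite dimensional, and it is nonzero when all |c_i| are large, since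
   the projector onto it then moves a periodized bump times a Gaussian very little at 0. *)
Require Import Defs.
From HB Require Import structures.
From mathcomp Require Import all_boot all_order all_algebra all_field.
From mathcomp Require Import all_classical all_reals all_analysis.
From mathcomp Require Import complex.
From mathcomp Require Import ring lra zify.

Set Implicit Arguments.
Unset Strict Implicit.
Unset Printing Implicit Defensive.

Import Order.TTheory GRing.Theory Num.Theory.
Import numFieldNormedType.Exports.
Import ComplexField.Normc.

Local Open Scope classical_set_scope.
Local Open Scope ring_scope.

(** All analysis is reduced to the integral [J] of continuous functions over [0, 1]. An integral
    over the plane is taken in polar coordinates with the half line compactified; by rapid decay its
    integrand extends continuously by 0, so it is an iterated [J], and neither Fubini nor dominated
    convergence is used. The Cauchy-Pompeiu formula becomes the fundamental theorem of calculus
    along the radius, because d/dz weighted by u and d/dconj(z) weighted by conj(u) have the same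
    mean over each circle. The kernels converge because a global section and all its derivatives are
    bounded by a polynomial times exp(phi), which follows from quasi-periodicity and the compactness
    of the torus. Sections of a line bundle are only assumed complex differentiable, so Goursat's
    theorem is needed to make them smooth. Adding the equations one at a time replaces the Dolbeault
    complex: each step is a short exact sequence 0 -> ker D_k -> F -> F -> 0 whose long exact
    sequence is followed by hand on Cech cochains, and harmonic representatives come from explicit
    Gaussian projectors instead of elliptic theory. *)

Lemma for_cont {T U : topologicalType} (f : T -> U) z :
  f x @[x --> nbhs z] --> f z -> {for z, continuous f}.
Proof. by []. Qed.

Lemma cvg_via {T : Type} {U V : topologicalType} (F : set_system T) (f : T -> U)
    (g : U -> V) (l : U) (m : V) :
  f x @[x --> F] --> l -> g x @[x --> nbhs l] --> m -> g (f x) @[x --> F] --> m.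
Proof. exact: cvg_comp. Qed.

(** * Complex numbers *)

Section ComplexBasics.
Variable R : realType.
Local Notation C := (Cplx R).

Definition rc (t : R) : C := real_complex R t.
Definition ci : C := ('i)%C.
Definition re (z : C) : R := complex.Re z.
Definition im (z : C) : R := complex.Im z.
Definition nrm (z : C) : R := normc z.

Lemma rc_is_zmod : zmod_morphism rc.
Proof. by move=> x y; rewrite /rc rmorphB. Qed.
Lemma rc_is_mon : monoid_morphism rc.
Proof. by split=> [|x y]; rewrite /rc ?rmorph1 ?rmorphM. Qed.
HB.instance Definition _ := GRing.isZmodMorphism.Build R C rc rc_is_zmod.
HB.instance Definition _ := GRing.isMonoidMorphism.Build R C rc rc_is_mon.

Lemma reD x y : re (x + y) = re x + re y. Proof. by case: x; case: y. Qed.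
Lemma imD x y : im (x + y) = im x + im y. Proof. by case: x; case: y. Qed.
Lemma reN x : re (- x) = - re x. Proof. by case: x. Qed.
Lemma imN x : im (- x) = - im x. Proof. by case: x. Qed.
Lemma reM x y : re (x * y) = re x * re y - im x * im y.
Proof. by case: x; case: y. Qed.
Lemma imM x y : im (x * y) = re x * im y + im x * re y.
Proof. by case: x; case: y. Qed.
Lemma re_rc t : re (rc t) = t. Proof. by []. Qed.
Lemma im_rc t : im (rc t) = 0. Proof. by []. Qed.
Lemma re_ci : re ci = 0. Proof. by []. Qed.
Lemma im_ci : im ci = 1. Proof. by []. Qed.
Lemma re0 : re 0 = 0. Proof. by []. Qed.
Lemma im0 : im 0 = 0. Proof. by []. Qed.
Lemma re1 : re 1 = 1. Proof. by []. Qed.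
Lemma im1 : im 1 = 0. Proof. by []. Qed.
Definition reimE := (reD, imD, reN, imN, reM, imM, re_rc, im_rc, re_ci, im_ci,
  re0, im0, re1, im1).
Lemma ciM : ci * ci = -1.
Proof. by rewrite -expr2 /ci sqr_i. Qed.
Lemma ci_neq0 : ci != 0.
Proof. by apply/eqP => -[] /eqP; rewrite oner_eq0. Qed.
Lemma cE z : z = rc (re z) + ci * rc (im z).
Proof. exact: complexE. Qed.
Lemma c_eq x y : re x = re y -> im x = im y -> x = y.
Proof. by case: x; case: y => a b c d /= -> ->. Qed.
Lemma rc_eq0 t : (rc t == 0) = (t == 0).
Proof. by apply/eqP/eqP => [[]|->]. Qed.

Lemma normE z : `|z| = rc (nrm z). Proof. by case: z. Qed.
Lemma nrmM x y : nrm (x * y) = nrm x * nrm y. Proof. exact: normcM. Qed.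
Lemma nrmD x y : nrm (x + y) <= nrm x + nrm y. Proof. exact: le_normcD. Qed.
Lemma nrmN x : nrm (- x) = nrm x. Proof. exact: normcN. Qed.
Lemma nrmB x y : nrm (x - y) = nrm (y - x). Proof. by rewrite -nrmN opprB. Qed.
Lemma nrmBD x y : nrm (x - y) <= nrm x + nrm y.
Proof. by rewrite -(nrmN y) nrmD. Qed.
Lemma nrm0 : nrm 0 = 0. Proof. exact: normc0. Qed.
Lemma nrm1 : nrm 1 = 1. Proof. exact: normc1. Qed.
Lemma nrm_ge0 z : 0 <= nrm z. Proof. by case: z => a b; exact: sqrtr_ge0. Qed.
Lemma nrm_eq0 z : (nrm z == 0) = (z == 0).
Proof. by apply/eqP/eqP => [/eq0_normc|->]; rewrite ?nrm0. Qed.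
Lemma nrm_gt0 z : (0 < nrm z) = (z != 0).
Proof. by rewrite lt0r nrm_ge0 nrm_eq0 andbT. Qed.
Lemma nrmV z : nrm z^-1 = (nrm z)^-1. Proof. exact: normcV. Qed.
Lemma nrmX z n : nrm (z ^+ n) = nrm z ^+ n.
Proof. by elim: n => [|n IH]; rewrite ?expr0 ?nrm1// !exprS nrmM IH. Qed.
Lemma nrm_rc t : nrm (rc t) = `|t|.
Proof. by rewrite /nrm /rc /= expr0n addr0 sqrtr_sqr. Qed.
Lemma nrm_ci : nrm ci = 1.
Proof. by rewrite /nrm /ci /= expr0n add0r expr1n sqrtr1. Qed.
Lemma sqr_nrm z : nrm z ^+ 2 = re z ^+ 2 + im z ^+ 2.
Proof. by case: z => a b; rewrite /nrm/= sqr_sqrtr// addr_ge0// sqr_ge0. Qed.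
Lemma re_le z : `|re z| <= nrm z.
Proof.
rewrite -(ler_pXn2r (ltn0Sn 1))// ?nnegrE// ?nrm_ge0//.
by rewrite sqr_nrm real_normK ?num_real// lerDl sqr_ge0.
Qed.
Lemma im_le z : `|im z| <= nrm z.
Proof.
rewrite -(ler_pXn2r (ltn0Sn 1))// ?nnegrE// ?nrm_ge0//.
by rewrite sqr_nrm real_normK ?num_real// lerDr sqr_ge0.
Qed.
Lemma nrm_le z : nrm z <= `|re z| + `|im z|.
Proof.
rewrite {1}(cE z) (le_trans (nrmD _ _))// nrmM nrm_ci mul1r !nrm_rc//.
Qed.

Definition cj (z : C) : C := conjc z.
Lemma re_conj z : re (cj z) = re z. Proof. by case: z. Qed.
Lemma im_conj z : im (cj z) = - im z. Proof. by case: z. Qed.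
Lemma conjM x y : cj (x * y) = cj x * cj y. Proof. exact: rmorphM. Qed.
Lemma conjD x y : cj (x + y) = cj x + cj y. Proof. exact: rmorphD. Qed.
Lemma nrm_conj z : nrm (cj z) = nrm z.
Proof. by case: z => a b; rewrite /nrm /= sqrrN. Qed.
Lemma mul_conj z : z * cj z = rc (nrm z ^+ 2).
Proof.
by rewrite sqr_nrm; apply: c_eq; rewrite !reimE re_conj im_conj; ring.
Qed.

(** A positive element of C is a positive real number, so the C-valued norm of the library can be
    traded for the real-valued [nrm]. *)
Lemma cvgC {T} (F : set_system T) {FF : Filter F} (f : T -> C) (l : C) :
  (f @ F --> l) <-> (forall e : R, 0 < e -> \forall x \near F, nrm (f x - l) < e).
Proof.
split=> [/cvgrPdist_lt fl e e0|fl].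
  have : 0 < rc e by rewrite -(rmorph0 rc) ltcR.
  move=> /fl; apply: filterS => x; rewrite normE ltcR.
  by rewrite nrmB.
apply/cvgrPdist_lt => e e0.
have /andP[/eqP ie re0'] : (im e == 0) && (0 < re e).
  by move: e0; rewrite ltcE /= eq_sym.
have ee : e = rc (re e) by apply: c_eq.
apply: filterS (fl _ re0') => x xl.
by rewrite ee normE ltcR nrmB.
Qed.

Lemma cvgR {T} (F : set_system T) {FF : Filter F} (f : T -> R) (l : R) :
  (f @ F --> l) <-> (forall e : R, 0 < e -> \forall x \near F, `|f x - l| < e).
Proof.
split=> [/cvgrPdist_lt fl e /fl|fl].
  by apply: filterS => x; rewrite distrC.
by apply/cvgrPdist_lt => e /fl; apply: filterS => x; rewrite distrC.
Qed.

Lemma cvg_nrm {T} (F : set_system T) {FF : Filter F} (f : T -> C) (l : C) :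
  f @ F --> l -> (fun x => nrm (f x)) @ F --> nrm l.
Proof.
move=> /cvgC fl; apply/cvgR => e /fl; apply: filterS => x; apply: le_lt_trans.
rewrite ler_norml; apply/andP; split.
  by rewrite lerNl opprB lerBlDr nrmB (le_trans _ (nrmD _ _))// subrK.
by rewrite lerBlDr (le_trans _ (nrmD _ _))// subrK.
Qed.
Lemma cvg_re {T} (F : set_system T) {FF : Filter F} (f : T -> C) (l : C) :
  f @ F --> l -> (fun x => re (f x)) @ F --> re l.
Proof.
move=> /cvgC fl; apply/cvgR => e /fl; apply: filterS => x; apply: le_lt_trans.
by rewrite -reN -reD re_le.
Qed.
Lemma cvg_im {T} (F : set_system T) {FF : Filter F} (f : T -> C) (l : C) :
  f @ F --> l -> (fun x => im (f x)) @ F --> im l.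
Proof.
move=> /cvgC fl; apply/cvgR => e /fl; apply: filterS => x; apply: le_lt_trans.
by rewrite -imN -imD im_le.
Qed.
Lemma cvg_conj {T} (F : set_system T) {FF : Filter F} (f : T -> C) (l : C) :
  f @ F --> l -> (fun x => cj (f x)) @ F --> cj l.
Proof.
move=> /cvgC fl; apply/cvgC => e /fl; apply: filterS => x.
by rewrite /cj/= -rmorphB -/(cj _) nrm_conj.
Qed.
Lemma cvg_rc {T} (F : set_system T) {FF : Filter F} (f : T -> R) (l : R) :
  f @ F --> l -> (fun x => rc (f x)) @ F --> rc l.
Proof.
move=> /cvgR fl; apply/cvgC => e /fl; apply: filterS => x.
by rewrite -rmorphB nrm_rc.
Qed.

Lemma re_cont : continuous re. Proof. by move=> z; exact: (@cvg_re _ (nbhs z) _ id z cvg_id). Qed.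
Lemma im_cont : continuous im. Proof. by move=> z; exact: (@cvg_im _ (nbhs z) _ id z cvg_id). Qed.
Lemma rc_cont : continuous rc. Proof. by move=> z; exact: (@cvg_rc _ (nbhs z) _ id z cvg_id). Qed.
Lemma conj_cont : continuous cj.
Proof. by move=> z; exact: (@cvg_conj _ (nbhs z) _ id z cvg_id). Qed.
Lemma nrm_cont : continuous nrm.
Proof. by move=> z; exact: (@cvg_nrm _ (nbhs z) _ id z cvg_id). Qed.

End ComplexBasics.
Arguments ci {R}.

HB.lock Definition ex (R : realType) (z : Cplx R) : Cplx R :=
  rc (expR (re z)) * (rc (cos (im z)) + ci * rc (sin (im z))).
(* A point of the unit circle, with angle counted in turns. *)
HB.lock Definition un (R : realType) (t : R) : Cplx R := ex (rc (2 * pi * t) * ci).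

Section Exponential.
Variable R : realType.
Local Notation C := (Cplx R).
Local Notation rc := (@rc R).
Local Notation re := (@re R).
Local Notation im := (@im R).
Local Notation ex := (@ex R).
Local Notation un := (@un R).
Implicit Types (z w : C).

Lemma exD z w : ex (z + w) = ex z * ex w.
Proof.
rewrite ex.unlock reD imD expRD cosD sinD; apply: c_eq; rewrite !reimE; ring.
Qed.
Lemma ex0 : ex 0 = 1.
Proof. by rewrite ex.unlock expR0 cos0 sin0 rmorph0 mulr0 addr0 mulr1 rmorph1. Qed.
Lemma nrm_ex z : nrm (ex z) = expR (re z).
Proof.
rewrite ex.unlock nrmM nrm_rc (ger0_norm (expR_ge0 _)) -[RHS]mulr1; congr (_ * _).
apply/eqP; rewrite -(eqrXn2 (ltn0Sn 1))// ?nrm_ge0// sqr_nrm !reimE.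
by rewrite expr1n !(mul0r,mul1r,mulr0,add0r,subr0,addr0) cos2Dsin2.
Qed.
Lemma ex_neq0 z : ex z != 0. Proof. by rewrite -nrm_gt0 nrm_ex expR_gt0. Qed.
Lemma exN z : ex (- z) = (ex z)^-1.
Proof.
by apply: (mulfI (ex_neq0 z)); rewrite -exD subrr ex0 divff// ex_neq0.
Qed.
Lemma ex_rc t : ex (rc t) = rc (expR t).
Proof. by rewrite ex.unlock re_rc im_rc cos0 sin0 rmorph0 mulr0 addr0 mulr1. Qed.
Lemma ex_cont : continuous ex.
Proof.
rewrite ex.unlock => z; apply: for_cont; apply: cvgM.
  apply: cvg_rc; apply: (@continuous_cvg _ _ _ _ _ _ expR).
    exact: (@continuous_expR R _).
  exact: re_cont.
apply: cvgD.
  apply: cvg_rc; apply: (@continuous_cvg _ _ _ _ _ _ cos).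
    exact: (@continuous_cos R _).
  exact: im_cont.
apply: cvgM; first exact: cvg_cst.
apply: cvg_rc; apply: (@continuous_cvg _ _ _ _ _ _ sin).
  exact: (@continuous_sin R _).
exact: im_cont.
Qed.

Lemma nrm_un t : nrm (un t) = 1.
Proof. by rewrite un.unlock nrm_ex !reimE mulr0 mul0r subr0 expR0. Qed.
Lemma un_neq0 t : un t != 0. Proof. rewrite un.unlock; exact: ex_neq0. Qed.
Lemma un_conj t : cj (un t) = (un t)^-1.
Proof.
apply: (mulfI (un_neq0 t)).
by rewrite mul_conj nrm_un expr1n rmorph1 divff// un_neq0.
Qed.
Lemma un0 : un 0 = 1. Proof. by rewrite un.unlock mulr0 rmorph0 mul0r ex0. Qed.
Lemma un1 : un 1 = 1.
Proof.
rewrite un.unlock mulr1 ex.unlock !reimE.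
rewrite !(mulr0,mulr1,mul0r,subrr,addr0,add0r) expR0 rmorph1 mul1r.
have -> : 2 * pi = 0 + pi *+ 2 :> R by rewrite add0r mulr2n; ring.
by rewrite cosD2pi sinD2pi cos0 sin0 rmorph0 rmorph1 mulr0 addr0.
Qed.
Lemma un_cont : continuous un.
Proof.
rewrite un.unlock => t; apply: for_cont.
apply: (@continuous_cvg _ _ _ _ _ _ ex); first exact: ex_cont.
apply: cvgM; last exact: cvg_cst.
apply: cvg_rc; apply: cvgM; [exact: cvg_cst|exact: cvg_id].
Qed.

End Exponential.

(** * Derivatives *)

Section Caratheodory.
Variable R : realType.
Local Notation C := (Cplx R).
Local Notation rc := (@rc R).
Implicit Types (f g : C -> C) (p q : R -> C).

(** Derivatives in Caratheodory's form: the slope s is a function continuous at 0, and its value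
    there is the derivative. Sum, product and chain rules become algebraic identities between
    slopes, without remainders to estimate. *)
Variant cder p (t : R) (l : C) : Prop := Cder (s : R -> C) of
  [/\ s h @[h --> nbhs 0] --> s 0, s 0 = l & forall h, p (t + h) = p t + rc h * s h].
Variant xder f (z : C) (l : C) : Prop := Xder (s : C -> C) of
  [/\ s h @[h --> nbhs 0] --> s 0, s 0 = l & forall h, f (z + h) = f z + h * s h].

Lemma cder_cst (a : C) t : cder (fun=> a) t 0.
Proof. by exists (fun=> 0); split=> [||h]; [exact: cvg_cst|by []|rewrite mulr0 addr0]. Qed.
Lemma cder_rc t : cder rc t 1.
Proof. by exists (fun=> 1); split=> [||h]; [exact: cvg_cst|by []|rewrite mulr1 rmorphD]. Qed.

Lemma cderD p q t a b : cder p t a -> cder q t b -> cder (fun x => p x + q x) t (a + b).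
Proof.
move=> [s [cs <- hs]] [r [cr <- hr]]; exists (fun x => s x + r x); split=> [||h].
- by apply: cvgD; [exact: cs|exact: cr].
- by [].
- by rewrite hs hr; ring.
Qed.
Lemma cderM p q t a b : cder p t a -> cder q t b ->
  cder (fun x => p x * q x) t (a * q t + p t * b).
Proof.
move=> [s [cs <- hs]] [r [cr <- hr]].
exists (fun x => s x * q t + p t * r x + rc x * s x * r x); split=> [||h].
- apply: cvgD; first apply: cvgD.
  + by apply: cvgM; [exact: cs|exact: cvg_cst].
  + by apply: cvgM; [exact: cvg_cst|exact: cr].
  + by apply: cvgM; [apply: cvgM; [exact: rc_cont|exact: cs]|exact: cr].
- by rewrite rmorph0; ring.
- by rewrite hs hr; ring.
Qed.
Lemma cderZ (k : C) p t a : cder p t a -> cder (fun x => k * p x) t (k * a).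
Proof.
move=> dp; have := cderM (cder_cst k t) dp.
by rewrite mul0r add0r.
Qed.
Lemma cderN p t a : cder p t a -> cder (fun x => - p x) t (- a).
Proof.
move=> /(cderZ (-1)); rewrite mulN1r; congr (cder _ _ _).
by apply/funext => x; rewrite mulN1r.
Qed.
Lemma cderB p q t a b : cder p t a -> cder q t b -> cder (fun x => p x - q x) t (a - b).
Proof. by move=> dp dq; apply: cderD; [exact: dp|exact: cderN]. Qed.
Lemma cder_eq p t a b : cder p t a -> a = b -> cder p t b.
Proof. by move=> ? <-. Qed.
Lemma cder_conj p t a : cder p t a -> cder (fun x => cj (p x)) t (cj a).
Proof.
move=> [s [cs <- hs]]; exists (fun x => cj (s x)); split=> [||h].
- exact: (cvg_conj cs).
- by [].
- by rewrite hs conjD conjM /cj conjc_real.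
Qed.
Lemma cder_cont p t a : cder p t a -> {for t, continuous p}.
Proof.
move=> [s [cs s0 hs]].
apply: for_cont.
rewrite (_ : p = (fun x => p t + rc (x - t) * s (x - t))); last first.
  by apply/funext => x; rewrite -hs addrC subrK.
have cB : (x - t) @[x --> nbhs t] --> (0:R).
  by rewrite -[X in _ --> X](subrr t); apply: cvgB; [exact: cvg_id|exact: cvg_cst].
apply: cvgD; first exact: cvg_cst.
apply: cvgM; first by rewrite subrr; apply: (cvg_via cB); exact: rc_cont.
by rewrite subrr; apply: (cvg_via cB); exact: cs.
Qed.

Lemma cder_comp f p t a b : cder p t a -> xder f (p t) b -> cder (f \o p) t (b * a).
Proof.
move=> dp [r [cr <- hr]]; have cp := cder_cont dp.
case: dp => s [cs <- hs].
exists (fun h => r (rc h * s h) * s h); split=> [||h] /=; last 2 first.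
- by rewrite rmorph0 mul0r.
- by rewrite hs hr; ring.
apply: cvgM; last exact: cs.
rewrite rmorph0 mul0r.
apply: (@cvg_via _ _ _ _ (fun h => rc h * s h) r 0); last exact: cr.
rewrite -[X in _ --> X](mul0r (s 0)) -(rmorph0 rc).
by apply: cvgM; [exact: rc_cont|exact: cs].
Qed.

Lemma xder_cst (a z : C) : xder (fun=> a) z 0.
Proof. by exists (fun=> 0); split=> [||h]; [exact: cvg_cst|by []|rewrite mulr0 addr0]. Qed.
Lemma xder_id z : xder id z 1.
Proof. by exists (fun=> 1); split=> [||h]; [exact: cvg_cst|by []|rewrite mulr1]. Qed.
Lemma xderD f g z a b : xder f z a -> xder g z b -> xder (fun x => f x + g x) z (a + b).
Proof.
move=> [s [cs <- hs]] [r [cr <- hr]]; exists (fun x => s x + r x); split=> [||h].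
- by apply: cvgD; [exact: cs|exact: cr].
- by [].
- by rewrite hs hr; ring.
Qed.
Lemma xderM f g z a b : xder f z a -> xder g z b ->
  xder (fun x => f x * g x) z (a * g z + f z * b).
Proof.
move=> [s [cs <- hs]] [r [cr <- hr]].
exists (fun x => s x * g z + f z * r x + x * s x * r x); split=> [||h].
- apply: cvgD; first apply: cvgD.
  + by apply: cvgM; [exact: cs|exact: cvg_cst].
  + by apply: cvgM; [exact: cvg_cst|exact: cr].
  + by apply: cvgM; [apply: cvgM; [exact: cvg_id|exact: cs]|exact: cr].
- by ring.
- by rewrite hs hr; ring.
Qed.
Lemma xderZ (k : C) f z a : xder f z a -> xder (fun x => k * f x) z (k * a).
Proof.
move=> dp; have := xderM (xder_cst k z) dp.
by rewrite mul0r add0r.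
Qed.
Lemma xder_cont f z a : xder f z a -> {for z, continuous f}.
Proof.
move=> [s [cs s0 hs]].
apply: for_cont.
rewrite (_ : f = (fun x => f z + (x - z) * s (x - z))); last first.
  by apply/funext => x; rewrite -hs addrC subrK.
have cB : (x - z) @[x --> nbhs z] --> (0:C).
  by rewrite -[X in _ --> X](subrr z); apply: cvgB; [exact: cvg_id|exact: cvg_cst].
apply: cvgD; first exact: cvg_cst.
apply: cvgM; first by rewrite subrr; exact: cB.
by rewrite subrr; apply: (cvg_via cB); exact: cs.
Qed.
Lemma xder_comp f g z a b : xder f z a -> xder g (f z) b -> xder (g \o f) z (b * a).
Proof.
move=> [s [cs <- hs]] [r [cr <- hr]].
exists (fun h => r (h * s h) * s h); split=> [||h] /=; last 2 first.
- by rewrite mul0r.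
- by rewrite hs hr; ring.
apply: cvgM; last exact: cs.
rewrite mul0r.
apply: (@cvg_via _ _ _ _ (fun h => h * s h) r 0); last exact: cr.
rewrite -[X in _ --> X](mul0r (s 0)).
by apply: cvgM; [exact: cvg_id|exact: cs].
Qed.

Lemma xderV z : z != 0 -> xder (fun x : C => x^-1) z (- z ^- 2).
Proof.
move=> z0.
(* Since 0^-1 = 0, the slope at h = - z has to satisfy 0 = z^-1 + h s(h); the first branch is that
   value. *)
exists (fun h => if z + h == 0 then - (h * z)^-1 else - (z * (z + h))^-1).
have cz : (z + h) @[h --> nbhs (0:C)] --> z.
  by rewrite -[X in _ --> X]addr0; apply: cvgD; [exact: cvg_cst|exact: cvg_id].
have n0 := cvgr_neq0 _ cz z0.
split.
- rewrite addr0 (negPf z0).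
  apply: (@cvg_trans _ ((- (z * (z + h))^-1) @[h --> nbhs (0:C)])).
    apply: near_eq_cvg; near=> h; rewrite ifN//; near: h; exact: n0.
  apply: cvgN; apply: cvgV; first by rewrite mulf_neq0.
  by apply: cvgM; [exact: cvg_cst|exact: cz].
- by rewrite addr0 (negPf z0) expr2.
- move=> h; case: ifPn => [/eqP zh|zh].
    have h0 : h != 0 by apply: contra_neq z0 => h0; rewrite -zh h0 addr0.
    by rewrite zh invr0; field; rewrite z0 h0.
  by field; rewrite z0 zh.
Unshelve. all: by end_near. Qed.

Lemma cder_uniq p t a b : cder p t a -> cder p t b -> a = b.
Proof.
move=> [s [cs <- hs]] [r [cr <- hr]].
have sr h : h != 0 -> s h = r h.
  move=> h0; have := hr h; rewrite hs => /addrI/mulfI; apply.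
  by rewrite rc_eq0.
apply/eqP; rewrite -subr_eq0 -nrm_eq0 eq_le nrm_ge0 andbT.
apply/ler_addgt0Pl => e e0; rewrite addr0.
have e2 : 0 < e / 2 by rewrite divr_gt0.
move: cs cr => /cvgC/(_ _ e2) ns /cvgC/(_ _ e2) nr.
have [d d0 D] := (nbhs_ballP _ _).1 (filterI ns nr).
have bd : ball (0:R) d (d / 2).
  rewrite /ball/= sub0r normrN gtr0_norm ?divr_gt0//.
  by rewrite ltr_pdivrMr// mulr_natr mulr2n ltrDl.
have [/= A B] := D _ bd.
have d2 : d / 2 != 0 by rewrite mulf_neq0 ?invr_neq0// gt_eqF.
rewrite (_ : s 0 - r 0 = (r (d / 2) - r 0) - (s (d / 2) - s 0)); last first.
  by rewrite (sr _ d2); ring.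
rewrite (le_trans (nrmBD _ _))// (splitr e) lerD// ltW//.
Qed.

Lemma cder_near p q t a : (\forall h \near nbhs (0:R), p (t + h) = q (t + h)) ->
  cder p t a -> cder q t a.
Proof.
move=> pq [s [cs <- hs]].
have p0 : p t = q t.
  by have /= := nbhs_singleton pq; rewrite addr0.
exists (fun h => if h == 0 then s 0 else (q (t + h) - q t) / rc h); split.
- rewrite eqxx; apply: cvg_trans cs; apply: near_eq_cvg.
  apply: filterS pq => h pq; case: eqP => [->//|/eqP h0].
  rewrite -pq -p0 hs; field; by rewrite rc_eq0.
- by rewrite eqxx.
- move=> h; case: eqP => [->|/eqP h0]; first by rewrite addr0 rmorph0 mul0r addr0.
  by field; rewrite rc_eq0.
Qed.

Lemma cder_shift p t a : cder p t a <-> cder (fun h => p (t + h)) 0 a.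
Proof.
split=> -[s [cs s0 hs]]; exists s; split=> [||h].
- exact: cs.
- by [].
- by rewrite add0r addr0.
- exact: cs.
- by [].
- by have := hs h; rewrite add0r addr0.
Qed.

Lemma cder_lin p t (k : R) a : cder p (k * t) a -> cder (fun x => p (k * x)) t (rc k * a).
Proof.
move=> [s [cs <- hs]]; exists (fun h => rc k * s (k * h)); split=> [||h].
- apply: cvgM; first exact: cvg_cst.
  rewrite mulr0; apply: (@cvg_via _ _ _ _ (fun h => k * h) s 0); last exact: cs.
  rewrite -[X in _ --> X](mulr0 k); apply: cvgM; [exact: cvg_cst|exact: cvg_id].
- by rewrite mulr0.
- by rewrite mulrDr hs rmorphM; ring.
Qed.

(** One half of the bridge to [is_derive], through which the derivatives of exp, cos and sin enter;
    [cder_re] and [cder_im] are the other half and serve the fundamental theorem of calculus. *)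
Lemma cder_real (h : R -> R) (t l : R) : is_derive t (1 : R) h l -> cder (fun x => rc (h x)) t (rc l).
Proof.
move=> [dh hl].
pose r x := if x == 0 then l else (h (t + x) - h t) / x.
exists (fun x => rc (r x)); split.
- apply: cvg_rc; rewrite /r eqxx -/(r _).
  have := dh; rewrite /derivable => /cvg_ex[l' cl].
  have ll : l' = l by rewrite -hl; apply/esym/cvg_lim.
  move: cl; rewrite ll => /cvgR cl; apply/cvgR => e e0.
  have : \forall x \near nbhs (0:R), x != 0 ->
      `|x^-1 *: ((h \o shift t) (x *: 1) - h t) - l| < e by exact: (cl _ e0).
  apply: filterS => x xl.
  case: eqP => [_|/eqP x0]; first by rewrite subrr normr0.
  have := xl x0; congr (`|_ - _| < _).
  by rewrite /GRing.scale/= mulr1 [x + t]addrC mulrC.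
- by rewrite /r eqxx.
- move=> x; rewrite /r; case: eqP => [->|/eqP x0].
    by rewrite addr0 rmorph0 mul0r addr0.
  by rewrite -rmorphM -rmorphD; congr rc; field.
Qed.

Lemma cder_re p t l : cder p t l -> is_derive t (1 : R) (fun x => re (p x)) (re l).
Proof.
move=> [s [cs <- hs]].
suff H : (fun h => h^-1 *: (re (p (h *: 1 + t)) - re (p t))) @ dnbhs (0:R) --> re (s 0).
  split; first by apply/cvg_ex; exists (re (s 0)).
  by apply: cvg_lim.
have : re (s x) @[x --> nbhs (0:R)] --> re (s 0) by apply: cvg_re; exact: cs.
move=> /cvgR cr; apply/cvgR => e /cr ce.
suff : \forall x \near nbhs (0:R), x != 0 ->
    `|x^-1 *: (re (p (x *: 1 + t)) - re (p t)) - re (s 0)| < e by [].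
apply: filterS ce => x xe x0; apply: le_lt_trans xe; rewrite le_eqVlt; apply/orP; left.
rewrite [x *: 1 + t]addrC /GRing.scale/= mulr1 hs reD reM re_rc im_rc mul0r subr0.
by apply/eqP; congr (`|_ - _|); field.
Qed.

Lemma cder_im p t l : cder p t l -> is_derive t (1 : R) (fun x => im (p x)) (im l).
Proof.
move=> /(cderZ (- ci)) /cder_re; rewrite !reimE oppr0 mul0r sub0r mulN1r opprK.
by congr is_derive; apply/funext => x; rewrite !reimE; ring.
Qed.

End Caratheodory.

HB.lock Definition J (R : realType) (f : R -> Cplx R) : Cplx R :=
  rc (\int[@lebesgue_measure R]_(x in `[0, 1]) re (f x)) +
  ci * rc (\int[@lebesgue_measure R]_(x in `[0, 1]) im (f x)).

(** * Integrals over the unit interval *)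

Section Mean.
Variable R : realType.
Local Notation C := (Cplx R).
Local Notation rc := (@rc R).
Local Notation mu := (@lebesgue_measure R).
Implicit Types (f g : R -> C).

Lemma integ01 (h : R -> R) : continuous h -> mu.-integrable `[0, 1] (EFin \o h).
Proof.
move=> ch; apply: continuous_compact_integrable; first exact: segment_compact.
exact: continuous_subspaceT.
Qed.
Lemma cre f : continuous f -> continuous (fun x => re (f x)).
Proof. by move=> cf x; apply: cvg_re; exact: cf. Qed.
Lemma cim f : continuous f -> continuous (fun x => im (f x)).
Proof. by move=> cf x; apply: cvg_im; exact: cf. Qed.

Lemma re_J f : re (J f) = \int[mu]_(x in `[0, 1]) re (f x).
Proof. by rewrite J.unlock !reimE; ring. Qed.
Lemma im_J f : im (J f) = \int[mu]_(x in `[0, 1]) im (f x).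
Proof. by rewrite J.unlock !reimE; ring. Qed.

Lemma JD f g : continuous f -> continuous g -> J (fun x => f x + g x) = J f + J g.
Proof.
move=> cf cg.
have If := integ01 (cre cf). have Ig := integ01 (cre cg).
have Jf := integ01 (cim cf). have Jg := integ01 (cim cg).
apply: c_eq; rewrite ?reD ?imD !(re_J,im_J) -RintegralD//.
  by apply: eq_Rintegral => x _; rewrite reD.
by apply: eq_Rintegral => x _; rewrite imD.
Qed.

Lemma JZ (k : C) f : continuous f -> J (fun x => k * f x) = k * J f.
Proof.
move=> cf.
have If := integ01 (cre cf). have Jf := integ01 (cim cf).
have Ic (a : R) (h : R -> R) : continuous h -> mu.-integrable `[0, 1] (EFin \o (fun x => a * h x)).
  move=> ch; apply: integ01 => x; apply: cvgM; [exact: cvg_cst|exact: ch].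
have I1 := Ic (re k) _ (cre cf). have I2 := Ic (im k) _ (cim cf).
have I3 := Ic (im k) _ (cre cf). have I4 := Ic (re k) _ (cim cf).
apply: c_eq; rewrite ?reM ?imM !(re_J,im_J) -!RintegralZl//.
  by rewrite -RintegralB//; apply: eq_Rintegral => x _; rewrite reM.
rewrite -RintegralD//; apply: eq_Rintegral => x _; rewrite imM; ring.
Qed.

Lemma JB f g : continuous f -> continuous g -> J (fun x => f x - g x) = J f - J g.
Proof.
move=> cf cg; have cN : continuous (fun x => -1 * g x).
  by move=> x; apply: cvgM; [exact: cvg_cst|exact: cg].
have := JD cf cN; rewrite (JZ _ cg) mulN1r => <-.
by congr J; apply/funext => x; rewrite mulN1r.
Qed.

Lemma Rint_cst (a : R) : \int[mu]_(x in `[0, 1]) (cst a x) = a.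
Proof.
rewrite Rintegral_cst// [X in fine X](_ : _ = 1%E) ?mulr1//.
by rewrite [LHS]lebesgue_measure_itv/= lte_fin ltr01 -EFinB subr0.
Qed.

Lemma J_cst (k : C) : J (fun=> k) = k.
Proof.
by apply: c_eq; rewrite ?re_J ?im_J -[RHS]Rint_cst.
Qed.

Lemma Rint_le (h k : R -> R) : continuous h -> continuous k ->
  (forall x, 0 <= x <= 1 -> h x <= k x) ->
  \int[mu]_(x in `[0, 1]) h x <= \int[mu]_(x in `[0, 1]) k x.
Proof.
move=> ch ck hk; apply: le_Rintegral; [by []|exact: integ01|exact: integ01|].
by move=> x /=; rewrite in_itv/=; exact: hk.
Qed.

Lemma nrm_J f (b : R -> R) : continuous f -> continuous b ->
  (forall x, 0 <= x <= 1 -> nrm (f x) <= b x) ->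
  nrm (J f) <= \int[mu]_(x in `[0, 1]) b x.
Proof.
move=> cf cb fb.
have [->|J0] := eqVneq (J f) 0.
  rewrite nrm0 -[X in X <= _](_ : \int[mu]_(x in `[0, 1]) (cst 0 x) = 0); last first.
    exact: Rint_cst.
  apply: Rint_le => [||x x01]; [exact: cst_continuous|exact: cb|].
  exact: le_trans (nrm_ge0 _) (fb _ x01).
(* Multiplying f by this unit number makes the integral a nonnegative real, so its modulus is the
   integral of a real part. *)
pose u := cj (J f) / rc (nrm (J f)).
have nJ0 : nrm (J f) != 0 by rewrite nrm_eq0.
have uJ : rc (nrm (J f)) = J (fun x => u * f x).
  rewrite JZ// /u mulrAC [cj _ * _]mulrC mul_conj rmorphXn/= expr2 mulfK//.
  by rewrite rc_eq0.
have nu : nrm u = 1.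
  by rewrite nrmM nrm_conj nrmV nrm_rc ger0_norm ?nrm_ge0// divff.
have cuf : continuous (fun x => u * f x).
  by move=> x; apply: cvgM; [exact: cvg_cst|exact: cf].
rewrite -[X in X <= _](re_rc (nrm (J f))) uJ re_J.
apply: Rint_le => [||x x01]; [exact: cre|exact: cb|].
rewrite (le_trans (ler_norm _))// (le_trans (re_le _))// nrmM nu mul1r; exact: fb.
Qed.

Lemma nrm_J_le f (M : R) : continuous f ->
  (forall x, 0 <= x <= 1 -> nrm (f x) <= M) -> nrm (J f) <= M.
Proof.
move=> cf fM; have cM : continuous (cst M : R -> R) by exact: cst_continuous.
by rewrite -[X in _ <= X]Rint_cst; exact: nrm_J.
Qed.

Lemma eq_J f g : (forall x, 0 <= x <= 1 -> f x = g x) -> J f = J g.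
Proof.
move=> fg; apply: c_eq; rewrite ?re_J ?im_J; apply: eq_Rintegral => x;
 by rewrite inE/= in_itv/= => x01; rewrite fg.
Qed.

Lemma Rint_FTC (F h : R -> R) : continuous h ->
  (forall x : R, 0 <= x <= 1 -> is_derive x (1 : R) F (h x)) ->
  \int[mu]_(x in `[0, 1]) h x = F 1 - F 0.
Proof.
move=> ch dF; rewrite /Rintegral.
have cF (x : R) : 0 <= x <= 1 -> F y @[y --> nbhs x] --> F x.
  move=> x01; apply: differentiable_continuous; apply/derivable1_diffP.
  by have := dF x x01; case.
rewrite (@continuous_FTC2 _ h F 0 1)//.
- exact: continuous_subspaceT.
- split.
  + by move=> x; rewrite in_itv/= => /andP[x0 x1]; case: (dF x); rewrite ?ltW.
  + by apply: cvg_at_right_filter; apply: cF; rewrite lexx ler01.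
  + by apply: cvg_at_left_filter; apply: cF; rewrite lexx ler01.
- move=> x; rewrite in_itv/= => /andP[x0 x1].
  by rewrite derive1E; case: (dF x); rewrite ?ltW.
Qed.

Lemma J_FTC (F f : R -> C) : continuous f ->
  (forall x : R, 0 <= x <= 1 -> cder F x (f x)) -> J f = F 1 - F 0.
Proof.
move=> cf dF; apply: c_eq.
  rewrite re_J reD reN; apply: (@Rint_FTC (fun x => re (F x))); first exact: cre.
  by move=> x /dF; exact: cder_re.
rewrite im_J imD imN; apply: (@Rint_FTC (fun x => im (F x))); first exact: cim.
by move=> x /dF; exact: cder_im.
Qed.

(* Tube lemma: the segment is compact. *)
Lemma unif01 (T : topologicalType) (F : T -> R -> C) (t0 : T) :
  (forall s : R, 0 <= s <= 1 -> F z.1 z.2 @[z --> nbhs (t0, s)] --> F t0 s) ->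
  forall e : R, 0 < e -> \forall t \near nbhs t0, forall s : R, 0 <= s <= 1 ->
    nrm (F t s - F t0 s) < e.
Proof.
move=> cF e e0.
have e2 : 0 < e / 2 by rewrite divr_gt0.
pose P (t : T) (s : R) := nrm (F t s - F t0 s) < e.
have HK' : forall s : R, `[0, 1]%classic s ->
    \forall s' \near nbhs s & t \near nbhs t0, P t s'.
  move=> s; rewrite /= in_itv/= => s01.
  have /cvgC/(_ _ e2) [[A B] /= [nA nB] AB] := cF s s01.
  exists (B, A) => //= -[s' t] /= [Bs At].
  have t0A := nbhs_singleton nA.
  have /= H1 : nrm (F t s' - F t0 s) < e / 2 by exact: (AB (t, s')).
  have /= H2 : nrm (F t0 s' - F t0 s) < e / 2 by exact: (AB (t0, s')).
  rewrite /P (_ : F t s' - F t0 s' = (F t s' - F t0 s) - (F t0 s' - F t0 s)); last by ring.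
  by rewrite (le_lt_trans (nrmBD _ _))// (splitr e) ltrD.
have /compact_near_coveringP H := @segment_compact R 0 1.
have := H _ (nbhs t0) P _; rewrite /P => H2.
apply: filterS (H2 _ HK') => t; rewrite /= => tP s s01.
by apply: tP; rewrite /= in_itv.
Unshelve. all: by end_near. Qed.

(** By [unif01] the integrands converge uniformly on the segment; this is the substitute for
    dominated convergence everywhere below. *)
Lemma J_cont_at (T : topologicalType) (F : T -> R -> C) (t0 : T) :
  (\forall t \near nbhs t0, continuous (F t)) ->
  (forall s : R, 0 <= s <= 1 -> F z.1 z.2 @[z --> nbhs (t0, s)] --> F t0 s) ->
  J (F t) @[t --> nbhs t0] --> J (F t0).
Proof.
move=> nF cF; apply/cvgC => e e0; have e2 : 0 < e / 2 by rewrite divr_gt0.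
have cF0 := nbhs_singleton nF.
near=> t.
have ct : continuous (F t) by near: t.
rewrite -JB//; apply: le_lt_trans (_ : e / 2 < e); last first.
  by rewrite ltr_pdivrMr// mulr_natr mulr2n ltrDl.
apply: nrm_J_le.
  by move=> x; apply: cvgB; [exact: ct|exact: cF0].
near: t; have := unif01 cF e2; apply: filterS => t tF s s01.
by rewrite ltW// tF.
Unshelve. all: by end_near. Qed.

End Mean.

(** * Limit rules for complex, real and vector-valued functions *)

Section ContinuityRules.
Variable R : realType.
Local Notation C := (Cplx R).
Local Notation rc := (@rc R).
Context {T : Type} {F : set_system T} {FF : Filter F}.

Lemma c_pair {U V : topologicalType} (f : T -> U) (g : T -> V) (a : U) (b : V) :
  f x @[x --> F] --> a -> g x @[x --> F] --> b -> (f x, g x) @[x --> F] --> (a, b).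
Proof. exact: cvg_pair. Qed.
Lemma c_fst {U V : topologicalType} (f : T -> U * V) (a : U * V) :
  f x @[x --> F] --> a -> (f x).1 @[x --> F] --> a.1.
Proof. by move=> fa; apply: (cvg_via fa); exact: cvg_fst. Qed.
Lemma c_snd {U V : topologicalType} (f : T -> U * V) (a : U * V) :
  f x @[x --> F] --> a -> (f x).2 @[x --> F] --> a.2.
Proof. by move=> fa; apply: (cvg_via fa); exact: cvg_snd. Qed.
Lemma c_fst' {U V : topologicalType} (f : T -> U * V) (a : U) (b : V) :
  f x @[x --> F] --> (a, b) -> (f x).1 @[x --> F] --> a.
Proof. exact: c_fst. Qed.
Lemma c_snd' {U V : topologicalType} (f : T -> U * V) (a : U) (b : V) :
  f x @[x --> F] --> (a, b) -> (f x).2 @[x --> F] --> b.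
Proof. exact: c_snd. Qed.
Lemma c_ex (f : T -> C) (a : C) : f x @[x --> F] --> a -> ex (f x) @[x --> F] --> ex a.
Proof. by move=> fa; apply: (cvg_via fa); exact: ex_cont. Qed.
Lemma c_un (f : T -> R) (a : R) : f x @[x --> F] --> a -> un (f x) @[x --> F] --> un a.
Proof. by move=> fa; apply: (cvg_via fa); exact: un_cont. Qed.
Lemma c_norm (f : T -> R) (a : R) : f x @[x --> F] --> a -> `|f x| @[x --> F] --> `|a|.
Proof. by move=> fa; apply: cvg_norm. Qed.
Lemma c_expR (f : T -> R) (a : R) :
  f x @[x --> F] --> a -> expR (f x) @[x --> F] --> expR a.
Proof. by move=> fa; apply: (cvg_via fa); exact: continuous_expR. Qed.
Lemma c_cst {U : topologicalType} (a : U) : a @[_ --> F] --> a.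
Proof. exact: cvg_cst. Qed.

Lemma c_add (f g : T -> C) (a b : C) :
  f x @[x --> F] --> a -> g x @[x --> F] --> b -> f x + g x @[x --> F] --> a + b.
Proof. by move=> fa gb; apply: cvgD; [exact: fa|exact: gb]. Qed.
Lemma c_opp (f : T -> C) (a : C) : f x @[x --> F] --> a -> - f x @[x --> F] --> - a.
Proof. by move=> fa; apply: cvgN; exact: fa. Qed.
Lemma c_mul (f g : T -> C) (a b : C) :
  f x @[x --> F] --> a -> g x @[x --> F] --> b -> f x * g x @[x --> F] --> a * b.
Proof. by move=> fa gb; apply: cvgM; [exact: fa|exact: gb]. Qed.
Lemma c_inv (f : T -> C) (a : C) : a != 0 ->
  f x @[x --> F] --> a -> (f x)^-1 @[x --> F] --> a^-1.
Proof. by move=> a0 fa; apply: cvgV; [exact: a0|exact: fa]. Qed.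
Lemma c_exp (n : nat) (f : T -> C) (a : C) :
  f x @[x --> F] --> a -> f x ^+ n @[x --> F] --> a ^+ n.
Proof.
move=> fa; elim: n => [|n IH]; first by rewrite expr0; exact: cvg_cst.
rewrite exprS (_ : (fun x => f x ^+ n.+1) = (fun x => f x * f x ^+ n)).
  by apply: c_mul; [exact: fa|exact: IH].
by apply/funext => x; rewrite exprS.
Qed.
Lemma r_add (f g : T -> R) (a b : R) :
  f x @[x --> F] --> a -> g x @[x --> F] --> b -> f x + g x @[x --> F] --> a + b.
Proof. by move=> fa gb; apply: cvgD; [exact: fa|exact: gb]. Qed.
Lemma r_opp (f : T -> R) (a : R) : f x @[x --> F] --> a -> - f x @[x --> F] --> - a.
Proof. by move=> fa; apply: cvgN; exact: fa. Qed.
Lemma r_mul (f g : T -> R) (a b : R) :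
  f x @[x --> F] --> a -> g x @[x --> F] --> b -> f x * g x @[x --> F] --> a * b.
Proof. by move=> fa gb; apply: cvgM; [exact: fa|exact: gb]. Qed.
Lemma r_inv (f : T -> R) (a : R) : a != 0 ->
  f x @[x --> F] --> a -> (f x)^-1 @[x --> F] --> a^-1.
Proof. by move=> a0 fa; apply: cvgV; [exact: a0|exact: fa]. Qed.
Lemma r_exp (n : nat) (f : T -> R) (a : R) :
  f x @[x --> F] --> a -> f x ^+ n @[x --> F] --> a ^+ n.
Proof.
move=> fa; elim: n => [|n IH]; first by rewrite expr0; exact: cvg_cst.
rewrite exprS (_ : (fun x => f x ^+ n.+1) = (fun x => f x * f x ^+ n)).
  by apply: r_mul; [exact: fa|exact: IH].
by apply/funext => x; rewrite exprS.
Qed.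

Variable g : nat.
Local Notation V := 'rV[Cplx R]_g.

Lemma nbhsV (v : V) (P : set V) : nbhs v P <->
  exists2 e : R, 0 < e & forall w : V, (forall k, nrm (w 0 k - v 0 k) < e) -> P w.
Proof.
split=> [/nbhs_ballP[e /= e0 eP]|[e e0 eP]].
  have /andP[/eqP ie re0'] : (im e == 0) && (0 < re e).
    by move: e0; rewrite ltcE /= eq_sym.
  exists (re e) => // w wv; apply: eP; split=> // i k.
  rewrite /ball/= ord1 (_ : e = rc (re e)); last exact: c_eq.
  by rewrite normE ltcR nrmB.
apply/nbhs_ballP; exists (rc e) => /=; first by rewrite -(rmorph0 rc) ltcR.
move=> w [_ wv]; apply: eP => k; have := wv 0 k.
by rewrite /ball/= normE ltcR nrmB.
Qed.

Lemma cvgV (f : T -> V) (v : V) : f x @[x --> F] --> v <->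
  (forall e : R, 0 < e -> \forall x \near F, forall k, nrm (f x 0 k - v 0 k) < e).
Proof.
split=> [fv e e0|H P /nbhsV[e e0 eP]].
  have H : nbhs v [set w : V | forall k, nrm (w 0 k - v 0 k) < e].
    by apply/nbhsV; exists e.
  exact: (fv _ H).
have := H e e0; rewrite /= => He; apply: filterS He => x; exact: eP.
Qed.
Lemma v_row (f : T -> V) (v : V) :
  (forall k, f x 0 k @[x --> F] --> v 0 k) -> f x @[x --> F] --> v.
Proof.
move=> H; apply/cvgV => e e0.
have : forall k, \forall x \near F, nrm (f x 0 k - v 0 k) < e.
  by move=> k; have /cvgC := H k; apply.
move=> /filter_forall; apply: filterS => x; exact.
Qed.
Lemma v_entry k (f : T -> V) (v : V) : f x @[x --> F] --> v -> f x 0 k @[x --> F] --> v 0 k.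
Proof.
move=> /cvgV H; apply/cvgC => e /H; apply: filterS => x; exact.
Qed.
Lemma v_add (f h : T -> V) (a b : V) :
  f x @[x --> F] --> a -> h x @[x --> F] --> b -> f x + h x @[x --> F] --> a + b.
Proof.
move=> fa hb; apply: v_row => k; rewrite mxE.
rewrite (_ : (fun x => _) = fun x => f x 0 k + h x 0 k); last by apply/funext => x; rewrite mxE.
by apply: c_add; exact: v_entry.
Qed.
Lemma v_scale (f : T -> C) (h : T -> V) (a : C) (b : V) :
  f x @[x --> F] --> a -> h x @[x --> F] --> b -> f x *: h x @[x --> F] --> a *: b.
Proof.
move=> fa hb; apply: v_row => k; rewrite mxE.
rewrite (_ : (fun x => _) = fun x => f x * h x 0 k); last by apply/funext => x; rewrite mxE.
by apply: c_mul; [exact: fa|exact: v_entry].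
Qed.
Lemma v_opp (h : T -> V) (b : V) : h x @[x --> F] --> b -> - h x @[x --> F] --> - b.
Proof.
move=> hb; rewrite -scaleN1r.
rewrite (_ : (fun x => _) = fun x => -1 *: h x); last by apply/funext => x; rewrite scaleN1r.
by apply: v_scale; [exact: c_cst|exact: hb].
Qed.
Lemma cvg_near_eq {U : topologicalType} (f h : T -> U) (l : U) :
  (\forall x \near F, f x = h x) -> f x @[x --> F] --> l -> h x @[x --> F] --> l.
Proof.
move=> fh fl P Pl.
have H : F [set x | P (f x)] by exact: (fl P Pl).
apply: (@filterS2 _ _ FF _ _ _ _ fh H) => x /= <-; exact.
Qed.
End ContinuityRules.

(** The limit rule is chosen from the head symbol under the abstraction. The last case eta-expands a
    function that is not an abstraction, so that its head symbol becomes visible to the other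
    cases. *)
Ltac ct1 := match goal with
  | |- cvg_to (nbhs (fmap (fun x => x) _)) _ => refine cvg_id
  | |- cvg_to (nbhs (fmap (fun x => (@?a x, @?b x)) _)) _ => refine (c_pair _ _)
  | |- cvg_to (nbhs (fmap (fun x => fst (@?a x)) _)) _ => first [refine (c_fst _)|refine (c_fst' _)]
  | |- cvg_to (nbhs (fmap (fun x => snd (@?a x)) _)) _ => first [refine (c_snd _)|refine (c_snd' _)]
  | |- cvg_to (nbhs (fmap (fun x => fun_of_matrix (@?a x) _ _) _)) _ => refine (v_entry _ _)
  | |- cvg_to (nbhs (fmap (fun x => (@?a x + @?b x)%R) _)) _ =>
      first [refine (c_add _ _)|refine (r_add _ _)|refine (v_add _ _)]
  | |- cvg_to (nbhs (fmap (fun x => (- @?a x)%R) _)) _ =>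
      first [refine (c_opp _)|refine (r_opp _)|refine (v_opp _)]
  | |- cvg_to (nbhs (fmap (fun x => (@?a x * @?b x)%R) _)) _ =>
      first [refine (c_mul _ _)|refine (r_mul _ _)]
  | |- cvg_to (nbhs (fmap (fun x => (@?a x ^+ _)%R) _)) _ =>
      first [refine (c_exp _ _)|refine (r_exp _ _)]
  | |- cvg_to (nbhs (fmap (fun x => rc (@?a x)) _)) _ => refine (cvg_rc _)
  | |- cvg_to (nbhs (fmap (fun x => re (@?a x)) _)) _ => refine (cvg_re _)
  | |- cvg_to (nbhs (fmap (fun x => im (@?a x)) _)) _ => refine (cvg_im _)
  | |- cvg_to (nbhs (fmap (fun x => cj (@?a x)) _)) _ => refine (cvg_conj _)
  | |- cvg_to (nbhs (fmap (fun x => nrm (@?a x)) _)) _ => refine (cvg_nrm _)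
  | |- cvg_to (nbhs (fmap (fun x => ex (@?a x)) _)) _ => refine (c_ex _)
  | |- cvg_to (nbhs (fmap (fun x => un (@?a x)) _)) _ => refine (c_un _)
  | |- cvg_to (nbhs (fmap (fun x => expR (@?a x)) _)) _ => refine (c_expR _)
  | |- cvg_to (nbhs (fmap (fun x => (`|@?a x|)%R) _)) _ => refine (c_norm _)
  | |- cvg_to (nbhs (fmap (fun x => (@?a x *: @?b x)%R) _)) _ => refine (v_scale _ _)
  | |- cvg_to (nbhs (fmap fst _)) _ => refine cvg_fst
  | |- cvg_to (nbhs (fmap snd _)) _ => refine cvg_snd
  | |- cvg_to (nbhs (fmap (fun x => ?a) _)) _ => refine (@c_cst _ _ _ _ a)
  | |- cvg_to (nbhs (fmap ?f ?F)) (nbhs ?l) => lazymatch f with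
      | (fun _ => _) => fail
      | _ => change (cvg_to (nbhs (fmap (fun x => f x) F)) (nbhs l))
      end
  end.
Ltac ct := repeat ct1; try match goal with H : ?G |- ?G' => constr_eq G G'; exact H end.
Ltac cct := let x := fresh "x" in move=> x; apply: for_cont; ct.

(** * Differentiation under the integral sign *)

Section ParamIntegral.
Variable R : realType.
Local Notation C := (Cplx R).
Local Notation rc := (@rc R).

(** The retraction of R onto [- d, d]. Composing with it turns a function that is controlled only on
    this interval into one that is continuous everywhere, as the lemmas on [J] require. *)
Definition clamp (d t : R) : R := (`|t + d| - `|t - d|) / 2.
Lemma clamp_cont d : continuous (clamp d).
Proof.
by rewrite /clamp; cct.
Qed.
Lemma clamp_id d t : `|t| <= d -> clamp d t = t.
Proof.
rewrite ler_norml /clamp => /andP[a b].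
rewrite ger0_norm ?ler0_norm; [by field|lra|lra].
Qed.
Lemma clamp_le d t : 0 <= d -> `|clamp d t| <= d.
Proof.
move=> d0; rewrite ler_norml /clamp.
by case: (ger0P (t + d)) => ?; case: (ger0P (t - d)) => ?; apply/andP; split; lra.
Qed.

Lemma cont_comp {T U V : topologicalType} (g : U -> V) (f : T -> U) :
  continuous g -> continuous f -> continuous (fun x => g (f x)).
Proof. by move=> cg cf x; apply: continuous_comp; [exact: cf|exact: cg]. Qed.

(** Hadamard's form of the increment. The mean of p' over the segment is a Caratheodory slope as
    soon as it depends continuously on h. *)
Lemma incr_J (p p' : R -> C) (d : R) : 0 <= d ->
  (forall t, `|t| <= d -> cder p t (p' t)) ->
  (forall t, `|t| <= d -> p' x @[x --> nbhs t] --> p' t) ->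
  forall h, `|h| <= d -> p h = p 0 + rc h * J (fun s => p' (clamp d (s * h))).
Proof.
move=> d0 dp cp h hd.
have cpc : continuous (fun x => p' (clamp d x)).
  move=> x; apply: for_cont; apply: (@cvg_via _ _ _ _ (clamp d) p' (clamp d x)).
    exact: clamp_cont.
  exact: cp (clamp_le _ d0).
have cq0 : continuous (fun s : R => p' (clamp d (s * h))).
  move=> s; apply: for_cont.
  by apply: (@cvg_via _ _ _ _ (fun s => s * h) (fun x => p' (clamp d x)) (s * h)); [ct|exact: cpc].
have cq : continuous (fun s : R => rc h * p' (clamp d (s * h))).
  by cct; exact: cq0.
rewrite -JZ//.
rewrite (@J_FTC _ (fun s => p (h * s)))//.
  by rewrite mulr1 mulr0; ring.
move=> x /andP[x0 x1]; rewrite [x * h]mulrC.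
have xh : `|h * x| <= d.
  rewrite normrM (ger0_norm x0) (le_trans _ hd)// ler_piMr//.
rewrite clamp_id//; apply: cder_lin; exact: dp.
Qed.

(** The slope of the integral is the integral of the slopes [G], which are means of F' by [incr_J]
    and hence jointly continuous. *)
Lemma cder_J (F F' : R -> R -> C) (d : R) : 0 < d ->
  (forall t, `|t| <= d -> continuous (F t)) ->
  (forall t s, `|t| <= d -> cder (F ^~ s) t (F' t s)) ->
  (forall t s, `|t| <= d -> F' z.1 z.2 @[z --> nbhs (t, s)] --> F' t s) ->
  cder (fun t => J (F t)) 0 (J (F' 0)).
Proof.
move=> d0 cF dF cF'.
pose G (h s : R) := J (fun u => F' (clamp d (u * h)) s).
have cl0 : clamp d 0 = 0 by rewrite clamp_id// normr0 ltW.
have cK (z : R * R * R) :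
    F' (clamp d (y.2 * y.1.1)) y.1.2 @[y --> nbhs z] --> F' (clamp d (z.2 * z.1.1)) z.1.2.
  apply: (@cvg_via _ _ _ _ (fun y : R * R * R => (clamp d (y.2 * y.1.1), y.1.2))
    (fun y => F' y.1 y.2) (clamp d (z.2 * z.1.1), z.1.2)); last first.
    by apply: cF'; apply: clamp_le; rewrite ltW.
  ct; apply: (@cvg_via _ _ _ _ (fun y : R * R * R => y.2 * y.1.1) (clamp d)); last exact: clamp_cont.
  by ct.
have cG (z : R * R) : G y.1 y.2 @[y --> nbhs z] --> G z.1 z.2.
  rewrite /G; apply: (@J_cont_at _ _ (fun y u => F' (clamp d (u * y.1)) y.2)).
    near=> y => u; apply: for_cont.
    apply: (@cvg_via _ _ _ _ (fun u : R => ((y, u) : R * R * R))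
      (fun y : R * R * R => F' (clamp d (y.2 * y.1.1)) y.1.2) (y, u)).
      by ct.
    exact: (cK (y, u)).
  by move=> s _; exact: (cK (z, s)).
have cGh h : continuous (G h).
  move=> s; apply: for_cont.
  apply: (@cvg_via _ _ _ _ (fun s => (h, s)) (fun y => G y.1 y.2) (h, s)).
    by ct.
  exact: (cG (h, s)).
have incr h s : `|h| <= d -> F h s = F 0 s + rc h * G h s.
  move=> hd; apply: (@incr_J (F ^~ s) (F' ^~ s) d) => //; first exact: ltW.
    by move=> t td; exact: dF.
  move=> t td; apply: (@cvg_via _ _ _ _ (fun t => (t, s)) (fun y => F' y.1 y.2) (t, s)).
    by ct.
  exact: cF'.
have F0d : `|0 : R| <= d by rewrite normr0 ltW.
apply: (@cder_near _ (fun t => J (F 0) + rc t * J (G t))).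
  apply/nbhs_ballP; exists d => //= h; rewrite /ball/= sub0r normrN add0r => /ltW hd.
  rewrite -JZ// -JD//; first by apply: eq_J => s _; rewrite (incr h s hd).
    exact: cF.
  move=> s; apply: cvgM; [exact: cvg_cst|exact: cGh].
exists (fun h => J (G h)); split.
- apply: J_cont_at; first by near=> h; exact: cGh.
  by move=> s _; exact: (cG (0, s)).
- by apply: eq_J => s _; rewrite /G; rewrite -[RHS]J_cst; apply: eq_J => u _; rewrite mulr0 cl0.
- by move=> h; rewrite add0r rmorph0 mul0r addr0.
Unshelve. all: by end_near. Qed.

Lemma primitive01 (f : R -> C) : continuous f ->
  exists P : R -> C, forall x, 0 <= x <= 1 -> cder P x (f x).
Proof.
move=> cf.
have H (h : R -> R) : continuous h -> exists P : R -> R, forall x : R, 0 <= x <= 1 ->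
    is_derive x (1 : R) P (h x).
  (* The base point - 1, and below the right end 2, leave room on both sides of [0, 1], so that the
     endpoints are covered too. *)
  move=> ch; exists (fun x => \int[@lebesgue_measure R]_(t in `[-1, x]) h t) => x /andP[x0 x1].
  have := @continuous_FTC1 _ h (BLeft (-1)) x 2 _ _ _ _.
  case.
  - by rewrite (le_lt_trans x1)// ltr1n.
  - apply: continuous_compact_integrable; first exact: segment_compact.
    exact: continuous_subspaceT.
  - by rewrite /Order.lt/=; lra.
  - exact: ch.
  - by move=> dP <-; rewrite derive1E; split.
have [P dP] := H _ (cre cf); have [Q dQ] := H _ (cim cf).
exists (fun x => rc (P x) + ci * rc (Q x)) => x x01; rewrite (cE (f x)).
apply: cderD; first exact: cder_real (dP x x01).
apply: cderZ; exact: cder_real (dQ x x01).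
Qed.

(** The midpoint subdivision behind the halving of parallelograms in Goursat's theorem; a primitive
    stands in for a change of variable. *)
Lemma J_split (f : R -> C) : continuous f ->
  J f = 2^-1 * (J (fun s => f (2^-1 * s)) + J (fun s => f (2^-1 + 2^-1 * s))).
Proof.
move=> cf; have [P dP] := primitive01 cf.
have h2 : rc 2^-1 = 2^-1 :> C by rewrite fmorphV/= rmorph_nat.
have i2 : (2 : R)^-1 = 1 / 2 by rewrite div1r.
rewrite (J_FTC cf dP).
have c1 : continuous (fun s : R => f (2^-1 * s)).
  by apply: (cont_comp cf); cct.
have c2 : continuous (fun s : R => f (2^-1 + 2^-1 * s)).
  by apply: (cont_comp cf); cct.
rewrite mulrDr -!JZ//.
rewrite (@J_FTC _ (fun s => P (2^-1 * s))) ?mulr0 ?mulr1; first last.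
- move=> x /andP[x0 x1]; rewrite -h2; apply: cder_lin; apply: dP.
  by rewrite i2; apply/andP; split; lra.
- by cct; exact: c1.
rewrite (@J_FTC _ (fun s => P (2^-1 + 2^-1 * s))) ?mulr0 ?mulr1 ?addr0; first last.
- move=> x /andP[x0 x1]; rewrite -h2; apply: (@cder_lin _ (fun y => P (2^-1 + y))).
  have : cder P (2^-1 + 2^-1 * x) (f (2^-1 + 2^-1 * x)).
    by apply: dP; rewrite i2; apply/andP; split; lra.
  case=> s [cs s0 hs]; exists s; split=> [||h]; [exact: cs|exact: s0|].
  by rewrite addrA hs.
- by cct; exact: c2.
have -> : (2 : R)^-1 + 2^-1 = 1 by rewrite i2; field.
by ring.
Qed.

End ParamIntegral.

(** * Smooth functions of several variables *)

(* [sl k v z] moves the coordinate [k] of [v] by [z]; it is locked, as all the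
   operations below, because unfolding matrix operations makes unification
   diverge. *)
HB.lock Definition sl (R : realType) (g : nat) (k : 'I_g) (v : 'rV[Cplx R]_g) (z : Cplx R) :
  'rV[Cplx R]_g := v + z *: delta_mx 0 k.
Definition ud (R : realType) (b : bool) : Cplx R := if b then ci else 1.
Definition curve (R : realType) (g : nat) (f : 'rV[Cplx R]_g -> Cplx R)
  (v : 'rV[Cplx R]_g) (d : 'I_g * bool) (t : R) : Cplx R := f (sl d.1 v (ud R d.2 * rc t)).
HB.lock Definition pd (R : realType) (g : nat) (d : 'I_g * bool)
    (f : 'rV[Cplx R]_g -> Cplx R) (v : 'rV[Cplx R]_g) : Cplx R :=
  xget 0 [set l | cder (curve f v d) 0 l].

Section Smooth.
Variables (R : realType) (g : nat).
Local Notation C := (Cplx R).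
Local Notation V := 'rV[Cplx R]_g.
Local Notation rc := (@rc R).
Local Notation dir := ('I_g * bool)%type.
Implicit Types (f h : V -> C) (v : V) (W : set V) (d : dir).

Local Notation sl := (@sl R g).
Local Notation ud := (@ud R).

Lemma slE k v (z : C) j : (sl k v z) 0 j = v 0 j + (j == k)%:R * z.
Proof. by rewrite sl.unlock !mxE eqxx/= mulrC. Qed.
Lemma sl0 k v : sl k v 0 = v.
Proof. by rewrite sl.unlock scale0r addr0. Qed.
Lemma slD k v (z w : C) : sl k (sl k v z) w = sl k v (z + w).
Proof. by rewrite sl.unlock -addrA -scalerDl. Qed.
Lemma slC k j v (z w : C) : sl k (sl j v z) w = sl j (sl k v w) z.
Proof. by rewrite sl.unlock addrAC. Qed.
Lemma sl_add k v a (z : C) : sl k (v + a) z = sl k v z + a.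
Proof. by rewrite sl.unlock addrAC. Qed.
Lemma c_sl {T : Type} {F : set_system T} {FF : Filter F} k (f : T -> V) (h : T -> C)
    (a : V) (b : C) :
  f x @[x --> F] --> a -> h x @[x --> F] --> b -> sl k (f x) (h x) @[x --> F] --> sl k a b.
Proof.
by rewrite sl.unlock => fa hb; apply: v_add; [|apply: v_scale; [|exact: c_cst]].
Qed.
Definition pdex d f v := exists l, cder (curve f v d) 0 l.

Lemma pdP d f v l : cder (curve f v d) 0 l -> pd d f v = l.
Proof.
move=> H; rewrite pd.unlock; apply: (@xget_unique _ 0 [set l | cder (curve f v d) 0 l] l) => //.
by move=> y Hy; exact: cder_uniq Hy H.
Qed.
Lemma pd_cder d f v : pdex d f v -> cder (curve f v d) 0 (pd d f v).
Proof. by move=> [l H]; rewrite (pdP H). Qed.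
Lemma curve_at f v d t : cder (curve f (sl d.1 v (ud d.2 * rc t)) d) 0 =1 cder (curve f v d) t.
Proof.
have E x : curve f (sl d.1 v (ud d.2 * rc t)) d x = curve f v d (t + x).
  by rewrite /curve slD -mulrDr -rmorphD.
move=> l; apply/propext; split=> -[s [cs s0 hs]]; exists s; split; [exact: cs|exact: s0| |exact: cs|exact: s0|].
- by move=> x; have := hs x; rewrite !E add0r addr0.
- by move=> x; rewrite !E hs add0r addr0.
Qed.

Lemma curve_cvg v d : sl d.1 v (ud d.2 * rc t) @[t --> nbhs (0 : R)] --> v.
Proof.
have H : sl d.1 v (ud d.2 * rc t) @[t --> nbhs (0 : R)] --> sl d.1 v (ud d.2 * rc 0).
  by apply: c_sl; ct.
by move: H; rewrite rmorph0 mulr0 sl0.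
Qed.

Lemma near_curve (P : set V) v d : (\forall x \near nbhs v, P x) ->
  \forall t \near nbhs (0 : R), P (sl d.1 v (ud d.2 * rc t)).
Proof.
move=> nP; have H : nbhs v P by exact: nP.
exact: (@curve_cvg v d _ H).
Qed.

Lemma cder_curve_near f h v d l : (\forall x \near nbhs v, f x = h x) ->
  cder (curve f v d) 0 l -> cder (curve h v d) 0 l.
Proof.
move=> fh; apply: cder_near; have := near_curve d fh.
by apply: filterS => t /=; rewrite /curve add0r.
Qed.

Lemma pd_near d f h v : (\forall x \near nbhs v, f x = h x) -> pd d f v = pd d h v.
Proof.
move=> fh; rewrite pd.unlock; congr xget; apply/seteqP; split=> l /=.
  exact: cder_curve_near.
by apply: cder_curve_near; apply: filterS fh => x.
Qed.

(** Differentiability of order n is stated pointwise through iterated partial derivatives; on an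
    open set this is the class C^n. In this form smoothness restricts and glues with no further
    argument. *)
Fixpoint smo (n : nat) f v : Prop := (f x @[x --> nbhs v] --> f v) /\
  (if n is n'.+1 then forall d, pdex d f v /\ smo n' (pd d f) v else True).

Lemma smo_0 f v : f x @[x --> nbhs v] --> f v -> smo 0 f v. Proof. by []. Qed.
Lemma smo_S n f v : f x @[x --> nbhs v] --> f v ->
  (forall d, pdex d f v /\ smo n (pd d f) v) -> smo n.+1 f v.
Proof. by []. Qed.
Lemma smo_cont n f v : smo n f v -> f x @[x --> nbhs v] --> f v.
Proof. by case: n => [|n] []. Qed.

Definition sm W f := forall n v, W v -> smo n f v.

Lemma near_near (P : V -> Prop) v : (\forall x \near nbhs v, P x) ->
  \forall x \near nbhs v, \forall y \near nbhs x, P y.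
Proof. by move=> /nbhs_interior. Qed.

Lemma smo_near n f h v : (\forall x \near nbhs v, f x = h x) -> smo n f v -> smo n h v.
Proof.
elim: n f h v => [|n IH] f h v fh /= [cf df].
  split; last by [].
  have <- := nbhs_singleton fh.
  exact: cvg_near_eq fh cf.
split.
  have <- := nbhs_singleton fh.
  exact: cvg_near_eq fh cf.
move=> d; have [[l fl] sf] := df d; split; first by exists l; exact: cder_curve_near fl.
apply: IH sf; have := near_near fh; apply: filterS => x; exact: pd_near.
Qed.

Lemma sm_ext W f h : open W -> (forall v, W v -> f v = h v) -> sm W f -> sm W h.
Proof.
move=> oW fh sf n v Wv; apply: smo_near (sf n v Wv).
by have := open_nbhs_nbhs (conj oW Wv); apply: filterS.
Qed.
Lemma sm_sub W W' f : W' `<=` W -> sm W f -> sm W' f.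
Proof. by move=> WW sf n v /WW; exact: sf. Qed.
Lemma sm_cont W f v : sm W f -> W v -> f x @[x --> nbhs v] --> f v.
Proof. by move=> sf Wv; case: (sf 0 v Wv). Qed.
Lemma sm_pdex W f d v : sm W f -> W v -> pdex d f v.
Proof. by move=> sf Wv; have [_ /(_ d)[]] := sf 1 v Wv. Qed.
Lemma sm_pd W f d : sm W f -> sm W (pd d f).
Proof. by move=> sf n v Wv; have [_ /(_ d)[]] := sf n.+1 v Wv. Qed.
Lemma pd_cderW W f d v : sm W f -> W v -> cder (curve f v d) 0 (pd d f v).
Proof. by move=> sf Wv; apply: pd_cder; exact: sm_pdex sf Wv. Qed.
Lemma pd_ext W f h d v : open W -> (forall v, W v -> f v = h v) -> W v -> pd d f v = pd d h v.
Proof.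
move=> oW fh Wv; apply: pd_near.
by have := open_nbhs_nbhs (conj oW Wv); apply: filterS.
Qed.

Lemma open_near W v : open W -> W v -> \forall x \near nbhs v, W x.
Proof. by move=> oW Wv; exact: open_nbhs_nbhs. Qed.

Lemma curve0 f v d : curve f v d 0 = f v.
Proof. by rewrite /curve rmorph0 mulr0 sl0. Qed.

(* The induction principle behind all closure properties: a class of functions
   that are continuous and have partial derivatives in the class is smooth. *)
Lemma sm_coind W (P : (V -> C) -> Prop) : open W ->
  (forall f v, P f -> W v -> f x @[x --> nbhs v] --> f v) ->
  (forall f d, P f -> exists2 h, P h & forall v, W v -> cder (curve f v d) 0 (h v)) ->
  forall f, P f -> sm W f.
Proof.
move=> oW cP dP f Pf n; elim: n f Pf => [|n IH] f Pf v Wv /=.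
  by split; [exact: cP|].
split; first exact: cP.
move=> d; have [h Ph fh] := dP f d Pf.
split; first by exists (h v); exact: fh.
apply: smo_near (IH h Ph v Wv).
by apply: filterS (open_near oW Wv) => x Wx; rewrite (pdP (fh x Wx)).
Qed.

Lemma sm_cst W (a : C) : open W -> sm W (fun=> a).
Proof.
move=> oW; apply: (@sm_coind _ (fun f => exists b : C, f = fun=> b)) => //.
- by move=> _ v [b ->] _; exact: c_cst.
- move=> _ d [b ->]; exists (fun=> 0); first by exists 0.
  by move=> v _; exact: cder_cst.
- by exists a.
Qed.

Lemma pd_cst d (a : C) v : pd d (fun=> a) v = 0.
Proof. by apply: pdP; exact: cder_cst. Qed.

Lemma pdD W f h d v : sm W f -> sm W h -> W v ->
  pd d (fun x => f x + h x) v = pd d f v + pd d h v.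
Proof.
move=> sf sh Wv; apply: pdP; have := cderD (pd_cderW d sf Wv) (pd_cderW d sh Wv).
by [].
Qed.
Lemma pdM W f h d v : sm W f -> sm W h -> W v ->
  pd d (fun x => f x * h x) v = pd d f v * h v + f v * pd d h v.
Proof.
move=> sf sh Wv; apply: pdP; have := cderM (pd_cderW d sf Wv) (pd_cderW d sh Wv).
by rewrite !curve0.
Qed.
Lemma pdZ W (k : C) f d v : sm W f -> W v -> pd d (fun x => k * f x) v = k * pd d f v.
Proof. by move=> sf Wv; apply: pdP; have := cderZ k (pd_cderW d sf Wv). Qed.

(** With n fixed, closure under products and circle means can be proved by induction on n, since the
    derivatives are only known to order n - 1. *)
Definition sn n W f := forall v, W v -> smo n f v.
Lemma smo_pred n f v : smo n.+1 f v -> smo n f v.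
Proof.
elim: n f v => [|n IH] f v [cf df]; first exact: smo_0.
by apply: smo_S => // d; have [? s] := df d; split; [|exact: IH].
Qed.
Lemma snS_pd n W f d v : sn n.+1 W f -> W v -> pdex d f v /\ smo n (pd d f) v.
Proof. by move=> sf Wv; have [_ /(_ d)] := sf v Wv. Qed.

Lemma sn_step n W f (df : dir -> V -> C) : open W ->
  (forall v, W v -> f x @[x --> nbhs v] --> f v) ->
  (forall d v, W v -> cder (curve f v d) 0 (df d v)) ->
  (forall d, sn n W (df d)) -> sn n.+1 W f.
Proof.
move=> oW cf hf sdf v Wv; apply: smo_S; first exact: cf.
move=> d; split; first by exists (df d v); exact: hf.
apply: (@smo_near _ (df d)) (sdf d v Wv).
by apply: filterS (open_near oW Wv) => x Wx; rewrite (pdP (hf d x Wx)).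
Qed.

Lemma snD n W f h : open W -> sn n W f -> sn n W h -> sn n W (fun x => f x + h x).
Proof.
move=> oW; elim: n f h => [|n IH] f h sf sh.
  by move=> v Wv; apply: smo_0; apply: c_add; [exact: (smo_cont (sf v Wv))|exact: (smo_cont (sh v Wv))].
apply: (@sn_step _ _ _ (fun d x => pd d f x + pd d h x)) => [//|v Wv|d v Wv|d].
- by apply: c_add; [exact: (smo_cont (sf v Wv))|exact: (smo_cont (sh v Wv))].
- by apply: cderD; apply: pd_cder; [exact: (snS_pd d sf Wv).1|exact: (snS_pd d sh Wv).1].
- by apply: IH => v Wv; [exact: (snS_pd d sf Wv).2|exact: (snS_pd d sh Wv).2].
Qed.

Lemma snM n W f h : open W -> sn n W f -> sn n W h -> sn n W (fun x => f x * h x).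
Proof.
move=> oW; elim: n f h => [|n IH] f h sf sh.
  by move=> v Wv; apply: smo_0; apply: c_mul; [exact: (smo_cont (sf v Wv))|exact: (smo_cont (sh v Wv))].
have sf' : sn n W f by move=> v Wv; apply: smo_pred; exact: sf.
have sh' : sn n W h by move=> v Wv; apply: smo_pred; exact: sh.
apply: (@sn_step _ _ _ (fun d x => pd d f x * h x + f x * pd d h x)) => [//|v Wv|d v Wv|d].
- by apply: c_mul; [exact: (smo_cont (sf v Wv))|exact: (smo_cont (sh v Wv))].
- have := cderM (pd_cder (snS_pd d sf Wv).1) (pd_cder (snS_pd d sh Wv).1).
  by rewrite !curve0.
- apply: snD => //; apply: IH => // v Wv; [exact: (snS_pd d sf Wv).2|exact: (snS_pd d sh Wv).2].
Qed.

Lemma smD W f h : open W -> sm W f -> sm W h -> sm W (fun x => f x + h x).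
Proof. by move=> oW sf sh n; apply: snD => // v Wv; [exact: sf|exact: sh]. Qed.
Lemma smM W f h : open W -> sm W f -> sm W h -> sm W (fun x => f x * h x).
Proof. by move=> oW sf sh n; apply: snM => // v Wv; [exact: sf|exact: sh]. Qed.

Lemma smZ W (k : C) f : open W -> sm W f -> sm W (fun x => k * f x).
Proof. by move=> oW sf; apply: smM => //; exact: sm_cst. Qed.
Lemma smN W f : open W -> sm W f -> sm W (fun x => - f x).
Proof. move=> oW /(smZ (-1) oW) H; apply: sm_ext H => // v _; exact: mulN1r. Qed.
Lemma smB W f h : open W -> sm W f -> sm W h -> sm W (fun x => f x - h x).
Proof. by move=> oW sf sh; apply: smD => //; exact: smN. Qed.
Lemma sm_sum W (I : Type) (s : seq I) (F : I -> V -> C) : open W ->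
  (forall i, sm W (F i)) -> sm W (fun x => \sum_(i <- s) F i x).
Proof.
move=> oW sF; elim: s => [|i s IH].
  by apply: (sm_ext oW) (sm_cst 0 oW) => v _; rewrite big_nil.
by apply: (sm_ext oW) (smD oW (sF i) IH) => v _; rewrite big_cons.
Qed.
Lemma pd_sum W (I : Type) (s : seq I) (F : I -> V -> C) d v : open W ->
  (forall i, sm W (F i)) -> W v ->
  pd d (fun x => \sum_(i <- s) F i x) v = \sum_(i <- s) pd d (F i) v.
Proof.
move=> oW sF Wv; elim: s => [|i s IH].
  rewrite big_nil -[RHS](pd_cst d 0 v); apply: pd_near.
  by near=> x; rewrite big_nil.
rewrite big_cons -IH -(pdD _ (sF i) (sm_sum s oW sF) Wv); apply: pd_near.
by near=> x; rewrite big_cons.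
Unshelve. all: by end_near. Qed.

Lemma smV W f : open W -> sm W f -> (forall v, W v -> f v != 0) -> sm W (fun x => (f x)^-1).
Proof.
move=> oW sf f0.
(* The class of the functions a / f^n is preserved by the quotient rule, as [sm_coind] asks. *)
pose P k := exists a n, sm W a /\ k = fun x => a x * (f x)^-1 ^+ n.
apply: (@sm_coind _ P) => //; last first.
- exists (fun=> 1), 1%N; split; first exact: sm_cst.
  by apply/funext => x; rewrite mul1r expr1.
- move=> _ d [a [n [sa ->]]].
  exists (fun v => (pd d a v * f v - n%:R * a v * pd d f v) * (f v)^-1 ^+ n.+1).
    eexists; exists n.+1; split; last reflexivity.
    apply: smB => //; first by apply: smM => //; exact: sm_pd.
    by apply: smM => //; [exact: smZ|exact: sm_pd].
  move=> v Wv.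
  have di : cder (fun t => (curve f v d t)^-1) 0 (- (f v) ^- 2 * pd d f v).
    have := cder_comp (pd_cderW d sf Wv) (xderV _); rewrite curve0; apply; exact: f0.
  have dX m : cder (fun t => (curve f v d t)^-1 ^+ m) 0
      (- m%:R * pd d f v * (f v)^-1 ^+ m.+1).
    elim: m => [|m IH].
      rewrite oppr0 !mul0r (_ : (fun _ => _) = fun=> 1); first exact: cder_cst.
      by apply/funext => t; rewrite expr0.
    rewrite (_ : (fun _ => _) = fun t => (curve f v d t)^-1 * (curve f v d t)^-1 ^+ m).
      apply: cder_eq (cderM di IH) _; rewrite curve0 !exprS -natr1; have := f0 v Wv => fv0.
      by set y := _^-1 ^+ m; field.
    by apply/funext => t; rewrite exprS.
  have := cderM (pd_cderW d sa Wv) (dX n); rewrite !curve0 => H; apply: cder_eq H _.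
  by rewrite exprS; have := f0 v Wv => fv0; field.
- move=> _ v [a [n [sa ->]]] Wv; apply: c_mul; first exact: (sm_cont sa Wv).
  apply: c_exp; apply: c_inv; first exact: f0.
  exact: (sm_cont sf Wv).
Qed.

Lemma sm_conj W f : open W -> sm W f -> sm W (fun x => cj (f x)).
Proof.
move=> oW sf; apply: (@sm_coind _ (fun k => exists2 a, sm W a & k = fun x => cj (a x))) => //.
- move=> _ v [a sa ->] Wv; apply: cvg_conj; exact: (sm_cont sa Wv).
- move=> _ d [a sa ->]; exists (fun x => cj (pd d a x)).
    by exists (pd d a) => //; exact: sm_pd.
  move=> v Wv; exact: cder_conj (pd_cderW d sa Wv).
- by exists f.
Qed.

Lemma curve_trans f a v d : curve (fun x => f (x + a)) v d = curve f (v + a) d.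
Proof. by apply/funext => t; rewrite /curve sl_add. Qed.
Lemma pd_trans f a d v : pd d (fun x => f (x + a)) v = pd d f (v + a).
Proof. by rewrite pd.unlock curve_trans. Qed.
Lemma smo_trans n f a v : smo n f (v + a) -> smo n (fun x => f (x + a)) v.
Proof.
have cF h x : h y @[y --> nbhs (x + a)] --> h (x + a) -> h (y + a) @[y --> nbhs x] --> h (x + a).
  by move=> ch; apply: (@cvg_via _ _ _ _ (fun y => y + a) h (x + a)); [ct|].
elim: n f v => [|n IH] f v /= [cf df]; first by split; [exact: cF|].
split; first exact: cF.
move=> d; have [[l fl] sf] := df d; split; first by exists l; rewrite curve_trans.
have -> : pd d (fun x => f (x + a)) = (fun x => pd d f (x + a)).
  by apply/funext => x; exact: pd_trans.
exact: IH.
Qed.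

Lemma cder_ext (p q : R -> C) t l : p =1 q -> cder p t l -> cder q t l.
Proof. by move=> /funext ->. Qed.

End Smooth.

(** * Polar coordinates *)

Section Planar.
Variable R : realType.
Local Notation C := (Cplx R).
Local Notation rc := (@rc R).

Lemma cder_exl (h : C) (s : R) : cder (fun x => ex (rc x * h)) s (h * ex (rc s * h)).
Proof.
have E (x : R) : ex (rc x * h) = rc (expR (re h * x)) * (rc (cos (im h * x)) + ci * rc (sin (im h * x))).
  by rewrite ex.unlock !reimE !mul0r subr0 addr0 ![x * _]mulrC.
rewrite (_ : (fun x => _) = (fun x => rc (expR (re h * x)) *
    (rc (cos (im h * x)) + ci * rc (sin (im h * x))))); last by apply/funext.
have d1 := cder_lin (cder_real (is_derive_expR (re h * s))).
have d2 := cder_lin (cder_real (is_derive_cos (im h * s))).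
have d3 := cder_lin (cder_real (is_derive_sin (im h * s))).
apply: cder_eq (cderM d1 (cderD d2 (cderZ ci d3))) _.
rewrite E rmorphN [X in _ = X * _](cE h).
set e := rc (expR _); set c := rc (cos _); set n := rc (sin _).
transitivity (rc (re h) * (e * (c + ci * n)) + rc (im h) * (ci * e * c + (-1) * e * n)); first by ring.
by rewrite -[-1]ciM; ring.
Qed.

(** By [exD] only the point 0 matters, and there (ex h - 1) / h is the mean of [ex] over the segment
    from 0 to h. *)
Lemma xder_ex (z : C) : xder (@ex R) z (ex z).
Proof.
exists (fun h => ex z * J (fun s => ex (rc s * h))); split.
- apply: c_mul; first exact: c_cst.
  apply: (@J_cont_at _ _ (fun h s => ex (rc s * h))).
    by near=> h; cct.
  by move=> s _; ct.
- rewrite (@eq_J _ _ (fun=> 1)) ?J_cst ?mulr1// => s _; by rewrite mulr0 ex0.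
- move=> h; rewrite exD.
  have -> : ex h = 1 + h * J (fun s => ex (rc s * h)); last by ring.
  rewrite -JZ; last by cct.
  rewrite (@J_FTC _ (fun s => ex (rc s * h))).
  + by rewrite rmorph1 rmorph0 mul1r mul0r ex0; ring.
  + by cct.
  + by move=> s _; exact: cder_exl.
Unshelve. all: by end_near. Qed.

Definition tau : C := rc (2 * pi) * ci.
Lemma tau_neq0 : tau != 0.
Proof. by rewrite mulf_neq0 ?ci_neq0// rc_eq0 mulf_neq0// gt_eqF// pi_gt0. Qed.
Lemma unE (t : R) : un t = ex (rc t * tau).
Proof. by rewrite un.unlock /tau !rmorphM; congr ex; ring. Qed.
Lemma cder_un (t : R) : cder (@un R) t (tau * un t).
Proof.
rewrite unE (_ : @un R = fun x => ex (rc x * tau)); first exact: cder_exl.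
by apply/funext => x; rewrite unE.
Qed.
Lemma unV_cont : continuous (fun t : R => (un t)^-1 : C).
Proof. by move=> t; apply: for_cont; apply: c_inv; [exact: un_neq0|ct]. Qed.
Lemma J_un : J (@un R) = 0.
Proof.
apply: (mulfI tau_neq0); rewrite mulr0 -JZ; last exact: un_cont.
rewrite (@J_FTC _ (@un R)) ?un1 ?un0 ?subrr//; first by cct.
by move=> s _; exact: cder_un.
Qed.
Lemma J_unV : J (fun t => (un t)^-1 : C) = 0.
Proof.
apply: (mulfI tau_neq0); rewrite mulr0 -JZ; last exact: unV_cont.
have cU : continuous (fun t : R => tau * (un t)^-1) by cct; exact: unV_cont.
rewrite (@J_FTC _ (fun t => - (un t)^-1)) ?un1 ?un0 ?invr1 ?subrr//.
move=> s _; have := cderN (cder_comp (cder_un s) (xderV (un_neq0 s))).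
by move=> /cder_eq; apply; have := un_neq0 s => u0; field.
Qed.

(** A C^1 function of the plane with its partial derivatives a = d/dx and b = d/dy; [zb] and [zd]
    are then d/dconj(z) and d/dz. *)
Definition pl (p a b : C -> C) := [/\ continuous a, continuous b,
  forall z, cder (fun t => p (z + rc t)) 0 (a z) &
  forall z, cder (fun t => p (z + ci * rc t)) 0 (b z)].
Definition zb (a b : C -> C) z := 2^-1 * (a z + ci * b z).
Definition zd (a b : C -> C) z := 2^-1 * (a z - ci * b z).

(** Continuous partial derivatives give a real differential: the increment is split into a
    horizontal and a vertical leg, and [incr_J] is applied to each. *)
Lemma pl_chain p a b : pl p a b -> forall (c : R -> C) t c', cder c t c' ->
  cder (p \o c) t (a (c t) * rc (re c') + b (c t) * rc (im c')).
Proof.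
move=> [ca cb da db] c t _ [s [cs <- hs]].
pose A (h : C) := J (fun u => a (c t + rc (u * re h))).
pose B (h : C) := J (fun u => b (c t + rc (re h) + ci * rc (u * im h))).
have cA : A h @[h --> nbhs 0] --> a (c t).
  have : A h @[h --> nbhs 0] --> A 0.
    apply: (@J_cont_at _ _ (fun h u => a (c t + rc (u * re h)))).
      near=> h => u; apply: for_cont.
      by apply: (@cvg_via _ _ _ _ (fun u => c t + rc (u * re h))); [ct|exact: ca].
    move=> u _; apply: (@cvg_via _ _ _ _ (fun z => c t + rc (z.2 * re z.1))); [ct|exact: ca].
  by rewrite {2}/A (@eq_J _ _ (fun=> a (c t))) ?J_cst// => u _; rewrite re0 mulr0 rmorph0 addr0.
have cB : B h @[h --> nbhs 0] --> b (c t).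
  have : B h @[h --> nbhs 0] --> B 0.
    apply: (@J_cont_at _ _ (fun h u => b (c t + rc (re h) + ci * rc (u * im h)))).
      near=> h => u; apply: for_cont.
      by apply: (@cvg_via _ _ _ _ (fun u => c t + rc (re h) + ci * rc (u * im h))); [ct|exact: cb].
    by move=> u _; apply: (@cvg_via _ _ _ _ (fun z => c t + rc (re z.1) + ci * rc (z.2 * im z.1))); [ct|exact: cb].
  rewrite {2}/B (@eq_J _ _ (fun=> b (c t))) ?J_cst// => u _.
  by rewrite re0 im0 mulr0 !rmorph0 mulr0 !addr0.
have pAB h : p (c t + h) = p (c t) + rc (re h) * A h + rc (im h) * B h.
  have -> : c t + h = c t + rc (re h) + ci * rc (im h) by rewrite {1}(cE h); ring.
  have i1 : p (c t + rc (re h)) = p (c t) + rc (re h) * A h.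
    have := @incr_J _ (fun t' => p (c t + rc t')) (fun t' => a (c t + rc t')) `|re h| (normr_ge0 _) _ _ (re h) (lexx _).
    rewrite rmorph0 addr0 => ->.
    - congr (_ + _ * _); apply: eq_J => u /andP[u0 u1]; rewrite clamp_id//.
      by rewrite normrM ger0_norm// ler_piMl.
    - move=> x _; apply/cder_shift; have := da (c t + rc x).
      by congr cder; apply/funext => y; rewrite rmorphD; congr p; ring.
    - move=> x _; apply: (@cvg_via _ _ _ _ (fun t' => c t + rc t')); [ct|exact: ca].
  rewrite -i1.
  have := @incr_J _ (fun t' => p (c t + rc (re h) + ci * rc t'))
    (fun t' => b (c t + rc (re h) + ci * rc t')) `|im h| (normr_ge0 _) _ _ (im h) (lexx _).
  rewrite rmorph0 mulr0 addr0 => ->.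
  - congr (_ + _ * _); apply: eq_J => u /andP[u0 u1]; rewrite clamp_id//.
    by rewrite normrM ger0_norm// ler_piMl.
  - move=> x _; apply/cder_shift; have := db (c t + rc (re h) + ci * rc x).
    by congr cder; apply/funext => y; rewrite rmorphD; congr p; ring.
  - move=> x _; apply: (@cvg_via _ _ _ _ (fun t' => c t + rc (re h) + ci * rc t')); [ct|exact: cb].
have ch : rc h * s h @[h --> nbhs (0 : R)] --> (0 : C).
  have H : rc h * s h @[h --> nbhs (0 : R)] --> rc 0 * s 0.
    by apply: c_mul; [exact: rc_cont|exact: cs].
  by move: H; rewrite rmorph0 mul0r.
exists (fun h => rc (re (s h)) * A (rc h * s h) + rc (im (s h)) * B (rc h * s h)); split.
- rewrite rmorph0 mul0r; apply: c_add; apply: c_mul; [exact: cvg_rc (cvg_re cs)| |exact: cvg_rc (cvg_im cs)|].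
    have -> : A 0 = a (c t) by rewrite /A (@eq_J _ _ (fun=> a (c t))) ?J_cst// => u _; rewrite re0 mulr0 rmorph0 addr0.
    exact: cvg_via ch cA.
  have -> : B 0 = b (c t).
    rewrite /B (@eq_J _ _ (fun=> b (c t))) ?J_cst// => u _.
    by rewrite re0 im0 mulr0 !rmorph0 mulr0 !addr0.
  exact: cvg_via ch cB.
- rewrite rmorph0 mul0r.
  have -> : A 0 = a (c t) by rewrite /A (@eq_J _ _ (fun=> a (c t))) ?J_cst// => u _; rewrite re0 mulr0 rmorph0 addr0.
  have -> : B 0 = b (c t).
    rewrite /B (@eq_J _ _ (fun=> b (c t))) ?J_cst// => u _.
    by rewrite re0 im0 mulr0 !rmorph0 mulr0 !addr0.
  by ring.
- move=> h /=; rewrite hs pAB reM imM re_rc im_rc !mul0r subr0 addr0 !rmorphM; ring.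
Unshelve. all: by end_near. Qed.

Lemma plM p a b q c d : continuous p -> continuous q -> pl p a b -> pl q c d ->
  pl (fun z => p z * q z) (fun z => a z * q z + p z * c z) (fun z => b z * q z + p z * d z).
Proof.
move=> cp cq [ca cb da db] [cc cd dc dd]; split.
- by cct; [exact: ca|exact: cq|exact: cp|exact: cc].
- by cct; [exact: cb|exact: cq|exact: cp|exact: cd].
- by move=> z; have := cderM (da z) (dc z); rewrite rmorph0 addr0.
- by move=> z; have := cderM (db z) (dd z); rewrite rmorph0 mulr0 addr0.
Qed.

Lemma xder_curve p z l (w : C) : xder p z l -> cder (fun t => p (z + w * rc t)) 0 (l * w).
Proof.
move=> H; have d : cder (fun t => z + w * rc t) 0 w.
  by apply: cder_eq (cderD (cder_cst z 0) (cderZ w (cder_rc 0))) _; rewrite add0r mulr1.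
by have := cder_comp d (f := p); rewrite rmorph0 mulr0 addr0; apply.
Qed.

Lemma pl_x p p' : continuous p' -> (forall z, xder p z (p' z)) ->
  pl p p' (fun z => ci * p' z).
Proof.
move=> cp' dp; split.
- exact: cp'.
- by cct; exact: cp'.
- move=> z; have := xder_curve 1 (dp z); rewrite mulr1.
  by congr cder; apply/funext => t; rewrite mul1r.
- by move=> z; rewrite mulrC; exact: xder_curve.
Qed.
Lemma pl_conj p a b : pl p a b -> pl (fun z => cj (p z)) (fun z => cj (a z)) (fun z => cj (b z)).
Proof.
move=> [ca cb da db]; split.
- by cct; exact: ca.
- by cct; exact: cb.
- by move=> z; exact: cder_conj.
- by move=> z; exact: cder_conj.
Qed.

Lemma cj_ci : cj ci = - ci :> C. Proof. by apply: c_eq; rewrite ?re_conj ?im_conj !reimE ?oppr0. Qed.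
Lemma cj_rc (t : R) : cj (rc t) = rc t. Proof. exact: conjc_real. Qed.
Lemma re_half (u : C) : rc (re u) = 2^-1 * (u + cj u).
Proof. by rewrite {2 3}(cE u) conjD conjM cj_ci !cj_rc; field. Qed.
Lemma im_half (u : C) : rc (im u) = 2^-1 * - ci * (u - cj u).
Proof.
rewrite {2 3}(cE u) conjD conjM cj_ci !cj_rc.
transitivity (- (ci * ci) * rc (im u)); last by field.
by rewrite ciM opprK mul1r.
Qed.

(** The real differential split into its C-linear and its antilinear part. *)
Lemma dir_split (a b u : C) : a * rc (re u) + b * rc (im u) =
  u * (2^-1 * (a - ci * b)) + cj u * (2^-1 * (a + ci * b)).
Proof. by rewrite re_half im_half; ring. Qed.

Section Polar.
Variables (p a b : C -> C).
Hypothesis P : pl p a b.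
Let ca : continuous a. Proof. by case: P. Qed.
Let cb : continuous b. Proof. by case: P. Qed.
Let czb : continuous (zb a b). Proof. by rewrite /zb; cct; [exact: ca|exact: cb]. Qed.
Let czd : continuous (zd a b). Proof. by rewrite /zd; cct; [exact: ca|exact: cb]. Qed.
Let U (f : C -> C) (cf : continuous f) (r : R) : continuous (fun t : R => f (rc r * un t)).
Proof. by move=> t; apply: for_cont; apply: (@cvg_via _ _ _ _ (fun t => rc r * un t)); [ct|exact: cf]. Qed.

(** The angular derivative of p on the circle of radius r has mean 0, and it is proportional to u
    dp/dz - conj(u) dp/dconj(z). *)
Lemma polar_balance (r : R) : J (fun t => un t * zd a b (rc r * un t)) =
  J (fun t => (un t)^-1 * zb a b (rc r * un t)).
Proof.
have [->|r0] := eqVneq r 0.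
  rewrite (@eq_J _ _ (fun t => zd a b 0 * un t)); last by move=> t _; rewrite rmorph0 mul0r mulrC.
  rewrite [RHS](@eq_J _ _ (fun t => zb a b 0 * (un t)^-1)); last by move=> t _; rewrite rmorph0 mul0r mulrC.
  by rewrite !JZ ?J_un ?J_unV ?mulr0//; [exact: unV_cont|exact: un_cont].
have c1 : continuous (fun t : R => un t * zd a b (rc r * un t)) by cct; exact: (U czd).
have c2 : continuous (fun t : R => (un t)^-1 * zb a b (rc r * un t)).
  by cct; [exact: unV_cont|exact: (U czb)].
apply/eqP; rewrite -subr_eq0 -JB//; apply/eqP.
have rt : rc r * tau != 0 by rewrite mulf_neq0 ?tau_neq0// rc_eq0.
apply: (mulfI rt); rewrite mulr0 -JZ; last by cct; [exact: (U czd)|exact: unV_cont|exact: (U czb)].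
rewrite (@J_FTC _ (fun t => p (rc r * un t))).
- by rewrite un1 un0 subrr.
- by cct; [exact: (U czd)|exact: unV_cont|exact: (U czb)].
- move=> t _; have := pl_chain P (cderZ (rc r) (cder_un t)) => /cder_eq; apply.
rewrite dir_split (conjM (rc r)) (conjM tau) cj_rc un_conj -/(zd _ _ _) -/(zb _ _ _).
have -> : cj tau = - tau by rewrite /tau conjM cj_rc cj_ci mulrN.
by rewrite /zd /zb; ring.
Qed.

(** The radial derivative is u dp/dz + conj(u) dp/dconj(z), and the two terms have the same mean by
    [polar_balance]; hence the factor 2. *)
Lemma polar_b (r : R) : cder (fun x => J (fun t => p (rc x * un t))) r
  (2 * J (fun t => (un t)^-1 * zb a b (rc r * un t))).
Proof.
apply/cder_shift.
have D x t : cder (fun x => p (rc (r + x) * un t)) x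
    (un t * zd a b (rc (r + x) * un t) + (un t)^-1 * zb a b (rc (r + x) * un t)).
  have d : cder (fun x => rc (r + x) * un t) x (un t).
    have := cderM (cderD (cder_cst (rc r) x) (cder_rc x)) (cder_cst (un t) x).
    rewrite add0r mul1r mulr0 addr0; congr cder; apply/funext => y; by rewrite rmorphD.
  have := pl_chain P d => /cder_eq; apply.
  by rewrite dir_split un_conj.
have cp x : continuous (fun t => p (rc x * un t)).
  by move=> t; exact: cder_cont (pl_chain P (cderZ (rc x) (cder_un t))).
have cV (z : R * R) : (un y.2)^-1 @[y --> nbhs z] --> ((un z.2)^-1 : C).
  by apply: c_inv; [exact: un_neq0|ct].
have K (f : C -> C) (z : R * R) : continuous f ->
    f (rc (r + y.1) * un y.2) @[y --> nbhs z] --> f (rc (r + z.1) * un z.2).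
  by move=> cf; apply: (@cvg_via _ _ _ _ (fun y : R * R => rc (r + y.1) * un y.2)); [ct|exact: cf].
have := @cder_J _ (fun x t => p (rc (r + x) * un t)) (fun x t =>
   un t * zd a b (rc (r + x) * un t) + (un t)^-1 * zb a b (rc (r + x) * un t)) 1 ltr01.
move=> /(_ _ _ _)/cder_eq; apply.
- by move=> x _; exact: cp.
- by move=> x t _; exact: D.
- move=> x t _; ct; [exact: (K _ (x, t) czd)|exact: (cV (x, t))|exact: (K _ (x, t) czb)].
- rewrite addr0 JD ?polar_balance; first by rewrite mulrDl mul1r.
    by cct; exact: (U czd).
  by cct; [exact: unV_cont|exact: (U czb)].
Qed.

Lemma polar_d (r : R) : cder (fun x => J (fun t => p (rc x * un t))) r
  (2 * J (fun t => un t * zd a b (rc r * un t))).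
Proof. by rewrite polar_balance; exact: polar_b. Qed.

End Polar.
End Planar.

Ltac ctv := repeat first [ct1 | match goal with
  | |- cvg_to (nbhs (fmap (fun x => sl _ (@?a x) (@?b x)) _)) _ => refine (c_sl _ _) end];
  try match goal with H : ?G |- ?G' => constr_eq G G'; exact H end.

(* [Dg ci k] is d/dconj(v_k) and [Dg (- ci) k] is d/dv_k. *)
HB.lock Definition Dg (R : realType) (g : nat) (e : Cplx R) (k : 'I_g)
    (f : 'rV[Cplx R]_g -> Cplx R) : 'rV[Cplx R]_g -> Cplx R :=
  fun v => 2^-1 * (pd (k, false) f v + e * pd (k, true) f v).

Section SmoothV.
Variables (R : realType) (g : nat).
Local Notation C := (Cplx R).
Local Notation V := 'rV[Cplx R]_g.
Local Notation rc := (@rc R).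
Local Notation dir := ('I_g * bool)%type.
Local Notation smT := (@sm R g setT).
Local Notation sl := (@sl R g).
Local Notation ud := (@ud R).
Implicit Types (f h : V -> C) (v w : V) (W : set V) (d : dir).
Local Notation mv d v t := (sl d.1 v (ud d.2 * rc t)).

Lemma smT_cont f : smT f -> continuous f.
Proof. by move=> sf v; exact: (sm_cont sf I). Qed.

Lemma c_comp {T : Type} {F : set_system T} {FF : Filter F} f (h : T -> V) (a : V) :
  continuous f -> h x @[x --> F] --> a -> f (h x) @[x --> F] --> f a.
Proof. by move=> cf ha; apply: (cvg_via ha); exact: cf. Qed.

Lemma pd_curve f d v t : smT f -> cder (curve f v d) t (pd d f (mv d v t)).
Proof. by move=> sf; rewrite -curve_at; exact: (pd_cderW d sf I). Qed.

Lemma incr_pd f d v (t : R) : smT f ->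
  f (mv d v t) = f v + rc t * J (fun s => pd d f (mv d v (s * t))).
Proof.
move=> sf; have sd := smT_cont (sm_pd d sf).
have dc x : `|x| <= `|t| -> cder (curve f v d) x (pd d f (mv d v x)).
  by move=> _; exact: pd_curve.
have cc x : `|x| <= `|t| -> pd d f (mv d v y) @[y --> nbhs x] --> pd d f (mv d v x).
  by move=> _; apply: (c_comp sd); ctv.
have := incr_J (normr_ge0 t) dc cc (lexx _).
rewrite curve0 -[f (mv d v t)]/(curve f v d t) => ->.
rewrite (@eq_J _ _ (fun s => pd d f (mv d v (s * t)))) => [//|u /andP[u0 u1]].
by rewrite clamp_id// normrM ger0_norm// ler_piMl.
Qed.

(** Differentiating both sides of [incr_pd] along d shows that the mean of [pd d (pd e f)] along e
    is a Caratheodory slope of [pd d f]. *)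
Lemma pdC f d e v : smT f -> pd d (pd e f) v = pd e (pd d f) v.
Proof.
move=> sf; apply/esym; apply: pdP.
have se := sm_pd e sf; have sde := sm_pd d se; have sd := sm_pd d sf.
have cse := smT_cont se; have csde := smT_cont sde.
pose K t := J (fun u => pd d (pd e f) (mv e v (u * t))).
exists K; split.
- apply: (@J_cont_at _ _ (fun t u => pd d (pd e f) (mv e v (u * t)))).
    by near=> t => u; apply: for_cont; apply: (c_comp csde); ctv.
  by move=> u _; apply: (c_comp csde); ctv.
- rewrite /K (@eq_J _ _ (fun=> pd d (pd e f) v)) ?J_cst// => u _.
  by rewrite mulr0 rmorph0 mulr0 sl0.
- move=> t; rewrite add0r curve0.
  have D1 : cder (fun s => f (mv e (mv d v s) t) - f (mv d v s)) 0
     (pd d f (mv e v t) - pd d f v).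
    apply: cderB; last exact: (pd_cderW d sf (I : setT v)).
    apply: cder_ext (pd_cderW d sf (I : setT (mv e v t))) => s.
    by rewrite /curve slC.
  have D2 : cder (fun s => rc t * J (fun u => pd e f (mv e (mv d v s) (u * t)))) 0
     (rc t * K t).
    apply: cderZ; apply: cder_eq.
      apply: (@cder_J _ (fun s u => pd e f (mv e (mv d v s) (u * t)))
       (fun s u => pd d (pd e f) (mv e (mv d v s) (u * t))) 1 ltr01).
      + by move=> s _ u; apply: for_cont; apply: (c_comp cse); ctv.
      + move=> s u _; have := @pd_curve _ d (mv e v (u * t)) s se.
        rewrite [X in cder _ _ (pd d _ X)]slC; apply: cder_ext => x.
        by rewrite /curve slC.
      + by move=> s u _; apply: (c_comp csde); ctv.
    by apply: eq_J => u _; rewrite rmorph0 mulr0 sl0.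
  have D12 : (fun s => f (mv e (mv d v s) t) - f (mv d v s)) =
    (fun s => rc t * J (fun u => pd e f (mv e (mv d v s) (u * t)))).
    by apply/funext => s; rewrite incr_pd// addrAC subrr add0r.
  move: D1; rewrite D12 => D1; have := cder_uniq D1 D2 => <-.
  by rewrite /curve; ring.
Unshelve. all: by end_near. Qed.

Lemma slice_pl f k v : smT f ->
  pl (fun z => f (sl k v z)) (fun z => pd (k, false) f (sl k v z))
     (fun z => pd (k, true) f (sl k v z)).
Proof.
move=> sf.
have cc e : continuous (fun z : C => pd (k, e) f (sl k v z)).
  move=> z; apply: for_cont; apply: c_comp; last by ctv.
  exact: smT_cont (sm_pd _ sf).
split=> [||z|z]; [exact: cc|exact: cc| |].
- apply: cder_ext (pd_cderW (k, false) sf (I : setT (sl k v z))) => t.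
  by rewrite /curve slD mul1r.
- apply: cder_ext (pd_cderW (k, true) sf (I : setT (sl k v z))) => t.
  by rewrite /curve slD.
Qed.

Lemma pd_co (k : 'I_g) d v : cder (curve (fun x : V => x 0 k) v d) 0
  ((d.1 == k)%:R * ud d.2).
Proof.
apply: (@cder_ext _ (fun t => v 0 k + ((d.1 == k)%:R * ud d.2) * rc t)).
  by move=> t; rewrite /curve slE eq_sym mulrA.
apply: cder_eq (cderD (cder_cst _ 0) (cderZ _ (cder_rc 0))) _.
by rewrite mulr1 add0r.
Qed.
Lemma sm_co (k : 'I_g) W : open W -> sm W (fun x : V => x 0 k).
Proof.
move=> oW; apply: (@sm_coind _ _ _ (fun f => (f = fun x : V => x 0 k) \/ exists a : C, f = fun=> a)).
- exact: oW.
- by move=> f v [->|[a ->]] _; [apply: v_entry; exact: cvg_id|exact: c_cst].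
- move=> f d [->|[a ->]].
  + exists (fun=> (d.1 == k)%:R * ud d.2); first by right; eexists.
    by move=> v _; exact: pd_co.
  + exists (fun=> 0); first by right; exists 0.
    by move=> v _; exact: cder_cst.
- by left.
Qed.

Local Notation Dg := (@Dg R g).
Implicit Types (e : C).
Lemma DgE e k f v : Dg e k f v = 2^-1 * (pd (k, false) f v + e * pd (k, true) f v).
Proof. by rewrite Dg.unlock. Qed.
Lemma sm_Dg W e k f : open W -> sm W f -> sm W (Dg e k f).
Proof.
move=> oW sf; rewrite Dg.unlock; apply: smZ; first exact: oW.
apply: smD; [exact: oW|exact: sm_pd|].
by apply: smZ; [exact: oW|exact: sm_pd].
Qed.
Lemma Dg_near e k f h v : (\forall x \near nbhs v, f x = h x) -> Dg e k f v = Dg e k h v.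
Proof. by move=> fh; rewrite Dg.unlock (pd_near _ fh) (pd_near _ fh). Qed.
Lemma Dg_ext W e k f h v : open W -> (forall v, W v -> f v = h v) -> W v -> Dg e k f v = Dg e k h v.
Proof. by move=> oW fh Wv; rewrite Dg.unlock (pd_ext _ oW fh Wv) (pd_ext _ oW fh Wv). Qed.
Lemma DgD W e k f h v : sm W f -> sm W h -> W v ->
  Dg e k (fun x => f x + h x) v = Dg e k f v + Dg e k h v.
Proof.
by move=> sf sh Wv; rewrite Dg.unlock (pdD (k, false) sf sh Wv) (pdD (k, true) sf sh Wv); ring.
Qed.
Lemma DgM W e k f h v : sm W f -> sm W h -> W v ->
  Dg e k (fun x => f x * h x) v = Dg e k f v * h v + f v * Dg e k h v.
Proof.
by move=> sf sh Wv; rewrite Dg.unlock (pdM (k, false) sf sh Wv) (pdM (k, true) sf sh Wv); ring.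
Qed.
Lemma DgZ W e k (a : C) f v : sm W f -> W v -> Dg e k (fun x => a * f x) v = a * Dg e k f v.
Proof.
by move=> sf Wv; rewrite Dg.unlock (pdZ a (k, false) sf Wv) (pdZ a (k, true) sf Wv); ring.
Qed.
Lemma Dg_cst e k (a : C) v : Dg e k (fun=> a) v = 0.
Proof. by rewrite Dg.unlock !pd_cst; ring. Qed.
Lemma Dg_trans e k f a v : Dg e k (fun x => f (x + a)) v = Dg e k f (v + a).
Proof. by rewrite Dg.unlock !pd_trans. Qed.

Lemma DgC f e e' k j v : smT f -> Dg e k (Dg e' j f) v = Dg e' j (Dg e k f) v.
Proof.
move=> sf.
have E a b i i' : Dg a i (Dg b i' f) v = 2^-1 * 2^-1 * (pd (i, false) (pd (i', false) f) v
   + b * pd (i, false) (pd (i', true) f) v + a * pd (i, true) (pd (i', false) f) v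
   + a * b * pd (i, true) (pd (i', true) f) v).
  have S d : smT (fun x => b * pd d f x) by apply: smZ; [exact: openT|exact: sm_pd].
  have S0 d : smT (pd d f) by exact: sm_pd.
  have S1 : smT (fun x => pd (i', false) f x + b * pd (i', true) f x).
    by apply: smD; [exact: openT|exact: S0|exact: S].
  have P d : pd d (Dg b i' f) v = 2^-1 * (pd d (pd (i', false) f) v + b * pd d (pd (i', true) f) v).
    rewrite Dg.unlock (pdZ _ d S1 I) (pdD d (S0 (i', false)) (S (i', true)) I).
    by rewrite (pdZ _ d (S0 (i', true)) I).
  transitivity (2^-1 * (pd (i, false) (Dg b i' f) v + a * pd (i, true) (Dg b i' f) v)).
    exact: DgE.
  by rewrite !P; ring.
rewrite !E (pdC (k, false) (j, false) v sf) (pdC (k, false) (j, true) v sf).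
by rewrite (pdC (k, true) (j, false) v sf) (pdC (k, true) (j, true) v sf); ring.
Qed.

Lemma sm_prod W (I : Type) (s : seq I) (F : I -> V -> C) : open W ->
  (forall i, sm W (F i)) -> sm W (fun x => \prod_(i <- s) F i x).
Proof.
move=> oW sF; elim: s => [|i s IH].
  by apply: (sm_ext oW) (sm_cst 1 oW) => v _; rewrite big_nil.
by apply: (sm_ext oW) (smM oW (sF i) IH) => v _; rewrite big_cons.
Qed.

Lemma xder_pd f v (k : 'I_g) l : xder (fun z => f (sl k v z)) 0 l ->
  forall b, cder (curve f v (k, b)) 0 (l * ud b).
Proof.
move=> H b; apply: cder_ext (xder_curve (ud b) H) => t.
by rewrite /curve add0r.
Qed.
Lemma xder_Dg f v (k : 'I_g) l : xder (fun z => f (sl k v z)) 0 l ->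
  Dg ci k f v = 0 /\ Dg (- ci) k f v = l.
Proof.
move=> /xder_pd H; rewrite Dg.unlock (pdP (H false)) (pdP (H true)) mulr1.
rewrite /ud; split.
  by transitivity (2^-1 * (l + l * (ci * ci))); [ring|rewrite ciM; ring].
by transitivity (2^-1 * (l - l * (ci * ci))); [ring|rewrite ciM; field].
Qed.

End SmoothV.

(** * Cutoff functions *)

Section Bump.
Variables (R : realType) (g : nat).
Local Notation C := (Cplx R).
Local Notation V := 'rV[Cplx R]_g.
Local Notation rc := (@rc R).
Implicit Types (P Q : {poly R}).

Lemma xder_poly (Q : {poly C}) z : xder (fun x => Q.[x]) z (Q^`()).[z].
Proof.
elim/poly_ind: Q => [|Q c IH].
  rewrite deriv0 horner0 (_ : (fun x => _) = fun=> 0); first exact: xder_cst.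
  by apply/funext => x; rewrite horner0.
rewrite (_ : (fun x => _) = fun x => Q.[x] * x + c); last first.
  by apply/funext => x; rewrite hornerMXaddC.
have := xderD (xderM IH (xder_id z)) (xder_cst c z).
by rewrite addr0 mulr1 derivD derivM derivX derivC addr0 !hornerE.
Qed.

(* These functions are closed under differentiation, which acts on [P] by [flD]. *)
Definition fl P (x : R) : R := if x <= 0 then 0 else P.[x^-1] * expR (- x^-1).
Definition flD P : {poly R} := 'X ^+ 2 * (P - P^`()).

Lemma poly_bound P : exists2 B : R, 0 <= B & forall u, 1 <= u -> `|P.[u]| <= B * u ^+ size P.
Proof.
elim/poly_ind: P => [|P c [B B0 PB]].
  by exists 0 => // u _; rewrite horner0 normr0 mul0r.
have [->|P0] := eqVneq P 0.
  exists `|c| => // u u1; rewrite mul0r add0r hornerC.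
  by rewrite ler_peMr// exprn_ege1.
exists (B + `|c|) => [|u u1]; first by rewrite addr_ge0.
have -> : size (P * 'X + c%:P) = (size P).+1.
  by rewrite size_MXaddC (negPf P0).
rewrite hornerMXaddC (le_trans (ler_normD _ _))// mulrDl lerD//.
  rewrite normrM (ger0_norm (le_trans ler01 u1)) exprSr mulrA ler_wpM2r//.
    exact: le_trans ler01 u1.
  exact: PB.
by rewrite ler_peMr// exprn_ege1.
Qed.

(** From t <= exp t at t = u / n, raised to the power n. *)
Lemma expR_bound (n : nat) (u : R) : 0 <= u -> u ^+ n <= n%:R ^+ n * expR u.
Proof.
case: n => [|n] u0; first by rewrite !expr0 mul1r (le_trans _ (expR_ge1Dx _))// lerDl.
have n0 : 0 < n.+1%:R :> R by rewrite ltr0n.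
have -> : expR u = expR (u / n.+1%:R) ^+ n.+1.
  by rewrite -expRM_natl mulrC divfK// gt_eqF.
have H := expR_ge1Dx (u / n.+1%:R).
have H2 : u <= n.+1%:R * expR (u / n.+1%:R).
  by rewrite -ler_pdivrMl// mulrC (le_trans _ H)// lerDr.
by rewrite -exprMn lerXn2r// nnegrE mulr_ge0// expR_ge0.
Qed.

Lemma fl_small P : exists2 K : R, 0 <= K & forall x, x <= 1 -> `|fl P x| <= K * `|x|.
Proof.
have [B B0 PB] := poly_bound P.
set m := size P; exists (B * m.+1%:R ^+ m.+1) => [|x x1].
  by rewrite mulr_ge0// exprn_ge0.
rewrite /fl; case: ifPn => [_|]; first by rewrite normr0 !mulr_ge0// exprn_ge0.
rewrite -ltNge => x0; rewrite (gtr0_norm x0).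
have u1 : 1 <= x^-1 by rewrite invf_ge1.
have u0 : 0 < x^-1 by rewrite invr_gt0.
rewrite normrM (gtr0_norm (expR_gt0 _)) expRN ler_pdivrMr ?expR_gt0//.
rewrite (le_trans (PB _ u1))// -/m.
have := expR_bound m.+1 (ltW u0); rewrite exprS => H.
have H2 : x^-1 ^+ m <= x * (m.+1%:R ^+ m.+1 * expR x^-1).
  by rewrite -(ler_pM2l u0) mulrA mulVf ?gt_eqF// mul1r.
rewrite (le_trans (ler_wpM2l B0 H2))//.
by rewrite le_eqVlt; apply/orP; left; apply/eqP; ring.
Qed.

Lemma fl_cont0 P : rc (fl P x) @[x --> nbhs (0 : R)] --> (0 : C).
Proof.
have [K K0 PK] := fl_small P; apply/cvgC => e e0.
apply/nbhs_ballP; exists (Num.min 1 (e / (K + 1))).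
  by rewrite /= lt_min ltr01 divr_gt0// ltr_wpDl.
move=> x bx; have : `|x| < Num.min 1 (e / (K + 1)) by move: bx; rewrite /ball/= sub0r normrN.
rewrite lt_min => /andP[x1 xe]; rewrite /mkset.
rewrite (_ : rc (fl P x) - 0 = rc (fl P x)); last by rewrite subr0.
rewrite nrm_rc (le_lt_trans (PK _ (ltW (le_lt_trans (ler_norm _) x1))))//.
have K1 : 0 < K + 1 by rewrite ltr_wpDl.
apply: le_lt_trans (_ : (K + 1) * `|x| < e); first by rewrite ler_wpM2r// lerDl.
by rewrite mulrC -ltr_pdivlMr.
Qed.

Lemma fl_der P (x : R) : cder (fun t => rc (fl P t)) x (rc (fl (flD P) x)).
Proof.
have [x0|x0|->] := ltgtP x 0.
- rewrite {2}/fl ltW// rmorph0; apply: (@cder_near _ (fun=> 0)); last exact: cder_cst.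
  apply/nbhs_ballP; exists (- x) => /=; first by rewrite oppr_gt0.
  move=> h; rewrite /ball/= sub0r normrN => /(le_lt_trans (ler_norm _)) hx.
  by rewrite /fl ifT ?rmorph0// -lerBrDl sub0r ltW.
- have xN : rc x != 0 by rewrite rc_eq0 gt_eqF.
  pose Q : {poly C} := map_poly rc P.
  have E t : 0 < t -> rc (fl P t) = Q.[(rc t)^-1] * ex (- (rc t)^-1).
    move=> t0; rewrite /fl ifN -?ltNge// rmorphM/= -fmorphV/= -rmorphN/= ex_rc.
    by rewrite /Q horner_map.
  have di := cder_comp (cder_rc x) (xderV xN).
  have d1 := cder_comp di (xder_poly Q _).
  have d2 := cder_comp (cderN di) (xder_ex _).
  apply: (@cder_near _ (fun t => Q.[(rc t)^-1] * ex (- (rc t)^-1))).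
    apply/nbhs_ballP; exists x => //= h; rewrite /ball/= sub0r normrN ltr_norml => /andP[h1 _].
    by rewrite E// -ltrBlDl sub0r.
  apply: cder_eq (cderM d1 d2) _ => /=.
  rewrite /fl ifN -?ltNge// rmorphM/= -ex_rc rmorphN/= fmorphV/=.
  have -> : rc (flD P).[x^-1] = (rc x)^-1 ^+ 2 * (Q.[(rc x)^-1] - (Q^`()).[(rc x)^-1]).
    rewrite /flD hornerM hornerXn hornerD hornerN rmorphM rmorphXn rmorphB fmorphV.
    by rewrite /Q deriv_map -fmorphV !horner_map fmorphV.
  by rewrite -exprVn; ring.
(* At 0 the slope is [fl P h / h], which is again of the form [fl], for 'X * P, because the argument
   of P is 1 / h; so continuity at 0 for all polynomials gives all derivatives. *)
- rewrite {2}/fl lexx rmorph0; exists (fun h => rc (fl ('X * P) h)); split.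
  + rewrite {2}/fl lexx rmorph0; exact: fl_cont0.
  + by rewrite /fl lexx rmorph0.
  + move=> h; rewrite add0r {2}/fl lexx rmorph0 add0r -rmorphM/=; congr rc.
    rewrite /fl; case: ifPn => [_|]; first by rewrite mulr0.
    rewrite -ltNge => h0; rewrite hornerM hornerX !mulrA divff ?mul1r//.
    by rewrite gt_eqF.
Qed.

Lemma cder_im0 (p : R -> R) t l : cder (fun x => rc (p x)) t l -> l = rc (re l).
Proof.
move=> /cder_im [_ H]; apply: c_eq => //; rewrite im_rc -H.
by rewrite (_ : (fun x => _) = cst 0) ?derive_cst//; apply/funext => x; rewrite im_rc.
Qed.

Lemma cder_comp_real (h p : R -> R) t l m : cder (fun x => rc (p x)) t l ->
  cder (fun x => rc (h x)) (p t) m -> cder (fun x => rc (h (p x))) t (m * l).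
Proof.
move=> dp; have lr := cder_im0 dp; case: dp => s [cs s0 hs] [r [cr <- hr]].
have pE x : p (t + x) = p t + x * re (s x).
  by have := congr1 (@re R) (hs x); rewrite reD reM !re_rc im_rc mul0r subr0.
exists (fun x => r (x * re (s x)) * rc (re (s x))); split.
- apply: c_mul; last exact: cvg_rc (cvg_re cs).
  rewrite mul0r; apply: (@cvg_via _ _ _ _ (fun x => x * re (s x)) r 0); last exact: cr.
  rewrite -[X in _ --> X](mul0r (re (s 0))); apply: r_mul; [exact: cvg_id|exact: cvg_re cs].
- by rewrite mul0r s0 -lr.
- by move=> x; rewrite pE hr rmorphM/=; ring.
Qed.

Lemma sm_fl (W : set V) (q : V -> R) P : open W -> sm W (fun v => rc (q v)) ->
  sm W (fun v => rc (fl P (q v))).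
Proof.
move=> oW sq n; elim: n P => [|n IH] P.
  move=> v Wv; apply: smo_0; apply: (@cvg_via _ _ _ _ (fun v => re (rc (q v))) (fun x => rc (fl P x)) (q v)).
    exact: cvg_re (sm_cont sq Wv).
  exact: cder_cont (fl_der P (q v)).
apply: (@sn_step _ _ _ _ _ (fun d v => rc (fl (flD P) (q v)) * pd d (fun v => rc (q v)) v)) => [//|v Wv|d v Wv|d].
- apply: (@cvg_via _ _ _ _ (fun v => re (rc (q v))) (fun x => rc (fl P x)) (q v)).
    exact: cvg_re (sm_cont sq Wv).
  exact: cder_cont (fl_der P (q v)).
- have := pd_cderW d sq Wv; rewrite /curve => H.
  apply: (@cder_comp_real (fl P) (fun x => q (sl d.1 v (ud R d.2 * rc x))) 0 _ _ H).
  by rewrite rmorph0 mulr0 sl0; exact: fl_der.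
- by apply: snM => //; [exact: IH|move=> v Wv; exact: (sm_pd d sq)].
Qed.

Definition cutr (t : R) : R := fl 1 (2 - t) / (fl 1 (2 - t) + fl 1 (t - 1)).
Lemma fl1_ge0 t : 0 <= fl 1 t.
Proof. by rewrite /fl; case: ifP => // _; rewrite hornerC mul1r expR_ge0. Qed.
Lemma fl1_gt0 t : 0 < t -> 0 < fl 1 t.
Proof. by move=> t0; rewrite /fl ifN -?ltNge// hornerC mul1r expR_gt0. Qed.
Lemma cutr_den t : 0 < fl 1 (2 - t) + fl 1 (t - 1).
Proof.
have [t1|t1] := lerP t 1.
  by rewrite ltr_pwDl ?fl1_ge0// fl1_gt0// subr_gt0 (le_lt_trans t1)// ltr1n.
by rewrite ltr_wpDl ?fl1_ge0// fl1_gt0// subr_gt0.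
Qed.
Lemma cutr1 t : t <= 1 -> cutr t = 1.
Proof.
move=> t1; have E : fl 1 (t - 1) = 0 by rewrite /fl subr_le0 t1.
rewrite /cutr E addr0 divff// gt_eqF// fl1_gt0//.
by rewrite subr_gt0 (le_lt_trans t1)// ltr1n.
Qed.
Lemma cutr0 t : 2 <= t -> cutr t = 0.
Proof. by move=> t2; rewrite /cutr {1}/fl subr_le0 t2 mul0r. Qed.
Lemma cutr_ge0 t : 0 <= cutr t.
Proof. by rewrite divr_ge0 ?fl1_ge0// ltW// cutr_den. Qed.
Lemma cutr_le1 t : cutr t <= 1.
Proof. by rewrite ler_pdivrMr ?cutr_den// mul1r lerDl fl1_ge0. Qed.
Lemma sm_cutr (W : set V) (q : V -> R) : open W -> sm W (fun v => rc (q v)) ->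
  sm W (fun v => rc (cutr (q v))).
Proof.
move=> oW sq.
have s1 : sm W (fun v => rc (fl 1 (2 - q v))).
  apply: sm_fl => //; apply: (sm_ext oW) (smB oW (sm_cst (rc 2) oW) sq) => v _.
  by rewrite rmorphB.
have s2 : sm W (fun v => rc (fl 1 (q v - 1))).
  apply: sm_fl => //; apply: (sm_ext oW) (smB oW sq (sm_cst (rc 1) oW)) => v _.
  by rewrite rmorphB.
have s3 := smD oW s1 s2.
have s4 : sm W (fun v => (rc (fl 1 (2 - q v)) + rc (fl 1 (q v - 1)))^-1).
  apply: (smV oW s3).
  by move=> v _; rewrite -rmorphD rc_eq0 gt_eqF// cutr_den.
apply: (sm_ext oW) (smM oW s1 s4) => v _.
by rewrite /cutr rmorphM fmorphV rmorphD.
Qed.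

(** The squared modulus keeps the cutoff smooth at a. The price is a support of radius sqrt(2) rho,
    which is bounded by 2 rho in [bmp_near0] and, for rho = r / 2, by 3/4 r in [beta_supp0]. *)
Definition cut (k : 'I_g) (a : C) (rho : R) (v : V) : C :=
  rc (cutr (nrm (v 0 k - a) ^+ 2 / rho ^+ 2)).
Lemma sm_cut k a rho : sm setT (cut k a rho).
Proof.
have oT := @openT V.
apply: sm_cutr => //.
have s1 : sm setT (fun v : V => v 0 k - a) by apply: smB => //; [exact: sm_co|exact: sm_cst].
have s2 := smM oT s1 (sm_conj oT s1).
apply: (sm_ext oT) (smM oT s2 (sm_cst (rc (rho ^+ 2))^-1 oT)) => v _.
by rewrite mul_conj [RHS]rmorphM; congr (_ * _); rewrite [RHS]fmorphV.
Qed.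
Lemma cut1 k a rho (v : V) : 0 < rho -> nrm (v 0 k - a) <= rho -> cut k a rho v = 1.
Proof.
move=> r0 vr; rewrite /cut cutr1 ?rmorph1// ler_pdivrMr ?exprn_gt0// mul1r.
by rewrite lerXn2r// nnegrE ?nrm_ge0// ltW.
Qed.
Lemma cut0 k a rho (v : V) : 0 < rho -> 2 * rho ^+ 2 <= nrm (v 0 k - a) ^+ 2 -> cut k a rho v = 0.
Proof. by move=> r0 vr; rewrite /cut cutr0 ?rmorph0// ler_pdivlMr ?exprn_gt0. Qed.

Definition bmp (a : V) (rho : R) (v : V) : C := \prod_k cut k (a 0 k) rho v.
Lemma sm_bmp a rho : sm setT (bmp a rho).
Proof. by apply: sm_prod; [exact: openT|move=> k; exact: sm_cut]. Qed.
Lemma bmp1 (a v : V) rho : 0 < rho -> (forall k, nrm (v 0 k - a 0 k) <= rho) -> bmp a rho v = 1.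
Proof. by move=> r0 va; rewrite /bmp big1// => k _; rewrite cut1. Qed.
Lemma bmp0 (a v : V) rho k : 0 < rho -> 2 * rho ^+ 2 <= nrm (v 0 k - a 0 k) ^+ 2 ->
  bmp a rho v = 0.
Proof. by move=> r0 vk; rewrite /bmp (bigD1 k)//= cut0 ?mul0r. Qed.

Lemma open_poly (a : V) (r : R) : open [set w : V | forall k, nrm (w 0 k - a 0 k) < r].
Proof.
rewrite openE => w wr; apply/nbhsV.
(* The maximum below is taken over the coordinates and starts from one of them, so g = 0 is treated
   apart. *)
have [g0|[k0]] : (forall k : 'I_g, False) \/ exists k : 'I_g, True.
  by have [k|k] := pickP (@predT 'I_g); [right; exists k|left=> x; have := k x].
  by exists 1 => // v _ k; case: (g0 k).
move=> _; pose m := \big[Order.max/nrm (w 0 k0 - a 0 k0)]_k nrm (w 0 k - a 0 k).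
have mr : m < r by apply/bigmax_ltP; split=> // k _; exact: wr.
exists (r - m) => [|v vw k]; first by rewrite subr_gt0.
rewrite (_ : v 0 k - a 0 k = (v 0 k - w 0 k) + (w 0 k - a 0 k)); last by ring.
rewrite (le_lt_trans (nrmD _ _))// -[r](subrK m) ltr_leD//.
by rewrite /m; apply: (le_bigmax_cond _ (fun k => nrm (w 0 k - a 0 k))).
Qed.

Lemma bmp_near0 (a v : V) rho k : 0 < rho -> 2 * rho <= nrm (v 0 k - a 0 k) ->
  \forall w \near nbhs v, bmp a rho w = 0.
Proof.
move=> r0 vk; apply/nbhsV; exists (rho / 2) => [|w wv]; first by rewrite divr_gt0.
have := wv k => wk; apply: (bmp0 (k := k)) => //.
have h : rho * (3 / 2) <= nrm (w 0 k - a 0 k).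
  have := nrmD (v 0 k - w 0 k) (w 0 k - a 0 k); rewrite addrA subrK (nrmB (v 0 k) (w 0 k)); lra.
apply: (@le_trans _ _ ((rho * (3 / 2)) ^+ 2)).
  by rewrite exprMn mulrC ler_pM2l ?exprn_gt0//; lra.
by rewrite lerXn2r// nnegrE ?nrm_ge0// mulr_ge0 ?ltW//; lra.
Qed.

Lemma sm_bmpM (a : V) rho (f : V -> C) : 0 < rho ->
  sm [set w : V | forall k, nrm (w 0 k - a 0 k) < 2 * rho] f ->
  sm setT (fun v => bmp a rho v * f v).
Proof.
move=> r0 sf n v _; have oT := @openT V.
have [vW|/existsNP[k]] := pselect (forall k, nrm (v 0 k - a 0 k) < 2 * rho).
  have oW := @open_poly a (2 * rho).
  by apply: (smM oW (sm_sub (@subsetT _ _) (@sm_bmp a rho)) sf).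
move=> /negP; rewrite -leNgt => vk.
apply: smo_near (sm_cst 0 oT n (v := v) I).
by apply: filterS (bmp_near0 r0 vk) => w ->; rewrite mul0r.
Qed.

(** Local statements about derivatives thereby follow from those for functions that are smooth on
    all of C^g. *)
Lemma sm_local (W : set V) (f : V -> C) v : open W -> sm W f -> W v ->
  exists2 h, sm setT h & \forall x \near nbhs v, h x = f x.
Proof.
move=> oW sf Wv; have /nbhsV[e e0 eW] := open_near oW Wv.
exists (fun x => bmp v (e / 2) x * f x).
  apply: sm_bmpM; first by rewrite divr_gt0.
  by apply: sm_sub sf => w /= wv; apply: eW; rewrite mulrC divfK in wv.
apply/nbhsV; exists (e / 2) => [|w wv]; first by rewrite divr_gt0.
by rewrite bmp1 ?divr_gt0 ?mul1r// => k; rewrite ltW.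
Qed.

End Bump.

Section RealEmbedding.
Variable R : realType.
Local Notation rc := (@rc R).
Lemma rcD x y : rc (x + y) = rc x + rc y. Proof. exact: rmorphD. Qed.
Lemma rcB x y : rc (x - y) = rc x - rc y. Proof. exact: rmorphB. Qed.
Lemma rcN x : rc (- x) = - rc x. Proof. exact: rmorphN. Qed.
Lemma rcM x y : rc (x * y) = rc x * rc y. Proof. exact: rmorphM. Qed.
Lemma rcV x : rc x^-1 = (rc x)^-1. Proof. exact: fmorphV. Qed.
Lemma rcX x n : rc (x ^+ n) = rc x ^+ n. Proof. exact: rmorphXn. Qed.
Lemma rc_nat n : rc n%:R = n%:R. Proof. exact: rmorph_nat. Qed.
Lemma rc0 : rc 0 = 0. Proof. by []. Qed.
Lemma rc1 : rc 1 = 1. Proof. by []. Qed.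
End RealEmbedding.

(** * Holomorphic functions *)

Section Goursat.
Variable R : realType.
Local Notation C := (Cplx R).
Local Notation rc := (@rc R).
Local Notation nrm := (@nrm R).

Lemma xder_near (f h : C -> C) z l : (\forall x \near nbhs (0 : C), f (z + x) = h (z + x)) ->
  xder f z l -> xder h z l.
Proof.
move=> fh [s [cs s0 hs]].
exists (fun x => if x == 0 then l else x^-1 * (h (z + x) - h z)); split; last first.
- move=> x; case: ifPn => [/eqP ->|x0]; first by rewrite mul0r !addr0.
  by rewrite mulrA divff// mul1r; ring.
- by rewrite eqxx.
- rewrite eqxx -s0; apply: cvg_near_eq cs.
  have fz : f z = h z by have := nbhs_singleton fh; rewrite addr0.
  apply: filterS fh => x xh; case: ifPn => [/eqP ->|x0]; first by rewrite s0.
  by rewrite -xh -fz hs addrAC subrr add0r mulrA mulVf// mul1r.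
Qed.

(* [par F w a b] is the integral of [F] along the boundary of a parallelogram. *)
Definition smean (F : C -> C) (w a : C) : C := J (fun s => F (w + a * rc s)).
Definition par F (w a b : C) : C := a * smean F w a + b * smean F (w + a) b
  - a * smean F (w + b) a - b * smean F w b.

Section ParLemmas.
Variable F : C -> C.
Hypothesis cF : continuous F.

Lemma cont_seg (w a : C) : continuous (fun s => F (w + a * rc s)).
Proof. by apply: (cont_comp cF); cct. Qed.

Lemma smean_half w a : smean F w (a + a) = 2^-1 * (smean F w a + smean F (w + a) a).
Proof.
have two : rc 2^-1 = 2^-1 :> C by rewrite fmorphV rmorph_nat.
rewrite /smean (J_split (@cont_seg _ _)); congr (_ * (_ + _)).
  by apply: eq_J => s _; congr F; rewrite rcM two; field.
by apply: eq_J => s _; congr F; rewrite rcD rcM two; field.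
Qed.

Lemma par_split w h k : par F w (h + h) (k + k) =
  par F w h k + par F (w + h) h k + par F (w + k) h k + par F (w + h + k) h k.
Proof.
rewrite /par !smean_half.
have -> : w + k + h = w + h + k by ring.
have -> : w + h + k + h = w + (h + h) + k by ring.
have -> : w + h + k + k = w + (k + k) + h by ring.
have -> : w + h + h = w + (h + h) by ring.
have -> : w + k + k = w + (k + k) by ring.
by field.
Qed.

End ParLemmas.

Lemma J_id : J rc = 2^-1.
Proof.
have two : 2 != 0 :> C by rewrite pnatr_eq0.
rewrite (J_FTC (F := fun s => 2^-1 * (rc s * rc s))); first by rewrite rmorph0 rmorph1; ring.
  exact: rc_cont.
move=> x _; apply: cder_eq (cderZ 2^-1 (cderM (cder_rc x) (cder_rc x))) _.
by field.
Qed.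

Lemma smean_aff (al be w a : C) : smean (fun p => al + be * p) w a = al + be * (w + 2^-1 * a).
Proof.
rewrite /smean (_ : (fun s => _) = fun s => (al + be * w) + (be * a) * rc s); last first.
  by apply/funext => s; ring.
rewrite JD; [|cct|cct]; rewrite J_cst JZ; last exact: rc_cont.
by rewrite J_id; ring.
Qed.

Lemma par_aff (al be w a b : C) : par (fun p => al + be * p) w a b = 0.
Proof. by rewrite /par !smean_aff; field. Qed.

Lemma parB F H w a b : continuous F -> continuous H ->
  par (fun p => F p - H p) w a b = par F w a b - par H w a b.
Proof.
move=> cF cH.
have E x y : smean (fun p => F p - H p) x y = smean F x y - smean H x y.
  by rewrite /smean (JB (@cont_seg _ cF x y) (@cont_seg _ cH x y)).
by rewrite /par !E; ring.
Qed.

Lemma par_le F w a b (M : R) : continuous F ->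
  (forall s, 0 <= s <= 1 -> nrm (F (w + a * rc s)) <= M /\ nrm (F (w + a + b * rc s)) <= M /\
     nrm (F (w + b + a * rc s)) <= M /\ nrm (F (w + b * rc s)) <= M) ->
  nrm (par F w a b) <= 2 * (nrm a + nrm b) * M.
Proof.
move=> cF H.
have E c x y : (forall s, 0 <= s <= 1 -> nrm (F (x + y * rc s)) <= M) ->
    nrm (c * smean F x y) <= nrm c * M.
  by move=> FM; rewrite nrmM ler_wpM2l ?nrm_ge0// /smean nrm_J_le//; exact: cont_seg.
have E1 := E a w a (fun s hs => (H s hs).1).
have E2 := E b (w + a) b (fun s hs => (H s hs).2.1).
have E3 := E a (w + b) a (fun s hs => (H s hs).2.2.1).
have E4 := E b w b (fun s hs => (H s hs).2.2.2).
rewrite /par (le_trans (nrmBD _ _))//.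
apply: le_trans (lerD (le_trans (nrmBD _ _) (lerD (le_trans (nrmD _ _) (lerD E1 E2)) E3)) E4) _.
by rewrite le_eqVlt; apply/orP; left; apply/eqP; ring.
Qed.

(** Nested dyadic squares, recorded by their lower left corners; each coordinate of the common point
    is the supremum of the corners. *)
Lemma bisect (P : nat -> R -> R -> Prop) : P 0 0 0 ->
  (forall n x y, P n x y -> exists e d : bool, P n.+1 (x + e%:R * 2^-1 ^+ n.+1) (y + d%:R * 2^-1 ^+ n.+1)) ->
  exists x y, [/\ 0 <= x <= 1, 0 <= y <= 1 & forall n, exists a b, [/\ P n a b,
    0 <= a, 0 <= b, a <= x <= a + 2^-1 ^+ n & b <= y <= b + 2^-1 ^+ n]].
Proof.
move=> P0 PS.
have H (z : nat * (R * R)) : exists ed : bool * bool, P z.1 z.2.1 z.2.2 ->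
    P z.1.+1 (z.2.1 + ed.1%:R * 2^-1 ^+ z.1.+1) (z.2.2 + ed.2%:R * 2^-1 ^+ z.1.+1).
  have [/PS[e [d h]]|n] := pselect (P z.1 z.2.1 z.2.2); first by exists (e, d).
  by exists (true, true).
have [f fP] := choice H.
pose u := fix u n : R * R := if n is m.+1 then
  ((u m).1 + (f (m, u m)).1%:R * 2^-1 ^+ m.+1, (u m).2 + (f (m, u m)).2%:R * 2^-1 ^+ m.+1)
  else (0, 0).
have uP n : P n (u n).1 (u n).2 by elim: n => [|n IH] //=; exact: (fP (n, u n)).
have hp n : 0 < 2^-1 ^+ n :> R by rewrite exprn_gt0.
have key (v : nat -> R) (e : nat -> bool) : v 0%N = 0 ->
    (forall n, v n.+1 = v n + (e n)%:R * 2^-1 ^+ n.+1) ->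
    exists x, forall n, 0 <= v n /\ v n <= x <= v n + 2^-1 ^+ n.
  move=> v0 vS.
  have inc n m : v n <= v (n + m)%N.
    elim: m => [|m IH]; first by rewrite addn0.
    by rewrite addnS vS (le_trans IH)// lerDl mulr_ge0// ltW.
  have dec n m : v (n + m)%N + 2^-1 ^+ (n + m) <= v n + 2^-1 ^+ n.
    elim: m => [|m IH]; first by rewrite addn0.
    rewrite addnS vS; apply: le_trans IH; rewrite -addrA lerD2l.
    have := hp (n + m)%N; rewrite exprS; set z := _ ^+ _ => z0.
    by case: (e _) => /=; lra.
  have ub n m : v m <= v n + 2^-1 ^+ n.
    have [nm|/ltnW mn] := leqP n m.
      by rewrite -(subnKC nm) (le_trans _ (dec n (m - n)%N))// lerDl ltW.
    by rewrite (le_trans (inc m (n - m)%N))// subnKC// lerDl ltW.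
  have hs : has_sup (range v).
    split; first by exists (v 0%N), 0%N.
    by exists (v 0%N + 2^-1 ^+ 0) => _ [m _ <-]; exact: ub.
  exists (sup (range v)) => n; split; first by rewrite -v0 (inc 0%N n).
  apply/andP; split; first by apply: (sup_upper_bound hs); exists n.
  by apply: ge_sup => [|_ [m _ <-]]; [exact: hs.1|exact: ub].
have [x xP] := key (fun n => (u n).1) (fun m => (f (m, u m)).1) erefl (fun=> erefl).
have [y yP] := key (fun n => (u n).2) (fun m => (f (m, u m)).2) erefl (fun=> erefl).
exists x, y; split.
- by have [_] := xP 0%N; rewrite /= add0r expr0.
- by have [_] := yP 0%N; rewrite /= add0r expr0.
- by move=> n; exists (u n).1, (u n).2; have [? ?] := xP n; have [? ?] := yP n.
Qed.

Lemma half_small (L e : R) : 0 < e -> exists n, L * 2^-1 ^+ n < e.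
Proof.
move=> e0; have [L0|L0] := lerP L 0.
  by exists 0%N; rewrite expr0 mulr1 (le_lt_trans L0).
have := @cvg_expr R 2^-1; rewrite ger0_norm// => H.
have /H/cvgR/(_ (e / L)) : 2^-1 < 1 :> R by lra.
rewrite divr_gt0// => /(_ isT) [n _ /(_ n (leqnn n))] /=.
rewrite subr0 ger0_norm ?exprn_ge0// => h; exists n.
by rewrite mulrC -ltr_pdivlMr.
Qed.

(** Quartering keeps a parallelogram with at least 4^-n of the integral. At the limit point F is
    affine up to an error that is small against the diameter, and affine functions integrate to 0 by
    [par_aff]; the perimeter and the diameter are both of order 2^-n, which compensates 4^n. *)
Lemma goursat F w a b : continuous F ->
  (forall s t : R, 0 <= s <= 1 -> 0 <= t <= 1 -> exists l, xder F (w + a * rc s + b * rc t) l) ->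
  par F w a b = 0.
Proof.
move=> cF dF; set I := par F w a b.
pose L := nrm a + nrm b; have L0 : 0 <= L by rewrite addr_ge0 ?nrm_ge0.
pose q n : R := 2^-1 ^+ n.
pose P n (x y : R) := nrm I <= 4 ^+ n * nrm (par F (w + a * rc x + b * rc y) (a * rc (q n)) (b * rc (q n))).
have PS n x y : P n x y -> exists e d : bool,
    P n.+1 (x + e%:R * 2^-1 ^+ n.+1) (y + d%:R * 2^-1 ^+ n.+1).
  rewrite /P => H; apply: contrapT => nP.
  have lt e d : 4 ^+ n.+1 * nrm (par F (w + a * rc (x + (e : bool)%:R * q n.+1) + b * rc (y + (d : bool)%:R * q n.+1))
      (a * rc (q n.+1)) (b * rc (q n.+1))) < nrm I.
    by rewrite ltNge; apply/negP => h; apply: nP; exists e, d.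
  have qn : q n = q n.+1 + q n.+1 by rewrite /q exprS; field.
  move: H; rewrite qn rmorphD !mulrDr par_split//; set W := w + a * rc x + b * rc y.
  set h := a * rc (q n.+1); set k := b * rc (q n.+1).
  have E1 := lt false false; have E2 := lt true false; have E3 := lt false true; have E4 := lt true true.
  rewrite !mul0r !mul1r !addr0 !rmorphD !mulrDr -/h -/k in E1 E2 E3 E4.
  rewrite !addrA in E2 E3 E4.
  rewrite (_ : w + a * rc x + h + b * rc y = W + h) in E2; last by rewrite /W; ring.
  rewrite (_ : w + a * rc x + h + b * rc y + k = W + h + k) in E4; last by rewrite /W; ring.
  rewrite -/W in E1 E3; apply/negP; rewrite -ltNge.
  apply: le_lt_trans (_ : 4 ^+ n * (nrm (par F W h k) + nrm (par F (W + h) h k)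
    + nrm (par F (W + k) h k) + nrm (par F (W + h + k) h k)) < _).
    rewrite ler_pM2l ?exprn_gt0//.
    rewrite (le_trans (nrmD _ _))// lerD2r (le_trans (nrmD _ _))// lerD2r.
    exact: nrmD.
  by rewrite exprS in E1 E2 E3 E4; rewrite !mulrDr; lra.
have P0 : P 0%N 0 0 by rewrite /P /q !expr0 rmorph0 rmorph1 !mulr0 !mulr1 !addr0 mul1r.
have [x [y [x01 y01 H]]] := bisect P0 PS.
have [l [s [cs s0 hs]]] := dF x y x01 y01.
set p := w + a * rc x + b * rc y in hs.
suff I0 e : 0 < e -> nrm I <= e.
  apply/eqP; rewrite -nrm_eq0 eq_le nrm_ge0 andbT; apply/ler_addgt0Pr => e e0.
  by rewrite add0r I0.
(* The final estimate is 2 * L * L * e'; the added 1 keeps the denominator positive when L = 0. *)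
move=> e0; pose e' := e / (2 * L * L + 1).
have D0 : 0 < 2 * L * L + 1 by rewrite ltr_wpDl// !mulr_ge0.
have e'0 : 0 < e' by rewrite divr_gt0.
move/cvgC : cs => /(_ e' e'0) /nbhs_normP[d /= d0 ds].
have d0' : 0 < re d by move: d0; rewrite ltcE => /andP[_].
have dE : d = rc (re d) by apply: c_eq => //; move: d0; rewrite ltcE => /andP[/eqP].
have [n nd] := half_small L d0'.
have [u [v [Pn u0 v0 /andP[ux xu] /andP[vy yv]]]] := H n.
set w' := w + a * rc u + b * rc v in Pn.
have cl c : nrm (c - p) <= L * q n -> nrm (F c - (F p - p * l + l * c)) <= L * q n * e'.
  move=> cp; have -> : F c - (F p - p * l + l * c) = (c - p) * (s (c - p) - s 0).
    by rewrite -{1}(subrK p c) addrC addrC (addrC _ p) hs -s0; ring.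
  rewrite nrmM ler_pM ?nrm_ge0// ltW//; apply: ds.
  rewrite /ball_/= sub0r normrN normE dE ltcR.
  exact: le_lt_trans cp nd.
have qn0 : 0 < q n by rewrite exprn_gt0.
have bd (s1 s2 : R) : 0 <= s1 <= q n -> 0 <= s2 <= q n ->
    nrm (w' + a * rc s1 + b * rc s2 - p) <= L * q n.
  move=> /andP[h1 h2] /andP[h3 h4].
  have -> : w' + a * rc s1 + b * rc s2 - p = a * rc (u + s1 - x) + b * rc (v + s2 - y).
    by rewrite /w' /p !rmorphB !rmorphD; ring.
  rewrite (le_trans (nrmD _ _))// !nrmM !nrm_rc mulrDl.
  by apply: lerD; apply: ler_wpM2l; rewrite ?nrm_ge0// ler_norml; apply/andP; split;
    rewrite /q in h2 h4 *; lra.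
have E : par F w' (a * rc (q n)) (b * rc (q n)) =
    par (fun c => F c - (F p - p * l + l * c)) w' (a * rc (q n)) (b * rc (q n)).
  have cA : continuous (fun c : C => F p - p * l + l * c) by cct.
  by rewrite (parB _ _ _ cF cA) par_aff subr0.
have cG : continuous (fun c => F c - (F p - p * l + l * c)).
  by move=> c; apply: for_cont; apply: c_add; [exact: cF|ct].
have G1 := @par_le _ w' (a * rc (q n)) (b * rc (q n)) (L * q n * e') cG.
have {}G1 : nrm (par F w' (a * rc (q n)) (b * rc (q n))) <= 2 * (L * q n) * (L * q n * e').
  rewrite E; apply: le_trans (G1 _) _ => [t /andP[t0 t1]|].
    have qt : 0 <= q n * t <= q n by rewrite (mulr_ge0 (ltW qn0) t0) (ger_pMr _ qn0).
    have q0 : (0 : R) <= 0 <= q n by rewrite lexx /= ltW.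
    have qq : 0 <= q n <= q n by rewrite lexx andbT ltW.
    split; [|split; [|split]]; apply: cl.
    - by have := bd _ _ qt q0; rewrite rmorph0 mulr0 addr0 rmorphM mulrA.
    - by have := bd _ _ qq qt; rewrite rmorphM mulrA.
    - by have := bd _ _ qt qq; rewrite rmorphM mulrA (addrAC w').
    - by have := bd _ _ q0 qt; rewrite rmorph0 mulr0 addr0 rmorphM mulrA.
  by rewrite !nrmM !nrm_rc (ger0_norm (ltW qn0)) -mulrDl.
rewrite (le_trans Pn)//; apply: le_trans (_ : 4 ^+ n * (2 * (L * q n) * (L * q n * e')) <= _).
  by rewrite ler_wpM2l ?exprn_ge0.
have -> : 4 ^+ n * (2 * (L * q n) * (L * q n * e')) = 2 * L * L * e'.
  have : 4 ^+ n * (q n * q n) = 1 by rewrite -exprMn -exprMn (_ : 4 * (2^-1 * 2^-1) = 1) ?expr1n//; field.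
  move=> q4; transitivity (2 * L * L * e' * (4 ^+ n * (q n * q n))); first by ring.
  by rewrite q4 mulr1.
by rewrite /e' mulrA ler_pdivrMr// mulrC ler_wpM2l// ?lerDl// ltW.
Qed.

End Goursat.

Section Holomorphic.
Variables (R : realType) (g : nat).
Local Notation C := (Cplx R).
Local Notation V := 'rV[Cplx R]_g.
Local Notation rc := (@rc R).
Local Notation nrm := (@nrm R).
Local Notation sl := (@sl R g).
Local Notation ud := (@ud R).
Local Notation Dg := (@Dg R g).
Local Notation dir := ('I_g * bool)%type.

(* Exponential coordinates turn annuli into rectangles with periodic sides. *)
Lemma circle_const (f : C -> C) (rho r1 r2 : R) : continuous f ->
  (forall z, 0 < nrm z -> nrm z < rho -> exists l, xder f z l) ->
  0 < r1 -> r1 < rho -> 0 < r2 -> r2 < rho ->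
  J (fun t => f (rc r1 * un t)) = J (fun t => f (rc r2 * un t)).
Proof.
move=> cf df r10 r1r r20 r2r.
have exp_tau : ex (tau R) = 1 by rewrite -[RHS]un1 unE mul1r.
pose F w := f (ex w); have cF : continuous F := cont_comp cf (@ex_cont R).
have exr r : 0 < r -> ex (rc (ln r)) = rc r by move=> r0; rewrite ex_rc lnK.
have E r : 0 < r -> smean F (rc (ln r)) (tau R) = J (fun t => f (rc r * un t)).
  move=> r0; apply: eq_J => s _; rewrite /F exD (exr _ r0).
  by rewrite (mulrC (tau R)) -unE.
rewrite -(E _ r10) -(E _ r20).
set a := rc (ln r2) - rc (ln r1).
have : par F (rc (ln r1)) a (tau R) = 0.
  apply: goursat => // s t /andP[s0 s1] _.
  set z := _ + _ + _.
  have [l hl] : exists l, xder f (ex z) l.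
    apply: df; first by rewrite nrm_gt0 ex_neq0.
    have rho0 : 0 < rho by exact: lt_trans r1r.
    have l1 : ln r1 < ln rho by rewrite ltr_ln ?posrE.
    have l2 : ln r2 < ln rho by rewrite ltr_ln ?posrE.
    rewrite nrm_ex -[rho in _ < rho]lnK ?posrE// ltr_expR.
    have -> : re z = ln r1 + (ln r2 - ln r1) * s.
      by rewrite /z /a /tau !reimE; ring.
    rewrite -subr_gt0.
    have -> : ln rho - (ln r1 + (ln r2 - ln r1) * s) =
      (1 - s) * (ln rho - ln r1) + s * (ln rho - ln r2) by ring.
    have [->|s1'] := eqVneq s 1; first by rewrite subrr mul0r add0r mul1r subr_gt0.
    apply: ltr_wpDr; first by rewrite mulr_ge0// subr_ge0 ltW.
    by rewrite mulr_gt0 ?subr_gt0// lt_neqAle s1'.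
  by exists (l * ex z); exact: xder_comp (xder_ex z) hl.
rewrite /par.
have -> : rc (ln r1) + a = rc (ln r2) by rewrite /a; ring.
have -> : smean F (rc (ln r1) + tau R) a = smean F (rc (ln r1)) a.
  apply: eq_J => s _; rewrite /F.
  rewrite (_ : _ + _ + _ = rc (ln r1) + a * rc s + tau R); last by ring.
  by rewrite exD exp_tau mulr1.
move=> /eqP; rewrite (_ : _ - _ = tau R * (smean F (rc (ln r2)) (tau R) -
  smean F (rc (ln r1)) (tau R))); last by ring.
by rewrite mulf_eq0 (negPf (tau_neq0 R)) /= subr_eq0 => /eqP ->.
Qed.

(** By [circle_const] the radius may tend to 0. At the centre only continuity enters, which makes
    the lemma applicable to a difference quotient. *)
Lemma circle_mean (f : C -> C) (rho r : R) : continuous f ->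
  (forall z, 0 < nrm z -> nrm z < rho -> exists l, xder f z l) ->
  0 < r -> r < rho -> J (fun t => f (rc r * un t)) = f 0.
Proof.
move=> cf df r0 rr.
have c2 : continuous (fun z : R * R => f (rc z.1 * un z.2)).
  by apply: (cont_comp cf); cct.
have : J (fun t => f (rc x * un t)) @[x --> nbhs (0 : R)] --> J (fun t => f (rc 0 * un t)).
  apply: (@J_cont_at _ _ (fun x t => f (rc x * un t))).
    by apply: nearW => x; apply: (cont_comp cf); cct.
  by move=> s _; exact: (c2 (0, s)).
rewrite (_ : (fun t => f (rc 0 * un t)) = fun=> f 0); last first.
  by apply/funext => t; rewrite rc0 mul0r.
rewrite J_cst => /cvgC cv.
apply/eqP; rewrite -subr_eq0 -nrm_eq0 eq_le nrm_ge0 andbT.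
apply/ler_addgt0Pr => e e0; rewrite add0r.
have /nbhs_ballP[d /= d0 dP] := cv e e0.
set m := Num.min (d / 2) r.
have m0 : 0 < m by rewrite lt_min divr_gt0.
have md : m < d by rewrite gt_min ltr_pdivrMr// ltr_pMr// ltr1n.
rewrite (@circle_const f rho r m)//; last by rewrite (le_lt_trans _ rr)// ge_min lexx orbT.
by apply/ltW/dP; rewrite /ball/= sub0r normrN gtr0_norm.
Qed.

Lemma near_shiftC (P : set C) z : (\forall x \near nbhs z, P x) ->
  \forall x \near nbhs (0 : C), P (z + x).
Proof.
have H : (z + x) @[x --> nbhs (0 : C)] --> z.
  by rewrite -[X in _ --> X]addr0; apply: c_add; [exact: c_cst|exact: cvg_id].
exact: H.
Qed.

Lemma xder_quot (f : C -> C) z : z != 0 -> forall l, xder f z l ->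
  exists k, xder (fun w => (f w - f 0) / w) z k.
Proof.
move=> z0 l fl.
have h := xderM (xderD fl (xder_cst (- f 0) z)) (xderV z0).
by eexists; exact: h.
Qed.

(* The derivative at the center is a mean over a circle: apply the mean value
   property to the difference quotient. *)
Lemma deriv_mean (f : C -> C) (rho r : R) l : continuous f ->
  (forall z, nrm z < rho -> exists l, xder f z l) -> xder f 0 l ->
  0 < r -> r < rho -> l = (rc r)^-1 * J (fun t => f (rc r * un t) * (un t)^-1).
Proof.
move=> cf df [s [cs s0 hs]] r0 rr.
have sE z : z != 0 -> s z = (f z - f 0) / z.
  by move=> z0; have := hs z; rewrite add0r => ->; rewrite addrC addKr mulrC mulKf.
have near0 z : z != 0 -> \forall x \near nbhs z, (f x - f 0) / x = s x.
  move=> z0; have N : \forall x \near nbhs z, x != 0.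
    exact: (cvgr_neq0 _ (@cvg_id _ (nbhs z)) z0).
  by apply: filterS N => x x0; rewrite sE.
have cs' : continuous s.
  move=> z; have [->|z0] := eqVneq z 0; first exact: cs.
  apply: for_cont; rewrite [X in _ --> X](sE z z0); apply: cvg_near_eq (near0 z z0) _.
  apply: c_mul; last by apply: (@c_inv _ _ _ _ id z z0); exact: cvg_id.
  by apply: c_add; [exact: cf|exact: c_cst].
have := @circle_mean s rho r cs' _ r0 rr; rewrite s0 => <-; last first.
  move=> z z0 zr; have z0' : z != 0 by rewrite -nrm_gt0.
  have [l' hl'] := df z zr; have [k hk] := xder_quot z0' hl'.
  exists k; apply: xder_near hk; exact: near_shiftC (near0 z z0').
have rC : rc r != 0 by rewrite rc_eq0 gt_eqF.
have cu : continuous (fun t => f (rc r * un t) * (un t)^-1).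
  move=> t; apply: for_cont; apply: c_mul; last exact: unV_cont.
  by apply: (@cvg_via _ _ _ _ (fun t => rc r * un t) f (rc r * un t)); [ct|exact: cf].
have cv : continuous (fun t : R => f 0 * (un t)^-1).
  by move=> t; apply: for_cont; apply: c_mul; [exact: c_cst|exact: unV_cont].
have -> : J (fun t => s (rc r * un t)) =
    J (fun t => (rc r)^-1 * (f (rc r * un t) * (un t)^-1 - f 0 * (un t)^-1)).
  apply: eq_J => t _; rewrite sE ?mulf_neq0 ?un_neq0//.
  by rewrite invfM; ring.
rewrite JZ; last by move=> t; apply: for_cont; apply: c_add; [exact: cu|apply: c_opp; exact: cv].
rewrite (JB cu cv) JZ; last exact: unV_cont.
by rewrite J_unV mulr0 subr0.
Qed.

(* The real factor is p / max(p, |z|). *)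
Definition prj (p : R) (z : C) : C := z * rc (2 * p / (p + nrm z + `|nrm z - p|)).
Lemma prj_den p z : 0 < p -> 0 < p + nrm z + `|nrm z - p|.
Proof. by move=> p0; have := nrm_ge0 z; have := normr_ge0 (nrm z - p); lra. Qed.
Lemma prj_cont p : 0 < p -> continuous (prj p).
Proof.
move=> p0 z; apply: for_cont; apply: c_mul; first exact: cvg_id.
apply: cvg_rc; apply: r_mul; first exact: c_cst.
by apply: r_inv; [rewrite gt_eqF// prj_den|ct].
Qed.
Lemma prj_id p z : 0 < p -> nrm z <= p -> prj p z = z.
Proof.
move=> p0 zp; rewrite /prj ler0_norm ?subr_le0// (_ : _ + _ = 2 * p); last by ring.
by rewrite divff ?rc1 ?mulr1// mulf_neq0 ?gt_eqF.
Qed.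
Lemma prj_le p z : 0 < p -> nrm (prj p z) <= p.
Proof.
move=> p0; have d0 := prj_den z p0; rewrite /prj nrmM nrm_rc.
rewrite ger0_norm; last by rewrite divr_ge0 ?ltW// mulr_gt0.
rewrite mulrA ler_pdivrMr// mulrCA -subr_ge0; have := nrm_ge0 z.
by case: (ger0P (nrm z - p)) => h z0; nra.
Qed.

(** The hypothesis of Osgood's lemma: easily read off from [differentiable], stable under quotients,
    and strong enough for smoothness by [sepholo_sm]. *)
Definition sepholo (W : set V) (f : V -> C) := forall v, W v ->
  f x @[x --> nbhs v] --> f v /\ forall k, exists l, xder (fun z => f (sl k v z)) 0 l.

Lemma xder_sl f (v : V) k z l : xder (fun w => f (sl k (sl k v z) w)) 0 l ->
  xder (fun w => f (sl k v w)) z l.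
Proof.
move=> [s [cs s0 hs]]; exists s; split=> // h.
by have := hs h; rewrite add0r !slD addr0.
Qed.

Lemma sl_ball (v0 v : V) (rho e : R) k z : (forall j, nrm (v 0 j - v0 0 j) < rho) ->
  nrm z <= e - rho -> forall j, nrm (sl k v z 0 j - v0 0 j) < e.
Proof.
move=> vv ze j; rewrite slE addrAC (le_lt_trans (nrmD _ _))//.
have H : nrm ((j == k)%:R * z) <= e - rho.
  by case: (j == k); rewrite ?mul1r// mul0r nrm0 (le_trans (nrm_ge0 z)).
by have := vv j; lra.
Qed.

Lemma sepholo_deriv W f (v0 : V) : open W -> sepholo W f -> W v0 ->
  exists2 rho : R, 0 < rho & forall v : V, (forall j, nrm (v 0 j - v0 0 j) < rho) ->
    W v /\ forall k, (forall t, W (sl k v (rc rho * un t))) /\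
    forall l, xder (fun z => f (sl k v z)) 0 l ->
      l = (rc rho)^-1 * J (fun t => f (sl k v (rc rho * un t)) * (un t)^-1).
Proof.
move=> oW hf Wv0; have /nbhsV[e e0 eW] := open_near oW Wv0.
have r0 : 0 < e / 4 by rewrite divr_gt0.
exists (e / 4) => // v vv; split; first by apply: eW => j; have := vv j; lra.
move=> k.
have inW z : nrm z <= e / 2 -> W (sl k v z).
  move=> ze; apply: eW; have h : nrm z <= e - e / 4 by lra.
  exact: (@sl_ball v0 v (e / 4) e k z vv h).
split=> [t|l hl].
  by apply: inW; rewrite nrmM nrm_un nrm_rc mulr1 ger0_norm; lra.
have p0 : 0 < e / 2 by rewrite divr_gt0.
(* [deriv_mean] wants continuity on all of C; the retraction [prj] onto a disc provides it without
   changing f on the circle in question. *)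
pose h z := f (sl k v (prj (e / 2) z)).
have hE z : nrm z <= e / 2 -> h z = f (sl k v z) by move=> ze; rewrite /h prj_id.
have nearE z : nrm z < e / 2 -> \forall x \near nbhs z, f (sl k v x) = h x.
  move=> ze; have : nrm x @[x --> nbhs z] --> nrm z by exact: nrm_cont.
  move=> /cvgR/(_ (e / 2 - nrm z)); rewrite subr_gt0 => /(_ ze).
  apply: filterS => x xz; rewrite hE//; move: xz.
  by case: (ger0P (nrm x - nrm z)); lra.
rewrite (@deriv_mean h (e / 2) (e / 4) l) //.
- congr (_ * _); apply: eq_J => t _; rewrite hE// nrmM nrm_un nrm_rc mulr1.
  by rewrite ger0_norm; lra.
- move=> z; apply: for_cont; rewrite /h.
  apply: (@cvg_via _ _ _ _ (fun x => sl k v (prj (e / 2) x)) f (sl k v (prj (e / 2) z))).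
    by apply: c_sl; [exact: c_cst|exact: prj_cont].
  by apply: (hf _ _).1; apply: inW; exact: prj_le.
- move=> z ze; have [l' hl'] := (hf _ (inW z (ltW ze))).2 k.
  by exists l'; apply: xder_near (near_shiftC (nearE z ze)) (xder_sl hl').
- by apply: xder_near (near_shiftC (nearE 0 _)) hl; rewrite nrm0.
- lra.
Qed.

Lemma sn_Jcircle n W W' (f : V -> C) (w : R -> C) r k : open W -> open W' -> continuous w ->
  (forall v t, W' v -> W (sl k v (rc r * un t))) -> sn n W f ->
  sn n W' (fun v => J (fun t => f (sl k v (rc r * un t)) * w t)).
Proof.
move=> oW oW' cw inW; elim: n f => [|n IH] f sf.
  move=> v W'v; apply: smo_0.
  apply: (@J_cont_at _ _ (fun v t => f (sl k v (rc r * un t)) * w t)).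
    apply: filterS (open_near oW' W'v) => v' W'v' t; apply: for_cont.
    apply: c_mul; last exact: cw.
    apply: (@cvg_via _ _ _ _ (fun t => sl k v' (rc r * un t)) f (sl k v' (rc r * un t))).
      by ctv; exact: un_cont.
    by apply: smo_cont (sf _ _); exact: inW.
  move=> t _; apply: c_mul; last by apply: (@cvg_via _ _ _ _ snd w t); [exact: cvg_snd|exact: cw].
  apply: (@cvg_via _ _ _ _ (fun z : V * R => sl k z.1 (rc r * un z.2)) f (sl k v (rc r * un t))).
    apply: c_sl; first exact: cvg_fst.
    by apply: c_mul; [exact: c_cst|apply: c_un; exact: cvg_snd].
  by apply: smo_cont (sf _ _); exact: inW.
have c0 h : sn n W h -> forall v t, W' v -> h x @[x --> nbhs (sl k v (rc r * un t))] --> h (sl k v (rc r * un t)).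
  by move=> sh v t W'v; apply: smo_cont (sh _ _); exact: inW.
have sf' : sn n W f by move=> v Wv; exact: smo_pred (sf v Wv).
apply: (@sn_step _ _ _ _ _ (fun d v => J (fun t => pd d f (sl k v (rc r * un t)) * w t))) => //.
- by move=> v W'v; exact: smo_cont (IH f sf' v W'v).
- move=> d v W'v.
  have /nbhs_ballP[e /= e0 eW] := near_curve d (open_near oW' W'v).
  have e20 : 0 < e / 2 by rewrite divr_gt0.
  have inW' t : `|t| <= e / 2 -> W' (sl d.1 v (ud d.2 * rc t)).
    move=> te; apply: eW; rewrite /ball/= sub0r normrN; lra.
  pose F' h t s := h (sl k (sl d.1 v (ud d.2 * rc t)) (rc r * un s)) * w s.
  have E0 : J (F' (pd d f) 0) = J (fun t => pd d f (sl k v (rc r * un t)) * w t).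
    by rewrite /F' rc0 mulr0 sl0.
  rewrite -E0; apply: (@cder_J _ (F' f) (F' (pd d f)) (e / 2) e20).
  + move=> t te s; apply: for_cont; apply: c_mul; last exact: cw.
    apply: (@cvg_via _ _ _ _ (fun s => sl k (sl d.1 v (ud d.2 * rc t)) (rc r * un s)) f
      (sl k (sl d.1 v (ud d.2 * rc t)) (rc r * un s))).
      by ctv; exact: un_cont.
    exact: (c0 f sf' _ _ (inW' t te)).
  + move=> t s te.
    have [pe _] := snS_pd d sf (inW _ s (inW' t te)).
    have := pd_cder pe; rewrite {1}slC curve_at slC => H.
    have Q := cderM H (cder_cst (w s) t); rewrite mulr0 addr0 in Q.
    by rewrite /F' slC; apply: cder_ext Q => x; rewrite /curve slC.
  + move=> t s te; apply: c_mul; last by apply: (@cvg_via _ _ _ _ snd w s); [exact: cvg_snd|exact: cw].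
    apply: (@cvg_via _ _ _ _ (fun z : R * R => sl k (sl d.1 v (ud d.2 * rc z.1)) (rc r * un z.2)) (pd d f)
      (sl k (sl d.1 v (ud d.2 * rc t)) (rc r * un s))).
      apply: c_sl; last by apply: c_mul; [exact: c_cst|apply: c_un; exact: cvg_snd].
      apply: c_sl; first exact: c_cst.
      by apply: c_mul; [exact: c_cst|apply: cvg_rc; exact: cvg_fst].
    apply: c0; last exact: inW'.
    by move=> x Wx; exact: (snS_pd d sf Wx).2.
- by move=> d; apply: IH => v Wv; exact: (snS_pd d sf Wv).2.
Qed.

(** A bootstrap: by Cauchy's formula each partial derivative is a weighted circle mean of f, and by
    [sn_Jcircle] circle means of C^n functions are C^n, so that f is C^(n+1). *)
Lemma sepholo_sm W f : open W -> sepholo W f -> sm W f /\ forall k v, W v -> Dg ci k f v = 0.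
Proof.
move=> oW hf; split; last first.
  move=> k v Wv; have [l hl] := (hf v Wv).2 k; exact: (xder_Dg hl).1.
suff H n : sn n W f by move=> n v Wv; exact: H.
elim: n => [|n IH] v Wv; first by apply: smo_0; exact: (hf v Wv).1.
apply: smo_S; first exact: (hf v Wv).1.
move=> [k b]; split.
  by have [l hl] := (hf v Wv).2 k; exists (l * ud b); exact: xder_pd hl b.
have [rho rho0 H] := sepholo_deriv oW hf Wv.
pose W' := [set x : V | forall j, nrm (x 0 j - v 0 j) < rho].
have oW' : open W' by exact: open_poly.
have W'v : W' v by move=> j; rewrite subrr nrm0.
have inW x t : W' x -> W (sl k x (rc rho * un t)) by move=> /H[_ /(_ k)[]].
have s1 := sn_Jcircle oW oW' (@unV_cont R) inW IH.
have s2 := snM oW' (fun x W'x => @sm_cst _ _ W' (ud b * (rc rho)^-1) oW' n x W'x) s1.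
apply: smo_near (s2 v W'v); apply: filterS (open_near oW' W'v) => x W'x.
have [Wx /(_ k)[_ Hx]] := H x W'x.
have [l hl] := (hf x Wx).2 k.
by rewrite (pdP (xder_pd hl b)) (Hx l hl); ring.
Qed.

Lemma differentiable_sepholo W f : (forall v, W v -> differentiable f v) -> sepholo W f.
Proof.
move=> df v Wv; split; first exact: differentiable_continuous (df v Wv).
move=> k; pose dv : V := delta_mx 0 k.
have D : derivable f v dv by apply: diff_derivable; exact: df.
have [l hl] : exists l : C, (fun h : C => h^-1 *: ((f \o shift v) (h *: dv) - f v)) @ 0^' --> l.
  by exists ('D_dv f v); exact: D.
exists l, (fun h => if h == 0 then l else h^-1 * (f (sl k v h) - f v)); split.
- rewrite eqxx; apply/cvgC => e e0; move/cvgC : hl => /(_ e e0); rewrite near_withinE.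
  apply: filterS => h H; case: ifPn => [_|h0]; first by rewrite subrr nrm0.
  by have := H h0; rewrite sl.unlock (addrC v).
- by rewrite eqxx.
- move=> h; rewrite add0r sl0; case: ifPn => [/eqP ->|h0]; first by rewrite sl0 mul0r addr0.
  by rewrite mulrA divff// mul1r; ring.
Qed.

Lemma smT_slice f v (z : C) k : sm setT f ->
  f (sl k v z) = f v + z * J (fun s => Dg (- ci) k f (sl k v (z * rc s))) +
    cj z * J (fun s => Dg ci k f (sl k v (z * rc s))).
Proof.
move=> sf; have P := slice_pl k v sf.
have cs (e : C) : continuous (fun s : R => Dg e k f (sl k v (z * rc s))).
  move=> s; apply: for_cont; apply: c_comp; first exact: (smT_cont (sm_Dg e k openT sf)).
  by ctv.
have ca (e a : C) : continuous (fun s : R => a * Dg e k f (sl k v (z * rc s))).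
  by move=> s; apply: for_cont; apply: c_mul; [exact: c_cst|exact: cs].
have H := @J_FTC _ (fun s => f (sl k v (z * rc s))) _ (_ : continuous (fun s : R =>
   z * Dg (- ci) k f (sl k v (z * rc s)) + cj z * Dg ci k f (sl k v (z * rc s)))).
rewrite rc0 rc1 mulr0 mulr1 sl0 in H; apply/eqP; rewrite -addrA addrC -subr_eq; apply/eqP.
rewrite -H; first by rewrite (JD (ca _ _) (ca _ _)) (JZ _ (cs _)) (JZ _ (cs _)).
  by move=> s; apply: for_cont; apply: c_add; apply: ca.
move=> s _; have := pl_chain P (cderZ z (cder_rc s)); rewrite mulr1 /=.
rewrite dir_split => h; apply: cder_eq h _; rewrite !DgE; ring.
Qed.

Definition lform (l : 'I_g -> C) (h : V) : C := \sum_k h 0 k * l k.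
Lemma lform_linear l : linear (lform l).
Proof.
move=> a u v; rewrite /lform scaler_sumr -big_split/=; apply: eq_bigr => k _.
by rewrite !mxE mulrDl -scalerAl.
Qed.
HB.instance Definition _ l := GRing.isLinear.Build C V C *:%R (lform l) (lform_linear l).

Lemma entry_le (h : V) k : `|h 0 k| <= `|h|.
Proof.
change (`|h 0 k| <= mx_norm h); rewrite mx_normE -[leLHS]nngE num_le.
exact: (le_bigmax _ _ (0, k)).
Qed.

(** The points [v + trunc m h] are the vertices of a path from v to v + h that changes one
    coordinate at a time. *)
Definition trunc (m : nat) (h : V) : V := \row_k (if (k < m)%N then h 0 k else 0).
Lemma trunc_cont m : continuous (trunc m).
Proof.
move=> h; apply: for_cont; apply: v_row => k; rewrite mxE.
apply: (@cvg_near_eq _ _ _ _ (fun h : V => if (k < m)%N then h 0 k else 0)).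
  by apply: nearW => x; rewrite mxE.
by case: ifP => _; [apply: v_entry; exact: cvg_id|exact: c_cst].
Qed.
Lemma trunc0 m : trunc m 0 = 0.
Proof. by apply/rowP => k; rewrite !mxE if_same. Qed.
Lemma truncS (k : 'I_g) h v : v + trunc k.+1 h = sl k (v + trunc k h) (h 0 k).
Proof.
apply/rowP => j; rewrite slE !mxE ltnS leq_eqVlt -addrA; congr (_ + _).
rewrite (_ : (j == k) = ((j : nat) == k)); last by rewrite -(inj_eq val_inj).
have [jk|_] := eqVneq (j : nat) k; last by rewrite mul0r addr0.
by rewrite jk ltnn mul1r add0r (val_inj jk).
Qed.

Lemma c_sum {T : Type} {F : set_system T} {FF : Filter F} (I : Type) (s : seq I)
    (f : I -> T -> C) (a : I -> C) : (forall i, f i x @[x --> F] --> a i) ->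
  (\sum_(i <- s) f i x) @[x --> F] --> \sum_(i <- s) a i.
Proof.
move=> fa; elim: s => [|i s IH].
  rewrite big_nil; apply: (@cvg_near_eq _ _ _ _ (fun=> 0)); last exact: c_cst.
  by apply: nearW => x; rewrite big_nil.
rewrite big_cons; apply: (@cvg_near_eq _ _ _ _ (fun x => f i x + \sum_(i <- s) f i x)).
  by apply: nearW => x; rewrite big_cons.
by apply: c_add; [exact: fa|exact: IH].
Qed.

Lemma differentiable_near (f h : V -> C) v : (\forall x \near nbhs v, h x = f x) ->
  differentiable h v -> differentiable f v.
Proof.
move=> hf /diff_locallyP[cl /eqaddoP o].
have fv : h v = f v by exact: nbhs_singleton hf.
have o' : f \o shift v = cst (f v) + 'd h v +o_ 0 id.
  apply/eqaddoP => eps eps0.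
  have sh : (x + v) @[x --> nbhs (0 : V)] --> v.
    by rewrite -[X in _ --> X]add0r; apply: v_add; [exact: cvg_id|exact: c_cst].
  have s2 : nbhs (0 : V) [set x | h (x + v) = f (x + v)] := sh _ hf.
  have o2 : nbhs (0 : V) [set x | `|(h \o shift v - (cst (h v) + 'd h v)) x| <= eps * `|x|] := o eps eps0.
  change (nbhs (0 : V) [set x | `|(f \o shift v - (cst (f v) + 'd h v)) x| <= eps * `|x|]).
  apply: filterS2 s2 o2 => x /= hx.
  by rewrite !fctE /= fv hx.
apply/diff_locallyP; rewrite (diff_unique cl o'); split; [exact: cl|exact: o'].
Qed.

(** The way back to Frechet differentiability, in which line bundles and their sections are defined.
    The increment telescopes along the path of [trunc]; by the Cauchy-Riemann equations each leg has
    only the C-linear term of [smT_slice], with a slope [Q k h] tending to [l k]. *)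
Lemma smT_differentiable f v : sm setT f ->
  (\forall x \near nbhs v, forall k, Dg ci k f x = 0) -> differentiable f v.
Proof.
move=> sf D0.
pose l k := Dg (- ci) k f v.
pose Q k (h : V) := J (fun s => Dg (- ci) k f (sl k (v + trunc k h) (h 0 k * rc s))).
have cQ k : Q k h @[h --> nbhs (0 : V)] --> l k.
  have -> : l k = Q k 0.
    by rewrite -[LHS]J_cst; apply: eq_J => s _; rewrite trunc0 mxE mul0r sl0 addr0.
  have cD := smT_cont (sm_Dg (- ci) k openT sf).
  apply: (@J_cont_at _ _ (fun h s => Dg (- ci) k f (sl k (v + trunc k h) (h 0 k * rc s)))).
    apply: nearW => h s; apply: for_cont; apply: (c_comp cD); apply: c_sl; first exact: c_cst.
    by apply: c_mul; [exact: c_cst|apply: cvg_rc; exact: cvg_id].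
  move=> s _; apply: (c_comp cD); apply: c_sl.
  2: by apply: c_mul; [apply: v_entry; exact: cvg_fst|apply: cvg_rc; exact: cvg_snd].
  apply: v_add; first exact: c_cst.
  apply: (@cvg_via _ _ _ _ fst (trunc k)); [exact: cvg_fst|exact: trunc_cont].
have [e e0 eD] : exists2 e : R, 0 < e & forall w : V, (forall k, nrm (w 0 k - v 0 k) < e) ->
  forall k, Dg ci k f w = 0 by apply/nbhsV.
have tele (h : V) : (forall k, nrm (h 0 k) < e) -> f (h + v) = f v + \sum_k h 0 k * Q k h.
  move=> he.
  have step (k : 'I_g) : f (v + trunc k.+1 h) = f (v + trunc k h) + h 0 k * Q k h.
    rewrite truncS smT_slice// -/(Q k h) -[RHS]addr0; congr (_ + _).
    rewrite (_ : J _ = 0) ?mulr0// -[RHS]J_cst; apply: eq_J => s /andP[s0 s1].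
    apply: eD => j; rewrite slE !mxE addrAC [v 0 j + _]addrC addrK.
    case: eqP => [->|_]; last first.
      by rewrite mul0r addr0; case: ifP => // _; rewrite nrm0.
    rewrite ltnn add0r mul1r nrmM nrm_rc ger0_norm//.
    by rewrite (le_lt_trans _ (he k))// ler_piMr ?nrm_ge0.
  have : forall m, (m <= g)%N -> f (v + trunc m h) = f v + \sum_(k < g | (k < m)%N) h 0 k * Q k h.
    elim=> [|m IH] mg.
      rewrite big_pred0 ?addr0// (_ : trunc 0 h = 0) ?addr0//.
      by apply/rowP => j; rewrite !mxE.
    rewrite (step (Ordinal mg)) IH ?(ltnW mg)// -addrA; congr (_ + _).
    rewrite [RHS](bigD1 (Ordinal mg)) ?ltnS//= addrC; congr (_ + _).
    apply: eq_bigl => k; rewrite ltnS -(inj_eq val_inj)/= andbC.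
    by rewrite ltn_neqAle.
  move=> /(_ g (leqnn g)); rewrite (_ : trunc g h = h); last first.
    by apply/rowP => j; rewrite !mxE ltn_ord.
  rewrite addrC => ->; congr (_ + _); apply: eq_bigl => k.
  by rewrite ltn_ord.
have cl : continuous (lform l).
  move=> h; apply: for_cont; rewrite /lform.
  apply: (@c_sum V (nbhs h) _ _ _ (fun k h => h 0 k * l k) (fun k => h 0 k * l k)) => k.
  by apply: c_mul; [apply: v_entry; exact: cvg_id|exact: c_cst].
have o : f \o shift v = cst (f v) + lform l +o_ 0 id.
  apply/eqaddoP => eps eps0.
  (* The error is shared among g + 1 parts rather than g, so that the quotient makes sense for g =
     0. *)
  have g1 : 0 < g.+1%:R :> C by rewrite ltr0n.
  have cQ' k : \forall h \near nbhs (0 : V), `|l k - Q k h| <= eps / g.+1%:R.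
    by have /cvgrPdist_le := cQ k; apply; rewrite divr_gt0.
  have n0 : nbhs (0 : V) [set h : V | forall k, nrm (h 0 k) < e].
    by apply/nbhsV; exists e => // w we k; have := we k; rewrite mxE subr0.
  have nQ : nbhs (0 : V) [set h : V | forall k, `|l k - Q k h| <= eps / g.+1%:R].
    by move: cQ' => /filter_forall; apply: filterS => x.
  change (nbhs (0 : V) [set x | `|(f \o shift v - (cst (f v) + lform l)) x| <= eps * `|x|]).
  apply: filterS2 n0 nQ => h he hQ; rewrite /mkset.
  have -> : (f \o shift v - (cst (f v) + lform l)) h = \sum_k h 0 k * (Q k h - l k).
    rewrite !fctE /= tele// /lform opprD addrACA subrr add0r -sumrB.
    by apply: eq_bigr => k _; rewrite mulrBr.
  apply: (le_trans (ler_norm_sum _ _ _)).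
  apply: (@le_trans _ _ (\sum_(k < g) `|h| * (eps / g.+1%:R))).
    apply: ler_sum => k _; rewrite normrM ler_pM//; first exact: entry_le.
    by rewrite distrC.
  rewrite sumr_const card_ord -[_ *+ _]mulr_natr /= -mulrA mulrC ler_wpM2r//.
  rewrite -mulrA ler_piMr ?(ltW eps0)//.
  by rewrite mulrC ler_pdivrMr// mul1r ler_nat.
apply/diff_locallyP; rewrite (diff_unique cl o); split; [exact: cl|exact: o].
Qed.

Lemma sm_differentiable W f v : open W -> W v -> sm W f ->
  (forall x k, W x -> Dg ci k f x = 0) -> differentiable f v.
Proof.
move=> oW Wv sf D0; have [h sh hf] := sm_local oW sf Wv.
have dh : differentiable h v.
  apply: smT_differentiable => //.
  have := near_near hf; apply: filterS2 (open_near oW Wv) => x Wx hx k.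
  by rewrite (Dg_near _ _ hx) D0.
exact: differentiable_near hf dh.
Qed.

End Holomorphic.

(** * The Cauchy transform in polar coordinates *)

Section PolarIntegral.
Variable R : realType.
Local Notation C := (Cplx R).
Local Notation rc := (@rc R).
Local Notation nrm := (@nrm R).

Lemma cder_compR (h : R -> C) (p : R -> R) t l m : cder (fun x => rc (p x)) t l ->
  cder h (p t) m -> cder (fun x => h (p x)) t (m * l).
Proof.
move=> dp; have lr := cder_im0 dp; case: dp => s [cs s0 hs] [r [cr <- hr]].
have pE x : p (t + x) = p t + x * re (s x).
  by have := congr1 (@re R) (hs x); rewrite reD reM !re_rc im_rc mul0r subr0.
exists (fun x => r (x * re (s x)) * rc (re (s x))); split.
- apply: c_mul; last exact: cvg_rc (cvg_re cs).
  rewrite mul0r; apply: (@cvg_via _ _ _ _ (fun x => x * re (s x)) r 0); last exact: cr.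
  rewrite -[X in _ --> X](mul0r (re (s 0))); apply: r_mul; [exact: cvg_id|exact: cvg_re cs].
- by rewrite mul0r s0 -lr.
- by move=> x; rewrite pE hr rcM; ring.
Qed.

(* The half line is compactified by r = s / (1 - s), so that 1 + r = (1 - s)^-1. *)
Definition rr (s : R) : R := s / (1 - s).
Lemma rrE s : s < 1 -> 1 + rr s = (1 - s)^-1.
Proof. by move=> s1; rewrite /rr; field; rewrite gt_eqF// subr_gt0. Qed.
Lemma rr_ge0 s : 0 <= s -> s < 1 -> 0 <= rr s.
Proof. by move=> s0 s1; rewrite divr_ge0// subr_ge0 ltW. Qed.
Lemma cder_rr s : s < 1 -> cder (fun x => rc (rr x)) s (rc ((1 - s)^-1 ^+ 2)).
Proof.
move=> s1; have n0 : 1 - rc s != 0 by rewrite -[1]/(rc 1) -rcB rc_eq0 gt_eqF// subr_gt0.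
have d1 := cderB (cder_cst 1 s) (cder_rc s).
have d2 := cderM (cder_rc s) (cder_comp d1 (xderV n0)).
apply: cder_eq (cder_ext _ d2) _ => [x|]; first by rewrite /rr rcM rcV rcB.
by rewrite rcX rcV rcB /=; field.
Qed.
Lemma rr_cont (s : R) : s < 1 -> rr x @[x --> nbhs s] --> rr s.
Proof.
move=> s1; apply: r_mul; first exact: cvg_id.
by apply: r_inv; [rewrite gt_eqF// subr_gt0|ct].
Qed.

Lemma near_lt1 (s : R) : s < 1 -> \forall x \near nbhs s, x < 1.
Proof.
move=> s1; apply/nbhs_ballP; exists (1 - s); first by rewrite /= subr_gt0.
by move=> x; rewrite /ball/= distrC => /(le_lt_trans (ler_norm _)); rewrite ltrBlDr subrK.
Qed.
Lemma near_gt1 (s : R) : 1 < s -> \forall x \near nbhs s, 1 < x.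
Proof.
move=> s1; apply/nbhs_ballP; exists (s - 1); first by rewrite /= subr_gt0.
by move=> x; rewrite /ball/= => /(le_lt_trans (ler_norm _)) => h; rewrite -subr_gt0; lra.
Qed.
Lemma near_shiftR (P : set R) t : (\forall x \near nbhs t, P x) ->
  \forall x \near nbhs (0 : R), P (t + x).
Proof.
have H : (t + x) @[x --> nbhs (0 : R)] --> t.
  by rewrite -[X in _ --> X]addr0; apply: r_add; [exact: c_cst|exact: cvg_id].
exact: H.
Qed.

(* Extension by 0 through the point at infinity [s = 1]. *)
Lemma ext0_cont (X : topologicalType) (sg : X -> R) (F : X -> C) (x0 : X) :
  sg x @[x --> nbhs x0] --> sg x0 ->
  (sg x0 < 1 -> F x @[x --> nbhs x0] --> F x0) ->
  (sg x0 = 1 -> exists2 B : R, 0 <= B & \forall x \near nbhs x0, 0 < sg x -> sg x < 1 ->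
     nrm (F x) <= B * (1 - sg x)) ->
  (if sg x < 1 then F x else 0) @[x --> nbhs x0] --> (if sg x0 < 1 then F x0 else 0).
Proof.
move=> cs cF bF; have [s1|s1|s1] := ltgtP (sg x0) 1.
- apply: cvg_near_eq (cF s1); have N : \forall x \near nbhs x0, sg x < 1 := cs _ (near_lt1 s1).
  by apply: filterS N => x x1; rewrite x1.
- apply: (@cvg_near_eq _ _ _ _ (fun=> 0)); last exact: c_cst.
  have N : \forall x \near nbhs x0, 1 < sg x := cs _ (near_gt1 s1).
  by apply: filterS N => x x1; rewrite ifN// -leNgt ltW.
- have [B B0 bB] := bF s1; apply/cvgC => e e0.
  have d0 : 0 < Num.min 1 (e / (B + 1)) by rewrite lt_min ltr01 divr_gt0// ltr_wpDl.
  have /cvgR/(_ _ d0) := cs; apply: filterS2 bB => x bx; rewrite s1 lt_min => /andP[x1 xe].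
  rewrite subr0; case: ifPn => [xl|_]; last by rewrite nrm0.
  rewrite ler0_norm in x1 xe; [|by rewrite subr_le0 ltW].
  have xg : 0 < sg x by lra.
  rewrite (le_lt_trans (bx xg xl))//.
  apply: le_lt_trans (_ : (B + 1) * (1 - sg x) < e).
    by rewrite ler_wpM2r ?lerDl// subr_ge0 ltW.
  by rewrite mulrC -ltr_pdivlMr ?ltr_wpDl//; lra.
Qed.

(** The fundamental theorem on the compactified half line. Decay of q' of order 3 pays for the
    Jacobian (1 - s)^-2 = (1 + r)^2 and leaves continuity at s = 1; decay of q of order 2 makes the
    primitive differentiable there, with derivative 0. *)
Lemma int_half_line (q q' : R -> C) (B : R) : 0 <= B -> continuous q' ->
  (forall r, cder q r (q' r)) ->
  (forall r, 0 <= r -> nrm (q r) * (1 + r) ^+ 2 <= B) ->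
  (forall r, 0 <= r -> nrm (q' r) * (1 + r) ^+ 3 <= B) ->
  J (fun s => if s < 1 then q' (rr s) * rc ((1 - s)^-1 ^+ 2) else 0) = - q 0.
Proof.
move=> B0 cq' dq bq bq'.
pose F s := if s < 1 then q (rr s) else 0.
have F1 : F 1 = 0 by rewrite /F ltxx.
have F0 : F 0 = q 0 by rewrite /F ltr01 /rr mul0r.
rewrite (@J_FTC _ F _).
- by rewrite F1 F0 sub0r.
- move=> s; apply: for_cont.
  apply: (@ext0_cont _ id (fun s => q' (rr s) * rc ((1 - s)^-1 ^+ 2))); first exact: cvg_id.
    move=> s1; apply: c_mul.
      by apply: (@cvg_via _ _ _ _ rr q' (rr s)); [exact: rr_cont|exact: cq'].
    apply: cvg_rc; apply: r_exp; apply: r_inv; first by rewrite gt_eqF// subr_gt0.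
    by ct.
  move=> s1; exists B => //; apply: nearW => x x0 x1.
  have p1 : 0 < 1 - x by rewrite subr_gt0.
  have := bq' (rr x) (rr_ge0 (ltW x0) x1); rewrite rrE// => h.
  have q0 : 0 <= (1 - x)^-1 by rewrite invr_ge0 ltW.
  rewrite nrmM nrm_rc (ger0_norm (exprn_ge0 _ q0)).
  by rewrite -ler_pdivrMr// -mulrA -exprSr.
- move=> x /andP[x0]; rewrite le_eqVlt => /orP[/eqP ->|x1].
    rewrite ltxx; exists (fun h => if h < 0 then F (1 + h) / rc h else 0); split.
    + rewrite ltxx; apply/cvgC => e e0.
      have d0 : 0 < Num.min 1 (e / (B + 1)) by rewrite lt_min ltr01 divr_gt0// ltr_wpDl.
      apply/nbhs_ballP; exists (Num.min 1 (e / (B + 1))) => // h.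
      rewrite /ball/= sub0r normrN lt_min subr0 => /andP[h1 he].
      case: ifPn => [hn|_]; last by rewrite nrm0.
      rewrite (ltr0_norm hn) in h1 he.
      have l1 : 1 + h < 1 by lra.
      have hh : 0 < - h by rewrite oppr_gt0.
      rewrite /F l1 nrmM nrmV nrm_rc ltr0_norm// ltr_pdivrMr//.
      have := bq (rr (1 + h)) (rr_ge0 _ l1); rewrite rrE// opprD addrA subrr add0r => H.
      have {}H : nrm (q (rr (1 + h))) <= B * (- h) ^+ 2.
        by rewrite -ler_pdivrMr ?exprn_gt0// -exprVn H//; lra.
      apply: (le_lt_trans H); rewrite expr2 mulrA ltr_pM2r//.
      apply: le_lt_trans (_ : (B + 1) * - h < e); first by rewrite ler_wpM2r ?lerDl// ltW.
      by rewrite mulrC -ltr_pdivlMr// ltr_wpDl.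
    + by rewrite ltxx.
    + move=> h; rewrite F1 add0r; case: ifPn => [hn|hp].
        by rewrite mulrC divfK// rc_eq0 lt_eqF.
      by rewrite mulr0 /F ifN// -leNgt lerDl leNgt.
  rewrite x1; apply: (@cder_near _ (fun s => q (rr s))).
    have := near_lt1 x1 => /near_shiftR; apply: filterS => h h1.
    by rewrite /F h1.
  exact: cder_compR (cder_rr x1) (dq _).
Qed.

(* The integral of u^-1 p over the plane in polar coordinates z = r u. *)
Definition tin (p : C -> C) (s t : R) : C :=
  if s < 1 then (un t)^-1 * p (rc (rr s) * un t) * rc ((1 - s)^-1 ^+ 2) else 0.
Definition T1 (p : C -> C) : C := J (fun s => J (tin p s)).
(** Of the four powers of decay two pay for the factor (1 - s)^-2, and the others make the integrand
    tend to 0 at s = 1. [DP] asks for this locally uniformly in a parameter, which is what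
    continuity and differentiation of [T1] use. *)
Definition dp (p : C -> C) (B : R) := forall z, nrm (p z) * (1 + nrm z) ^+ 4 <= B.
Definition DP (X : topologicalType) (p : X -> C -> C) :=
  continuous (fun z : X * C => p z.1 z.2) /\
  forall x : X, exists B, \forall y \near nbhs x, dp (p y) B.
Definition DP1 (p : C -> C) := continuous p /\ exists B, dp p B.

Lemma dp_ge0 p B : dp p B -> 0 <= B.
Proof. by move=> /(_ 0); apply: le_trans; rewrite mulr_ge0 ?nrm_ge0// nrm0 addr0 expr1n. Qed.

Lemma tin_bound p B s t : dp p B -> 0 < s -> s < 1 -> nrm (tin p s t) <= B * (1 - s) ^+ 2.
Proof.
move=> pB s0 s1; have r0 := rr_ge0 (ltW s0) s1.
have p1 : 0 < 1 - s by rewrite subr_gt0.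
have q0 : 0 <= (1 - s)^-1 by rewrite invr_ge0 ltW.
rewrite /tin s1 !nrmM nrmV nrm_un invr1 mul1r nrm_rc (ger0_norm (exprn_ge0 _ q0)).
have := pB (rc (rr s) * un t); rewrite nrmM nrm_un mulr1 nrm_rc (ger0_norm r0) rrE// => h.
rewrite -ler_pdivrMr ?exprn_gt0// -mulrA -exprVn -exprD.
exact: h.
Qed.

Section Cont.
Variables (X : topologicalType) (p : X -> C -> C).
Hypothesis P : DP p.

Lemma tin_cont : continuous (fun z : (X * R) * R => tin (p z.1.1) z.1.2 z.2).
Proof.
move=> z; apply: for_cont.
apply: (@ext0_cont _ (fun z : (X * R) * R => z.1.2) (fun z => (un z.2)^-1 *
   p z.1.1 (rc (rr z.1.2) * un z.2) * rc ((1 - z.1.2)^-1 ^+ 2))).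
- by apply: c_snd; exact: cvg_fst.
- move=> s1.
  have cs : x.1.2 @[x --> nbhs z] --> z.1.2 by apply: c_snd; exact: cvg_fst.
  have c1 : (un x.2)^-1 @[x --> nbhs z] --> (un z.2)^-1.
    by apply: (@cvg_via _ _ _ _ snd (fun t : R => (un t)^-1) z.2); [exact: cvg_snd|exact: unV_cont].
  have crr : rr x.1.2 @[x --> nbhs z] --> rr z.1.2.
    by apply: (@cvg_via _ _ _ _ (fun x : (X * R) * R => x.1.2) rr z.1.2); [exact: cs|exact: rr_cont].
  have cu : un x.2 @[x --> nbhs z] --> un z.2 by apply: c_un; exact: cvg_snd.
  have c2 : p x.1.1 (rc (rr x.1.2) * un x.2) @[x --> nbhs z] --> p z.1.1 (rc (rr z.1.2) * un z.2).
    apply: (@cvg_via _ _ _ _ (fun x : (X * R) * R => (x.1.1, rc (rr x.1.2) * un x.2))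
      (fun y : X * C => p y.1 y.2) (z.1.1, rc (rr z.1.2) * un z.2)); last exact: (P.1 (z.1.1, rc (rr z.1.2) * un z.2)).
    apply: c_pair; first by apply: c_fst; exact: cvg_fst.
    by apply: c_mul; [apply: cvg_rc; exact: crr|exact: cu].
  apply: c_mul; first by apply: c_mul; [exact: c1|exact: c2].
  apply: cvg_rc; apply: r_exp; apply: r_inv; first by rewrite gt_eqF// subr_gt0.
  by apply: r_add; [exact: c_cst|apply: r_opp; exact: cs].
- move=> s1; have [B nB] := P.2 z.1.1.
  have B0 : 0 <= B by exact: dp_ge0 (nbhs_singleton nB).
  exists B => //.
  have c1 : x.1.1 @[x --> nbhs z] --> z.1.1 by apply: c_fst; exact: cvg_fst.
  have N : \forall x \near nbhs z, dp (p x.1.1) B := c1 _ nB.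
  apply: filterS N => x xB x0 x1.
  have := tin_bound x.2 xB x0 x1; rewrite /tin x1 => h; apply: (le_trans h).
  have p1 : 0 < 1 - x.1.2 by rewrite subr_gt0.
  rewrite expr2 mulrA ler_piMr//; first by rewrite mulr_ge0// ltW.
  by rewrite lerBlDr lerDl ltW.
Qed.

Lemma tinJ_cont : continuous (fun z : X * R => J (tin (p z.1) z.2)).
Proof.
move=> z; apply: for_cont.
apply: (@J_cont_at _ _ (fun (z : X * R) t => tin (p z.1) z.2 t)).
  apply: nearW => y t; apply: for_cont.
  apply: (@cvg_via _ _ _ _ (fun t => (y, t)) (fun z : (X * R) * R => tin (p z.1.1) z.1.2 z.2) (y, t)).
    by apply: c_pair; [exact: c_cst|exact: cvg_id].
  exact: (@tin_cont (y, t)).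
by move=> s _; exact: (@tin_cont (z, s)).
Qed.

Lemma T1_cont : continuous (fun x => T1 (p x)).
Proof.
move=> x; apply: for_cont; apply: (@J_cont_at _ _ (fun (x : X) s => J (tin (p x) s))).
  apply: nearW => y s; apply: for_cont.
  apply: (@cvg_via _ _ _ _ (fun s => (y, s)) (fun z : X * R => J (tin (p z.1) z.2)) (y, s)).
    by apply: c_pair; [exact: c_cst|exact: cvg_id].
  exact: (@tinJ_cont (y, s)).
by move=> s _; exact: (@tinJ_cont (x, s)).
Qed.

End Cont.

Lemma DP_DP1 (X : topologicalType) (p : X -> C -> C) x : DP p -> DP1 (p x).
Proof.
move=> [cp bp]; split; last by have [B nB] := bp x; exists B; exact: nbhs_singleton nB.
move=> z; apply: for_cont.
apply: (@cvg_via _ _ _ _ (fun z : C => (x, z)) (fun z : X * C => p z.1 z.2) (x, z)); last exact: (cp (x, z)).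
by apply: c_pair; [exact: c_cst|exact: cvg_id].
Qed.

Lemma DP1_DP (p : C -> C) : DP1 p -> DP (fun _ : R => p).
Proof.
move=> [cp [B pB]]; split; last by move=> x; exists B; apply: nearW.
by move=> z; apply: for_cont; apply: (@cvg_via _ _ _ _ snd p z.2); [exact: cvg_snd|exact: cp].
Qed.

Lemma tin_cont1 p s : DP1 p -> continuous (tin p s).
Proof.
move=> /DP1_DP P t; apply: for_cont.
apply: (@cvg_via _ _ _ _ (fun t => ((0 : R, s), t)) (fun z : (R * R) * R => tin p z.1.2 z.2) ((0 : R, s), t)).
  by apply: c_pair; [exact: c_cst|exact: cvg_id].
exact: (@tin_cont _ _ P ((0 : R, s), t)).
Qed.

Lemma tinJ_cont1 p : DP1 p -> continuous (fun s => J (tin p s)).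
Proof.
move=> /DP1_DP P s; apply: for_cont.
apply: (@cvg_via _ _ _ _ (fun s => (0 : R, s)) (fun z : R * R => J (tin p z.2)) (0 : R, s)).
  by apply: c_pair; [exact: c_cst|exact: cvg_id].
exact: (@tinJ_cont _ _ P (0 : R, s)).
Qed.

Lemma T1D p q : DP1 p -> DP1 q -> T1 (fun z => p z + q z) = T1 p + T1 q.
Proof.
move=> Pp Pq; rewrite /T1 -(JD (tinJ_cont1 Pp) (tinJ_cont1 Pq)); congr J; apply/funext => s.
rewrite -(JD (tin_cont1 Pp) (tin_cont1 Pq)); congr J; apply/funext => t.
by rewrite /tin; case: ifP => _; ring.
Qed.
Lemma T1Z (a : C) p : DP1 p -> T1 (fun z => a * p z) = a * T1 p.
Proof.
move=> Pp; rewrite /T1 -(JZ _ (tinJ_cont1 Pp)); congr J; apply/funext => s.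
rewrite -(JZ _ (tin_cont1 Pp)); congr J; apply/funext => t.
by rewrite /tin; case: ifP => _; ring.
Qed.
Lemma eq_T1 p q : p =1 q -> T1 p = T1 q.
Proof. by move=> /funext ->. Qed.
Lemma T1_zero p : (forall r, J (fun t => (un t)^-1 * p (rc r * un t)) = 0) -> DP1 p -> T1 p = 0.
Proof.
move=> p0 Pp; rewrite /T1 -[RHS]J_cst; congr J; apply/funext => s.
rewrite /tin; case: (s < 1); last exact: J_cst.
rewrite (_ : (fun t => _) = fun t => rc ((1 - s)^-1 ^+ 2) * ((un t)^-1 * p (rc (rr s) * un t))).
  rewrite JZ ?p0 ?mulr0// => t; apply: for_cont; apply: c_mul; first exact: unV_cont.
  by apply: (@cvg_via _ _ _ _ (fun t => rc (rr s) * un t) p (rc (rr s) * un t)); [ct|exact: Pp.1].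
by apply/funext => t; ring.
Qed.
Lemma DP1D p q : DP1 p -> DP1 q -> DP1 (fun z => p z + q z).
Proof.
move=> [cp [B pB]] [cq [D qD]]; split.
  by move=> z; apply: for_cont; apply: c_add; [exact: cp|exact: cq].
exists (B + D) => z; apply: le_trans (lerD (pB z) (qD z)).
by rewrite -mulrDl ler_wpM2r ?nrmD// exprn_ge0// addr_ge0// nrm_ge0.
Qed.
Lemma DP1Z (a : C) p : DP1 p -> DP1 (fun z => a * p z).
Proof.
move=> [cp [B pB]]; split.
  by move=> z; apply: for_cont; apply: c_mul; [exact: c_cst|exact: cp].
by exists (nrm a * B) => z; rewrite nrmM -mulrA ler_wpM2l ?nrm_ge0//.
Qed.

Lemma T1_cder (p p' : R -> C -> C) : DP p -> DP p' ->
  (forall x z, cder (fun x => p x z) x (p' x z)) -> cder (fun x => T1 (p x)) 0 (T1 (p' 0)).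
Proof.
move=> P P' dpp.
have tinE (f : R -> C -> C) x s : DP f -> continuous (fun y => J (tin (f x) y)) by move=> /(DP_DP1 x)/tinJ_cont1.
have dt x s t : cder (fun x => tin (p x) s t) x (tin (p' x) s t).
  rewrite /tin; case: ifP => _; last exact: cder_cst.
  have := cderM (cderZ ((un t)^-1) (dpp x (rc (rr s) * un t))) (cder_cst (rc ((1 - s)^-1 ^+ 2)) x).
  by rewrite mulr0 addr0.
have dJ x s : cder (fun x => J (tin (p x) s)) x (J (tin (p' x) s)).
  apply/cder_shift; rewrite -{2}[x]addr0.
  apply: (@cder_J _ (fun h => tin (p (x + h)) s) (fun h => tin (p' (x + h)) s) 1) => //.
  - by move=> h _; apply: tin_cont1; exact: DP_DP1.
  - move=> h t _; apply/cder_shift; have /cder_shift := dt (x + h) s t.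
    by apply: cder_ext => y; rewrite addrA.
  - move=> h t _.
    apply: (@cvg_via _ _ _ _ (fun z : R * R => ((x + z.1, s), z.2))
      (fun z : (R * R) * R => tin (p' z.1.1) z.1.2 z.2) ((x + h, s), t)); last exact: (@tin_cont _ _ P' ((x + h, s), t)).
    apply: c_pair; last exact: cvg_snd.
    apply: c_pair; last exact: c_cst.
    by apply: r_add; [exact: c_cst|exact: cvg_fst].
apply: (@cder_J _ (fun x s => J (tin (p x) s)) (fun x s => J (tin (p' x) s)) 1) => //.
- by move=> x _; exact: tinE.
- by move=> x s _; exact: (@tinJ_cont _ _ P' (x, s)).
Qed.

Lemma circ_bound (f : R -> C) p B r : continuous (fun t => f t * p (rc r * un t)) ->
  (forall t, nrm (f t) <= 1) -> 0 <= r -> dp p B ->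
  nrm (J (fun t => f t * p (rc r * un t))) * (1 + r) ^+ 4 <= B.
Proof.
move=> cf f1 r0 pB; have q0 : 0 < 1 + r by rewrite ltr_pwDl.
rewrite -ler_pdivlMr ?exprn_gt0//; apply: nrm_J_le => // t _.
have := pB (rc r * un t); rewrite nrmM nrm_un mulr1 nrm_rc (ger0_norm r0) => h.
rewrite nrmM ler_pdivlMr ?exprn_gt0//; apply: le_trans h; rewrite ler_wpM2r ?exprn_ge0 ?(ltW q0)//.
by rewrite ler_piMl ?nrm_ge0.
Qed.

(** The hypothesis says that the circle mean q of p has derivative twice the circle mean of u^-1 k;
    integrate it over the half line, where q starts from p 0 and tends to 0. *)
Lemma polar_int p k : DP1 p -> DP1 k ->
  (forall r, cder (fun x => J (fun t => p (rc x * un t))) r (2 * J (fun t => (un t)^-1 * k (rc r * un t)))) ->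
  T1 k = - (2^-1 * p 0).
Proof.
move=> Pp Pz polar.
have cu (q : C -> C) r : continuous q -> continuous (fun t => (un t)^-1 * q (rc r * un t)).
  move=> cq t; apply: for_cont; apply: c_mul; first exact: unV_cont.
  by apply: (@cvg_via _ _ _ _ (fun t => rc r * un t) q (rc r * un t)); [ct|exact: cq].
have [B pB] := Pp.2; have [D zD] := Pz.2.
pose q r := J (fun t => p (rc r * un t)).
pose q' r := 2 * J (fun t => (un t)^-1 * k (rc r * un t)).
have two : 2 != 0 :> C by rewrite pnatr_eq0.
have E : J (fun s => 2 * J (tin (k) s)) = - q 0.
  rewrite -(@int_half_line q q' (B + 2 * D)).
  - congr J; apply/funext => s; rewrite /tin; case: (s < 1); last by rewrite J_cst mulr0.
    rewrite /q' -mulrA; congr (_ * _); rewrite mulrC -JZ; last exact: cu Pz.1.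
    by congr J; apply/funext => t; ring.
  - by rewrite addr_ge0 ?(dp_ge0 pB)// mulr_ge0// (dp_ge0 zD).
  - move=> r; apply: for_cont; apply: c_mul; first exact: c_cst.
    apply: (@J_cont_at _ _ (fun r t => (un t)^-1 * k (rc r * un t))).
      by apply: nearW => r'; exact: cu Pz.1.
    move=> t _; apply: c_mul.
      by apply: (@cvg_via _ _ _ _ snd (fun t : R => (un t)^-1) t); [exact: cvg_snd|exact: unV_cont].
    apply: (@cvg_via _ _ _ _ (fun z : R * R => rc z.1 * un z.2) (k) (rc r * un t)); last exact: Pz.1.
    by apply: c_mul; [apply: cvg_rc; exact: cvg_fst|apply: c_un; exact: cvg_snd].
  - exact: polar.
  - move=> r r0; have h : 1 <= 1 + r by rewrite lerDl.
    have := @circ_bound (fun=> 1) p B r; rewrite /q.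
    rewrite (_ : (fun t => 1 * _) = fun t => p (rc r * un t)); last by apply/funext => t; rewrite mul1r.
    move=> H; apply: le_trans (_ : nrm (J (fun t => p (rc r * un t))) * (1 + r) ^+ 4 <= _).
      by rewrite ler_wpM2l ?nrm_ge0// ler_weXn2l.
    apply: (@le_trans _ _ B); last by rewrite lerDl mulr_ge0// (dp_ge0 zD).
    apply: H => //; last by move=> t; rewrite nrm1.
    by apply: (cont_comp Pp.1); cct.
  - move=> r r0; have h : 1 <= 1 + r by rewrite lerDl.
    have := @circ_bound (fun t => (un t)^-1) (k) D r (cu _ r Pz.1).
    move=> /(_ _ r0 zD) H; rewrite /q' nrmM.
    apply: (@le_trans _ _ (2 * D)); last by rewrite lerDr (dp_ge0 pB).
    rewrite -mulrA (_ : nrm 2 = 2); last by rewrite -(rc_nat R 2) nrm_rc ger0_norm.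
    rewrite ler_wpM2l//; apply: le_trans (H _) => [|t]; last by rewrite nrmV nrm_un invr1.
    by rewrite ler_wpM2l ?nrm_ge0// ler_weXn2l.
have q0 : q 0 = p 0.
  by rewrite /q -[RHS]J_cst; congr J; apply/funext => t; rewrite rc0 mul0r.
rewrite JZ in E; last exact: tinJ_cont1.
by apply: (mulfI two); rewrite E q0; field.
Qed.

Lemma pompeiu p a b : pl p a b -> DP1 p -> DP1 (zb a b) -> T1 (zb a b) = - (2^-1 * p 0).
Proof. by move=> P Pp Pz; apply: polar_int => // r; exact: polar_b. Qed.

Lemma pl_cj : pl (@cj R) (fun=> 1) (fun=> - ci).
Proof.
have c1 : continuous (fun _ : C => 1 : C) by cct.
have H := pl_conj (pl_x c1 (@xder_id R)).
have E1 : cj 1 = 1 :> C by rewrite -rc1 cj_rc.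
have E2 : cj (ci * 1) = - ci :> C by rewrite mulr1 cj_ci.
by move: H; rewrite E1 E2.
Qed.

Lemma zd_cj (p a b : C -> C) (z : C) : zd (fun z => 1 * p z + cj z * a z) (fun z => - ci * p z + cj z * b z) z =
  cj z * zd a b z.
Proof.
rewrite /zd; transitivity (2^-1 * ((1 + ci * ci) * p z + cj z * (a z - ci * b z))); first by ring.
by rewrite ciM subrr mul0r add0r mulrCA.
Qed.

Lemma cj_polar (r t : R) : cj (rc r * un t) = rc r * (un t)^-1.
Proof. by rewrite conjM cj_rc un_conj. Qed.

Lemma polar_d_cj p a b r : pl p a b -> continuous p ->
  cder (fun x => J (fun t => cj (rc x * un t) * p (rc x * un t))) r
    (2 * J (fun t => un t * (cj (rc r * un t) * zd a b (rc r * un t)))).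
Proof.
move=> P cp; have := polar_d (plM (@conj_cont R) cp pl_cj P) r.
move=> H; apply: cder_eq H _; congr (_ * J _); apply/funext => t.
by rewrite zd_cj.
Qed.

(** The factor z cancels the Cauchy kernel, so this is the integral of dp/dz over the plane. It is
    an instance of [polar_int] for conj(z) p, which vanishes at 0. *)
Lemma pompeiu_d p a b : pl p a b -> continuous p -> DP1 (fun z => cj z * p z) ->
  DP1 (fun z => z * zd a b z) -> T1 (fun z => z * zd a b z) = 0.
Proof.
move=> P cp Pp Pz; rewrite (polar_int Pp Pz).
  by rewrite -rc0 cj_rc rc0 mul0r mulr0 oppr0.
move=> r; apply: cder_eq (polar_d_cj r P cp) _; congr (_ * J _); apply/funext => t.
by rewrite cj_polar; field; exact: un_neq0.
Qed.

(* w(r) = r mean(u^-1 p) satisfies w' = 2 c r w and w(0) = 0. *)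
Lemma circle_zero p a b (c : R) : pl p a b -> continuous p ->
  (forall z, zd a b z = rc c * cj z * p z) ->
  forall r, J (fun t => (un t)^-1 * p (rc r * un t)) = 0.
Proof.
move=> P cp hzd.
pose w r := J (fun t => cj (rc r * un t) * p (rc r * un t)).
have cu r : continuous (fun t => (un t)^-1 * p (rc r * un t)).
  move=> t; apply: for_cont; apply: c_mul; first exact: unV_cont.
  by apply: (@cvg_via _ _ _ _ (fun t => rc r * un t) p (rc r * un t)); [ct|exact: cp].
have wE r : w r = rc r * J (fun t => (un t)^-1 * p (rc r * un t)).
  rewrite -JZ//; congr J; apply/funext => t; rewrite cj_polar; ring.
have dw r : cder w r (2 * rc c * rc r * w r).
  apply: cder_eq (polar_d_cj r P cp) _; rewrite wE.
  rewrite (_ : (fun t => _) = fun t => (rc c * rc r * rc r) * ((un t)^-1 * p (rc r * un t))).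
    by rewrite (JZ _ (cu r)); ring.
  by apply/funext => t; rewrite hzd cj_polar; field; exact: un_neq0.
pose W r := w r * ex (rc r * rc r * - rc c).
have dW r : cder W r 0.
  have d2 := cderM (cderM (cder_rc r) (cder_rc r)) (cder_cst (- rc c) r).
  apply: cder_eq (cderM (dw r) (cder_comp d2 (xder_ex _))) _.
  by rewrite /=; ring.
have W0 r : W r = 0.
  have := @J_FTC _ (fun s => W (r * s)) (fun=> 0) (fun _ => cvg_cst _).
  rewrite J_cst mulr1 mulr0 => H.
  have {}H : 0 = W r - W 0.
    apply: H => x _; have := cder_lin (dW (r * x)).
    by rewrite mulr0.
  have W00 : W 0 = 0 by rewrite /W wE rc0 mul0r mul0r.
  by move/eqP: H; rewrite W00 subr0 eq_sym => /eqP.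
have wz r : w r = 0.
  by have /eqP := W0 r; rewrite mulf_eq0 (negPf (ex_neq0 _)) orbF => /eqP.
move=> r; have [->|r0] := eqVneq r 0.
  rewrite (_ : (fun t => _) = fun t => p 0 * (un t)^-1).
    by rewrite JZ ?J_unV ?mulr0//; exact: unV_cont.
  by apply/funext => t; rewrite rc0 mul0r mulrC.
by have /eqP := wz r; rewrite wE mulf_eq0 rc_eq0 (negPf r0) => /eqP.
Qed.

End PolarIntegral.

(** * Gaussian Green operators *)

Section Green.
Variables (R : realType) (g : nat) (cw : 'I_g -> R).
Local Notation C := (Cplx R).
Local Notation V := 'rV[Cplx R]_g.
Local Notation rc := (@rc R).
Local Notation nrm := (@nrm R).
Local Notation im := (@im R).
Local Notation re := (@re R).
Local Notation sl := (@sl R g).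
Local Notation ud := (@ud R).
Local Notation Dg := (@Dg R g).
Local Notation dir := ('I_g * bool)%type.
Local Notation smT := (@sm R g setT).
Local Notation mv d v t := (sl d.1 v (ud d.2 * rc t)).
Implicit Types (f h : V -> C) (v : V).

Definition wt v : R := \sum_i cw i * im (v 0 i) ^+ 2.
Definition sz v : R := \sum_i nrm (v 0 i).
(** The polynomial factor lets the bound survive multiplication by Im v_j, which passing from
    covariant to plain derivatives introduces. *)
Definition gb f := exists (K : R) (N : nat), forall v, nrm (f v) <= K * (1 + sz v) ^+ N * expR (wt v).
Fixpoint gr n f := gb f /\ (if n is n'.+1 then forall d : dir, gr n' (pd d f) else True).
Definition Gr f := smT f /\ forall n, gr n f.

Lemma sz_ge0 v : 0 <= sz v. Proof. by apply: sumr_ge0 => i _; exact: nrm_ge0. Qed.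
Lemma sz1 v : 1 <= 1 + sz v. Proof. by rewrite lerDl sz_ge0. Qed.
Lemma gb_nneg f K N : (forall v, nrm (f v) <= K * (1 + sz v) ^+ N * expR (wt v)) -> 0 <= K.
Proof.
move=> /(_ 0) h; have : 0 <= K * ((1 + sz 0) ^+ N * expR (wt 0)).
  by rewrite mulrA (le_trans (nrm_ge0 _) h).
by rewrite pmulr_lge0// mulr_gt0 ?expR_gt0// exprn_gt0// (lt_le_trans ltr01)// sz1.
Qed.
Lemma gbD f h : gb f -> gb h -> gb (fun v => f v + h v).
Proof.
move=> [K [N fK]] [L [M hL]]; have K0 := gb_nneg fK; have L0 := gb_nneg hL.
exists (K + L), (N + M)%N => v; rewrite (le_trans (nrmD _ _))// !mulrDl.
have p1 := exprn_ege1 N (sz1 v); have p2 := exprn_ege1 M (sz1 v).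
have s0 : 0 <= 1 + sz v by rewrite (le_trans ler01)// sz1.
apply: lerD.
  apply: (le_trans (fK v)); rewrite ler_wpM2r ?expR_ge0// ler_wpM2l// exprD.
  by rewrite ler_peMr// exprn_ge0.
apply: (le_trans (hL v)); rewrite ler_wpM2r ?expR_ge0// ler_wpM2l// exprD.
by rewrite ler_peMl// exprn_ge0.
Qed.
Lemma gbZ (a : C) f : gb f -> gb (fun v => a * f v).
Proof.
move=> [K [N fK]]; exists (nrm a * K), N => v.
by rewrite nrmM -!mulrA ler_wpM2l ?nrm_ge0// mulrA.
Qed.
Lemma gb_y j f : gb f -> gb (fun v => rc (im (v 0 j)) * f v).
Proof.
move=> [K [N fK]]; exists K, N.+1 => v; have K0 := gb_nneg fK.
rewrite nrmM nrm_rc exprSr mulrA mulrAC [_ * (1 + _)]mulrC ler_pM ?nrm_ge0//.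
rewrite (le_trans (im_le _))// (le_trans _ (_ : sz v <= _)) ?lerDr//.
rewrite /sz (bigD1 j)//= lerDl; apply: sumr_ge0 => i _; exact: nrm_ge0.
Qed.
Lemma gr_ext n f h : f =1 h -> gr n f -> gr n h.
Proof. by move=> /funext ->. Qed.
Lemma grD n f h : smT f -> smT h -> gr n f -> gr n h -> gr n (fun v => f v + h v).
Proof.
elim: n f h => [|n IH] f h sf sh [gf pf] [gh ph]; split=> //; try exact: gbD.
move=> d; apply: gr_ext (IH _ _ (sm_pd d sf) (sm_pd d sh) (pf d) (ph d)) => v.
by rewrite (pdD d sf sh).
Qed.
Lemma grZ n (a : C) f : smT f -> gr n f -> gr n (fun v => a * f v).
Proof.
elim: n f => [|n IH] f sf [gf pf]; split=> //; try exact: gbZ.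
move=> d; apply: gr_ext (IH _ (sm_pd d sf) (pf d)) => v.
by rewrite (pdZ _ d sf).
Qed.
Lemma gr_mono n f : gr n.+1 f -> gr n f.
Proof.
elim: n f => [|n IH] f [gf pf]; split=> //.
by move=> d; apply: IH; exact: pf.
Qed.
Lemma sm_im j (W : set V) : open W -> sm W (fun v => rc (im (v 0 j))).
Proof.
move=> oW; have s1 := smB oW (sm_co j oW) (sm_conj oW (sm_co j oW)).
by apply: (sm_ext oW) (smZ (2^-1 * - ci) oW s1) => v _; rewrite im_half.
Qed.
Lemma pd_im j d v : cder (curve (fun v => rc (im (v 0 j))) v d) 0 ((d == (j, true))%:R).
Proof.
have : cder (fun t => rc (im (v 0 j)) + (d == (j, true))%:R * rc t) 0 ((d == (j, true))%:R).
  have := cderD (cder_cst (rc (im (v 0 j))) 0) (cderZ (d == (j, true))%:R (cder_rc 0)).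
  by rewrite add0r mulr1.
apply: cder_ext => t; rewrite /curve slE imD rcD; congr (_ + _).
case: d => i b; rewrite xpair_eqE eq_sym /=; case: (j == i); case: b => /=;
  by rewrite ?mul0r ?mul1r ?imM ?re_ci ?im_ci ?re_rc ?im_rc ?im1 ?re1 ?mul0r ?mul1r ?mulr0 ?addr0 ?add0r ?im_rc ?rc0.
Qed.
Lemma gr_y n j f : smT f -> gr n f -> gr n (fun v => rc (im (v 0 j)) * f v).
Proof.
have sy := @sm_im j setT openT.
elim: n f => [|n IH] f sf gf; first by split=> //; apply: gb_y; exact: gf.1.
split; first by apply: gb_y; exact: gf.1.
move=> d; have gf' := gr_mono gf; case: gf => _ pf.
have h1 := grZ (d == (j, true))%:R sf gf'.
have h2 := IH _ (sm_pd d sf) (pf d).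
have oT := @openT V.
apply: gr_ext (grD (smZ _ oT sf) (smM oT sy (sm_pd d sf)) h1 h2) => v.
by rewrite (pdM d sy sf I) (pdP (pd_im j d v)).
Qed.
Lemma Gr_ext f h : f =1 h -> Gr f -> Gr h.
Proof. by move=> /funext ->. Qed.
Lemma Gr_pd d f : Gr f -> Gr (pd d f).
Proof. by move=> [sf gf]; split=> [|n]; [exact: sm_pd|exact: (gf n.+1).2]. Qed.
Lemma GrD f h : Gr f -> Gr h -> Gr (fun v => f v + h v).
Proof. by move=> [sf gf] [sh gh]; split=> [|n]; [apply: smD => //; exact: openT|exact: grD]. Qed.
Lemma GrZ a f : Gr f -> Gr (fun v => a * f v).
Proof. by move=> [sf gf]; split=> [|n]; [apply: smZ => //; exact: openT|exact: grZ]. Qed.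
Lemma GrB f h : Gr f -> Gr h -> Gr (fun v => f v - h v).
Proof.
move=> Gf /(GrZ (-1)) Gh; apply: Gr_ext (GrD Gf Gh) => v.
by rewrite mulN1r.
Qed.
Lemma Gr_Dg e j f : Gr f -> Gr (Dg e j f).
Proof.
move=> Gf; apply: Gr_ext (GrZ 2^-1 (GrD (Gr_pd (j, false) Gf) (GrZ e (Gr_pd (j, true) Gf)))) => v.
by rewrite DgE.
Qed.

Lemma poly_exp_bound (a : R) M : 0 < a ->
  exists B, forall r, 0 <= r -> (1 + r) ^+ M * expR (- (a * r ^+ 2)) <= B.
Proof.
move=> a0; exists ((2 / a) ^+ M * (M%:R ^+ M * expR a)) => r r0.
have u0 : 0 <= a * (1 + r ^+ 2) by rewrite mulr_ge0 ?(ltW a0)// addr_ge0// sqr_ge0.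
have := expR_bound M u0; set u := a * _ => ub.
have h1 : (1 + r) ^+ M <= (2 / a) ^+ M * u ^+ M.
  rewrite -exprMn lerXn2r ?nnegrE ?addr_ge0//.
    by rewrite mulr_ge0// divr_ge0// ltW.
  rewrite (_ : 2 / a * u = 2 * (1 + r ^+ 2)); last by rewrite /u; field; rewrite gt_eqF.
  rewrite -subr_ge0 (_ : _ - _ = (1 - r) ^+ 2 + r + r ^+ 2); last by ring.
  by rewrite !addr_ge0 ?sqr_ge0.
apply: le_trans (ler_wpM2r (expR_ge0 _) h1) _.
rewrite -mulrA ler_wpM2l//; first by rewrite exprn_ge0// divr_ge0// ltW.
apply: le_trans (ler_wpM2r (expR_ge0 _) ub) _.
rewrite -mulrA -expRD (_ : u - _ = a)//.
by rewrite /u; ring.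
Qed.

Section Kernel.
Variable k : 'I_g.
Local Notation c := (cw k).
Hypothesis c0 : c != 0.

Definition cA : R := if 0 <= c then c else 0.
(* The factor exp(Theta) makes z |-> f(v + z e_k) decay like exp(- |c| |z|^2 / 2) when
   |f| <= exp(wt). For c > 0 the |z|^2 term makes [Gk] a right inverse of d/dconj(v_k);
   for c < 0 it is absent, Theta is holomorphic, and [Gk] is a left inverse. *)
Definition Theta (y : R) (z : C) : C :=
  - rc cA * (z * cj z) + (rc (c / 2) * (z * z) + 2 * rc c * ci * rc y * z).
Definition Ek (y : R) (z : C) : C := ex (Theta y z).
Definition Kf f m v z : C := f (sl k v z) * z ^+ m * Ek (im (v 0 k)) z.

(** The reason for the shape of [Theta]: moving by z along the k-th coordinate multiplies exp(wt) by
    exp(c (y + Im z)^2 - c y^2), and the modulus of [Ek] compensates this down to the same Gaussian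
    for both signs of c. *)
Lemma nrm_Ek y z : nrm (Ek y z) * expR (c * (y + im z) ^+ 2) =
  expR (c * y ^+ 2) * expR (- (`|c| / 2 * nrm z ^+ 2)).
Proof.
rewrite /Ek nrm_ex -!expRD sqr_nrm; congr expR; rewrite /Theta !reimE re_conj im_conj /cA.
by case: (ger0P c) => hc; rewrite ?reimE; field.
Qed.
Lemma wt_sl v z : wt (sl k v z) = wt v + (c * (im (v 0 k) + im z) ^+ 2 - c * im (v 0 k) ^+ 2).
Proof.
rewrite /wt (bigD1 k)//= [in RHS](bigD1 k)//= slE eqxx mul1r imD.
rewrite (eq_bigr (fun i => cw i * im (v 0 i) ^+ 2)); first by ring.
by move=> i ik; rewrite slE (negPf ik) mul0r addr0.
Qed.
Lemma sz_sl v z : sz (sl k v z) <= sz v + nrm z.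
Proof.
rewrite /sz (bigD1 k)//= [in leRHS](bigD1 k)//= slE eqxx mul1r.
rewrite (eq_bigr (fun i => nrm (v 0 i))); last by move=> i ik; rewrite slE (negPf ik) mul0r addr0.
by rewrite addrAC lerD2r nrmD.
Qed.

Lemma Kf_le f m v z K N : (forall v, nrm (f v) <= K * (1 + sz v) ^+ N * expR (wt v)) ->
  nrm (Kf f m v z) <= K * (1 + sz v) ^+ N * expR (wt v) *
    ((1 + nrm z) ^+ (N + m) * expR (- (`|c| / 2 * nrm z ^+ 2))).
Proof.
move=> fK; have K0 := gb_nneg fK; have z0 := nrm_ge0 z; have s0 := sz_ge0 v.
rewrite /Kf !nrmM nrmX.
apply: (@le_trans _ _ (K * (1 + sz (sl k v z)) ^+ N * expR (wt (sl k v z)) * nrm z ^+ m * nrm (Ek (im (v 0 k)) z))).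
  by do 2!rewrite ler_wpM2r ?exprn_ge0 ?nrm_ge0//.
have -> : K * (1 + sz (sl k v z)) ^+ N * expR (wt (sl k v z)) * nrm z ^+ m * nrm (Ek (im (v 0 k)) z) =
    K * expR (wt v) * ((1 + sz (sl k v z)) ^+ N * nrm z ^+ m) * expR (- (`|c| / 2 * nrm z ^+ 2)).
  have E := nrm_Ek (im (v 0 k)) z.
  rewrite wt_sl !expRD expRN; move: E; set e1 := expR (c * (_ + _) ^+ 2); set e2 := expR (c * _ ^+ 2) => E.
  have e20 : e2 != 0 by rewrite gt_eqF// expR_gt0.
  transitivity (K * (1 + sz (sl k v z)) ^+ N * expR (wt v) * nrm z ^+ m * e2^-1 * (nrm (Ek (im (v 0 k)) z) * e1)).
    by field.
  by rewrite E; field.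
rewrite exprD !mulrA ler_wpM2r ?expR_ge0//.
rewrite [leRHS](_ : _ = K * expR (wt v) * (((1 + sz v) * (1 + nrm z)) ^+ N * (1 + nrm z) ^+ m)); last first.
  by rewrite exprMn; ring.
rewrite -mulrA ler_wpM2l ?mulr_ge0 ?expR_ge0// ler_pM ?exprn_ge0 ?addr_ge0 ?sz_ge0//.
  rewrite lerXn2r ?nnegrE ?mulr_ge0 ?addr_ge0 ?sz_ge0//.
  rewrite (le_trans (_ : _ <= 1 + (sz v + nrm z)))//; first by rewrite lerD2l sz_sl.
  by rewrite -subr_ge0 (_ : _ - _ = sz v * nrm z) ?mulr_ge0//; ring.
by rewrite lerXn2r ?nnegrE ?addr_ge0// lerDr.
Qed.

Lemma near_bounded v0 : exists S W, forall v, (forall j, nrm (v 0 j - v0 0 j) < 1) -> sz v <= S /\ wt v <= W.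
Proof.
exists (\sum_i (nrm (v0 0 i) + 1)), (\sum_i `|cw i| * (nrm (v0 0 i) + 1) ^+ 2) => v vv.
have nv j : nrm (v 0 j) <= nrm (v0 0 j) + 1.
  by rewrite -{1}[v 0 j](subrK (v0 0 j)) (le_trans (nrmD _ _))// addrC lerD2l ltW.
split; apply: ler_sum => i _ //.
rewrite (le_trans (ler_norm _))// normrM ler_wpM2l// ger0_norm ?sqr_ge0//.
rewrite -[leLHS]real_normK ?num_real// lerXn2r ?nnegrE ?addr_ge0 ?nrm_ge0//.
exact: le_trans (im_le _) (nv i).
Qed.

Lemma Kf_dom f m v0 : gb f -> exists B, \forall v \near nbhs v0, dp (Kf f m v) B.
Proof.
move=> [K [N fK]]; have K0 := gb_nneg fK.
have a0 : 0 < `|c| / 2 by rewrite divr_gt0// normr_gt0.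
have [S [W SW]] := near_bounded v0; have [B BP] := @poly_exp_bound (`|c| / 2) (N + m + 4) a0.
exists (K * (1 + S) ^+ N * expR W * B); apply/nbhsV; exists 1 => // v /SW[vS vW] z.
have q0 : 0 <= 1 + nrm z by rewrite addr_ge0// nrm_ge0.
apply: (le_trans (ler_wpM2r (exprn_ge0 _ q0) (@Kf_le f m v z K N fK))).
rewrite -[leLHS]mulrA; apply: ler_pM.
- by rewrite !mulr_ge0 ?expR_ge0// exprn_ge0// addr_ge0// sz_ge0.
- by rewrite !mulr_ge0 ?expR_ge0// exprn_ge0.
- have S0 : 0 <= S by rewrite (le_trans (sz_ge0 v)).
  apply: ler_pM; rewrite ?expR_ge0 ?mulr_ge0 ?exprn_ge0 ?addr_ge0 ?sz_ge0 ?ler_expR//.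
  by rewrite ler_wpM2l// lerXn2r ?nnegrE ?addr_ge0 ?sz_ge0// lerD2l.
- by rewrite mulrAC -exprD BP// nrm_ge0.
Qed.

Lemma Theta_cont : continuous (fun z : R * C => Theta z.1 z.2).
Proof. by rewrite /Theta; cct. Qed.
Lemma Kf_cont f m : continuous f -> continuous (fun z : V * C => Kf f m z.1 z.2).
Proof.
move=> cf z; apply: for_cont; rewrite /Kf; apply: c_mul; first apply: c_mul.
- by apply: (c_comp cf); apply: c_sl; [exact: cvg_fst|exact: cvg_snd].
- by apply: c_exp; exact: cvg_snd.
- apply: c_ex; apply: (@cvg_via _ _ _ _ (fun z : V * C => (im (z.1 0 k), z.2))
    (fun z : R * C => Theta z.1 z.2) (im (z.1 0 k), z.2)); last exact: (@Theta_cont (im (z.1 0 k), z.2)).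
  by apply: c_pair; [apply: cvg_im; apply: v_entry; exact: cvg_fst|exact: cvg_snd].
Qed.
Lemma Kf_DP f m : Gr f -> DP (Kf f m).
Proof.
move=> [sf gf]; split=> [z|]; first exact: (@Kf_cont f m (smT_cont sf) z).
by move=> v; apply: Kf_dom; exact: (gf 0%N).1.
Qed.
Lemma Kf_DP1 f m v : Gr f -> DP1 (Kf f m v).
Proof. by move=> Gf; exact: DP_DP1 (Kf_DP m Gf). Qed.

(** With the angle counted in turns, dA = 2 pi r dr dt, so [T1 p] is 1 / (2 pi) times the integral
    of p(z) / z dA, and the factor - 2 gives the usual - 1 / pi of the Cauchy transform. The
    exponent m counts the powers of z that come from differentiating [Ek] in y. *)
Definition Gk f m v : C := - 2 * T1 (Kf f m v).

Lemma GkD f h m v : Gr f -> Gr h -> Gk (fun v => f v + h v) m v = Gk f m v + Gk h m v.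
Proof.
move=> Gf Gh; rewrite /Gk -mulrDr -(T1D (Kf_DP1 m v Gf) (Kf_DP1 m v Gh)).
by congr (_ * _); apply: eq_T1 => z; rewrite /Kf; ring.
Qed.
Lemma GkZ (a : C) f m v : Gr f -> Gk (fun v => a * f v) m v = a * Gk f m v.
Proof.
move=> Gf; rewrite /Gk mulrCA -(T1Z a (Kf_DP1 m v Gf)).
by congr (_ * _); apply: eq_T1 => z; rewrite /Kf; ring.
Qed.
Lemma Gk_cont f m : Gr f -> continuous (Gk f m).
Proof.
move=> Gf v; apply: for_cont; apply: c_mul; first exact: c_cst.
exact: (@T1_cont _ _ _ (Kf_DP m Gf) v).
Qed.
Lemma eq_Gk f h m v : (forall z, f (sl k v z) = h (sl k v z)) -> Gk f m v = Gk h m v.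
Proof. by move=> fh; congr (_ * _); apply: eq_T1 => z; rewrite /Kf fh. Qed.

Lemma cder_Ek z y (de : R) x : cder (fun x => Ek (y + de * x) z) x
  (2 * rc c * ci * z * rc de * Ek (y + de * x) z).
Proof.
rewrite /Ek /Theta.
have H : cder (fun x => - rc cA * (z * cj z) + (rc (c / 2) * (z * z) + 2 * rc c * ci * rc (y + de * x) * z)) x
   (2 * rc c * ci * z * rc de).
  have d1 := cderD (cder_cst (rc y) x) (cderZ (rc de) (cder_rc x)).
  have d2 := cderM (cderZ (2 * rc c * ci) d1) (cder_cst z x).
  have d3 := cderD (cder_cst (- rc cA * (z * cj z)) x) (cderD (cder_cst (rc (c / 2) * (z * z)) x) d2).
  apply: cder_eq (cder_ext _ d3) _; last by ring.
  by move=> t; have -> : rc (y + de * t) = rc y + rc de * rc t by rewrite rcD rcM.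
exact: (cder_eq (cder_comp H (xder_ex _)) (mulrC _ _)).
Qed.

Lemma DP_comp (X Y : topologicalType) (p : X -> C -> C) (u : Y -> X) :
  continuous u -> DP p -> DP (fun y => p (u y)).
Proof.
move=> cu [cp bp]; split.
  move=> z; apply: for_cont; apply: (@cvg_via _ _ _ _ (fun z : Y * C => (u z.1, z.2))
    (fun z : X * C => p z.1 z.2) (u z.1, z.2)); last exact: (cp (u z.1, z.2)).
  apply: c_pair; last exact: cvg_snd.
  by apply: (@cvg_via _ _ _ _ fst u z.1); [exact: cvg_fst|exact: cu].
by move=> y; have [B nB] := bp (u y); exists B; exact: (cu y _ nB).
Qed.
Lemma DPD (X : topologicalType) (p q : X -> C -> C) : DP p -> DP q -> DP (fun x z => p x z + q x z).
Proof.
move=> [cp bp] [cq bq]; split.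
  by move=> z; apply: for_cont; apply: c_add; [exact: cp|exact: cq].
move=> x; have [B nB] := bp x; have [D nD] := bq x; exists (B + D).
apply: filterS2 nB nD => y yB yD z; apply: le_trans (lerD (yB z) (yD z)).
by rewrite -mulrDl ler_wpM2r ?nrmD// exprn_ge0// addr_ge0// nrm_ge0.
Qed.
Lemma DPZ (X : topologicalType) (a : C) (p : X -> C -> C) : DP p -> DP (fun x z => a * p x z).
Proof.
move=> [cp bp]; split.
  by move=> z; apply: for_cont; apply: c_mul; [exact: c_cst|exact: cp].
move=> x; have [B nB] := bp x; exists (nrm a * B); apply: filterS nB => y yB z.
by rewrite nrmM -mulrA ler_wpM2l ?nrm_ge0//.
Qed.

Definition ydir (d : dir) : R := (d == (k, true))%:R.

Lemma im_mv d v (t : R) : im ((mv d v t) 0 k) = im (v 0 k) + ydir d * t.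
Proof.
rewrite slE imD /ydir; congr (_ + _).
case: d => i b; rewrite xpair_eqE eq_sym /=; case: (i == k); case: b => /=;
  by rewrite ?mul0r ?mul1r ?imM ?re_ci ?im_ci ?re_rc ?im_rc ?im1 ?re1 ?mul0r ?mul1r ?mulr0 ?addr0 ?add0r.
Qed.

(** A displacement of v moves f and also the parameter y = Im v_k of the kernel. The latter happens
    only in the direction (k, true) and brings down the factor 2 i c z, hence the term with m +
    1. *)
Lemma Gk_pd f m d v : Gr f ->
  cder (curve (Gk f m) v d) 0 (Gk (pd d f) m v + 2 * rc c * ci * rc (ydir d) * Gk f m.+1 v).
Proof.
move=> Gf; have cm : continuous (fun t : R => mv d v t) by cct; apply: c_sl; ct.
have Gp := Gr_pd d Gf.
pose a := 2 * rc c * ci * rc (ydir d).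
have P0 := DP_comp cm (Kf_DP m Gf).
have P1 := DPD (DP_comp cm (Kf_DP m Gp)) (DPZ a (DP_comp cm (Kf_DP m.+1 Gf))).
have := T1_cder P0 P1 => /(_ _)/(cderZ (- 2)) H; apply: cder_eq (H _) _.
  move=> x z; rewrite /Kf.
  have d1 := pd_curve d (sl k v z) x Gf.1; have d2 := cder_Ek z (im (v 0 k)) (ydir d) x.
  have := cderM (cderM d1 (cder_cst (z ^+ m) x)) d2.
  rewrite !im_mv; rewrite -!(slC d.1) => d3; apply: cder_eq (cder_ext _ d3) _.
    by move=> t; rewrite /curve im_mv slC.
  by rewrite exprS /curve /a; ring.
rewrite rc0 mulr0 sl0 /Gk (T1D (Kf_DP1 m v Gp) (DP1Z a (Kf_DP1 m.+1 v Gf))).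
by rewrite (T1Z a (Kf_DP1 m.+1 v Gf)) /a; ring.
Qed.

Lemma Gk_sm f m : Gr f -> smT (Gk f m).
Proof.
move=> Gf; have oT := @openT V.
suff H n : forall f m, Gr f -> sn n setT (Gk f m) by move=> n; exact: H.
elim: n => [|n IH] {}f {}m {}Gf; first by move=> v _; apply: smo_0; exact: Gk_cont.
apply: (@sn_step _ _ _ _ _ (fun d v => Gk (pd d f) m v + 2 * rc c * ci * rc (ydir d) * Gk f m.+1 v)) => //.
- by move=> v _; exact: Gk_cont.
- by move=> d v _; exact: Gk_pd.
- move=> d; apply: snD => //; first by apply: IH; exact: Gr_pd.
  by apply: snM => //; [move=> v _; exact: (sm_cst _ oT)|exact: IH].
Qed.

Lemma Dg_Gk e j f m v : Gr f ->
  Dg e j (Gk f m) v = Gk (Dg e j f) m v + (j == k)%:R * (e * ci * rc c) * Gk f m.+1 v.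
Proof.
move=> Gf; rewrite DgE (pdP (Gk_pd m (j, false) v Gf)) (pdP (Gk_pd m (j, true) v Gf)).
have -> : Gk (Dg e j f) m v = 2^-1 * (Gk (pd (j, false) f) m v + e * Gk (pd (j, true) f) m v).
  have G1 := Gr_pd (j, false) Gf; have G2 := Gr_pd (j, true) Gf.
  rewrite -GkZ// -GkD//; last exact: GrZ.
  by rewrite -GkZ; [apply: eq_Gk => z; rewrite DgE|exact: GrD G1 (GrZ e G2)].
by rewrite /ydir !xpair_eqE andbF andbT rc0; case: (j == k) => /=; rewrite ?rc1 ?rc0; field.
Qed.

(* Functions of one complex variable with their d/dconj(z) and d/dz. *)
Definition plz (p be de : C -> C) := pl p (fun z => be z + de z) (fun z => - ci * (be z - de z)).
Lemma zb_plz (be de : C -> C) z : zb (fun z => be z + de z) (fun z => - ci * (be z - de z)) z = be z.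
Proof.
rewrite /zb; transitivity (2^-1 * (be z + de z - ci * ci * (be z - de z))); first by ring.
by rewrite ciM; field.
Qed.
Lemma zd_plz (be de : C -> C) z : zd (fun z => be z + de z) (fun z => - ci * (be z - de z)) z = de z.
Proof.
rewrite /zd; transitivity (2^-1 * (be z + de z + ci * ci * (be z - de z))); first by ring.
by rewrite ciM; field.
Qed.
Lemma pl_eq p a b a' b' : a =1 a' -> b =1 b' -> pl p a b -> @pl R p a' b'.
Proof. by move=> /funext -> /funext ->. Qed.
Lemma plz_of p a b : pl p a b -> plz p (zb a b) (zd a b).
Proof.
apply: pl_eq => z; rewrite /zb /zd; first by field.
transitivity (- (ci * ci) * b z); last by field.
by rewrite ciM; ring.
Qed.
Lemma plz_eq p be de be' de' : be =1 be' -> de =1 de' -> plz p be de -> plz p be' de'.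
Proof. by move=> /funext -> /funext ->. Qed.
Lemma plzM p q be de be' de' : continuous p -> continuous q -> plz p be de -> plz q be' de' ->
  plz (fun z => p z * q z) (fun z => be z * q z + p z * be' z) (fun z => de z * q z + p z * de' z).
Proof. by move=> cp cq h1 h2; apply: pl_eq (plM cp cq h1 h2) => z; ring. Qed.
Lemma plzD p q be de be' de' : plz p be de -> plz q be' de' ->
  plz (fun z => p z + q z) (fun z => be z + be' z) (fun z => de z + de' z).
Proof.
move=> [ca cb da db] [ca' cb' da' db']; split.
- by move=> z; apply: for_cont; apply: (@cvg_near_eq _ _ _ _ (fun z => (be z + de z) + (be' z + de' z)));
    [apply: nearW => x; ring|rewrite (_ : _ + _ + _ = (be z + de z) + (be' z + de' z)); [apply: c_add; [exact: ca|exact: ca']|ring]].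
- by move=> z; apply: for_cont; apply: (@cvg_near_eq _ _ _ _ (fun z => - ci * (be z - de z) + - ci * (be' z - de' z)));
    [apply: nearW => x; ring|rewrite (_ : - ci * _ = - ci * (be z - de z) + - ci * (be' z - de' z)); [apply: c_add; [exact: cb|exact: cb']|ring]].
- by move=> z; apply: cder_eq (cderD (da z) (da' z)) _; ring.
- by move=> z; apply: cder_eq (cderD (db z) (db' z)) _; ring.
Qed.
Lemma plz_cst (a : C) : plz (fun=> a) (fun=> 0) (fun=> 0).
Proof.
split; [by cct|by cct| |] => z.
  by apply: cder_eq (cder_cst _ _) _; rewrite addr0.
by apply: cder_eq (cder_cst _ _) _; rewrite subr0 mulr0.
Qed.
Lemma plz_id : plz id (fun=> 0) (fun=> 1).
Proof.
have c1 : continuous (fun _ : C => 1 : C) by cct.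
by apply: pl_eq (pl_x c1 (@xder_id R)) => z; ring.
Qed.
Lemma plz_cj : plz (@cj R) (fun=> 1) (fun=> 0).
Proof. by apply: pl_eq (pl_cj R) => z; ring. Qed.
Lemma plz_ex p be de : continuous p -> plz p be de ->
  plz (fun z => ex (p z)) (fun z => be z * ex (p z)) (fun z => de z * ex (p z)).
Proof.
move=> cp [ca cb da db].
have ce : continuous (fun z => ex (p z)) by exact: cont_comp (@ex_cont R) cp.
split.
- move=> z; apply: for_cont; apply: (@cvg_near_eq _ _ _ _ (fun z => (be z + de z) * ex (p z))).
    by apply: nearW => x; ring.
  by rewrite -mulrDl; apply: c_mul; [exact: ca|exact: ce].
- move=> z; apply: for_cont; apply: (@cvg_near_eq _ _ _ _ (fun z => - ci * (be z - de z) * ex (p z))).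
    by apply: nearW => x; ring.
  rewrite (_ : - ci * _ = - ci * (be z - de z) * ex (p z)); last by ring.
  by apply: c_mul; [exact: cb|exact: ce].
- move=> z; apply: cder_eq (cder_comp (da z) (xder_ex _)) _.
  by rewrite rc0 addr0; ring.
- move=> z; apply: cder_eq (cder_comp (db z) (xder_ex _)) _.
  by rewrite rc0 mulr0 addr0; ring.
Qed.

Lemma plz_Ek y : plz (Ek y) (fun z => - rc cA * z * Ek y z)
  (fun z => (- rc cA * cj z + rc c * z + 2 * rc c * ci * rc y) * Ek y z).
Proof.
have ci' : continuous (id : C -> C) by cct.
have cc : continuous (@cj R) := @conj_cont R.
have ck (a : C) : continuous (fun _ : C => a) by cct.
have c2 : continuous (fun z : C => z * cj z) by cct.
have c3 : continuous (fun z : C => z * z) by cct.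
have h1 := plzM (ck (- rc cA)) c2 (plz_cst _) (plzM ci' cc plz_id plz_cj).
have h2 := plzM (ck (rc (c / 2))) c3 (plz_cst _) (plzM ci' ci' plz_id plz_id).
have h3 := plzM (ck (2 * rc c * ci * rc y)) ci' (plz_cst _) plz_id.
have cT : continuous (Theta y) by rewrite /Theta; cct.
have two : rc (c / 2) = rc c / 2 by rewrite rcM rcV rc_nat.
apply: plz_eq (plz_ex cT (plzD h1 (plzD h2 h3))) => z; rewrite /Ek; congr (_ * _); first by ring.
by rewrite two; field.
Qed.

Lemma slice_plz f v : smT f -> plz (fun z => f (sl k v z)) (fun z => Dg ci k f (sl k v z))
  (fun z => Dg (- ci) k f (sl k v z)).
Proof.
move=> sf; apply: plz_eq (plz_of (slice_pl k v sf)) => z; rewrite /zb /zd DgE//.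
by rewrite mulNr.
Qed.

Lemma Kf_plz f v : smT f -> plz (Kf f 0 v)
  (fun z => Kf (Dg ci k f) 0 v z + - rc cA * Kf f 1 v z)
  (fun z => Kf (Dg (- ci) k f) 0 v z +
     (- rc cA * cj z + rc c * z + 2 * rc c * ci * rc (im (v 0 k))) * Kf f 0 v z).
Proof.
move=> sf; have cT y : continuous (Theta y) by rewrite /Theta; cct.
have cE : continuous (Ek (im (v 0 k))) := cont_comp (@ex_cont R) (cT _).
have cs : continuous (fun z => f (sl k v z)).
  by move=> z; apply: for_cont; apply: (c_comp (smT_cont sf)); apply: c_sl; ct.
have P := plzM cs cE (slice_plz v sf) (plz_Ek (im (v 0 k))).
have E : (fun z => f (sl k v z) * Ek (im (v 0 k)) z) = Kf f 0 v.
  by apply/funext => z; rewrite /Kf expr0 mulr1.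
rewrite E in P; apply: plz_eq P => z; rewrite /Kf !expr0 ?expr1; ring.
Qed.

Lemma Kf1 f m v z : z * Kf f m v z = Kf f m.+1 v z.
Proof. by rewrite /Kf exprS; ring. Qed.

(** Cauchy-Pompeiu for z |-> [Kf f 0 v z], whose value at 0 is f v. The second term comes from
    d/dconj(z) of [Theta], and disappears for c < 0. *)
Lemma Gk_dbar f v : Gr f -> Gk (Dg ci k f) 0 v = f v + rc cA * Gk f 1 v.
Proof.
move=> Gf; have GD := Gr_Dg ci k Gf.
have h1 := Kf_DP1 0 v GD; have h2 := DP1Z (- rc cA) (Kf_DP1 1 v Gf).
have P := Kf_plz v Gf.1.
have zbE := funext (zb_plz (fun z => Kf (Dg ci k f) 0 v z + - rc cA * Kf f 1 v z)
  (fun z => Kf (Dg (- ci) k f) 0 v z +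
     (- rc cA * cj z + rc c * z + 2 * rc c * ci * rc (im (v 0 k))) * Kf f 0 v z)).
have := pompeiu P (Kf_DP1 0 v Gf); rewrite zbE => /(_ (DP1D h1 h2)).
rewrite (T1D h1 h2) (T1Z _ (Kf_DP1 1 v Gf)) {3}/Kf sl0 expr0 mulr1 /Gk => H.
have E0 : Ek (im (v 0 k)) 0 = 1 by rewrite /Ek /Theta !(mul0r, mulr0, addr0) ex0.
rewrite E0 mulr1 in H.
have -> : T1 (Kf (Dg ci k f) 0 v) = - (2^-1 * f v) + rc cA * T1 (Kf f 1 v).
  by rewrite -H; ring.
by field.
Qed.

Section Negative.
Hypothesis cneg : c < 0.
Lemma cA_neg : cA = 0. Proof. by rewrite /cA ifN// -ltNge. Qed.

Lemma Kf_plz_neg f v : smT f -> plz (Kf f 0 v) (fun z => Kf (Dg ci k f) 0 v z)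
  (fun z => Kf (Dg (- ci) k f) 0 v z + (rc c * z + 2 * rc c * ci * rc (im (v 0 k))) * Kf f 0 v z).
Proof.
move=> sf; apply: plz_eq (Kf_plz v sf) => z; rewrite cA_neg rc0; ring.
Qed.

(** The integral of d/dz ([Kf f 0 v]) over the plane is 0 by [pompeiu_d]. Expanded and combined with
    [Dg_Gk], this says that the covariant derivative d/dv_k + 2 i c Im v_k kills [Gk f 1]. *)
Lemma Gk_cov f v : Gr f ->
  Gk (Dg (- ci) k f) 1 v + rc c * Gk f 2 v + 2 * rc c * ci * rc (im (v 0 k)) * Gk f 1 v = 0.
Proof.
move=> Gf; have GD := Gr_Dg (- ci) k Gf.
set y := 2 * rc c * ci * rc (im (v 0 k)).
have P := Kf_plz_neg v Gf.1.
have zdE := zd_plz (fun z => Kf (Dg ci k f) 0 v z)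
  (fun z => Kf (Dg (- ci) k f) 0 v z + (rc c * z + y) * Kf f 0 v z).
have h1 := Kf_DP1 1 v GD; have h2 := DP1Z (rc c) (Kf_DP1 2 v Gf); have h3 := DP1Z y (Kf_DP1 1 v Gf).
have E : (fun z => z * zd (fun z => Kf (Dg ci k f) 0 v z + (Kf (Dg (- ci) k f) 0 v z + (rc c * z + y) * Kf f 0 v z))
    (fun z => - ci * (Kf (Dg ci k f) 0 v z - (Kf (Dg (- ci) k f) 0 v z + (rc c * z + y) * Kf f 0 v z))) z) =
  (fun z => (Kf (Dg (- ci) k f) 1 v z + rc c * Kf f 2 v z) + y * Kf f 1 v z).
  by apply/funext => z; rewrite zdE -!Kf1; ring.
have cK := (Kf_DP1 0 v Gf).1.
have := pompeiu_d P cK; rewrite E => H.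
have {}H := H _ (DP1D (DP1D h1 h2) h3).
rewrite (T1D (DP1D h1 h2) h3) (T1D h1 h2) (T1Z _ (Kf_DP1 2 v Gf)) (T1Z _ (Kf_DP1 1 v Gf)) in H.
rewrite /Gk -/y; transitivity (- 2 * (T1 (Kf (Dg (- ci) k f) 1 v) + rc c * T1 (Kf f 2 v) + y * T1 (Kf f 1 v))).
  by ring.
rewrite H; first by rewrite mulr0.
have [cK1 [B KB]] := Kf_DP1 1 v Gf; split.
  by move=> z; apply: for_cont; apply: c_mul; [exact: conj_cont|exact: cK].
by exists B => z; have := KB z; rewrite -Kf1 !nrmM nrm_conj.
Qed.

(** If the covariant derivative kills f on the slice, then p = [Kf f 0 v] satisfies dp/dz = c
    conj(z) p, so all the circle means in its Cauchy transform vanish by [circle_zero]. *)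
Lemma Gk_cov0 f v : Gr f ->
  (forall z, Dg (- ci) k f (sl k v z) + 2 * rc c * ci * rc (im (sl k v z 0 k)) * f (sl k v z) = 0) ->
  Gk f 0 v = 0.
Proof.
move=> Gf Af; rewrite /Gk (T1_zero _ (Kf_DP1 0 v Gf)) ?mulr0// => r.
apply: (circle_zero (c := c) (Kf_plz_neg v Gf.1) (Kf_DP1 0 v Gf).1) => z.
rewrite zd_plz.
have Df : Dg (- ci) k f (sl k v z) = - (2 * rc c * ci * rc (im (sl k v z 0 k)) * f (sl k v z)).
  by apply/eqP; rewrite -addr_eq0 Af.
rewrite {1}/Kf Df slE eqxx mul1r imD rcD /Kf (im_half z).
transitivity ((rc c * cj z + (rc c * (z - cj z)) * (1 + ci * ci)) * (f (sl k v z) * z ^+ 0 * Ek (im (v 0 k)) z)).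
  by field.
by rewrite ciM subrr mulr0 addr0.
Qed.

End Negative.

(* Translation by a lattice vector: the exponential factors cancel. *)
Lemma Gk_trans f m v lam (ka : C) : Gr f ->
  (forall v, f (v + lam) = ka * ex (- (2 * ci * \sum_i rc (cw i) * rc (im (lam 0 i)) * v 0 i)) * f v) ->
  Gk f m (v + lam) = ka * ex (- (2 * ci * \sum_i rc (cw i) * rc (im (lam 0 i)) * v 0 i)) * Gk f m v.
Proof.
move=> Gf qf; rewrite /Gk mulrCA -(T1Z _ (Kf_DP1 m v Gf)); congr (_ * _); apply: eq_T1 => z.
rewrite /Kf sl_add qf mxE imD.
have -> : \sum_i rc (cw i) * rc (im (lam 0 i)) * (sl k v z) 0 i =
    \sum_i rc (cw i) * rc (im (lam 0 i)) * v 0 i + rc c * rc (im (lam 0 k)) * z.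
  rewrite (bigD1 k)//= [in RHS](bigD1 k)//= slE eqxx mul1r.
  rewrite (eq_bigr (fun i => rc (cw i) * rc (im (lam 0 i)) * v 0 i)); first by ring.
  by move=> i ik; rewrite slE (negPf ik) mul0r addr0.
set S := \sum_i _; rewrite mulrDr opprD exD.
have -> : Ek (im (v 0 k) + im (lam 0 k)) z = ex (2 * ci * (rc c * rc (im (lam 0 k)) * z)) * Ek (im (v 0 k)) z.
  by rewrite /Ek -exD; congr ex; rewrite /Theta rcD; ring.
set T := 2 * ci * (_ * z); have n0 := ex_neq0 T; rewrite (exN T).
by field.
Qed.

End Kernel.
End Green.

(** * Comparison with Gaussian integrals, and derivative bounds from circles *)

Section Radial.
Variable R : realType.
Local Notation C := (Cplx R).
Local Notation rc := (@rc R).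
Local Notation nrm := (@nrm R).
Local Notation re := (@re R).

(** The norm is moved inside both integrals. The majorant is taken of the form u times a radial
    function, so that u^-1 p0 is real and its transform can be computed by [T1_gauss]. *)
Lemma T1_le (p p0 : C -> C) : DP1 p -> DP1 p0 ->
  (forall r t, 0 <= r -> nrm (p (rc r * un t)) <= re ((un t)^-1 * p0 (rc r * un t))) ->
  nrm (T1 p) <= re (T1 p0).
Proof.
move=> Pp P0 H; rewrite /T1 re_J.
apply: (nrm_J (tinJ_cont1 Pp) (cre (tinJ_cont1 P0))) => s /andP[s0 _].
rewrite re_J; apply: (nrm_J (tin_cont1 Pp) (cre (tin_cont1 P0))) => t _.
rewrite /tin; case: ifP => s1; last by rewrite nrm0 re0.
have d0 : 0 <= (1 - s)^-1 ^+ 2 by exact: sqr_ge0.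
rewrite nrmM nrm_rc (ger0_norm d0) nrmM nrmV nrm_un invr1 mul1r.
rewrite reM re_rc im_rc mulr0 subr0 ler_wpM2r//.
exact: H (rr_ge0 s0 s1).
Qed.

Lemma gauss_DP1 (a K : R) (q : C -> C) : 0 < a -> continuous q ->
  (forall z, nrm (q z) <= K * (1 + nrm z) ^+ 3) -> DP1 (fun z => ex (- rc a * (z * cj z)) * q z).
Proof.
move=> a0 cq qK; have [B HB] := poly_exp_bound 7 a0.
have K0 : 0 <= K.
  by have := qK 0; rewrite nrm0 addr0 expr1n mulr1; apply: le_trans; exact: nrm_ge0.
split.
  move=> z; apply: for_cont; apply: c_mul; last exact: cq.
  apply: c_ex; apply: c_mul; first exact: c_cst.
  by apply: c_mul; [exact: cvg_id|apply: cvg_conj; exact: cvg_id].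
exists (K * B) => z; rewrite nrmM mul_conj -rcN -rcM ex_rc nrm_rc ger0_norm ?expR_ge0//.
apply: (@le_trans _ _ (K * ((1 + nrm z) ^+ 7 * expR (- (a * nrm z ^+ 2))))); last first.
  by rewrite ler_wpM2l// HB// nrm_ge0.
rewrite mulNr (_ : (1 + nrm z) ^+ 7 = (1 + nrm z) ^+ 3 * (1 + nrm z) ^+ 4); last by rewrite -exprD.
rewrite (_ : K * _ = expR (- (a * nrm z ^+ 2)) * (K * (1 + nrm z) ^+ 3) * (1 + nrm z) ^+ 4); last by ring.
by rewrite ler_wpM2r ?exprn_ge0 ?addr_ge0 ?nrm_ge0// ler_wpM2l ?expR_ge0.
Qed.
Lemma q_bound (A B : R) (z : C) (n : nat) : (n <= 1)%N ->
  nrm (z ^+ n * (rc A + rc B * (z * cj z))) <= (`|A| + `|B|) * (1 + nrm z) ^+ 3.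
Proof.
move=> n1; have z0 := nrm_ge0 z.
have h1 : nrm z ^+ n <= 1 + nrm z.
  by case: n n1 => [|[]]// _; rewrite ?expr0 ?expr1 ?lerDl ?lerDr.
have h2 : nrm (rc A + rc B * (z * cj z)) <= (`|A| + `|B|) * (1 + nrm z) ^+ 2.
  apply: le_trans (nrmD _ _) _; rewrite nrmM !nrm_rc mul_conj nrm_rc [`|_ ^+ 2|]ger0_norm ?sqr_ge0// mulrDl lerD//.
    by rewrite ler_peMr// -[1 + _]addr0 exprn_ege1// addr0 lerDl.
  by rewrite ler_wpM2l// lerXn2r ?nnegrE ?addr_ge0// lerDr.
rewrite nrmM nrmX (_ : _ * (1 + nrm z) ^+ 3 = (1 + nrm z) * ((`|A| + `|B|) * (1 + nrm z) ^+ 2)); last by ring.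
by apply: ler_pM => //; rewrite ?exprn_ge0 ?nrm_ge0.
Qed.
Lemma q_cont (A B : R) n : continuous (fun z : C => z ^+ n * (rc A + rc B * (z * cj z))).
Proof.
move=> z; apply: for_cont; apply: c_mul; first by apply: c_exp; exact: cvg_id.
apply: c_add; first exact: c_cst.
apply: c_mul; first exact: c_cst.
by apply: c_mul; [exact: cvg_id|apply: cvg_conj; exact: cvg_id].
Qed.
Definition gauss (a A B : R) (n : nat) (z : C) : C :=
  ex (- rc a * (z * cj z)) * (z ^+ n * (rc A + rc B * (z * cj z))).
Lemma DP1_gauss a A B n : 0 < a -> (n <= 1)%N -> DP1 (gauss a A B n).
Proof.
by move=> a0 n1; exact: (gauss_DP1 a0 (@q_cont A B n) (fun z => q_bound A B z n1)).
Qed.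
Lemma T1_gauss (a A B : R) : 0 < a -> T1 (gauss a A B 1) = rc (A / (2 * a) + B / (2 * a ^+ 2)).
Proof.
(* These make exp(- a |z|^2) (al + be |z|^2) a function whose d/dconj(z) is - 1/2 of the integrand;
   by [pompeiu] the answer is its value al at 0. *)
move=> a0; pose be := B / (2 * a); pose al := A / (2 * a) + B / (2 * a ^+ 2).
have an : a != 0 by rewrite gt_eqF.
have P1 : plz (fun z : C => - rc a * (z * cj z)) (fun z => - rc a * z) (fun z => - rc a * cj z).
  apply: plz_eq (plzM _ _ (plz_cst (- rc a)) (plzM _ _ (@plz_id R) (@plz_cj R))).
  - by move=> z; ring.
  - by move=> z; ring.
  - by move=> z; apply: for_cont; exact: c_cst.
  - move=> z; apply: for_cont; apply: c_mul; first exact: cvg_id.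
    by apply: cvg_conj; exact: cvg_id.
  - by move=> z; apply: for_cont; exact: cvg_id.
  - by move=> z; apply: for_cont; apply: cvg_conj; exact: cvg_id.
have c1 : continuous (fun z : C => - rc a * (z * cj z)).
  move=> z; apply: for_cont; apply: c_mul; first exact: c_cst.
  by apply: c_mul; [exact: cvg_id|apply: cvg_conj; exact: cvg_id].
have P2 : plz (fun z : C => z ^+ 0 * (rc al + rc be * (z * cj z))) (fun z => rc be * z) (fun z => rc be * cj z).
  have h : plz (fun z : C => rc al + rc be * (z * cj z)) (fun z => rc be * z) (fun z => rc be * cj z).
    have cz : continuous (fun z : C => z * cj z).
      move=> z; apply: for_cont; apply: c_mul; first exact: cvg_id.
      by apply: cvg_conj; exact: cvg_id.
    apply: plz_eq (plzD (plz_cst (rc al)) (plzM _ cz (plz_cst (rc be)) (plzM _ _ (@plz_id R) (@plz_cj R)))).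
    - by move=> z; ring.
    - by move=> z; ring.
    - by move=> z; apply: for_cont; exact: c_cst.
    - by move=> z; apply: for_cont; exact: cvg_id.
    - by move=> z; apply: for_cont; apply: cvg_conj; exact: cvg_id.
  by rewrite (_ : (fun z : C => z ^+ 0 * _) = (fun z : C => rc al + rc be * (z * cj z)))//; apply/funext => z; rewrite expr0 mul1r.
have ce : continuous (fun z : C => ex (- rc a * (z * cj z))).
  by move=> z; apply: for_cont; apply: c_ex; exact: c1.
have bE z : - rc a * z * ex (- rc a * (z * cj z)) * (z ^+ 0 * (rc al + rc be * (z * cj z))) +
    ex (- rc a * (z * cj z)) * (rc be * z) = - 2^-1 * gauss a A B 1 z.
  rewrite /gauss expr0 expr1 mul1r /al /be !(rcD, rcM, rcV, rcX, rc_nat).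
  have a' : rc a != 0 by rewrite rc_eq0.
  by field.
have P3 := plz_eq bE (fun _ => erefl) (plzM ce (@q_cont al be 0) (plz_ex c1 P1) P2).
have := pompeiu P3 (DP1_gauss al be a0 (isT : (0 <= 1)%N)).
set zz := zb _ _; have zE : zz = (fun z => - 2^-1 * gauss a A B 1 z).
  by apply/funext => z; rewrite /zz zb_plz.
rewrite zE => /(_ (DP1Z _ (DP1_gauss A B a0 (isT : (1 <= 1)%N)))).
rewrite (T1Z _ (DP1_gauss A B a0 _))// mul0r !mulr0 ex0 expr0 addr0 !mul1r mulNr => /oppr_inj.
by apply: mulfI; rewrite invr_eq0 pnatr_eq0.
Qed.

Lemma plz_xder (p be de : C -> C) z : plz p be de -> (forall z, be z = 0) -> xder p z (de z).
Proof.
move=> P b0; have [ca cb _ _] := P.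
have cd : continuous de.
  by move=> w; have := ca w; rewrite (_ : (fun z => be z + de z) = de)//; apply/funext => u; rewrite b0 add0r.
exists (fun h => J (fun t => de (z + h * rc t))); split.
- apply: (@J_cont_at R C (fun (h : C) t => de (z + h * rc t)) 0).
    apply: nearW => h t; apply: for_cont; apply: cvg_via (cd _).
    by apply: c_add; [exact: c_cst|apply: c_mul; [exact: c_cst|apply: cvg_rc; exact: cvg_id]].
  move=> s _; apply: cvg_via (cd _).
  apply: c_add; first exact: c_cst.
  by apply: c_mul; [exact: cvg_fst|apply: cvg_rc; exact: cvg_snd].
- rewrite (_ : (fun t => _) = fun=> de z) ?J_cst//; by apply/funext => t; rewrite mul0r addr0.
- move=> h; have cdh : continuous (fun t => de (z + h * rc t)).
    move=> t; apply: for_cont; apply: cvg_via (cd _).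
    by apply: c_add; [exact: c_cst|apply: c_mul; [exact: c_cst|apply: cvg_rc; exact: cvg_id]].
  rewrite -JZ// (J_FTC (F := fun t => p (z + h * rc t))) => [||t _].
  + by rewrite rc1 rc0 mulr1 mulr0 addr0 [RHS]addrC subrK.
  + by move=> t; apply: for_cont; apply: c_mul; [exact: c_cst|exact: cdh].
  have dc : cder (fun t => z + h * rc t) t h.
    apply: cder_eq (cderD (cder_cst z t) (cderZ h (cder_rc t))) _; by rewrite add0r mulr1.
  apply: cder_eq (pl_chain P dc) _; rewrite /= b0 add0r sub0r.
  by transitivity ((rc (re h) + ci * rc (im h)) * de (z + h * rc t)); [ring|rewrite -cE].
Qed.
Lemma hol_deriv_le (p be de : C -> C) (M : R) : plz p be de -> (forall z, be z = 0) ->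
  (forall z, nrm z = 1 -> nrm (p z) <= M) -> nrm (de 0) <= M.
Proof.
move=> P b0 pM; have X z := plz_xder z P b0.
have cp : continuous p by move=> z; exact: xder_cont (X z).
rewrite (deriv_mean cp (fun z _ => ex_intro _ _ (X z)) (X 0) ltr01 (ltr1n R 2)).
rewrite rc1 invr1 mul1r; apply: nrm_J_le => [t|t _].
  apply: for_cont; apply: c_mul; last exact: unV_cont.
  by apply: cvg_via (cp _); apply: c_mul; [exact: c_cst|apply: c_un; exact: cvg_id].
by rewrite nrmM nrmV nrm_un invr1 mulr1 mul1r pM// nrm_un.
Qed.
Lemma antihol_deriv_le (p be de : C -> C) (M : R) : plz p be de -> (forall z, de z = 0) ->
  (forall z, nrm z = 1 -> nrm (p z) <= M) -> nrm (be 0) <= M.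
Proof.
move=> P d0 pM; rewrite -nrm_conj.
apply: (@hol_deriv_le (fun z => cj (p z)) (fun=> 0) (fun z => cj (be z))) => // [|z z1]; last first.
  by rewrite nrm_conj pM.
apply: pl_eq (pl_conj P) => z; first by rewrite d0 addr0 add0r.
by rewrite d0 subr0 sub0r conjM -mulN1r conjM cj_ci (_ : cj (-1) = -1) ?mulN1r ?opprK ?mulrN ?mulNr ?opprK// -rc1 -rcN cj_rc.
Qed.
End Radial.

(** * Smoothness of exponentials *)

Section SmoothExp.
Variables (R : realType) (g : nat).
Local Notation C := (Cplx R).
Local Notation V := 'rV[Cplx R]_g.
Lemma sn_pd_ex n (W : set V) (p : V -> C) : open W -> sm W p ->
  sn n W (fun v => ex (p v)) /\ forall d v, W v -> cder (curve (fun v => ex (p v)) v d) 0 (pd d p v * ex (p v)).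
Proof.
move=> oW sp.
have H d v : W v -> cder (curve (fun v => ex (p v)) v d) 0 (pd d p v * ex (p v)).
  move=> Wv; have := cder_comp (pd_cderW d sp Wv) (xder_ex _); rewrite /curve mulr0 sl0 mulrC.
  exact.
split=> //; elim: n => [|n IH].
  move=> v Wv; apply: smo_0; apply: c_ex; exact: sm_cont sp Wv.
apply: (sn_step oW) (H) _ => [v Wv|d]; first by apply: c_ex; exact: sm_cont sp Wv.
by apply: snM => //; exact: (sm_pd d sp n).
Qed.
Lemma sm_ex (W : set V) (p : V -> C) : open W -> sm W p -> sm W (fun v => ex (p v)).
Proof. by move=> oW sp n; exact: (sn_pd_ex n oW sp).1. Qed.
Lemma pd_ex (W : set V) (p : V -> C) d v : open W -> sm W p -> W v ->
  pd d (fun v => ex (p v)) v = pd d p v * ex (p v).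
Proof. by move=> oW sp Wv; apply: pdP; exact: (sn_pd_ex 0 oW sp).2. Qed.
End SmoothExp.

(** Evaluation at the m points embeds H into K^m, so a family whose evaluation matrix has full row
    rank has at most m members, and one of maximal size is a basis. *)
Lemma fin_basis (T : Type) (K : fieldType) m (H : (T -> K) -> Prop) (pt : 'I_m -> T) :
  (forall a f h, H f -> H h -> H (fun v => a * f v + h v)) -> H (fun=> 0) ->
  (forall f, H f -> (forall i, f (pt i) = 0) -> forall v, f v = 0) ->
  exists n (b : 'I_n -> T -> K), [/\ forall i, H (b i),
    forall a : 'I_n -> K, (forall v, \sum_i a i * b i v = 0) -> forall i, a i = 0 &
    forall f, H f -> exists a : 'I_n -> K, forall v, f v = \sum_i a i * b i v].
Proof.
move=> HD H0 inj.
have Hs n (a : 'I_n -> K) (b : 'I_n -> T -> K) : (forall i, H (b i)) -> H (fun v => \sum_i a i * b i v).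
  move=> Hb; elim: n a b Hb => [|n IH] a b Hb.
    by rewrite (_ : (fun v => _) = fun=> 0)//; apply/funext => v; rewrite big_ord0.
  rewrite (_ : (fun v => _) = fun v => a ord0 * b ord0 v + \sum_i a (lift ord0 i) * b (lift ord0 i) v).
    by apply: HD => //; apply: IH.
  by apply/funext => v; rewrite big_ord_recl.
pose mat n (b : 'I_n -> T -> K) := \matrix_(i < n, j < m) b i (pt j).
pose Q n := `[< exists b : 'I_n -> T -> K, (forall i, H (b i)) /\ row_free (mat n b) >].
have Q0 : exists n, Q n.
  exists 0; apply/asboolP; exists (fun _ _ => 0); split=> //.
  by rewrite /row_free; apply/eqP; apply/eqP; rewrite -leqn0 rank_leq_row.
have Qm n : Q n -> (n <= m)%N by move=> /asboolP[b [_ /eqP <-]]; exact: rank_leq_col.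
case: (ex_maxnP Q0 Qm) => n /asboolP[b [Hb fb]] nmax.
have ind (a : 'I_n -> K) : (forall j, \sum_i a i * b i (pt j) = 0) -> forall i, a i = 0.
  move=> h i; have : (\row_i a i) *m mat n b = 0.
    by apply/rowP => j; rewrite !mxE -[RHS](h j); apply: eq_bigr => k _; rewrite !mxE.
  move=> /eqP; rewrite mulmx_free_eq0// => /eqP/rowP/(_ i).
  by rewrite !mxE.
exists n, b; split=> // [a h|f Hf]; first by apply: ind => j.
pose b' i := if unlift ord0 i is Some j then b j else f.
have Hb' i : H (b' i) by rewrite /b'; case: unlift.
have : ~~ row_free (mat n.+1 b').
  apply/negP => fr; have : Q n.+1 by apply/asboolP; exists b'.
  by move=> /nmax; rewrite ltnn.
rewrite -kermx_eq0 => /rowV0Pn[u /sub_kermxP uM u0].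
have Z v : u 0 ord0 * f v + \sum_i u 0 (lift ord0 i) * b i v = 0.
  have : (\sum_i u 0 i * b' i v) = 0.
    apply: inj (Hs _ (u 0) b' Hb') _ v => j.
    by have /rowP/(_ j) := uM; rewrite !mxE => h; rewrite -[RHS]h; apply: eq_bigr => i _; rewrite !mxE.
  rewrite big_ord_recl {1}/b' unlift_none => h; rewrite -[RHS]h; congr (_ + _).
  by apply: eq_bigr => i _; rewrite /b' liftK.
have un0 : u 0 ord0 != 0.
  apply: contraNneq u0 => u00; apply/eqP/rowP => i; rewrite mxE; case: (unliftP ord0 i) => [j|] -> //.
  by apply: (ind (fun j => u 0 (lift ord0 j))) => k; rewrite -[RHS](Z (pt k)) u00 mul0r add0r.
exists (fun i => - (u 0 ord0)^-1 * u 0 (lift ord0 i)) => v.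
have /eqP := Z v; rewrite addr_eq0 => /eqP h.
under eq_bigr do rewrite -mulrA.
by rewrite -mulr_sumr mulNr -mulrN -h mulrA mulVf// mul1r.
Qed.

(** * Cech cohomology of sheaves with commuting operators *)

Section Cech.
Variables (X : topologicalType) (T : Type) (pr : T -> X) (K : fieldType).
Local Notation fn := (T -> K).
Implicit Types (U : X -> set X) (W : set X) (f h : fn).

Definition on W f h := forall v, W (pr v) -> f v = h v.
(** The number n counts the indices: Cech degree p is [cch p.+1], and [cch 0] is the augmentation, a
    single function on the whole space. *)
Definition cch n := ('I_n -> X) -> fn.
Definition ov n (U : X -> set X) (s : 'I_n -> X) : set X := [set x | forall k, U (s k) x].
Definition cov (U : X -> set X) := forall x, open (U x) /\ U x x.
Definition refn (U' U : X -> set X) := forall x, U' x `<=` U x.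
Definition ceq n (U : X -> set X) (b c : cch n) := forall s, on (ov U s) (b s) (c s).
Definition isc (F : set X -> fn -> Prop) n U (c : cch n) := forall s, F (ov U s) (c s).
Definition cd n (c : cch n) : cch n.+1 := fun s v => \sum_(k < n.+1) (-1) ^+ k * c (fun l => s (lift k l)) v.
Definition c0 n : cch n := fun _ _ => 0.
Definition cadd n (b c : cch n) : cch n := fun s v => b s v + c s v.
Definition cscale n (a : K) (c : cch n) : cch n := fun s v => a * c s v.
Definition csub n (b c : cch n) : cch n := cadd b (cscale (-1) c).
Definition cmap n (D : fn -> fn) (c : cch n) : cch n := fun s => D (c s).
Definition ccst (F : fn) : cch 1 := fun _ => F.
Definition capU (U U' : X -> set X) x := U x `&` U' x.

Lemma on_sub W W' f h : W' `<=` W -> on W f h -> on W' f h.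
Proof. by move=> WW fh v /WW /fh. Qed.

Lemma refn_refl U : refn U U. Proof. by move=> x y. Qed.
Lemma refn_trans U1 U2 U3 : refn U1 U2 -> refn U2 U3 -> refn U1 U3.
Proof. by move=> h1 h2 x y /h1 /h2. Qed.
Lemma capUl U U' : refn (capU U U') U. Proof. by move=> x y []. Qed.
Lemma capUr U U' : refn (capU U U') U'. Proof. by move=> x y []. Qed.
Lemma cov_cap U U' : cov U -> cov U' -> cov (capU U U').
Proof. by move=> cU cU' x; have [? ?] := cU x; have [? ?] := cU' x; split; [exact: openI|]. Qed.
Lemma ov_sub n U' U (s : 'I_n -> X) : refn U' U -> ov U' s `<=` ov U s.
Proof. by move=> UU x h k; exact: UU. Qed.
Lemma ov_open n U (s : 'I_n -> X) : cov U -> open (ov U s).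
Proof.
move=> cU; rewrite openE => x xs.
have : \forall y \near nbhs x, forall k, U (s k) y.
  apply: filter_forall => k; have [oo _] := cU (s k).
  by move: oo; rewrite openE => /(_ x (xs k)).
by [].
Qed.
Lemma ov_face n U (s : 'I_n.+1 -> X) k : ov U s `<=` ov U (fun l => s (lift k l)).
Proof. by move=> x h l; exact: h. Qed.

Lemma ceq_refl n U (c : cch n) : ceq U c c. Proof. by []. Qed.
Lemma ceq_sym n U (b c : cch n) : ceq U b c -> ceq U c b.
Proof. by move=> h s v Wv; rewrite h. Qed.
Lemma ceq_trans n U (b c e : cch n) : ceq U b c -> ceq U c e -> ceq U b e.
Proof. by move=> h h' s v Wv; rewrite h// h'. Qed.
Lemma ceq_ref n U' U (b c : cch n) : refn U' U -> ceq U b c -> ceq U' b c.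
Proof. by move=> UU h s; apply: on_sub (h s); exact: ov_sub. Qed.
Lemma cd_eq n U (b c : cch n) : ceq U b c -> ceq U (cd b) (cd c).
Proof.
move=> h s v Wv; apply: eq_bigr => k _; rewrite h//; exact: ov_face Wv.
Qed.
Lemma cdD n (b c : cch n) s v : cd (cadd b c) s v = cd b s v + cd c s v.
Proof. by rewrite -big_split/=; apply: eq_bigr => k _; rewrite mulrDr. Qed.
Lemma cdZ n a (c : cch n) s v : cd (cscale a c) s v = a * cd c s v.
Proof. by rewrite mulr_sumr; apply: eq_bigr => k _; rewrite mulrCA. Qed.
Lemma cdB n (b c : cch n) s v : cd (csub b c) s v = cd b s v - cd c s v.
Proof. by rewrite cdD cdZ mulN1r. Qed.
Lemma cd0 n s v : cd (c0 (n := n)) s v = 0.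
Proof. by rewrite /cd big1// => k _; rewrite mulr0. Qed.
Lemma csubE n (b c : cch n) s v : csub b c s v = b s v - c s v.
Proof. by rewrite /csub /cadd /cscale mulN1r. Qed.

(* By [cd_tcons], c |-> c o tcons x is a contracting homotopy. *)
Definition tcons n (x : X) (s : 'I_n -> X) : 'I_n.+1 -> X :=
  fun k => if unlift ord0 k is Some j then s j else x.
Lemma tcons0 n x (s : 'I_n -> X) : tcons x s ord0 = x.
Proof. by rewrite /tcons unlift_none. Qed.
Lemma tconsS n x (s : 'I_n -> X) j : tcons x s (lift ord0 j) = s j.
Proof. by rewrite /tcons liftK. Qed.
Lemma tcons_eta n (s : 'I_n.+1 -> X) : s = tcons (s ord0) (fun j => s (lift ord0 j)).
Proof. by apply/funext => k; rewrite /tcons; case: unliftP => [j|] ->. Qed.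
Lemma tcons_face0 n x (s : 'I_n -> X) : (fun l => tcons x s (lift ord0 l)) = s.
Proof. by apply/funext => l; rewrite tconsS. Qed.
Lemma tcons_face n x (s : 'I_n.+1 -> X) (k : 'I_n.+1) :
  (fun l => tcons x s (lift (lift ord0 k) l)) = tcons x (fun l => s (lift k l)).
Proof.
apply/funext => l; case: (unliftP ord0 l) => [j|] ->; last first.
  have -> : lift (lift ord0 k) (ord0 : 'I_n.+1) = ord0 by apply: val_inj.
  by rewrite !tcons0.
rewrite tconsS (_ : lift (lift ord0 k) (lift ord0 j) = lift ord0 (lift k j)) ?tconsS//.
by apply: val_inj; rewrite /= /bump /= !add1n ltnS addnS.
Qed.
Lemma cd_tcons n (c : cch n.+1) x (s : 'I_n.+1 -> X) v :
  cd c (tcons x s) v = c s v - cd (fun s' => c (tcons x s')) s v.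
Proof.
rewrite {1}/cd big_ord_recl expr0 mul1r tcons_face0; congr (_ + _).
rewrite /cd -sumrN; apply: eq_bigr => k _.
by rewrite tcons_face /= /bump /= add1n exprS mulN1r mulNr.
Qed.
Lemma cdd n (c : cch n) s v : cd (cd c) s v = 0.
Proof.
elim: n c s v => [|n IH] c s v.
  rewrite (tcons_eta s) cd_tcons /cd !big_ord_recl !big_ord0 !addr0 !expr0 !mul1r.
  apply/eqP; rewrite subr_eq0; apply/eqP; congr (c _ v).
  by apply/funext => -[].
rewrite (tcons_eta s) cd_tcons.
rewrite (_ : (fun s' => cd c (tcons _ s')) = csub c (cd (fun s' => c (tcons (s ord0) s')))).
  by rewrite cdB IH subr0 subrr.
by apply/funext => s'; apply/funext => w; rewrite cd_tcons csubE.
Qed.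

(** Sections are total functions on T of which only the values over W count. Since a candidate for
    gluing is then already one function, gluing reduces to the locality clause [sh_loc]. *)
Record sheaf (F : set X -> fn -> Prop) := Sheaf {
  sh_ext : forall W f h, open W -> on W f h -> F W f -> F W h;
  sh_sub : forall W W' f, W' `<=` W -> F W f -> F W' f;
  sh_add : forall W f h, open W -> F W f -> F W h -> F W (fun v => f v + h v);
  sh_scale : forall W a f, open W -> F W f -> F W (fun v => a * f v);
  sh_zero : forall W, open W -> F W (fun=> 0);
  sh_loc : forall W f, (forall x, W x -> exists W', [/\ open W', W' x & F W' f]) -> F W f }.

Section SheafLemmas.
Variable F : set X -> fn -> Prop.
Hypothesis S : sheaf F.
Lemma isc_ref n U' U (c : cch n) : refn U' U -> isc F U c -> isc F U' c.
Proof. by move=> UU h s; apply: (sh_sub S) (h s); exact: ov_sub. Qed.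
Lemma iscD n U (b c : cch n) : cov U -> isc F U b -> isc F U c -> isc F U (cadd b c).
Proof. by move=> cU hb hc s; apply: (sh_add S) => //; exact: ov_open. Qed.
Lemma iscZ n U a (c : cch n) : cov U -> isc F U c -> isc F U (cscale a c).
Proof. by move=> cU hc s; apply: (sh_scale S) => //; exact: ov_open. Qed.
Lemma iscB n U (b c : cch n) : cov U -> isc F U b -> isc F U c -> isc F U (csub b c).
Proof. by move=> cU hb hc; apply: iscD => //; exact: iscZ. Qed.
Lemma sh_sum W (I : Type) (r : seq I) (G : I -> fn) : open W -> (forall i, F W (G i)) ->
  F W (fun v => \sum_(i <- r) G i v).
Proof.
move=> oW FG; elim: r => [|i r IH].
  by apply: (sh_ext S oW) (sh_zero S oW) => v _; rewrite big_nil.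
by apply: (sh_ext S oW) (sh_add S oW (FG i) IH) => v _; rewrite big_cons.
Qed.
Lemma isc_d n U (c : cch n) : cov U -> isc F U c -> isc F U (cd c).
Proof.
move=> cU hc s; have oo := @ov_open _ U s cU; apply: sh_sum => // k.
exact: (sh_scale S ((-1) ^+ k) oo (sh_sub S (@ov_face _ U s k) (hc _))).
Qed.
End SheafLemmas.

(** For n = 0 this says that a 0-cocycle is a global section after refinement; for n > 0 it is the
    vanishing of cohomology in degree n. *)
Definition acyc F := forall n U (c : cch n.+1), cov U -> isc F U c -> ceq U (cd c) (c0 (n := n.+2)) ->
  exists U' (b : cch n), [/\ cov U', refn U' U, isc F U' b & ceq U' c (cd b)].

(** The contractions c |-> [c \o tcons x] leave the overlaps of the covering; multiplied by chi x
    they extend by 0, and their sum over x is a primitive of c. *)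
Lemma acyc_soft F : sheaf F ->
  (forall U, cov U -> exists (r : seq X) (chi : X -> fn),
     [/\ forall v, \sum_(x <- r) chi x v = 1, forall x v, chi x v != 0 -> U x (pr v) &
       forall x W f, open W -> F (U x `&` W) f -> F W (fun v => chi x v * f v)]) ->
  acyc F.
Proof.
move=> SF PU n U c cU hc dc; have [r [chi [chi1 chi0 chiF]]] := PU U cU.
exists U, (fun s v => \sum_(x <- r) chi x v * c (tcons x s) v); split=> //; first exact: refn_refl.
  move=> s; have oo := @ov_open _ U s cU; apply: (sh_sum SF) => // x; apply: chiF => //.
  apply: (sh_sub SF) (hc _) => y [xy sy] k; case: (unliftP ord0 k) => [j|] ->.
    by rewrite tconsS.
  by rewrite tcons0.
move=> s v sv.
rewrite /cd (eq_bigr (fun k : 'I_n.+1 => \sum_(x <- r) chi x v * ((-1) ^+ k * c (tcons x (fun l => s (lift k l))) v))); last first.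
  by move=> k _; rewrite mulr_sumr; apply: eq_bigr => x _; rewrite mulrCA.
rewrite exchange_big /=; transitivity (\sum_(x <- r) chi x v * c s v).
  by rewrite -mulr_suml chi1 mul1r.
apply: eq_bigr => x _.
rewrite -mulr_sumr; have [->|cx] := eqVneq (chi x v) 0; first by rewrite !mul0r.
congr (_ * _); apply/eqP; rewrite -subr_eq0; apply/eqP.
have : cd c (tcons x s) v = 0.
  apply: dc => k; case: (unliftP ord0 k) => [j|] ->; first by rewrite tconsS.
  by rewrite tcons0; exact: chi0.
by rewrite cd_tcons.
Qed.

Section Operators.
Variables (I : eqType) (D : I -> fn -> fn) (S : set X -> fn -> Prop).
Hypothesis SS : sheaf S.
Hypothesis Dloc : forall i W f h, open W -> on W f h -> on W (D i f) (D i h).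
Hypothesis DD : forall i W f h, open W -> S W f -> S W h ->
  on W (D i (fun v => f v + h v)) (fun v => D i f v + D i h v).
Hypothesis DZ : forall i W a f, open W -> S W f -> on W (D i (fun v => a * f v)) (fun v => a * D i f v).
Hypothesis DS : forall i W f, open W -> S W f -> S W (D i f).
Hypothesis DC : forall i j W f, open W -> S W f -> on W (D i (D j f)) (D j (D i f)).

Lemma D0 i W : open W -> on W (D i (fun=> 0)) (fun=> 0).
Proof.
move=> oW v Wv; transitivity (D i (fun w => 0 * 0) v).
  by congr (D i _ v); apply/funext => w; rewrite mul0r.
by rewrite (DZ i 0 oW (sh_zero SS oW) Wv) mul0r.
Qed.

Definition FF (l : seq I) W f := S W f /\ forall i, i \in l -> on W (D i f) (fun=> 0).

Lemma FF_sub l l' W f : {subset l' <= l} -> FF l W f -> FF l' W f.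
Proof. by move=> ll [Sf Df]; split=> // i /ll; exact: Df. Qed.
Lemma FF_sheaf l : sheaf (FF l).
Proof.
split.
- move=> W f h oW fh [Sf Df]; split; first exact: (sh_ext SS) fh Sf.
  move=> i il v Wv; rewrite -(Dloc i oW fh Wv); exact: Df.
- move=> W W' f WW [Sf Df]; split; first exact: (sh_sub SS) WW Sf.
  by move=> i il; apply: on_sub (Df i il).
- move=> W f h oW [Sf Df] [Sh Dh]; split; first exact: (sh_add SS).
  by move=> i il v Wv; rewrite (DD _ oW Sf Sh Wv) (Df i il v Wv) (Dh i il v Wv) addr0.
- move=> W a f oW [Sf Df]; split; first exact: (sh_scale SS).
  by move=> i il v Wv; rewrite (DZ _ _ oW Sf Wv) (Df i il v Wv) mulr0.
- move=> W oW; split; first exact: (sh_zero SS).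
  by move=> i il; exact: D0.
- move=> W f H; split.
    by apply: (sh_loc SS) => x /H[W' [oW' W'x [Sf _]]]; exists W'.
  by move=> i il v /H[W' [oW' W'x [_ Df]]]; exact: Df.
Qed.
Lemma FF_D l k W f : open W -> FF l W f -> FF l W (D k f).
Proof.
move=> oW [Sf Df]; split; first exact: DS.
move=> i il v Wv; rewrite (DC _ _ oW Sf Wv) (Dloc k oW (Df i il) Wv).
exact: (D0 _ oW).
Qed.
Lemma FF_cons l k W f : FF l W f -> on W (D k f) (fun=> 0) -> FF (k :: l) W f.
Proof. by move=> [Sf Df] Dk; split=> // i; rewrite inE => /orP[/eqP ->//|]; exact: Df. Qed.
Lemma FF_tail l k W f : FF (k :: l) W f -> FF l W f.
Proof. by apply: FF_sub => i il; rewrite inE il orbT. Qed.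

Lemma isc_D l k n U (c : cch n) : cov U -> isc (FF l) U c -> isc (FF l) U (cmap (D k) c).
Proof. by move=> cU hc s; apply: FF_D => //; exact: ov_open. Qed.
Lemma isc_tail l k n U (c : cch n) : isc (FF (k :: l)) U c -> isc (FF l) U c.
Proof. by move=> hc s; exact: FF_tail (hc s). Qed.
Lemma isc_cons l k n U (c : cch n) : isc (FF l) U c -> ceq U (cmap (D k) c) (c0 (n := n)) ->
  isc (FF (k :: l)) U c.
Proof. by move=> hc h s; apply: FF_cons (hc s) (h s). Qed.
Lemma isc_head l k n U (c : cch n) : isc (FF (k :: l)) U c -> ceq U (cmap (D k) c) (c0 (n := n)).
Proof. by move=> hc s; apply: (hc s).2; rewrite inE eqxx. Qed.
Lemma cmap_eq n k U (b c : cch n) : cov U -> ceq U b c -> ceq U (cmap (D k) b) (cmap (D k) c).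
Proof. by move=> cU h s; apply: Dloc => //; exact: ov_open. Qed.
Lemma cmap0 n k U : cov U -> ceq U (cmap (D k) (c0 (n := n))) (c0 (n := n)).
Proof. by move=> cU s; apply: D0; exact: ov_open. Qed.
Lemma D_sum k W (J : Type) (r : seq J) (G : J -> fn) : open W -> (forall i, S W (G i)) ->
  on W (D k (fun v => \sum_(i <- r) G i v)) (fun v => \sum_(i <- r) D k (G i) v).
Proof.
move=> oW SG; elim: r => [|i r IH] v Wv.
  have h : on W (fun v => \sum_(i <- [::]) G i v) (fun=> 0) by move=> w _; rewrite big_nil.
  by rewrite big_nil (Dloc k oW h Wv) (D0 k oW Wv).
rewrite big_cons -(IH v Wv) -(DD k oW (SG i) (sh_sum SS r oW SG) Wv).
by apply: (Dloc k oW) Wv => w _; rewrite big_cons.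
Qed.
Lemma cmap_d n k U (c : cch n) : cov U -> isc S U c -> ceq U (cmap (D k) (cd c)) (cd (cmap (D k) c)).
Proof.
move=> cU hc s v sv; have oo := @ov_open _ U s cU.
have hk (j : 'I_n.+1) : S (ov U s) (c (fun l => s (lift j l))) by apply: (sh_sub SS) (hc _); exact: ov_face.
rewrite /cmap /cd (D_sum k _ oo) => [|i|//]; last exact: (sh_scale SS).
by apply: eq_bigr => i _; rewrite (DZ _ _ oo).
Qed.
Lemma isc_FF_S l n U (c : cch n) : isc (FF l) U c -> isc S U c.
Proof. by move=> h s; exact: (h s).1. Qed.
Lemma cmapB n k U (b c : cch n) : cov U -> isc S U b -> isc S U c ->
  ceq U (cmap (D k) (csub b c)) (csub (cmap (D k) b) (cmap (D k) c)).
Proof.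
move=> cU hb hc s v sv; have oo := @ov_open _ U s cU.
by rewrite /cmap /csub /cadd (DD k oo (hb s) (sh_scale SS _ oo (hc s)) sv) (DZ _ _ oo (hc s) sv).
Qed.

(** Local surjectivity of D_k, with a preimage chosen on each overlap after a refinement. The empty
    tuple is left out because its overlap is the whole space, where global surjectivity [onto] is
    what is needed. *)
Definition lifts k l := forall n U (e : cch n.+1), cov U -> isc (FF l) U e ->
  exists U' (e' : cch n.+1), [/\ cov U', refn U' U, isc (FF l) U' e' & ceq U' (cmap (D k) e') e].
Definition onto k l := forall f, FF l setT f -> exists2 h, FF l setT h & forall v, D k h v = f v.

Lemma covT : cov (fun=> setT). Proof. by move=> x; split=> //; exact: openT. Qed.
Lemma ov0 U (s : 'I_0 -> X) : ov U s = setT.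
Proof. by apply/seteqP; split=> // x _ []. Qed.

(** A primitive b of c exists before the equation D_k = 0 is imposed. Its image D_k b is a cocycle,
    hence some cd e; lifting e to e' and replacing b by b - cd e' makes D_k b vanish. When c has
    degree 1, e is a global section and its lift is where [onto] enters. *)
Lemma acyc_pos k l : lifts k l -> onto k l -> acyc (FF l) -> acyc (FF (k :: l)).
Proof.
move=> lf on_ ac n U c cU hc dc.
have [U1 [b [cU1 r1 hb cb]]] := ac n U c cU (isc_tail hc) dc.
have hbS := isc_FF_S hb.
have Db0 : ceq U1 (cd (cmap (D k) b)) (c0 (n := n.+1)).
  apply: ceq_trans (ceq_sym (cmap_d k cU1 hbS)) _.
  apply: ceq_trans (ceq_sym (cmap_eq k cU1 cb)) _.
  exact: ceq_ref r1 (isc_head hc).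
suff [U2 [b' [cU2 r2 hb' cb']]] : exists U2 (b' : cch n),
    [/\ cov U2, refn U2 U1, isc (FF (k :: l)) U2 b' & ceq U2 (cd b) (cd b')].
  exists U2, b'; split=> //; first exact: refn_trans r2 r1.
  exact: ceq_trans (ceq_ref r2 cb) cb'.
case: n => [|n] in c hc dc b hb cb hbS Db0 *.
  exists U1, b; split=> //; first exact: refn_refl.
  apply: (isc_cons hb) => s v _.
  have vv : ov U1 (fun _ : 'I_1 => pr v) (pr v) by move=> j; exact: (cU1 _).2.
  have := Db0 _ v vv; rewrite /cd big_ord_recl big_ord0 addr0 expr0 mul1r /c0 => <-.
  by congr (D k (b _) v); apply/funext; case.
have [U2 [e [cU2 r2 he ce]]] := ac n U1 (cmap (D k) b) cU1 (isc_D k cU1 hb) Db0.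
have [U3 [e' [cU3 r3 he' ce']]] : exists U3 (e' : cch n),
    [/\ cov U3, refn U3 U2, isc (FF l) U3 e' & ceq U3 (cmap (D k) e') e].
  case: n => [|n] in c hc dc b hb cb hbS Db0 e he ce *; last exact: lf.
  pose s0 : 'I_0 -> X := fun j => match j with Ordinal m i => match notF i with end end.
  have es s : e s = e s0 by congr e; apply/funext; case.
  have h0 : FF l setT (e s0) by have := he s0; rewrite ov0.
  have [h hh hD] := on_ (e s0) h0.
  by exists U2, (fun _ => h); split=> [//||s|s v _];
    [exact: refn_refl|rewrite ov0|rewrite /cmap hD es].
exists U3, (csub b (cd e')); have r31 := refn_trans r3 r2.
have hb3 := isc_ref (FF_sheaf l) r31 hb.
have hd := isc_d (FF_sheaf l) cU3 he'.
split=> //.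
  apply: isc_cons; first exact: (iscB (FF_sheaf l)).
  apply: ceq_trans (cmapB k cU3 (isc_FF_S hb3) (isc_FF_S hd)) _ => s v sv.
  rewrite csubE (ceq_ref r3 ce sv) (cmap_d k cU3 (isc_FF_S he') sv) (cd_eq ce' sv).
  by rewrite subrr.
by move=> s v sv; rewrite cdB cdd subr0.
Qed.

Section Negative.
Variables (E N : seq I).
Hypothesis acE : acyc (FF E).
Hypothesis lf : forall k l, uniq (k :: l) -> {subset k :: l <= N} -> lifts k (l ++ E).
Local Notation GG l := (FF (l ++ E)).
Local Notation gs := (FF E setT).

Fixpoint span (l : seq I) (F : fn) : Prop := match l with
  | [::] => forall v, F v = 0
  | k :: l' => exists G H, [/\ gs G, span l' H & forall v, F v = D k G v + H v] end.
(** On cohomology: D_k acts injectively in degree [size l], so the kernel of D_k has no cohomology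
    left in that degree. *)
Hypothesis inj : forall k l F, uniq (k :: l) -> {subset k :: l <= N} -> gs F ->
  span l (D k F) -> span l F.

Definition nulc l p U (c : cch p.+1) : Prop := exists U', [/\ cov U', refn U' U &
  match p return cch p.+1 -> Prop with
  | 0 => fun c => ceq U' c (c0 (n := 1))
  | q.+1 => fun c => exists2 b : cch q.+1, isc (GG l) U' b & ceq U' c (cd b) end c].

(* [rep l U c F]: under the iterated connecting homomorphisms of the exact sequences
   0 -> ker D_k -> FF -> FF -> 0, k in l, the cocycle [c] comes from the global section [F]. *)
Fixpoint rep (l : seq I) U : cch (size l).+1 -> fn -> Prop :=
  match l return cch (size l).+1 -> fn -> Prop with
  | [::] => fun c F => ceq U c (ccst F)
  | k :: l' => fun c F => exists U' (b : cch (size l').+1),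
      [/\ cov U', refn U' U, isc (GG l') U' b, ceq U' c (cd b) & rep U' (cmap (D k) b) F] end.

Lemma span_ext l F F' : F =1 F' -> span l F -> span l F'.
Proof. by move=> /funext ->. Qed.
Lemma rep_Fext l U (c : cch (size l).+1) F F' : F =1 F' -> rep U c F -> rep U c F'.
Proof. by move=> /funext ->. Qed.
Lemma rep_ref l U U' (c : cch (size l).+1) F : cov U' -> refn U' U -> rep U c F -> rep U' c F.
Proof.
elim: l U U' c F => [|k l IH] U U' c F cU' r /=; first exact: ceq_ref.
move=> [U1 [b [cU1 r1 hb cb rb]]]; have cc := cov_cap cU1 cU'; have rl : refn (capU U1 U') U1 := @capUl _ _.
exists (capU U1 U'), b; split=> //.
- exact: capUr.
- exact: (isc_ref (FF_sheaf _) rl hb).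
- exact: ceq_ref rl cb.
- exact: IH cc rl rb.
Qed.
Lemma rep_eq l U (c c' : cch (size l).+1) F : ceq U c c' -> rep U c F -> rep U c' F.
Proof.
case: l c c' => [|k l] c c' cc /=; first exact: ceq_trans (ceq_sym cc).
move=> [U1 [b [cU1 r1 hb cb rb]]]; exists U1, b; split=> //.
exact: ceq_trans (ceq_ref r1 (ceq_sym cc)) cb.
Qed.
Lemma rep_lin l U (c c' : cch (size l).+1) F F' a : cov U -> rep U c F -> rep U c' F' ->
  rep U (cadd c (cscale a c')) (fun v => F v + a * F' v).
Proof.
elim: l U c c' F F' => [|k l IH] U c c' F F' cU /=.
  by move=> h h' s v sv; rewrite /cadd /cscale h// h'.
move=> [U1 [b [cU1 r1 hb cb rb]]] [U2 [b' [cU2 r2 hb' cb' rb']]].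
have cc := cov_cap cU1 cU2; have rl : refn (capU U1 U2) U1 := @capUl _ _.
have rr : refn (capU U1 U2) U2 := @capUr _ _.
have hb1 := isc_ref (FF_sheaf _) rl hb; have hb2 := isc_ref (FF_sheaf _) rr hb'.
exists (capU U1 U2), (cadd b (cscale a b')); split=> //.
- exact: refn_trans rl r1.
- by apply: (iscD (FF_sheaf _) cc hb1); exact: (iscZ (FF_sheaf _)).
- by move=> s v sv; rewrite /cadd /cscale (ceq_ref rl cb sv) (ceq_ref rr cb' sv) cdD cdZ.
apply: rep_eq (IH _ _ _ _ _ cc (rep_ref cc rl rb) (rep_ref cc rr rb')) => s v sv.
have oo := @ov_open _ _ s cc; have h1 := (hb1 s).1; have h2 := (hb2 s).1.
by rewrite /cmap /cadd /cscale (DD k oo h1 (sh_scale SS a oo h2) sv) (DZ k a oo h2 sv).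
Qed.
Lemma rep_D l j U (c : cch (size l).+1) F : cov U -> rep U c F -> rep U (cmap (D j) c) (D j F).
Proof.
elim: l U c F => [|k l IH] U c F cU /=.
  by move=> h s; apply: Dloc (h s); exact: ov_open.
move=> [U1 [b [cU1 r1 hb cb rb]]]; exists U1, (cmap (D j) b); split=> //.
- exact: isc_D.
- apply: ceq_trans (cmap_eq j cU1 cb) _; exact: cmap_d (isc_FF_S hb).
apply: rep_eq (IH _ _ _ cU1 rb) => s; apply: DC; [exact: ov_open|exact: (hb s).1].
Qed.

Lemma nulc_ref l p U U' (c : cch p.+1) : cov U' -> refn U' U -> nulc l U c -> nulc l U' c.
Proof.
move=> cU' r [U1 [cU1 r1 h]]; exists (capU U1 U'); split.
- exact: cov_cap.
- exact: capUr.
have rl : refn (capU U1 U') U1 := @capUl _ _.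
case: p c h => [|p] c; first exact: ceq_ref.
move=> [b hb cb]; exists b; first exact: (isc_ref (FF_sheaf _) rl hb).
exact: ceq_ref rl cb.
Qed.
Lemma nulc_unref l p U U' (c : cch p.+1) : refn U' U -> nulc l U' c -> nulc l U c.
Proof.
move=> r [U1 [cU1 r1 h]]; exists U1; split=> //; exact: refn_trans r1 r.
Qed.
Lemma nulc_eq l p U (c c' : cch p.+1) : ceq U c c' -> nulc l U c -> nulc l U c'.
Proof.
move=> cc [U1 [cU1 r1 h]]; exists U1; split=> //; have cc1 := ceq_ref r1 cc.
case: p c c' cc cc1 h => [|p] c c' cc cc1; first exact: ceq_trans (ceq_sym cc1).
by move=> [b hb cb]; exists b => //; exact: ceq_trans (ceq_sym cc1) cb.
Qed.
Lemma nulc0 l p U : cov U -> nulc l U (c0 (n := p.+1)).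
Proof.
move=> cU; exists U; split=> //; first exact: refn_refl.
case: p => [|p]; first exact: ceq_refl.
exists (c0 (n := p.+1)).
  by move=> s; apply: (sh_zero (FF_sheaf _)); exact: ov_open.
by move=> s v _; rewrite cd0.
Qed.

(** The correction step of the connecting homomorphism: a primitive of D_k b is lifted through D_k,
    and its coboundary is subtracted from b. In degree 0 there is nothing to correct. *)
Lemma adjust k l q U (b : cch q.+1) : lifts k (l ++ E) -> cov U -> isc (GG l) U b ->
  nulc l U (cmap (D k) b) -> exists U' (b' : cch q.+1),
    [/\ cov U', refn U' U, isc (GG (k :: l)) U' b' & ceq U' (cd b') (cd b)].
Proof.
move=> lk cU hb [U1 [cU1 r1 h]]; have Sh := FF_sheaf (l ++ E).
have hb1 := isc_ref Sh r1 hb.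
case: q b hb h hb1 => [|q] b hb h hb1.
  by exists U1, b; split=> //; exact: (isc_cons hb1).
case: h => e he be; have [U2 [e' [cU2 r2 he' ee]]] := lk _ _ _ cU1 he.
have r21 := refn_trans r2 r1; have hb2 := isc_ref Sh r21 hb; have hd := isc_d Sh cU2 he'.
exists U2, (csub b (cd e')); split=> //.
  apply: isc_cons; first exact: (iscB Sh).
  apply: ceq_trans (cmapB k cU2 (isc_FF_S hb2) (isc_FF_S hd)) _ => s v sv.
  by rewrite csubE (ceq_ref r2 be sv) (cmap_d k cU2 (isc_FF_S he') sv) (cd_eq ee sv) subrr.
by move=> s v sv; rewrite cdB cdd subr0.
Qed.

Lemma cd_D0 l k n U (b : cch n) (c : cch n.+1) : cov U -> isc (GG (k :: l)) U c -> isc (GG l) U b ->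
  ceq U c (cd b) -> ceq U (cd (cmap (D k) b)) (c0 (n := n.+1)).
Proof.
move=> cU hc hb cb; apply: ceq_trans (ceq_sym (cmap_d k cU (isc_FF_S hb))) _.
apply: ceq_trans (ceq_sym (cmap_eq k cU cb)) _; exact: isc_head hc.
Qed.

Lemma gsB F F' a : gs F -> gs F' -> gs (fun v => F v + a * F' v).
Proof.
by move=> h h'; apply: (sh_add (FF_sheaf E) openT h); exact: (sh_scale (FF_sheaf E) a openT h').
Qed.

(** Together the clauses say that the relation [rep] identifies the cohomology of the sheaf cut out
    by l ++ E in degree [size l] with gs modulo [span l], and that all other degrees vanish. *)
Definition cohomology_spec l := [/\
  forall U (c : cch (size l).+1), cov U -> isc (GG l) U c -> ceq U (cd c) (c0 (n := (size l).+2)) ->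
    exists F U', [/\ gs F, cov U', refn U' U & rep U' c F],
  forall F, gs F -> exists U (c : cch (size l).+1),
    [/\ cov U, isc (GG l) U c, ceq U (cd c) (c0 (n := (size l).+2)) & rep U c F],
  forall U (c : cch (size l).+1) F, cov U -> gs F -> isc (GG l) U c -> rep U c F ->
    nulc l U c -> span l F,
  forall U (c : cch (size l).+1) F, cov U -> gs F -> isc (GG l) U c -> rep U c F ->
    span l F -> nulc l U c &
  forall q U (c : cch q.+1), q <> size l -> cov U -> isc (GG l) U c ->
    ceq U (cd c) (c0 (n := q.+2)) -> nulc l U c].

Lemma cohomology_nil : cohomology_spec [::].
Proof.
split => /=.
- move=> U c cU hc dc; have [U' [b [cU' r hb cb]]] := acE cU hc dc.
  pose s0 : 'I_0 -> X := fun j => match j with Ordinal m i => match notF i with end end.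
  exists (b s0), U'; split=> //; first by have := hb s0; rewrite ov0.
  move=> s v sv; rewrite cb// /cd big_ord_recl big_ord0 addr0 expr0 mul1r /ccst.
  by congr (b _ v); apply/funext; case.
- move=> F gF; exists (fun=> setT), (ccst F); split.
  + exact: covT.
  + by move=> s; apply: (sh_sub (FF_sheaf E)) gF.
  + move=> s v _; rewrite /cd big_ord_recl big_ord_recl big_ord0 /ccst /bump /=.
    by rewrite expr0 expr1 mul1r mulN1r addr0 subrr.
  + exact: ceq_refl.
- move=> U c F cU gF hc rc_ [U' [cU' r c'0]] v.
  pose s := fun _ : 'I_1 => pr v.
  have s1 : ov U' s (pr v) by move=> k; exact: (cU' _).2.
  have s2 : ov U s (pr v) by exact: ov_sub r _ s1.
  by have := rc_ s v s2; rewrite /ccst => <-; rewrite c'0.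
- move=> U c F cU gF hc rc_ F0; exists U; split=> //; first exact: refn_refl.
  by apply: ceq_trans rc_ _ => s v _; exact: F0.
- case=> // q U c _ cU hc dc; have [U' [b [cU' r hb cb]]] := acE cU hc dc.
  by exists U'; split=> //; exists b.
Qed.

(** The long exact sequence of 0 -> ker D_k -> F_l -> F_l -> 0. Only degree [size l] of F_l is
    nonzero and D_k is injective there, so the cokernel of D_k is the cohomology of the kernel one
    degree higher. *)
Lemma cohomology_cons k l : uniq (k :: l) -> {subset k :: l <= N} ->
  cohomology_spec l -> cohomology_spec (k :: l).
Proof.
move=> ukl skl [A B C1 C2 C3]; have lk := lf ukl skl; have Sh := FF_sheaf (l ++ E).
split.
- move=> U c cU hc dc.
  have [U1 [cU1 r1 [b hb cb]]] : nulc l U c.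
    by apply: C3 => //; [move=> /= /eqP; rewrite -[X in X == _]addn1 -[X in _ == X]addn0 eqn_add2l|exact: isc_tail hc].
  have hc1 := isc_ref (FF_sheaf _) r1 hc.
  have [F [U2 [gF cU2 r2 rF]]] := A _ _ cU1 (isc_D k cU1 hb) (cd_D0 cU1 hc1 hb cb).
  exists F, U2; split=> //; first exact: refn_trans r2 r1.
  exists U2, b; split=> //; [exact: refn_refl|exact: (isc_ref Sh r2 hb)|exact: ceq_ref r2 cb].
- move=> F gF; have [U [c [cU hc dc rF]]] := B F gF.
  have [U1 [b [cU1 r1 hb cb]]] := lk _ _ _ cU hc.
  exists U1, (cd b); split=> //.
  + apply: isc_cons; first exact: isc_d.
    apply: ceq_trans (cmap_d k cU1 (isc_FF_S hb)) _.
    by apply: ceq_trans (cd_eq cb) _; exact: ceq_ref r1 dc.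
  + by move=> s v _; rewrite cdd.
  + exists U1, b; split=> //; [exact: refn_refl|].
    by apply: rep_eq (ceq_sym cb) _; exact: rep_ref cU1 r1 rF.
- move=> U c F cU gF hc [U1 [b [cU1 r1 hb cb rb]]] [U2 [cU2 r2 [b' hb' cb']]].
  have cc := cov_cap cU1 cU2; have rl : refn (capU U1 U2) U1 := @capUl _ _.
  have rr : refn (capU U1 U2) U2 := @capUr _ _.
  have hb1 := isc_ref Sh rl hb; have hb2 := isc_ref Sh rr (isc_tail hb').
  have hbb := iscB Sh cc hb1 hb2.
  (* The primitives b and b' of c differ by a cocycle, represented by G. As D_k b' = 0, both F and
     D_k G represent D_k b, so that F - D_k G represents 0 and lies in span l. *)
  have [|G [U3 [gG cU3 r3 rG]]] := A _ _ cc hbb.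
    move=> s v sv; rewrite cdB -(ceq_ref rl cb sv) -(ceq_ref rr cb' sv) subrr//.
  have Db' : ceq U3 (cmap (D k) (csub b b')) (cmap (D k) b).
    have hb3 := isc_ref Sh r3 hb1; have hb4 := isc_ref Sh r3 hb2.
    apply: ceq_trans (cmapB k cU3 (isc_FF_S hb3) (isc_FF_S hb4)) _ => s v sv.
    rewrite csubE; have := isc_head hb' => /(_ s v); rewrite /c0 => ->; first by rewrite subr0.
    exact: ov_sub (refn_trans r3 rr) _ sv.
  have R1 := rep_eq Db' (rep_D k cU3 rG).
  have R2 := rep_ref cU3 (refn_trans r3 rl) rb.
  have R := rep_lin (-1) cU3 R2 R1.
  have gD : gs (D k G) by exact: FF_D openT gG.
  have hD := isc_ref Sh (refn_trans r3 rl) (isc_D k cU1 hb).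
  have Z : ceq U3 (cadd (cmap (D k) b) (cscale (-1) (cmap (D k) b))) (c0 (n := (size l).+1)).
    by move=> s v _; rewrite /cadd /cscale mulN1r subrr.
  exists G, (fun v => F v + -1 * D k G v); split=> //; last by move=> v; rewrite mulN1r addrC subrK.
  apply: (C1 _ _ _ cU3 _ _ (rep_eq Z R) (nulc0 l _ cU3)); first exact: gsB.
  by move=> s; exact: (sh_zero Sh (@ov_open _ U3 s cU3)).
- move=> U c F cU gF hc [U1 [b [cU1 r1 hb cb rb]]] [G [H [gG sH FE]]].
  have [U2 [b2 [cU2 hb2 db2 rG]]] := B G gG.
  have cc := cov_cap cU1 cU2; have rl : refn (capU U1 U2) U1 := @capUl _ _.
  have rr : refn (capU U1 U2) U2 := @capUr _ _.
  have hb1' := isc_ref Sh rl hb; have hb2' := isc_ref Sh rr hb2.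
  have hbb := iscB Sh cc hb1' hb2'.
  have R := rep_lin (-1) cc (rep_ref cc rl rb) (rep_ref cc rr (rep_D k cU2 rG)).
  have gD : gs (D k G) by exact: FF_D openT gG.
  have R' : rep (capU U1 U2) (cmap (D k) (csub b b2)) (fun v => F v + -1 * D k G v).
    apply: rep_eq R; apply: ceq_sym.
    exact: (cmapB k cc (isc_FF_S hb1') (isc_FF_S hb2')).
  have nl : nulc l (capU U1 U2) (cmap (D k) (csub b b2)).
    apply: (C2 _ _ _ cc (gsB (-1) gF gD) (isc_D k cc hbb) R').
    by apply: span_ext sH => v; rewrite FE mulN1r addrAC subrr add0r.
  have [U3 [b' [cU3 r3 hb' db']]] := adjust lk cc hbb nl.
  exists U3; split=> //; first exact: refn_trans r3 (refn_trans rl r1).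
  exists b' => // s v sv; rewrite db'// cdB (ceq_ref (refn_trans r3 rl) cb sv).
  by rewrite (ceq_ref (refn_trans r3 rr) db2 sv) subr0.
- move=> q U c ql cU hc dc.
  have [U1 [cU1 r1 h]] : nulc l U c.
    (* In the critical degree [size l] the class of c in F_l is represented by some F; since D_k c =
       0, D_k F lies in span l, and so does F by [inj]. *)
    have hc' := isc_tail hc; have [qe|/eqP qe] := eqVneq q (size l); last exact: C3.
    subst q; have [F [U1 [gF cU1 r1 rF]]] := A U c cU hc' dc.
    apply: (nulc_unref r1); have hc1 := isc_ref Sh r1 hc'.
    apply: (C2 _ _ _ cU1 gF hc1 rF); apply: (inj ukl skl gF).
    apply: (C1 _ _ _ cU1 (FF_D k openT gF) (isc_D k cU1 hc1) (rep_D k cU1 rF)).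
    apply: nulc_eq (nulc0 l _ cU1); apply: ceq_sym.
    exact: ceq_ref r1 (isc_head hc).
  case: q c ql hc dc h => [|q] c ql hc dc h; first by exists U1.
  case: h => b hb cb; have hc1 := isc_ref (FF_sheaf _) r1 hc.
  have nl : nulc l U1 (cmap (D k) b).
    apply: C3 => //; [by move=> qe; apply: ql; rewrite /= qe|exact: isc_D|exact: cd_D0 cU1 hc1 hb cb].
  have [U3 [b' [cU3 r3 hb' db']]] := adjust lk cU1 hb nl.
  exists U3; split=> //; first exact: refn_trans r3 r1.
  by exists b' => // s v sv; rewrite db'// (ceq_ref r3 cb sv).
Qed.

Lemma cohomology l : uniq l -> {subset l <= N} -> cohomology_spec l.
Proof.
elim: l => [|k l IH] ul sl; first exact: cohomology_nil.
apply: cohomology_cons => //; apply: IH; first by case/andP: ul.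
by move=> i il; apply: sl; rewrite inE il orbT.
Qed.

End Negative.
End Operators.
End Cech.

(** * The sheaf of smooth quasi-periodic functions on a torus *)

Section Torus.
Variables (R : realType) (g : nat) (Lam : zmodClosed 'rV[Cplx R]_g).
Local Notation C := (Cplx R).
Local Notation V := 'rV[Cplx R]_g.
Local Notation X := (torus Lam).
Local Notation pr := (@torus_proj R g Lam).
Local Notation nrm := (@nrm R).
Local Notation rc := (@rc R).
Local Notation im := (@im R).
Local Notation sl := (@sl R g).
Local Notation Dg := (@Dg R g).
Local Notation smT := (@sm R g setT).
Implicit Types (f h : V -> C) (v w a lam : V) (W : set X) (U : X -> set X) (x : X).

Lemma prE v w : (pr v = pr w) <-> (v - w \in Lam).
Proof. by rewrite Quotient.idealrBE; split=> [|/eqP]; [move=> h; apply/eqP; exact: h|]. Qed.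
Lemma pr_lam v lam : lam \in Lam -> pr (v + lam) = pr v.
Proof. by move=> h; apply/prE; rewrite addrAC subrr add0r. Qed.
Lemma pr_ex (x : X) : exists v, pr v = x.
Proof. by exists (repr x); exact: reprK. Qed.
Lemma pr_open W : open W <-> open (pr @^-1` W).
Proof. by []. Qed.

Definition Bl a (r : R) : set V := [set w : V | forall k, nrm (w 0 k - a 0 k) < r].
Lemma Bl_open a r : open (Bl a r). Proof. exact: open_poly. Qed.
Lemma Bl_center a r : 0 < r -> Bl a r a. Proof. by move=> r0 k; rewrite subrr nrm0. Qed.
Lemma Bl_sub a r r' : r <= r' -> Bl a r `<=` Bl a r'.
Proof. by move=> rr w h k; exact: lt_le_trans (h k) rr. Qed.
Lemma Bl_tri a v w r s : Bl a r v -> Bl v s w -> Bl a (r + s) w.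
Proof.
move=> hv hw k; rewrite (_ : w 0 k - a 0 k = (v 0 k - a 0 k) + (w 0 k - v 0 k)); last by ring.
by rewrite (le_lt_trans (nrmD _ _))// ltrD.
Qed.
Lemma Bl_sym v w s : Bl v s w -> Bl w s v.
Proof. by move=> h k; rewrite nrmB. Qed.
Lemma open_trans (A : set V) lam : open A -> open [set w | A (w + lam)].
Proof.
move=> oA; rewrite openE => w Aw; have /nbhsV[e e0 eA] := open_near oA Aw.
apply/nbhsV; exists e => // u uw; apply: eA => k.
by rewrite !mxE opprD addrACA subrr addr0.
Qed.
Definition PB a r : set X := pr @` Bl a r.
Lemma PBE a r v : PB a r (pr v) <-> exists2 lam, lam \in Lam & Bl a r (v + lam).
Proof.
split=> [[w wB /prE wv]|[lam h hB]].
  by exists (w - v) => //; rewrite addrC subrK.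
by exists (v + lam) => //; exact: pr_lam.
Qed.
Lemma PB_open a r : open (PB a r).
Proof.
apply/pr_open; rewrite openE => v /PBE[lam h hB].
have := open_near (open_trans (lam := lam) (@Bl_open a r)) hB.
by apply: filterS => w hw; apply/PBE; exists lam.
Qed.

Section Periodize.
Variable E : V -> V -> C.
Hypothesis E_sm : forall lam, smT (E lam).
Hypothesis E_neq0 : forall lam v, E lam v != 0.
Hypothesis E_coc : forall lam mu v, lam \in Lam -> mu \in Lam -> E (lam + mu) v = E lam (v + mu) * E mu v.
Hypothesis E_hol : forall k lam v, Dg ci k (E lam) v = 0.

Definition qp W f := forall v lam, lam \in Lam -> W (pr v) -> f (v + lam) = E lam v * f v.
(** The smooth sections over W of the line bundle with factor of automorphy [E], read on C^g. *)
Definition SS W f := sm (pr @^-1` W) f /\ qp W f.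

Lemma E0 v : E 0 v = 1.
Proof.
have h0 : 0 \in Lam by exact: rpred0.
have := E_coc v h0 h0; rewrite !addr0 => /eqP.
by rewrite -{1}[E 0 v]mul1r (inj_eq (mulIf (E_neq0 _ _))) eq_sym => /eqP.
Qed.

Lemma SS_sheaf : sheaf pr SS.
Proof.
split.
- move=> W f h oW fh [sf qf]; split; first by apply: sm_ext sf => //.
  by move=> v lam hl Wv; rewrite -!fh ?pr_lam// qf.
- move=> W W' f WW [sf qf]; split; first by apply: sm_sub sf => v; exact: WW.
  by move=> v lam hl /WW; exact: qf.
- move=> W f h oW [sf qf] [sh qh]; split; first exact: smD.
  by move=> v lam hl Wv; rewrite qf// qh// mulrDr.
- move=> W a f oW [sf qf]; split; first exact: smZ.
  by move=> v lam hl Wv; rewrite qf// mulrCA.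
- move=> W oW; split; first exact: sm_cst.
  by move=> v lam hl Wv; rewrite mulr0.
- move=> W f H; split.
    by move=> n v Wv; have [W' [oW' W'v [sf _]]] := H _ Wv; exact: sf.
  by move=> v lam hl Wv; have [W' [oW' W'v [_ qf]]] := H _ Wv; exact: qf.
Qed.

Lemma DS_loc k W f h : open W -> on pr W f h -> on pr W (Dg ci k f) (Dg ci k h).
Proof. by move=> oW fh v Wv; apply: (@Dg_ext _ _ (pr @^-1` W)). Qed.
Lemma DS_add k W f h : open W -> SS W f -> SS W h ->
  on pr W (Dg ci k (fun v => f v + h v)) (fun v => Dg ci k f v + Dg ci k h v).
Proof. by move=> oW [sf _] [sh _] v Wv; rewrite (DgD _ _ sf sh). Qed.
Lemma DS_scale k W (a : C) f : open W -> SS W f ->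
  on pr W (Dg ci k (fun v => a * f v)) (fun v => a * Dg ci k f v).
Proof. by move=> oW [sf _] v Wv; rewrite (DgZ _ _ _ sf). Qed.

Lemma qp_Dg e k W f v lam : open W -> SS W f -> lam \in Lam -> W (pr v) ->
  Dg e k f (v + lam) = Dg e k (E lam) v * f v + E lam v * Dg e k f v.
Proof.
move=> oW [sf qf] hl Wv; rewrite -Dg_trans.
rewrite (@Dg_ext _ _ (pr @^-1` W) e k _ (fun w => E lam w * f w))//; last by move=> w Ww; rewrite qf.
by rewrite (DgM _ _ (sm_sub (@subsetT _ _) (E_sm lam)) sf).
Qed.
Lemma DS_stable k W f : open W -> SS W f -> SS W (Dg ci k f).
Proof.
move=> oW Sf; split; first by apply: sm_Dg => //; exact: Sf.1.
by move=> v lam hl Wv; rewrite (qp_Dg _ _ oW Sf hl Wv) E_hol mul0r add0r.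
Qed.
Lemma DgC_loc (A : set V) f e e' k j v : open A -> sm A f -> A v ->
  Dg e k (Dg e' j f) v = Dg e' j (Dg e k f) v.
Proof.
move=> oA sf Av; have [h sh hf] := sm_local oA sf Av.
have H e1 k1 e2 k2 : Dg e1 k1 (Dg e2 k2 h) v = Dg e1 k1 (Dg e2 k2 f) v.
  apply: Dg_near; have := near_near hf; apply: filterS => x hx; exact: Dg_near.
by rewrite -!H DgC.
Qed.
Lemma DS_comm k j W f : open W -> SS W f -> on pr W (Dg ci k (Dg ci j f)) (Dg ci j (Dg ci k f)).
Proof. by move=> oW [sf _] v Wv; apply: (@DgC_loc (pr @^-1` W)). Qed.

Section Disc.
Variable dl : R.
Hypothesis disc : forall lam, lam \in Lam -> (forall k, nrm (lam 0 k) < dl) -> lam = 0.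

Lemma lam_uniq a r v lam mu : 2 * r <= dl -> lam \in Lam -> mu \in Lam ->
  Bl a r (v + lam) -> Bl a r (v + mu) -> lam = mu.
Proof.
move=> r2 hl hm Bl1 Bl2; apply/eqP; rewrite -subr_eq0; apply/eqP/disc; first exact: rpredB.
move=> k; have h1 := Bl1 k; have h2 := Bl2 k; rewrite !mxE in h1 h2 *.
rewrite (_ : _ - _ = (v 0 k + lam 0 k - a 0 k) - (v 0 k + mu 0 k - a 0 k)); last by ring.
by rewrite (le_lt_trans (nrmBD _ _))// (lt_le_trans _ r2)// mulrDl !mul1r ltrD.
Qed.

Definition lamof a r v : V := xget 0 [set lam | lam \in Lam /\ Bl a r (v + lam)].
(** For 2 r <= dl the translates of the ball are disjoint, so a function on the ball extends to its
    orbit in just one quasi-periodic way. The value 0 elsewhere is harmless when f vanishes near the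
    boundary of the ball, as in [per_SST]. *)
Definition per a r f v : C :=
  if `[< Bl a r (v + lamof a r v) /\ lamof a r v \in Lam >] then (E (lamof a r v) v)^-1 * f (v + lamof a r v) else 0.

Lemma lamofE a r v lam : 2 * r <= dl -> lam \in Lam -> Bl a r (v + lam) -> lamof a r v = lam.
Proof.
move=> r2 hl hB; rewrite /lamof; case: xgetP => [mu _ [hm hBm]|/(_ lam)]; last by case.
exact: lam_uniq r2 hm hl hBm hB.
Qed.
Lemma per_eq a r f v lam : 2 * r <= dl -> lam \in Lam -> Bl a r (v + lam) ->
  per a r f v = (E lam v)^-1 * f (v + lam).
Proof. by move=> r2 hl hB; rewrite /per (lamofE r2 hl hB) asboolT. Qed.
Lemma per_0 a r f v : (forall lam, lam \in Lam -> ~ Bl a r (v + lam)) -> per a r f v = 0.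
Proof. by move=> h; rewrite /per asboolF// => -[h1 h2]; exact: h h2 h1. Qed.

Lemma per_qp a r f v mu : 2 * r <= dl -> mu \in Lam -> per a r f (v + mu) = E mu v * per a r f v.
Proof.
move=> r2 hm; have [[lam [hl hB]]|H] := pselect (exists lam, lam \in Lam /\ Bl a r (v + lam)).
  have hlm : lam - mu \in Lam by exact: rpredB.
  have vE : v + mu + (lam - mu) = v + lam by rewrite [lam - mu]addrC addrA addrK.
  rewrite (per_eq f r2 hl hB) (@per_eq a r f (v + mu) (lam - mu))//; last by rewrite vE.
  rewrite vE; have := E_coc v hlm hm; rewrite subrK => ->.
  have := E_neq0 (lam - mu) (v + mu); have := E_neq0 mu v => n1 n2.
  by field; rewrite n1 n2.
rewrite !per_0 ?mulr0// => lam hl hB; apply: H; first by exists lam.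
by exists (mu + lam); split; [exact: rpredD|rewrite addrA].
Qed.

Lemma per_near a r f v lam : 2 * r <= dl -> lam \in Lam -> Bl a r (v + lam) ->
  \forall w \near nbhs v, (E lam w)^-1 * f (w + lam) = per a r f w.
Proof.
move=> r2 hl hB; have := open_near (open_trans (lam := lam) (@Bl_open a r)) hB.
by apply: filterS => w hw; rewrite (per_eq f r2 hl hw).
Qed.
Lemma per_smo a r f v lam n : 2 * r <= dl -> lam \in Lam -> Bl a r (v + lam) -> sm (Bl a r) f ->
  smo n (per a r f) v.
Proof.
move=> r2 hl hB sf; apply: smo_near (per_near f r2 hl hB) _.
have oA := open_trans (lam := lam) (@Bl_open a r).
have sV := smV oA (sm_sub (@subsetT _ _) (E_sm lam)) (fun w _ => E_neq0 lam w).
have sf' : sm [set w | Bl a r (w + lam)] (fun w => f (w + lam)).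
  by move=> m w hw; apply: smo_trans; exact: sf.
exact: (smM oA sV sf' n (v := v) hB).
Qed.
Lemma per_Dg a r f v lam k : 2 * r <= dl -> lam \in Lam -> Bl a r (v + lam) -> sm (Bl a r) f ->
  Dg ci k (per a r f) v = (E lam v)^-1 * Dg ci k f (v + lam).
Proof.
move=> r2 hl hB sf; rewrite -(Dg_near _ _ (per_near f r2 hl hB)).
have oA := open_trans (lam := lam) (@Bl_open a r).
have sE : sm [set w | Bl a r (w + lam)] (E lam) := sm_sub (@subsetT _ _) (E_sm lam).
have sV := smV oA sE (fun w _ => E_neq0 lam w).
have sf' : sm [set w | Bl a r (w + lam)] (fun w => f (w + lam)).
  by move=> m w hw; apply: smo_trans; exact: sf.
rewrite (DgM _ _ sV sf' hB) Dg_trans.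
suff -> : Dg ci k (fun w => (E lam w)^-1) v = 0 by rewrite mul0r add0r.
have := DgM ci k sE sV hB; rewrite E_hol mul0r add0r.
rewrite (@Dg_ext _ _ _ ci k _ (fun=> 1) v oA)//; last by move=> w _; rewrite divff.
by rewrite Dg_cst => /esym/eqP; rewrite mulf_eq0 (negPf (E_neq0 _ _)) => /eqP.
Qed.
Lemma per_SS a r f : 2 * r <= dl -> sm (Bl a r) f -> SS (PB a r) (per a r f).
Proof.
move=> r2 sf; split=> [n v /PBE[lam hl hB]|v lam hl _]; first exact: (per_smo n r2 hl hB sf).
exact: per_qp.
Qed.
Lemma per_supp a r r' f v : 2 * r <= dl -> r' < r ->
  (forall v k, Bl a r v -> r' <= nrm (v 0 k - a 0 k) -> f v = 0) ->
  ~ PB a r (pr v) -> \forall w \near nbhs v, per a r f w = 0.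
Proof.
move=> r2 rr f0 H.
apply/nbhsV; exists (r - r') => [|w wv]; first by rewrite subr_gt0.
have [[lam [hl hB]]|H'] := pselect (exists lam, lam \in Lam /\ Bl a r (w + lam)); last first.
  by rewrite per_0// => lam hl hB; apply: H'; exists lam.
rewrite (per_eq f r2 hl hB).
have [h|/existsNP[k]] := pselect (Bl a r' (w + lam)); last first.
  by move=> /negP; rewrite -leNgt => h; rewrite (f0 _ k hB h) mulr0.
case: H; apply/PBE; exists lam => // k; rewrite (_ : r = r' + (r - r')); last by ring.
apply: (Bl_tri h) => j; rewrite !mxE nrmB.
by rewrite (_ : _ - _ = w 0 j - v 0 j) ?wv//; ring.
Qed.
Lemma per_SST a r r' f : 2 * r <= dl -> r' < r -> sm (Bl a r) f ->
  (forall v k, Bl a r v -> r' <= nrm (v 0 k - a 0 k) -> f v = 0) -> SS setT (per a r f).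
Proof.
move=> r2 rr sf f0; split=> [n v _|v lam hl _]; last exact: per_qp.
have [/PBE[lam hl hB]|H] := pselect (PB a r (pr v)); first exact: (per_smo n r2 hl hB sf).
apply: smo_near (sm_cst 0 openT n (v := v) I).
by apply: filterS (per_supp r2 rr f0 H) => w ->.
Qed.

End Disc.
End Periodize.

(** * Compactness, partitions of unity and local solvability *)

Section Global.
Variables (E : V -> V -> C).
Hypothesis E_sm : forall lam, smT (E lam).
Hypothesis E_neq0 : forall lam v, E lam v != 0.
Hypothesis E_coc : forall lam mu v, lam \in Lam -> mu \in Lam -> E (lam + mu) v = E lam (v + mu) * E mu v.
Hypothesis E_hol : forall k lam v, Dg ci k (E lam) v = 0.
Variables (dl rho : R).
Hypothesis dl0 : 0 < dl.
Hypothesis disc : forall lam, lam \in Lam -> (forall k, nrm (lam 0 k) < dl) -> lam = 0.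
Hypothesis cocpt : forall v, exists2 lam, lam \in Lam & forall k, nrm ((v + lam) 0 k) <= rho.
Local Notation SE := (SS E).

(** Squares rather than discs, because a square is the continuous image of a product of two
    intervals. *)
Definition sq (p : R) : set C := (fun z : R * R => rc z.1 + ci * rc z.2) @` (`[- p, p] `*` `[- p, p]).
Lemma sq_compact p : compact (sq p).
Proof.
apply: continuous_compact; last by apply: compact_setX; exact: segment_compact.
apply: continuous_subspaceT => z; apply: for_cont.
apply: c_add; first by apply: cvg_rc; exact: cvg_fst.
by apply: c_mul; [exact: c_cst|apply: cvg_rc; exact: cvg_snd].
Qed.
Lemma sq_le p z : nrm z <= p -> sq p z.
Proof.
move=> zp; exists (re z, im z); last by rewrite -cE.
split; rewrite /= in_itv /= -ler_norml; apply: le_trans zp; [exact: re_le|exact: im_le].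
Qed.
Definition KV (p : R) : set V := [set v | forall i, sq p (v ord0 i)].
Lemma KV_compact p : compact (KV p).
Proof. by apply: (@rV_compact _ _ (fun=> sq p)) => i; exact: sq_compact. Qed.
Lemma cpt_bounded (A : set V) f : compact A -> continuous f -> exists2 M : R, 0 <= M & forall v, A v -> nrm (f v) <= M.
Proof.
move=> cA cf; have cn : continuous (fun v => nrm (f v)).
  by move=> v; apply: for_cont; apply: cvg_nrm; exact: cf.
have ci' : compact ((fun v => nrm (f v)) @` A).
  by apply: continuous_compact cA; exact: continuous_subspaceT.
have [M [_ hM]] := compact_bounded ci'.
exists (`|M| + 1) => [|v Av]; first by rewrite addr_ge0.
have lt : M < `|M| + 1 by rewrite (le_lt_trans (ler_norm _))// ltrDl.
by have := hM _ lt (nrm (f v)) (ex_intro2 _ _ v Av erefl); apply: le_trans; exact: ler_norm.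
Qed.
Lemma cov_KV v : exists2 lam, lam \in Lam & KV rho (v + lam).
Proof. by have [lam hl h] := cocpt v; exists lam => // i; exact: sq_le. Qed.
Lemma pr_cont : continuous pr.
Proof. exact/continuousP. Qed.
Lemma X_compact : compact [set: X].
Proof.
have -> : [set: X] = pr @` KV rho.
  apply/seteqP; split=> // x _; have [v <-] := pr_ex x; have [lam hl h] := cov_KV v.
  by exists (v + lam) => //; exact: pr_lam.
by apply: continuous_compact (@KV_compact rho); apply: continuous_subspaceT; exact: pr_cont.
Qed.

Definition bmpR a (p : R) v : R := \prod_k cutr (nrm (v 0 k - a 0 k) ^+ 2 / p ^+ 2).
Lemma bmp_rc a p v : bmp a p v = rc (bmpR a p v).
Proof. by rewrite /bmp /bmpR rmorph_prod. Qed.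
Lemma bmpR_ge0 a p v : 0 <= bmpR a p v.
Proof. by apply: prodr_ge0 => k _; exact: cutr_ge0. Qed.
(** The trivial factor of automorphy: with it [per] produces functions on the torus, out of which
    the partition of unity is made. *)
Definition one : V -> V -> C := fun _ _ => 1.
Lemma one_sm lam : smT (one lam). Proof. by apply: sm_cst; exact: openT. Qed.
Lemma one_neq0 lam v : one lam v != 0. Proof. exact: oner_neq0. Qed.
Lemma one_coc lam mu v : lam \in Lam -> mu \in Lam -> one (lam + mu) v = one lam (v + mu) * one mu v.
Proof. by rewrite /one mulr1. Qed.

Lemma small_ball U x (m : R) : 0 < m -> cov U -> exists r, [/\ 0 < r, m * r <= dl & Bl (repr x) (m * r) `<=` pr @^-1` U x].
Proof.
move=> m0 cU; have [oU Ux] := cU x.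
have := open_near (_ : open (pr @^-1` U x)) (_ : (pr @^-1` U x) (repr x)).
rewrite /= (_ : pr (repr x) = x); last exact: reprK.
move=> /(_ oU Ux) /nbhsV[e e0 eU].
have d0 : 0 < Num.min e dl by rewrite lt_min e0.
have mE : m * (Num.min e dl / m) = Num.min e dl by rewrite mulrC divfK// gt_eqF.
exists (Num.min e dl / m); rewrite mE; split; first by rewrite divr_gt0.
  by rewrite ge_min lexx orbT.
by move=> w hw; apply: eU => k; rewrite (lt_le_trans (hw k))// ge_min lexx.
Qed.

Definition beta a r := per one a r (bmp a (r / 2)).
Section Beta.
Variables (a : V) (r : R).
Hypotheses (r0 : 0 < r) (r2 : 2 * r <= dl).
Lemma beta_supp0 v k : Bl a r v -> 3 / 4 * r <= nrm (v 0 k - a 0 k) -> bmp a (r / 2) v = 0.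
Proof.
move=> _ h; apply: (@bmp0 _ _ _ _ _ k); first by rewrite divr_gt0.
apply: (@le_trans _ _ ((3 / 4 * r) ^+ 2)).
  by rewrite !exprMn exprVn -subr_ge0 (_ : _ - _ = r ^+ 2 / 16) ?divr_ge0 ?sqr_ge0//; field.
by rewrite lerXn2r// nnegrE ?nrm_ge0// mulr_ge0 ?ltW//; lra.
Qed.
Lemma r34 : 3 / 4 * r < r. Proof. by rewrite gtr_pMl//; lra. Qed.
Lemma beta_SS : SS one setT (beta a r).
Proof.
apply: (per_SST one_sm one_neq0 one_coc disc r2 r34 _ beta_supp0).
by apply: sm_sub (@sm_bmp _ _ a (r / 2)).
Qed.
Lemma beta_near0 v : ~ PB a r (pr v) -> \forall w \near nbhs v, beta a r w = 0.
Proof. by move=> h; apply: (per_supp one disc r2 r34 beta_supp0 h). Qed.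
Lemma beta_ge0 v : exists2 t : R, 0 <= t & beta a r v = rc t.
Proof.
rewrite /beta /per; case: asboolP => _; last by exists 0.
by rewrite invr1 mul1r bmp_rc; eexists; last reflexivity; exact: bmpR_ge0.
Qed.
Lemma beta_pos v : PB a (r / 2) (pr v) -> beta a r v = 1.
Proof.
move=> /PBE[lam hl hB]; have hB' : Bl a r (v + lam) by apply: Bl_sub hB; rewrite ler_pdivrMr// ler_pMr//; lra.
rewrite /beta (per_eq one disc _ r2 hl hB') invr1 mul1r bmp1 ?divr_gt0// => k.
exact: ltW.
Qed.
End Beta.

Lemma partition_of_unity U : cov U -> exists (s : seq X) (chi : X -> V -> C),
  [/\ forall v, \sum_(x <- s) chi x v = 1, forall x v, chi x v != 0 -> U x (pr v) &
    forall x W f, open W -> SE (U x `&` W) f -> SE W (fun v => chi x v * f v)].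
Proof.
move=> cU; have /choice[r rP] : forall x, exists r, [/\ 0 < r, 2 * r <= dl & Bl (repr x) (2 * r) `<=` pr @^-1` U x].
  by move=> x; apply: small_ball.
have := X_compact; rewrite compact_cover => /(_ _ setT (fun x => PB (repr x) (r x / 2))).
case=> [x _|x _|D _ Dc]; first exact: PB_open.
  exists x => //; exists (repr x); last exact: reprK.
  by apply: Bl_center; have [r0 _ _] := rP x; rewrite divr_gt0.
pose s : seq X := finmap.enum_fset D; pose be x := beta (repr x) (r x).
pose tot v := \sum_(x <- s) be x v.
(* All terms are nonnegative reals, and the bump whose half-size ball contains the point equals
   1. *)
have totP v : exists2 t : R, 0 < t & tot v = rc t.
  have [x /= xD xB] := Dc (pr v) I.
  have H (u : seq X) : exists2 t : R, 0 <= t & \sum_(x <- u) be x v = rc t.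
    elim: u => [|y u [t t0 tE]]; first by exists 0; rewrite ?big_nil.
    have [t' t'0 tE'] := beta_ge0 (repr y) (r y) v.
    by exists (t' + t); rewrite ?addr_ge0// big_cons tE rcD -tE'.
  have [r0 r2 _] := rP x; have b1 := beta_pos r0 r2 xB.
  have [t t0 tE] := H (rem x s); exists (1 + t); first by rewrite ltr_wpDr.
  have xs : x \in s by [].
  by rewrite /tot (big_rem x xs)/= tE rcD /be b1.
have tot0 v : tot v != 0 by have [t t0 ->] := totP v; rewrite rc_eq0 gt_eqF.
have bS x : SS one setT (be x) by have [r0 r2 _] := rP x; exact: beta_SS.
have totS : SS one setT tot by apply: (sh_sum (SS_sheaf one) s openT bS).
have chiS x : smT (fun v => be x v / tot v).
  apply: smM; [exact: openT|exact: (bS x).1|].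
  by apply: smV; [exact: openT|exact: totS.1|move=> v _; exact: tot0].
have bU x v : be x v != 0 -> U x (pr v).
  have [r0 r2 rU] := rP x; move=> b0; apply: contrapT => nU.
  have nPB : ~ PB (repr x) (r x) (pr v).
    move=> /PBE[lam hl hB]; apply: nU; rewrite -(pr_lam v hl); apply: rU.
    by apply: Bl_sub hB; rewrite ler_pMl//; lra.
  by have /nbhs_singleton b0' := beta_near0 r0 r2 nPB; rewrite /be b0' eqxx in b0.
exists s, (fun x v => be x v / tot v); split.
- by move=> v; rewrite -mulr_suml -/(tot v) divff.
- by move=> x v; rewrite mulf_eq0 negb_or => /andP[/bU].
- move=> x W f oW [sf qf]; split.
    move=> n v Wv; have [Uv|nU] := pselect (U x (pr v)).
      have oA : open (pr @^-1` (U x `&` W)) by apply: openI oW; exact: (cU x).1.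
      have sx : sm (pr @^-1` (U x `&` W)) (fun w => be x w / tot w) := sm_sub (@subsetT _ _) (chiS x).
      by apply: (smM oA sx sf); split.
    apply: smo_near (sm_cst 0 openT n (v := v) I).
    have [r0 r2 rU] := rP x.
    have nPB : ~ PB (repr x) (r x) (pr v).
      move=> /PBE[lam hl hB]; apply: nU; rewrite -(pr_lam v hl); apply: rU.
      by apply: Bl_sub hB; rewrite ler_pMl//; lra.
    by apply: filterS (beta_near0 r0 r2 nPB) => w bw; rewrite /be bw mul0r mul0r.
  move=> v lam hl Wv.
  have qb := (bS x).2 v lam hl I; have qt := totS.2 v lam hl I; rewrite /one !mul1r in qb qt.
  rewrite qb qt; have [b0|b0] := eqVneq (be x v) 0; first by rewrite b0 !mul0r mulr0.
  have UW : (U x `&` W) (pr v) by exact: (Logic.conj (bU x v b0) Wv).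
  by rewrite (qf v lam hl UW) mulrCA.
Qed.

Lemma acyc_SE : acyc pr SE.
Proof. by apply: (acyc_soft (SS_sheaf E)) => U cU; exact: partition_of_unity. Qed.

(** Functions of compact support satisfy the growth bound for any weights. Positive ones make [Gk] a
    right inverse of d/dconj(v_k), so the Green operator also solves the equation locally. *)
Definition w1 : 'I_g -> R := fun=> 1.
Lemma wt1_ge0 v : 0 <= wt w1 v.
Proof. by apply: sumr_ge0 => i _; rewrite mul1r sqr_ge0. Qed.
Lemma Gr_cpt f a (s : R) : smT f -> (forall v k, s < nrm (v 0 k - a 0 k) -> f v = 0) -> Gr w1 f.
Proof.
pose p := \sum_i nrm (a 0 i) + `|s|.
have G f' : smT f' -> (forall v k, s < nrm (v 0 k - a 0 k) -> f' v = 0) -> gb w1 f'.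
  move=> sf f0; have [M M0 hM] := cpt_bounded (@KV_compact p) (smT_cont sf).
  exists M, 0%N => v; rewrite expr0 mulr1.
  have [[k h]|/forallNP H] := pselect (exists k, s < nrm (v 0 k - a 0 k)).
    by rewrite (f0 v k h) nrm0 mulr_ge0 ?expR_ge0.
  apply: (@le_trans _ _ M); last by rewrite ler_peMr// -expR0 ler_expR wt1_ge0.
  apply: hM => k; apply: sq_le; have /negP := H k; rewrite -leNgt => h.
  rewrite -[v ord0 k](subrK (a 0 k)) (le_trans (nrmD _ _))// addrC lerD//.
    by rewrite (bigD1 k)//= lerDl; apply: sumr_ge0 => i _; exact: nrm_ge0.
  exact: le_trans h (ler_norm _).
move=> sf f0; split=> // n; elim: n f sf f0 => [|n IH] f sf f0; first by split=> //; exact: G.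
split; first exact: G.
move=> d; apply: IH; first exact: sm_pd.
move=> v k sv; rewrite (@pd_near _ _ d f (fun=> 0)) ?pd_cst//.
have : (fun x : V => nrm (x 0 k - a 0 k)) @ nbhs v --> nrm (v 0 k - a 0 k).
  by apply: cvg_nrm; apply: c_add; [apply: v_entry; exact: cvg_id|exact: c_cst].
move=> /cvgR/(_ (nrm (v 0 k - a 0 k) - s)); rewrite subr_gt0 => /(_ sv).
apply: filterS => x; rewrite ltr_norml => /andP[h _]; apply: (f0 x k).
by move: h; set A := nrm _; set B := nrm _; lra.
Qed.

Lemma Dg_indep e i f v : (forall z, f (sl i v z) = f v) -> Dg e i f v = 0.
Proof.
move=> fi; have H b : pd (i, b) f v = 0.
  by apply: pdP; apply: cder_ext (cder_cst (f v) 0) => t; rewrite /curve fi.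
by rewrite DgE !H mulr0 addr0 mulr0.
Qed.

Lemma Dg_bmp a r v i : 0 < r -> nrm (v 0 i - a 0 i) < r -> Dg ci i (bmp a r) v = 0.
Proof.
move=> r0 vi.
have near_i : nbhs v [set w : V | \prod_(k | k != i) cut k (a 0 k) r w = bmp a r w].
  have : (fun x : V => nrm (x 0 i - a 0 i)) @ nbhs v --> nrm (v 0 i - a 0 i).
    by apply: cvg_nrm; apply: c_add; [apply: v_entry; exact: cvg_id|exact: c_cst].
  move=> /cvgR/(_ (r - nrm (v 0 i - a 0 i))); rewrite subr_gt0 => /(_ vi).
  apply: filterS => x; rewrite ltr_norml => /andP[_ h].
  rewrite /= /bmp [RHS](bigD1 i)//= cut1 ?mul1r//.
  by move: h; set A := nrm _; set B := nrm _; lra.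
rewrite -(Dg_near ci i near_i); apply: Dg_indep => z; apply: eq_bigr => k ki.
by rewrite /cut slE (negPf ki) mul0r addr0.
Qed.

(** Cut f off and apply the Green operator in the coordinate k. For i != k it commutes with
    [Dg ci i], which kills the cut off function along the whole slice in direction k through a point
    of the small ball, because [bmp] is a product of cutoffs in single coordinates and the i-th one
    is locally 1. *)
Lemma local_solve a r f k (J : seq 'I_g) : 0 < r -> k \notin J -> sm (Bl a (2 * r)) f ->
  (forall i v, i \in J -> Bl a (2 * r) v -> Dg ci i f v = 0) ->
  exists h, [/\ smT h, forall v, Bl a r v -> Dg ci k h v = f v &
    forall i v, i \in J -> Bl a r v -> Dg ci i h v = 0].
Proof.
move=> r0 kJ sf Df; pose F v := bmp a r v * f v.
have sF : smT F by exact: sm_bmpM.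
have F0 v j : 2 * r < nrm (v 0 j - a 0 j) -> F v = 0.
  move=> h; rewrite /F (nbhs_singleton (bmp_near0 r0 (ltW h))) mul0r//.
have GF := Gr_cpt sF F0.
have c0 : w1 k != 0 by exact: oner_neq0.
exists (Gk w1 k F 0); split.
- exact: (Gk_sm c0 0 GF).
- move=> v vB; rewrite (Dg_Gk c0 _ _ _ _ GF) eqxx mul1r (Gk_dbar c0 _ GF) /cA /w1 ler01 ciM.
  rewrite mulN1r mulNr addrK /F bmp1 ?mul1r//.
  by move=> j; rewrite ltW.
- move=> i v iJ vB; have ik : i != k by apply: contraNneq kJ => <-.
  rewrite (Dg_Gk c0 _ _ _ _ GF) (negPf ik) !mul0r addr0.
  have Z z : Dg ci i F (sl k v z) = 0.
    set w := sl k v z; have wi j : j != k -> nrm (w 0 j - a 0 j) < r.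
      by move=> jk; rewrite slE (negPf jk) mul0r addr0.
    have [wk|wk] := ltrP (nrm (w 0 k - a 0 k)) (2 * r).
      have wB : Bl a (2 * r) w.
        move=> j; have [->//|jk] := eqVneq j k.
        by rewrite (lt_le_trans (wi j jk))// ler_peMl ?ltW//; lra.
      rewrite (DgM _ _ (sm_sub (@subsetT _ _) (@sm_bmp _ _ a r)) sf wB) Dg_bmp ?wi//.
      by rewrite Df// mul0r mulr0 addr0.
    rewrite (@Dg_near _ _ ci i F (fun=> 0)) ?Dg_cst//.
    by apply: filterS (bmp_near0 r0 wk) => x bx; rewrite /F bx mul0r.
  have GD := Gr_Dg ci i GF.
  rewrite (@eq_Gk _ _ w1 k _ (fun v => 0 * Dg ci i F v) 0 v).
    by rewrite (GkZ c0 _ _ _ GD) mul0r.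
  by move=> z; rewrite Z mul0r.
Qed.

Lemma lifts_SE k J : k \notin J -> lifts pr (Dg ci) SE k J.
Proof.
move=> kJ n U e cU he.
have /choice[r rP] : forall x, exists r, [/\ 0 < r, 4 * r <= dl & Bl (repr x) (4 * r) `<=` pr @^-1` U x].
  by move=> x; apply: small_ball.
pose U' x := PB (repr x) (r x).
have cU' : cov U'.
  move=> x; split; first exact: PB_open.
  exists (repr x); last exact: reprK.
  by apply: Bl_center; have [] := rP x.
have r' : refn U' U.
  move=> x _ [v vB <-]; have [r0 _ rU] := rP x; apply: rU; apply: Bl_sub vB.
  by rewrite ler_peMl ?ltW//; lra.
have key (s : 'I_n.+1 -> X) : exists h, FF pr (Dg ci) SE J (ov U' s) h /\
    forall v, ov U' s (pr v) -> Dg ci k h v = e s v.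
  have [[y yov]|nov] := pselect (exists y, ov U' s y); last first.
    exists (fun=> 0); split; last by move=> v h; case: nov; exists (pr v).
    split=> [|i iJ v h]; last by case: nov; exists (pr v).
    by split=> [n' v h|v lam hl h]; case: nov; exists (pr v).
  (* The ball of least radius r0 among those of the tuple: its double lies in every U (s j), because
     r (s j) + 3 * r0 <= 4 * r (s j). *)
  pose k0 := [arg min_(j < ord0) r (s j)]%O.
  have k0P j : r (s k0) <= r (s j) by rewrite /k0; case: arg_minP => // i _; apply.
  set a : V := repr (s k0); set r0 := r (s k0).
  have [r00 r4 rU] := rP (s k0).
  have [w wB wy] := yov k0; rewrite -wy in yov.
  have sub : Bl a (2 * r0) `<=` pr @^-1` ov U s.
    move=> u uB j; have /PBE[mu hm hB] := yov j.
    have [rj0 _ rjU] := rP (s j); rewrite -(pr_lam u hm); apply: rjU.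
    have h1 : Bl w (3 * r0) u.
      move=> i; have := (Bl_tri (Bl_sym wB) uB) i; rewrite (_ : r0 + 2 * r0 = 3 * r0)//; ring.
    apply: (@Bl_sub _ (r (s j) + 3 * r0)); last first.
      by apply: (Bl_tri hB) => i; rewrite !mxE opprD addrACA subrr addr0; exact: h1.
    by have := k0P j; rewrite -/r0; lra.
  have [[sf qf] Df] := he s.
  have [h [sh hk hJ]] := @local_solve a r0 (e s) k J r00 kJ (sm_sub sub sf) (fun i v iJ vB => Df i iJ v (sub v vB)).
  have r2 : 2 * r0 <= dl by apply: le_trans r4; rewrite ler_wpM2r ?ltW//; lra.
  have sh' : sm (Bl a r0) h := sm_sub (@subsetT _ _) sh.
  have ovP : ov U' s `<=` PB a r0 by move=> x /(_ k0).
  exists (per E a r0 h); split; last first.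
    move=> v vov; have /PBE[lam hl hB] := ovP _ vov.
    rewrite (per_Dg E_sm E_neq0 E_hol disc k r2 hl hB sh') hk// qf//; last by apply: ov_sub vov.
    by rewrite mulrA mulVf ?mul1r.
  split; first by apply: (sh_sub (SS_sheaf E) ovP); exact: (per_SS E_sm E_neq0 E_coc disc r2 sh').
  move=> i iJ v vov; have /PBE[lam hl hB] := ovP _ vov.
  by rewrite (per_Dg E_sm E_neq0 E_hol disc i r2 hl hB sh') hJ// mulr0.
have [e' e'P] := choice key.
exists U', e'; split=> //.
- by move=> s; exact: (e'P s).1.
- by move=> s v sv; exact: (e'P s).2.
Qed.

End Global.
End Torus.

(** * Cohomology on the torus *)

Section Weighted.
Variables (R : realType) (g : nat) (Lam : zmodClosed 'rV[Cplx R]_g).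
Local Notation C := (Cplx R).
Local Notation V := 'rV[Cplx R]_g.
Local Notation X := (torus Lam).
Local Notation pr := (@torus_proj R g Lam).
Local Notation nrm := (@nrm R).
Local Notation rc := (@rc R).
Local Notation im := (@im R).
Local Notation re := (@re R).
Local Notation sl := (@sl R g).
Local Notation Dg := (@Dg R g).
Local Notation smT := (@sm R g setT).
Implicit Types (f h F H : V -> C) (v w a lam : V) (W : set X) (U : X -> set X) (x : X).
Variables (cw : 'I_g -> R) (ka : V -> C) (dl rho : R).
Hypothesis c0 : forall k, cw k != 0.
Hypothesis ka_neq0 : forall lam, ka lam != 0.
Hypothesis dl0 : 0 < dl.
Hypothesis disc : forall lam, lam \in Lam -> (forall k, nrm (lam 0 k) < dl) -> lam = 0.
Hypothesis cocpt : forall v, exists2 lam, lam \in Lam & forall k, nrm ((v + lam) 0 k) <= rho.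
Local Notation wt := (wt cw).
Local Notation Gr := (Gr cw).
Local Notation Gk := (Gk cw).

Definition Ew lam v : C := ka lam * ex (- (2 * ci * \sum_i rc (cw i) * rc (im (lam 0 i)) * v 0 i)).
Hypothesis Ew_coc : forall lam mu v, lam \in Lam -> mu \in Lam -> Ew (lam + mu) v = Ew lam (v + mu) * Ew mu v.
Hypothesis nrm_Ew : forall lam v, lam \in Lam -> nrm (Ew lam v) = expR (wt (v + lam) - wt v).
Local Notation SE := (@SS R g Lam Ew).

Lemma Ew_neq0 lam v : Ew lam v != 0.
Proof. by rewrite mulf_neq0// ex_neq0. Qed.
Lemma Ew_sl k lam v z : Ew lam (sl k v z) = Ew lam v * ex (- (2 * ci * rc (cw k) * rc (im (lam 0 k))) * z).
Proof.
rewrite /Ew -[RHS]mulrA -exD; congr (_ * ex _); rewrite [in LHS](bigD1 k)//= [in RHS](bigD1 k)//=.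
rewrite (eq_bigr (fun i => rc (cw i) * rc (im (lam 0 i)) * v 0 i)) => [|i ik].
  by rewrite slE eqxx mul1r; ring.
by rewrite slE (negPf ik) mul0r addr0.
Qed.
Lemma xder_Ew k lam v : xder (fun z => Ew lam (sl k v z)) 0 (- (2 * ci * rc (cw k) * rc (im (lam 0 k))) * Ew lam v).
Proof.
set b := - _.
have -> : (fun z => Ew lam (sl k v z)) = (fun z => Ew lam v * ex (b * z)) by apply/funext => z; exact: Ew_sl.
have -> : b * Ew lam v = Ew lam v * (ex (b * 0) * (b * 1)) by rewrite mulr0 ex0 mul1r mulr1 mulrC.
apply: xderZ; exact: (xder_comp (xderZ b (xder_id 0)) (xder_ex _)).
Qed.
Lemma Ew_cont lam : continuous (Ew lam).
Proof.
move=> v; apply: for_cont; apply: c_mul; first exact: c_cst.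
apply: c_ex; apply: c_opp; apply: c_mul; first exact: c_cst.
apply: c_sum => i; apply: c_mul; first exact: c_cst.
by apply: v_entry; exact: cvg_id.
Qed.
Lemma Ew_hol_sm lam : smT (Ew lam) /\ forall k v, setT v -> Dg ci k (Ew lam) v = 0.
Proof.
apply: sepholo_sm; first exact: openT.
by move=> v _; split=> [|k]; [exact: Ew_cont|eexists; exact: xder_Ew].
Qed.
Lemma Ew_sm lam : smT (Ew lam). Proof. exact: (Ew_hol_sm lam).1. Qed.
Lemma Ew_hol k lam v : Dg ci k (Ew lam) v = 0. Proof. exact: (Ew_hol_sm lam).2. Qed.

Local Notation DD := (Dg ci).
Lemma SE_sheaf : sheaf pr SE. Proof. exact: SS_sheaf. Qed.
Lemma SE_DS k W f : open W -> SE W f -> SE W (DD k f).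
Proof. exact: (DS_stable Ew_sm Ew_hol). Qed.
Notation fDloc := (@DS_loc R g Lam).
Notation fDD := (@DS_add R g Lam Ew).
Notation fDZ := (@DS_scale R g Lam Ew).
Notation fDC := (@DS_comm R g Lam Ew).
Local Notation FE := (FF pr DD SE).

Definition Ac k f v : C := Dg (- ci) k f v + 2 * rc (cw k) * ci * rc (im (v 0 k)) * f v.
Lemma sm_Ac k (W : set V) f : open W -> sm W f -> sm W (Ac k f).
Proof.
move=> oW sf; apply: smD => //; first exact: sm_Dg.
apply: smM => //; apply: smM => //; first exact: sm_cst.
exact: sm_im.
Qed.
(** Under translation by lam the derivative of the factor contributes - 2 i c Im lam_k, which the
    change of Im v_k in the correction term cancels. *)
Lemma SE_Ac k W f : open W -> SE W f -> SE W (Ac k f).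
Proof.
move=> oW Sf; split; first by apply: sm_Ac => //; exact: Sf.1.
move=> v lam hl Wv; rewrite /Ac (qp_Dg Ew_sm _ _ oW Sf hl Wv) (xder_Dg (xder_Ew k lam v)).2.
by rewrite (Sf.2 v lam hl Wv) mxE imD rcD; ring.
Qed.

Lemma wt_bounded (p : R) : exists2 M : R, 0 <= M & forall v, KV p v -> `|wt v| <= M.
Proof.
have cf : continuous (fun v => rc (wt v)).
  have -> : (fun v => rc (wt v)) = (fun v => \sum_i rc (cw i) * rc (im (v 0 i)) ^+ 2).
    by apply/funext => v; rewrite /wt raddf_sum; apply: eq_bigr => i _ /=; rewrite rcM rcX.
  move=> v; apply: for_cont; apply: c_sum => i; apply: c_mul; first exact: c_cst.
  by apply: c_exp; apply: cvg_rc; apply: cvg_im; apply: v_entry; exact: cvg_id.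
have [M M0 hM] := cpt_bounded (@KV_compact R g p) cf.
by exists M => // v /hM; rewrite nrm_rc.
Qed.

(** By [nrm_Ew] the function exp(- wt) |F| is periodic, so a bound on the compact set [KV rho],
    which meets every orbit, transfers to any other compact set at the cost of bounds for [wt]. *)
Lemma SE_transfer p : exists2 M : R, 0 <= M & forall F B, SE setT F ->
  (forall v, KV rho v -> nrm (F v) <= B) -> forall v, KV p v -> nrm (F v) <= M * B.
Proof.
have [M1 M10 h1] := wt_bounded p; have [M2 M20 h2] := wt_bounded rho.
exists (expR (M1 + M2)) => [|F B [_ qF] FB v pv]; first exact: expR_ge0.
have [lam hl lv] := cov_KV cocpt v.
have := FB _ lv; rewrite (qF v lam hl I) nrmM nrm_Ew// => h.
rewrite -ler_pdivrMl ?expR_gt0// -expRN; apply: le_trans h.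
rewrite ler_wpM2r ?nrm_ge0// ler_expR.
have := h1 _ pv; have := h2 _ lv; rewrite !ler_norml => /andP[? _] /andP[_ ?]; lra.
Qed.
Lemma SE_gb F : SE setT F -> gb cw F.
Proof.
move=> SF; have [M1 M10 h1] := wt_bounded rho.
have [B B0 hB] := cpt_bounded (@KV_compact R g rho) (smT_cont SF.1).
exists (expR M1 * B), 0%N => v; rewrite expr0 mulr1.
have [lam hl lv] := cov_KV cocpt v.
have := hB _ lv; rewrite (SF.2 v lam hl I) nrmM nrm_Ew// => h.
apply: (@le_trans _ _ (expR (M1 + wt v) * B)); last by rewrite expRD mulrAC.
rewrite -ler_pdivrMl ?expR_gt0// -expRN; apply: le_trans h.
rewrite ler_wpM2r ?nrm_ge0// ler_expR.
have := h1 _ lv; rewrite ler_norml => /andP[? _]; lra.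
Qed.
(** Plain partial derivatives destroy quasi-periodicity, while [DD k] and [Ac k] keep it. A partial
    derivative is a combination of these two and of Im v_k F, and each of the three is bounded by
    induction. *)
Lemma SE_Gr F : SE setT F -> Gr F.
Proof.
move=> SF; split; first exact: SF.1.
move=> n; elim: n F SF => [|n IH] F SF; first by split=> //; exact: SE_gb.
split; first exact: SE_gb.
have H (al be : C) k : gr cw n (fun v => al * DD k F v + be * Dg (- ci) k F v).
  have sD e : smT (Dg e k F) by apply: sm_Dg; [exact: openT|exact: SF.1].
  have sA : smT (Ac k F) by apply: sm_Ac; [exact: openT|exact: SF.1].
  have sy : smT (fun v => rc (im (v 0 k)) * F v) by apply: smM; [exact: openT|exact: sm_im openT|exact: SF.1].
  have g1 := grZ al (sD ci) (IH _ (SE_DS k openT SF)).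
  have g2 := IH _ (SE_Ac k openT SF).
  have g3 := grZ (- (2 * rc (cw k) * ci)) sy (gr_y k SF.1 (IH _ SF)).
  have s3 := smZ (- (2 * rc (cw k) * ci)) openT sy.
  have g4 := grZ be (smD openT sA s3) (grD sA s3 g2 g3).
  apply: gr_ext (grD (smZ al openT (sD ci)) (smZ be openT (smD openT sA s3)) g1 g4).
  by move=> v; rewrite /Ac; ring.
move=> [k []].
  apply: gr_ext (H (- ci) ci k) => v; rewrite !DgE.
  rewrite (_ : - ci * _ + _ = - (ci * ci) * (2^-1 * 2) * pd (k, true) F v); last by ring.
  by rewrite ciM opprK mul1r mulVf ?mul1r ?pnatr_eq0.
apply: gr_ext (H 1 1 k) => v; rewrite !DgE.
rewrite (_ : 1 * _ + _ = (2^-1 * 2) * pd (k, false) F v); last by ring.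
by rewrite mulVf ?mul1r ?pnatr_eq0.
Qed.

Lemma SE_Gk k m F : SE setT F -> SE setT (Gk k F m).
Proof.
move=> SF; have GF := SE_Gr SF; split; first exact: (Gk_sm (c0 k) m GF).
move=> v lam hl _; apply: (Gk_trans (c0 k) m v GF) => w.
by rewrite (SF.2 w lam hl I).
Qed.
Lemma Gk_zero k m v : Gk k (fun=> 0) m v = 0.
Proof.
have h := SE_Gr (sh_zero SE_sheaf openT).
rewrite (@eq_Gk _ _ cw k _ (fun v => 0 * 0) m v); last by move=> z; rewrite mul0r.
by rewrite (GkZ (c0 k) _ _ _ h) mul0r.
Qed.
Lemma DD_Gk i k m F v : i != k -> SE setT F -> DD i (Gk k F m) v = Gk k (DD i F) m v.
Proof. by move=> ik /SE_Gr GF; rewrite (Dg_Gk (c0 k) _ _ _ _ GF) (negPf ik) !mul0r addr0. Qed.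
Lemma FE_Gk l k m F : k \notin l -> FE l setT F -> FE l setT (Gk k F m).
Proof.
move=> kl [SF DF]; split; first exact: SE_Gk.
move=> i il v _; rewrite DD_Gk//; last by apply: contraNneq kl => <-.
by rewrite (@eq_Gk _ _ cw k _ (fun=> 0)) ?Gk_zero// => z; exact: DF.
Qed.
Lemma DD_Gk0 k F v : Gr F -> DD k (Gk k F 0) v = F v + (rc (cA cw k) - rc (cw k)) * Gk k F 1 v.
Proof.
move=> GF; rewrite (Dg_Gk (c0 k) _ _ _ _ GF) eqxx mul1r (Gk_dbar (c0 k) _ GF) ciM.
by ring.
Qed.

Lemma onto_pos k l : 0 < cw k -> k \notin l -> onto pr DD SE k l.
Proof.
move=> ck kl F hF; exists (Gk k F 0); first exact: FE_Gk.
by move=> v; rewrite (DD_Gk0 k v (SE_Gr hF.1)) /cA (ltW ck) subrr mul0r addr0.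
Qed.
Lemma lifts_E k l : k \notin l -> lifts pr DD SE k l.
Proof. exact: (lifts_SE Ew_sm Ew_neq0 Ew_coc Ew_hol dl0 disc). Qed.
Lemma acyc_E l : uniq l -> (forall k, k \in l -> 0 < cw k) -> acyc pr (FE l).
Proof.
elim: l => [|k l IH] ul pl.
  move=> n U c cU hc dc.
  have [U' [b [cU' r hb cb]]] := acyc_SE (E := Ew) dl0 disc cocpt cU (fun s => (hc s).1) dc.
  by exists U', b; split=> // s; split.
have /andP[kl ul'] : (k \notin l) && uniq l by [].
apply: (acyc_pos SE_sheaf fDloc fDD fDZ SE_DS fDC).
- exact: lifts_E.
- by apply: onto_pos => //; apply: pl; rewrite inE eqxx.
- by apply: IH => // j jl; apply: pl; rewrite inE jl orbT.
Qed.

Section Spaces.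
Variables (P N : seq 'I_g).
Hypotheses (uP : uniq P) (uN : uniq N).
Hypothesis cP : forall k, k \in P -> 0 < cw k.
Hypothesis cN : forall k, k \in N -> cw k < 0.
Hypothesis PN : forall k, (k \in P) || (k \in N).
Local Notation gs := (FE P setT).
Local Notation span := (span pr DD SE P).

Lemma N_notP k : k \in N -> k \notin P.
Proof. by move=> /cN kN; apply/negP => /cP kP; have := lt_trans kN kP; rewrite ltxx. Qed.
Lemma span_SE l F : span l F -> SE setT F.
Proof.
elim: l F => [|k l IH] F /=.
  by move=> F0; apply: (sh_ext SE_sheaf openT) (sh_zero SE_sheaf openT) => v _; rewrite F0.
move=> [G [H [gG /IH SH FE]]]; apply: (sh_ext SE_sheaf openT) (sh_add SE_sheaf openT (SE_DS k openT gG.1) SH).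
by move=> v _; rewrite FE.
Qed.
Lemma span_Gk k m l F : k \in N -> k \notin l -> span l F -> span l (Gk k F m).
Proof.
move=> kN; elim: l F => [|j l IH] F /= kl.
  by move=> F0 v; rewrite (@eq_Gk _ _ cw k _ (fun=> 0)) ?Gk_zero.
have [jk kl'] : j != k /\ k \notin l by move: kl; rewrite inE negb_or eq_sym => /andP.
move=> [G [H [gG sH FE]]]; exists (Gk k G m), (Gk k H m); split.
- by apply: FE_Gk gG; exact: N_notP.
- exact: IH.
- move=> v; rewrite (DD_Gk _ _ jk gG.1).
  rewrite -(GkD (c0 k) _ _ (SE_Gr (SE_DS j openT gG.1)) (SE_Gr (span_SE sH))).
  by apply: eq_Gk => z; exact: FE.
Qed.
Lemma cA_N k : k \in N -> cA cw k = 0.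
Proof. by move=> /cN; exact: cA_neg. Qed.
(** For c_k < 0, [Gk k] is a left inverse of [DD k], and it maps span l into itself because it
    commutes with the other operators. *)
Lemma inj_neg k l F : uniq (k :: l) -> {subset k :: l <= N} -> gs F -> span l (DD k F) -> span l F.
Proof.
move=> /andP[kl _] sN gF sD; have kN : k \in N by apply: sN; rewrite inE eqxx.
apply: span_ext (span_Gk 0 kN kl sD) => v.
by rewrite (Gk_dbar (c0 k) _ (SE_Gr gF.1)) cA_N// rc0 mul0r addr0.
Qed.
Lemma torus_cohomology : cohomology_spec pr DD SE P N.
Proof.
apply: (cohomology SE_sheaf fDloc fDD fDZ SE_DS fDC (E := P) (N := N)) => //.
- exact: acyc_E.
- move=> k l /andP[kl _] sN; apply: lifts_E; rewrite mem_cat negb_or kl N_notP//.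
  by apply: sN; rewrite inE eqxx.
- exact: inj_neg.
Qed.

(** * Harmonic sections: uniqueness, existence and finite dimension *)

Definition harm F := gs F /\ forall k v, k \in N -> Ac k F v = 0.
Lemma harm_Gk0 k F v : k \in N -> harm F -> Gk k F 0 v = 0.
Proof.
move=> kN [gF AF]; apply: (Gk_cov0 (c0 k) (cN kN) (SE_Gr gF.1)) => z; exact: AF.
Qed.
(** Write F = D_k G + H and apply [Gk k]: a harmonic F goes to 0, so G = - [Gk k H 0]. Substituting
    back gives F = c_k [Gk k H 1], which lies in span l together with H; the list thus shrinks to
    the empty one. *)
Lemma harm_span l F : uniq l -> {subset l <= N} -> harm F -> span l F -> forall v, F v = 0.
Proof.
move=> ul sl hF; elim: l ul sl => [|k l IH] //= /andP[kl ul] sl [G [H [gG sH FE]]].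
have kN : k \in N by apply: sl; rewrite inE eqxx.
apply: IH => //; first by move=> j jl; apply: sl; rewrite inE jl orbT.
have GE v : G v = -1 * Gk k H 0 v.
  have := harm_Gk0 v kN hF.
  rewrite (@eq_Gk _ _ cw k _ (fun v => DD k G v + H v)) => [|z]; last exact: FE.
  rewrite (GkD (c0 k) _ _ (SE_Gr (SE_DS k openT gG.1)) (SE_Gr (span_SE sH))).
  rewrite (Gk_dbar (c0 k) _ (SE_Gr gG.1)) cA_N// rc0 mul0r addr0 => /eqP.
  by rewrite addr_eq0 mulN1r => /eqP.
have -> : F = (fun v => rc (cw k) * Gk k H 1 v).
  apply/funext => v; rewrite FE (_ : G = fun v => -1 * Gk k H 0 v); last exact/funext.
  rewrite (DgZ _ _ _ (SE_Gk k 0 (span_SE sH)).1)// (DD_Gk0 k v (SE_Gr (span_SE sH))) cA_N// rc0; ring.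
have := span_Gk 1 kN kl sH; move: (Gk k H 1) => H'.
move: (rc (cw k)) => b; clear -c0 ka_neq0.
elim: l H' => [|j l IH] H' /=; first by move=> h v; rewrite h mulr0.
move=> [G' [H2 [gG' sH' HE]]]; exists (fun v => b * G' v), (fun v => b * H2 v); split.
- exact: (sh_scale (FF_sheaf SE_sheaf fDloc fDD fDZ _) b openT gG').
- exact: IH.
- by move=> v; rewrite HE mulrDr (DgZ _ _ _ gG'.1.1).
Qed.

(* [Pk k] is the projector F |-> F - D_k G_k F onto ker A_k for c_k < 0, and
   F |-> F - G_k D_k F onto ker D_k for c_k > 0. *)
Definition Pk k F v : C := - rc `|cw k| * Gk k F 1 v.
Lemma SE_Pk k F : SE setT F -> SE setT (Pk k F).
Proof. by move=> SF; apply: (sh_scale SE_sheaf _ openT); exact: SE_Gk. Qed.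
Lemma Pk_neg k F v : k \in N -> Gr F -> F v - Pk k F v = DD k (Gk k F 0) v.
Proof.
move=> kN GF; rewrite (DD_Gk0 k v GF) cA_N// /Pk ltr0_norm ?cN// rcN rc0; ring.
Qed.
Lemma Pk_pos k F v : k \in P -> Gr F -> F v - Pk k F v = Gk k (DD k F) 0 v.
Proof.
move=> kP GF; rewrite (Gk_dbar (c0 k) _ GF) /cA (ltW (cP kP)) /Pk gtr0_norm ?cP//; ring.
Qed.
Lemma FE_Pk l k F : k \notin l -> FE l setT F -> FE l setT (Pk k F).
Proof.
move=> kl hF; apply: (sh_scale (FF_sheaf SE_sheaf fDloc fDD fDZ l) _ openT).
exact: FE_Gk.
Qed.
Lemma DD_Pk k F v : k \in P -> SE setT F -> DD k (Pk k F) v = 0.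
Proof.
move=> kP SF; have SD := SE_DS k openT SF.
have -> : Pk k F = (fun v => F v + -1 * Gk k (DD k F) 0 v).
  by apply/funext => w; rewrite -(Pk_pos w kP (SE_Gr SF)); ring.
rewrite (DgD _ _ SF.1 (smZ _ openT (SE_Gk k 0 SD).1) I) (DgZ _ _ _ (SE_Gk k 0 SD).1 I).
by rewrite (DD_Gk0 k v (SE_Gr SD)) /cA (ltW (cP kP)) subrr; ring.
Qed.
Lemma Ac_Pk k F v : k \in N -> SE setT F -> Ac k (Pk k F) v = 0.
Proof.
move=> kN SF; have GF := SE_Gr SF.
rewrite /Ac (DgZ _ _ _ (SE_Gk k 1 SF).1 I) (Dg_Gk (c0 k) _ _ _ _ GF) eqxx mul1r.
rewrite (_ : - ci * ci * rc (cw k) = rc (cw k)); last by rewrite mulNr ciM opprK mul1r.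
rewrite -[RHS](mulr0 (- rc `|cw k|)) -(Gk_cov (c0 k) (cN kN) v GF) /Pk; ring.
Qed.
Lemma Ac_Pk_other j k F v : j != k -> SE setT F -> Ac j (Pk k F) v = Pk k (Ac j F) v.
Proof.
move=> jk SF; have GF := SE_Gr SF.
have GD : Gr (Dg (- ci) j F) by exact: Gr_Dg.
set b := 2 * rc (cw j) * ci.
have E : Gk k (Ac j F) 1 v = Gk k (fun w => Dg (- ci) j F w + b * rc (im (v 0 j)) * F w) 1 v.
  by apply: eq_Gk => z; rewrite /Ac slE (negPf jk) mul0r addr0.
rewrite /Pk E (GkD (c0 k) _ _ GD (GrZ _ GF)) (GkZ (c0 k) _ _ _ GF).
rewrite /Ac (DgZ _ _ _ (SE_Gk k 1 SF).1 I) (Dg_Gk (c0 k) _ _ _ _ GF) (negPf jk) !mul0r addr0 -/b; ring.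
Qed.

(** Each projector changes the section by an image of [DD k] and preserves the equations obtained
    before, because operators in distinct coordinates commute. *)
Lemma harm_proj l F (H := foldr Pk F l) : uniq l -> {subset l <= N} -> gs F ->
  [/\ gs H, forall k v, k \in l -> Ac k H v = 0 & span l (fun v => F v + -1 * H v)].
Proof.
rewrite {}/H => ul sl gF; elim: l ul sl => [|k l IH] ul sl /=.
  by split=> // v; rewrite mulN1r subrr.
have /andP[kl ul'] := ul; have kN : k \in N by apply: sl; rewrite inE eqxx.
have [|gH AH sH] := IH ul'; first by move=> j jl; apply: sl; rewrite inE jl orbT.
move: (foldr Pk F l) gH AH sH => H gH AH sH; split.
- by apply: FE_Pk gH; exact: N_notP.
- move=> j v; rewrite inE => /orP[/eqP ->|jl]; first exact: (Ac_Pk _ kN gH.1).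
  have jk : j != k by apply: contraNneq kl => <-.
  rewrite (Ac_Pk_other _ jk gH.1) /Pk (@eq_Gk _ _ cw k _ (fun=> 0)) ?Gk_zero ?mulr0// => z.
  exact: AH.
- exists (Gk k H 0), (fun v => F v + -1 * H v); split=> //.
    by apply: FE_Gk gH; exact: N_notP.
  by move=> v; rewrite -(Pk_neg _ kN (SE_Gr gH.1)); ring.
Qed.

Lemma sq_add p q (z w : C) : sq p z -> nrm w <= q -> sq (p + q) (z + w).
Proof.
move=> [[x y] /= [hx hy] <-] wq; exists (x + re w, y + im w); last first.
  by rewrite /= !rcD [in RHS](cE w); ring.
have h1 := le_trans (re_le w) wq; have h2 := le_trans (im_le w) wq.
move: hx hy h1 h2; rewrite /= !in_itv /= !ler_norml => /andP[? ?] /andP[? ?] /andP[? ?] /andP[? ?].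
by split; apply/andP; split; lra.
Qed.
Lemma KV_sl p q k v z : KV p v -> 0 <= q -> nrm z <= q -> KV (p + q) (sl k v z).
Proof.
move=> pv q0 zq i; rewrite slE; apply: sq_add; first exact: pv.
by case: (i == k); rewrite ?mul1r ?mul0r ?nrm0.
Qed.
Lemma KV_im p k v : KV p v -> `|im (v 0 k)| <= p.
Proof.
move=> /(_ k)[[x y] /= [_]]; rewrite in_itv /= => hy <-.
by rewrite (_ : im _ = y) ?ler_norml// !reimE; ring.
Qed.

Definition Cm : R := \sum_i `|cw i|.
Lemma Cm_le k : `|cw k| <= Cm.
Proof. by rewrite /Cm (bigD1 k)//= lerDl; apply: sumr_ge0. Qed.
(* Along a positive direction a harmonic section is holomorphic, along a negative one it
   is antiholomorphic up to the factor exp(2 c y^2); so circle means bound derivatives. *)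
Lemma harm_grad p : exists2 L : R, 0 <= L & forall F B, harm F ->
  (forall v, KV (p + 1) v -> nrm (F v) <= B) -> forall k v, KV p v ->
  nrm (DD k F v) <= L * B /\ nrm (Dg (- ci) k F v) <= L * B.
Proof.
(* M bounds the factor [ex (Th z)] below on the unit circle, where |Th| <= 2 Cm + 2 Cm |p|. *)
pose M := expR (Cm * (2 + 2 * `|p|)).
have M1 : 1 <= M by rewrite -expR0 ler_expR mulr_ge0 ?addr_ge0// ?mulr_ge0//; apply: sumr_ge0.
have Cm0 : 0 <= Cm by apply: sumr_ge0.
exists (M + 2 * Cm * `|p|) => [|F B [[SF DF] AF] FB k v pv].
  by rewrite addr_ge0 ?mulr_ge0// (le_trans _ M1).
have slB z : nrm z <= 1 -> nrm (F (sl k v z)) <= B by move=> z1; apply: FB; exact: (KV_sl k pv).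
have B0 : 0 <= B by apply: le_trans (nrm_ge0 _) (slB 0 _); rewrite nrm0.
have P0 := slice_plz k v SF.1.
have L1 : B <= (M + 2 * Cm * `|p|) * B.
  by rewrite ler_peMl// (le_trans M1)// lerDl mulr_ge0 ?mulr_ge0.
have /orP[kP|kN] := PN k.
  split; first by rewrite (DF k kP v I) nrm0; exact: le_trans B0 L1.
  apply: le_trans L1; have := @hol_deriv_le _ _ _ _ B P0 (fun z => DF k kP _ I).
  by rewrite sl0; apply=> z z1; apply: slB; rewrite z1.
have yp : `|im (v 0 k)| <= `|p| by apply: le_trans (KV_im k pv) (ler_norm _).
split; last first.
  have /eqP := AF k v kN; rewrite addr_eq0 => /eqP ->; rewrite nrmN !nrmM nrm_ci mulr1 !nrm_rc.
  apply: (@le_trans _ _ ((2 * Cm * `|p|) * B)); last by rewrite ler_wpM2r// lerDr (le_trans _ M1).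
  have -> : nrm 2 = 2 by rewrite -rc_nat nrm_rc ger0_norm.
  have FvB : nrm (F v) <= B by rewrite -[v](sl0 k); apply: slB; rewrite nrm0.
  by rewrite ler_pM ?mulr_ge0 ?nrm_ge0// ler_pM ?mulr_ge0// ler_wpM2l// Cm_le.
pose b := rc (cw k); pose y := rc (im (v 0 k)).
(* The z-derivative of Th is 2 i c (y + Im z), so d/dz of F ex(Th) is (A_k F) ex(Th) = 0 and the
   product is antiholomorphic. As Th and its d/dconj(z) vanish at z = 0, its antiholomorphic
   derivative there is that of F. *)
pose Th z : C := - b * (z * cj z) + (2^-1 * b * (z * z) + 2 * b * ci * y * z).
have c_id : continuous (fun z : C => z) by move=> z; apply: for_cont; exact: cvg_id.
have c_cj : continuous (@cj R) by move=> z; apply: for_cont; apply: cvg_conj; exact: cvg_id.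
have cM (f h : C -> C) : continuous f -> continuous h -> continuous (fun z => f z * h z).
  by move=> cf ch z; apply: for_cont; apply: c_mul; [exact: cf|exact: ch].
have cC (a : C) : continuous (fun _ : C => a) by move=> z; apply: for_cont; exact: c_cst.
have PT : plz Th (fun z => - b * z) (fun z => - b * cj z + (b * z + 2 * b * ci * y)).
  apply: plz_eq (plzD (plzM (cC _) (cM _ _ c_id c_cj) (plz_cst (- b)) (plzM c_id c_cj (@plz_id R) (@plz_cj R)))
    (plzD (plzM (cC _) (cM _ _ c_id c_id) (plz_cst (2^-1 * b)) (plzM c_id c_id (@plz_id R) (@plz_id R)))
      (plzM (cC _) c_id (plz_cst (2 * b * ci * y)) (@plz_id R)))) => z; first by ring.
  by field.
have cTh : continuous Th.
  move=> z; apply: for_cont; apply: c_add; first exact: cM (cC _) (cM _ _ c_id c_cj) z.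
  by apply: c_add; [exact: cM (cC _) (cM _ _ c_id c_id) z|exact: cM (cC _) c_id z].
have cF : continuous (fun z => F (sl k v z)).
  move=> z; apply: for_cont; apply: c_comp (smT_cont SF.1) _.
  by apply: c_sl; [exact: c_cst|exact: cvg_id].
have cE' : continuous (fun z => ex (Th z)) by move=> z; apply: for_cont; apply: c_ex; exact: cTh.
have P1 := plzM cF cE' P0 (plz_ex cTh PT).
have := @antihol_deriv_le _ _ _ _ (M * B) P1.
have Th0 : Th 0 = 0 by rewrite /Th; ring.
rewrite /= sl0 Th0 ex0 (_ : DD k F v * 1 + _ = DD k F v); last by ring.
move=> H.
apply: (@le_trans _ _ (M * B)); last by rewrite ler_wpM2r// lerDl mulr_ge0// mulr_ge0.
apply: H => z.
  have := AF k (sl k v z) kN; rewrite /Ac slE eqxx mul1r imD rcD -/b -/y => h.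
  have e : - b * cj z + (b * z + 2 * b * ci * y) = 2 * b * ci * (y + rc (im z)).
    rewrite im_half (_ : 2 * b * ci * (y + _) = 2 * b * ci * y + 2 * 2^-1 * (- (ci * ci)) * (b * (z - cj z))); last by ring.
    by rewrite ciM opprK mulfV ?pnatr_eq0//; ring.
  rewrite e -[RHS](mul0r (ex (Th z))) -h.
  move: (Dg (- ci) k F (sl k v z)) (F (sl k v z)) (ex (Th z)) (rc (im z)) => A1 A2 A3 A4; ring.
move=> z1; rewrite nrmM mulrC ler_pM ?nrm_ge0//; last by apply: slB; rewrite z1.
rewrite nrm_ex ler_expR; apply: le_trans (ler_norm _) _; apply: le_trans (re_le _) _.
have bC : nrm b <= Cm by rewrite nrm_rc Cm_le.
have h2 : nrm (2 : C) = 2 by rewrite -rc_nat nrm_rc ger0_norm.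
apply: le_trans (nrmD _ _) _; apply: (@le_trans _ _ (nrm b + (nrm b + 2 * nrm b * nrm y))).
  rewrite lerD//; first by rewrite nrmM nrmN nrmM nrm_conj z1 !mulr1.
  apply: le_trans (nrmD _ _) _; rewrite lerD// !nrmM z1 ?nrm_ci !mulr1 ?h2//.
  by rewrite nrmV h2 ler_piMl ?nrm_ge0// invf_le1// ler1n.
have : nrm b * nrm y <= Cm * `|p| by rewrite ler_pM ?nrm_ge0// nrm_rc.
by move: bC; lra.
Qed.

Lemma harm_lin (a : C) F H : harm F -> harm H -> harm (fun v => a * F v + H v).
Proof.
move=> [gF AF] [gH AH]; have Sh := FF_sheaf SE_sheaf fDloc fDD fDZ P.
split; first by apply: (sh_add Sh openT _ gH); exact: (sh_scale Sh a openT gF).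
move=> k v kN; have aF := smZ a openT gF.1.1.
rewrite /Ac (DgD _ _ aF gH.1.1 I) (DgZ _ _ _ gF.1.1 I).
transitivity (a * Ac k F v + Ac k H v); first by rewrite /Ac; ring.
by rewrite AF// AH// mulr0 addr0.
Qed.
Lemma harm0 : harm (fun=> 0).
Proof.
split; first exact: (sh_zero (FF_sheaf SE_sheaf fDloc fDD fDZ P) openT).
by move=> k v _; rewrite /Ac Dg_cst mulr0 addr0.
Qed.

Lemma harm_step : exists2 e : R, 0 < e & forall F B, harm F ->
  (forall v, KV rho v -> nrm (F v) <= B) -> forall a v, KV rho a -> KV rho v ->
  (forall k, nrm (v 0 k - a 0 k) <= e) -> nrm (F v - F a) <= B / 2.
Proof.
have [L L0 hL] := harm_grad (rho + 1); have [M M0 hM] := SE_transfer (rho + 1 + 1).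
pose D := L * M; have D0 : 0 <= D by rewrite mulr_ge0.
(* Passing from a to v takes g moves of one coordinate, each changing F by at most 2 * e * D * B;
   this e makes the total at most B / 2, and e <= 1 keeps the moves inside the set where the
   gradient is bounded. *)
pose e : R := (4 * g.+1%:R * (D + 1))^-1.
have e0 : 0 < e by rewrite invr_gt0 !mulr_gt0// ?ltr0n// ltr_wpDl.
have e1 : e <= 1.
  rewrite invf_le1 ?mulr_gt0 ?ltr0n// ?ltr_wpDl//.
  have g1 : 1 <= g.+1%:R :> R by rewrite ler1n.
  by apply: mulr_ege1; [apply: mulr_ege1 => //; rewrite ler1n|rewrite lerDr].
exists e => // F B hF FB a v Ka Kv av.
have B0 : 0 <= B by exact: le_trans (nrm_ge0 _) (FB _ Ka).
have sF : smT F := hF.1.1.1.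
have FB2 := hM F B hF.1.1 FB; have G := hL F (M * B) hF FB2.
have step k w z : KV rho w -> nrm z <= e -> nrm (F (sl k w z) - F w) <= 2 * e * (D * B).
  move=> Kw ze; rewrite (smT_slice w z k sF).
  set X1 := z * _; set X2 := cj z * _; rewrite (_ : F w + X1 + X2 - F w = X1 + X2); last by ring.
  rewrite {}/X1 {}/X2.
  have cD c : continuous (fun s => Dg c k F (sl k w (z * rc s))).
    move=> s; apply: for_cont; apply: c_comp (smT_cont (sm_Dg c k openT sF)) _.
    apply: c_sl; first exact: c_cst.
    by apply: c_mul; [exact: c_cst|apply: cvg_rc; exact: cvg_id].
  have zs s : 0 <= s <= 1 -> KV (rho + 1) (sl k w (z * rc s)).
    move=> /andP[s0 s1]; apply: KV_sl => //; rewrite nrmM nrm_rc ger0_norm//.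
    by rewrite mulr_ile1 ?nrm_ge0// (le_trans ze).
  have DB0 : 0 <= D * B by rewrite mulr_ge0.
  apply: le_trans (nrmD _ _) _; rewrite mulrDl mul1r mulrDl lerD// nrmM ?nrm_conj.
    apply: ler_pM; rewrite ?nrm_ge0//; apply: nrm_J_le => [|s s01]; first exact: cD.
    by rewrite /D -mulrA; exact: (G k _ (zs s s01)).2.
  apply: ler_pM; rewrite ?nrm_ge0//; apply: nrm_J_le => [|s s01]; first exact: cD.
  by rewrite /D -mulrA; exact: (G k _ (zs s s01)).1.
pose h : V := v - a.
have Kt m : KV rho (a + trunc m h).
  move=> i; rewrite !mxE; case: ifP => _; last by rewrite addr0; exact: Ka.
  by rewrite addrC subrK; exact: Kv.
have T m : (m <= g)%N -> nrm (F (a + trunc m h) - F a) <= m%:R * (2 * e * (D * B)).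
  elim: m => [|m IH] mg.
    rewrite (_ : trunc 0 h = 0) ?addr0 ?subrr ?nrm0 ?mul0r//.
    by apply/rowP => i; rewrite !mxE.
  have := truncS (Ordinal mg) h a => /= ->; set w := a + _.
  rewrite (_ : F _ - F a = (F (sl (Ordinal mg) w (h 0 (Ordinal mg))) - F w) + (F w - F a)); last by ring.
  apply: le_trans (nrmD _ _) _; rewrite -nat1r mulrDl mul1r lerD//; last exact: IH (ltnW mg).
  by apply: step; [exact: Kt|rewrite /h !mxE].
have := T g (leqnn g); rewrite (_ : a + trunc g h = v); last first.
  by apply/rowP => i; rewrite !mxE ltn_ord addrC subrK.
move=> H; apply: (le_trans H).
have : g%:R * (2 * e * D) <= 2^-1.
  have -> : 2^-1 = e * (2 * g.+1%:R * (D + 1)) :> R.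
    rewrite /e; field; rewrite gt_eqF ?ltr_wpDl//= nat1r pnatr_eq0//.
  rewrite (_ : _ * (2 * e * D) = e * (2 * g%:R * D)); last by ring.
  rewrite ler_wpM2l ?(ltW e0)// ler_pM ?mulr_ge0// ?ler_wpM2l// ?lerDl// ler_nat//.
move=> H2; rewrite (_ : _ * (2 * e * (D * B)) = g%:R * (2 * e * D) * B); last by ring.
by rewrite mulrC ler_wpM2l.
Qed.

(** A harmonic section that vanishes on a finite e-net of [KV rho] satisfies |F| <= B / 2 there
    whenever |F| <= B, hence is 0. So harmonic sections are determined by finitely many values. *)
Lemma harm_basis : exists n (b : 'I_n -> V -> C), [/\ forall i, harm (b i),
  forall a : 'I_n -> C, (forall v, \sum_i a i * b i v = 0) -> forall i, a i = 0 &
  forall F, harm F -> exists a : 'I_n -> C, forall v, F v = \sum_i a i * b i v].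
Proof.
have [e e0 he] := harm_step.
have := @KV_compact R g rho; rewrite compact_cover => /(_ _ (KV rho) (fun a => Bl a e)).
case=> [a _|v Kv|A AK Ac_].
- exact: Bl_open.
- by exists v => //; exact: Bl_center.
pose s : seq V := finmap.enum_fset A.
apply: (@fin_basis _ _ (size s) harm (fun i => nth 0 s i) harm_lin harm0) => F hF Fs.
have FA a : a \in s -> F a = 0.
  by move=> aS; have i := index_mem a s; rewrite aS in i; rewrite -[a](nth_index 0 aS) (Fs (Ordinal i)).
have half B : (forall v, KV rho v -> nrm (F v) <= B) -> forall v, KV rho v -> nrm (F v) <= B / 2.
  move=> FB v Kv; have [a /= aA av] := Ac_ v Kv.
  have Ka : KV rho a by have := AK a aA; rewrite inE.
  have := he F B hF FB a v Ka Kv (fun k => ltW (av k)); rewrite (FA a aA) subr0; exact.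
have [B B0 FB] := cpt_bounded (@KV_compact R g rho) (smT_cont hF.1.1.1).
have hn n : forall v, KV rho v -> nrm (F v) <= B * 2^-1 ^+ n.
  elim: n => [|n IH] v Kv; first by rewrite expr0 mulr1 FB.
  by rewrite exprSr mulrA half.
have F0 v : KV rho v -> F v = 0.
  move=> Kv; apply/eqP; rewrite -nrm_eq0 eq_le nrm_ge0 andbT leNgt; apply/negP => F0.
  have [n] := half_small B F0; rewrite ltNge => /negP; apply; exact: hn.
move=> v; have [lam hl lv] := cov_KV cocpt v.
have := F0 _ lv; rewrite (hF.1.1.2 v lam hl I) => /eqP.
by rewrite mulf_eq0 (negPf (Ew_neq0 _ _)) => /eqP.
Qed.

(** * A nonzero harmonic section for large weights *)

Definition qs v : R := \sum_i nrm (v 0 i) ^+ 2.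
Lemma qs_ge0 v : 0 <= qs v. Proof. by apply: sumr_ge0 => i _; exact: sqr_ge0. Qed.
Lemma qs_sl k v z : qs (sl k v z) <= 2 * qs v + 2 * nrm z ^+ 2.
Proof.
rewrite /qs (bigD1 k)//= [\sum_i nrm (v 0 i) ^+ 2](bigD1 k)//= slE eqxx mul1r.
have h : nrm (v 0 k + z) ^+ 2 <= 2 * nrm (v 0 k) ^+ 2 + 2 * nrm z ^+ 2.
  apply: (@le_trans _ _ ((nrm (v 0 k) + nrm z) ^+ 2)).
    by rewrite lerXn2r ?nnegrE ?addr_ge0 ?nrm_ge0// nrmD.
  by rewrite -subr_ge0 (_ : _ - _ = (nrm (v 0 k) - nrm z) ^+ 2) ?sqr_ge0//; ring.
rewrite (eq_bigr (fun i => nrm (v 0 i) ^+ 2)) => [|i ik].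
  have : 0 <= \sum_(i | i != k) nrm (v 0 i) ^+ 2 by apply: sumr_ge0 => i _; exact: sqr_ge0.
  by move: h; lra.
by rewrite slE (negPf ik) mul0r addr0.
Qed.

(** By [nrm_Ek] the kernel becomes a Gaussian with exponent |c| / 2, whose moments [T1_gauss]
    evaluates. The part of the bound quadratic in z costs 8 L / |c|, the gain from large weights;
    the factor 2 of [qs_sl] turns into 4 L. *)
Lemma Pk_bound k f (K L : R) : Gr f -> 0 <= K -> 0 <= L ->
  (forall v, nrm (f v) <= expR (wt v) * (K + L * qs v)) ->
  forall v, nrm (Pk k f v) <= expR (wt v) * (2 * K + 8 * L / `|cw k| + 4 * L * qs v).
Proof.
move=> Gf K0 L0 fB v; pose c := `|cw k|; have cp : 0 < c by rewrite normr_gt0.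
have a0 : 0 < c / 2 by rewrite divr_gt0.
pose A := expR (wt v) * (K + 2 * L * qs v); pose B := expR (wt v) * (2 * L).
rewrite /Pk /Gk nrmM nrmN nrm_rc normr_id nrmM nrmN.
have -> : nrm 2 = 2 by rewrite -rc_nat nrm_rc ger0_norm.
have H := @T1_le _ _ _ (Kf_DP1 (c0 k) 1 v Gf) (DP1_gauss A B a0 (isT : (1 <= 1)%N)).
apply: (@le_trans _ _ (c * (2 * re (T1 (gauss (c / 2) A B 1))))); last first.
  rewrite (T1_gauss _ _ a0) re_rc /A /B -/c le_eqVlt; apply/orP; left; apply/eqP.
  by field; rewrite gt_eqF.
rewrite -/c ler_wpM2l ?(ltW cp)// ler_wpM2l//; apply: H => r t r0.
set z := rc r * un t; have zr : nrm z = r by rewrite nrmM nrm_un mulr1 nrm_rc ger0_norm.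
have -> : (un t)^-1 * gauss (c / 2) A B 1 z = rc (expR (- (c / 2 * r ^+ 2)) * (r * (A + B * r ^+ 2))).
  rewrite /gauss expr1 mul_conj zr mulNr -(rcM (c / 2)) -rcN ex_rc; clearbody A B; rewrite !(rcM, rcD) /z.
  have := un_neq0 t; move: (un t) => u un0.
  by field.
clearbody z; rewrite re_rc /Kf expr1 nrmM nrmM zr.
have E : expR (wt (sl k v z)) * nrm (Ek cw k (im (v 0 k)) z) = expR (wt v) * expR (- (c / 2 * r ^+ 2)).
  have := nrm_Ek cw k (im (v 0 k)) z; rewrite zr -/c => h.
  rewrite wt_sl addrA expRD expRN.
  rewrite -[in RHS](mulfK (_ : expR (cw k * im (v 0 k) ^+ 2) != 0) (expR (- (c / 2 * r ^+ 2)))) ?gt_eqF ?expR_gt0//.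
  rewrite [expR (- (c / 2 * r ^+ 2)) * _]mulrC -h expRD; ring.
apply: (@le_trans _ _ (expR (wt (sl k v z)) * (K + L * qs (sl k v z)) * r * nrm (Ek cw k (im (v 0 k)) z))).
  by rewrite ler_wpM2r ?nrm_ge0// ler_wpM2r.
rewrite (_ : _ * _ * r * _ = expR (wt (sl k v z)) * nrm (Ek cw k (im (v 0 k)) z) * (r * (K + L * qs (sl k v z)))); last by ring.
rewrite E (_ : expR _ * (r * _) = expR (wt v) * expR (- (c / 2 * r ^+ 2)) * (r * (K + 2 * L * qs v + 2 * L * r ^+ 2))); last first.
  by rewrite /A /B; ring.
rewrite ler_wpM2l ?mulr_ge0 ?expR_ge0// ler_wpM2l//.
have := qs_sl k v z; rewrite zr => /(ler_wpM2l L0); move: (L * qs _) => X1.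
by lra.
Qed.

(* The Gaussian section on C^g fixed by all the projectors [Pk]. *)
Definition mc i : R := if cw i <= 0 then cw i else 0.
Definition Q0 v : C := \sum_i rc (2 * mc i) * (rc (im (v 0 i)) * rc (im (v 0 i))).
Definition f0 v : C := ex (Q0 v).
Lemma sm_Q0 : smT Q0.
Proof.
apply: sm_sum; first exact: openT.
by move=> i; apply: smZ; [exact: openT|apply: smM; [exact: openT|exact: sm_im openT|exact: sm_im openT]].
Qed.
Lemma sm_f0 : smT f0. Proof. exact: sm_ex openT sm_Q0. Qed.
Lemma pd_f0 k b v : pd (k, b) f0 v = b%:R * (4 * rc (mc k)) * (rc (im (v 0 k)) * f0 v).
Proof.
rewrite (pd_ex _ openT sm_Q0 I) mulrA; congr (_ * _).
rewrite /Q0 (pd_sum _ _ openT) => [|i|//]; last first.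
  by apply: smZ; [exact: openT|apply: smM; [exact: openT|exact: sm_im openT|exact: sm_im openT]].
have E i : pd (k, b) (fun v => rc (2 * mc i) * (rc (im (v 0 i)) * rc (im (v 0 i)))) v =
    ((k == i) && b)%:R * (4 * rc (mc i) * rc (im (v 0 i))).
  have sy := @sm_im R g i setT openT.
  rewrite (pdZ _ _ (smM openT sy sy) I) (pdM _ sy sy I) (pdP (pd_im i (k, b) v)).
  by rewrite xpair_eqE eqb_id rcM rc_nat; ring.
rewrite (eq_bigr _ (fun i _ => E i)) (bigD1 k)//= big1 ?addr0 => [|i ik].
  by rewrite eqxx /=; ring.
by rewrite eq_sym (negPf ik) mul0r.
Qed.
Lemma Dg_f0 e k v : Dg e k f0 v = e * (2 * rc (mc k)) * (rc (im (v 0 k)) * f0 v).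
Proof.
rewrite DgE !pd_f0 !mul0r add0r mul1r.
rewrite (_ : 2^-1 * _ = (2^-1 * 2) * (e * (2 * rc (mc k)) * (rc (im (v 0 k)) * f0 v))); last by ring.
by rewrite mulVf ?mul1r ?pnatr_eq0.
Qed.
Lemma f0_le v : nrm (f0 v) <= expR (wt v).
Proof.
have E : Q0 v = rc (\sum_i 2 * mc i * (im (v 0 i) * im (v 0 i))).
  by rewrite raddf_sum; apply: eq_bigr => i _; rewrite /= !rcM.
rewrite /f0 E nrm_ex ler_expR re_rc; apply: ler_sum => i _.
rewrite -expr2 ler_wpM2r ?sqr_ge0// /mc.
by case: (leP (cw i) 0) => h; lra.
Qed.
Lemma Gr_f0 : Gr f0.
Proof.
split; first exact: sm_f0.
have gb0 : gb cw f0 by exists 1, 0%N => v; rewrite expr0 !mul1r f0_le.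
elim=> [|n IH]; first by split.
split=> // -[k b].
have sy : smT (fun v => rc (im (v 0 k)) * f0 v) by apply: smM; [exact: openT|exact: sm_im openT|exact: sm_f0].
by apply: gr_ext (grZ (b%:R * (4 * rc (mc k))) sy (gr_y k sm_f0 IH)) => v; rewrite pd_f0.
Qed.
Lemma Pk_f0 k v : Pk k f0 v = f0 v.
Proof.
have /orP[kP|kN] := PN k.
  have := Pk_pos v kP Gr_f0; rewrite (@eq_Gk _ _ cw k _ (fun=> 0)) ?Gk_zero.
    by move=> /eqP; rewrite subr_eq0 => /eqP.
  by move=> z; rewrite Dg_f0 /mc leNgt (cP kP) rc0; ring.
have := Pk_neg v kN Gr_f0; rewrite (@Dg_near _ _ ci k _ (fun=> 0)) ?Dg_cst.
  by move=> /eqP; rewrite subr_eq0 => /eqP.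
apply: nearW => w; apply: (Gk_cov0 (c0 k) (cN kN) Gr_f0) => z.
by rewrite Dg_f0 /mc (ltW (cN kN)); ring.
Qed.

Definition r0 : R := dl / 2.
(** Chosen so that L0 |v|^2 >= 2 outside the polydisc of radius r0 / 2, on which [g0] and [f0]
    agree; see [g0_f0]. *)
Definition L0 : R := 2 / (r0 / 2) ^+ 2.
Lemma r0_gt0 : 0 < r0. Proof. by rewrite divr_gt0. Qed.
Lemma r02 : 2 * r0 <= dl. Proof. by rewrite mulrC divfK. Qed.
Definition g0 := per Lam Ew 0 r0 (fun v => bmp 0 (r0 / 2) v * f0 v).
Lemma g0_SE : SE setT g0.
Proof.
apply: (per_SST Ew_sm Ew_neq0 Ew_coc disc r02 (r34 r0_gt0)).
  apply: (sm_sub (@subsetT _ _)); apply: smM; [exact: openT|exact: sm_bmp|exact: sm_f0].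
by move=> v k hB h; rewrite (beta_supp0 r0_gt0 hB h) mul0r.
Qed.
Lemma bmp_le1 a p v : nrm (bmp a p v) <= 1.
Proof.
rewrite bmp_rc nrm_rc ger0_norm ?bmpR_ge0// /bmpR.
by apply: prodr_ile1 => k _; rewrite cutr_ge0 cutr_le1.
Qed.
Lemma g0_le v : nrm (g0 v) <= expR (wt v).
Proof.
rewrite /g0 /per; case: asboolP => [[hB hl]|_]; last by rewrite nrm0 expR_ge0.
move: (lamof _ _ _ _) hl hB => lam hl hB.
rewrite !nrmM nrmV nrm_Ew// ler_pdivrMl ?expR_gt0// -expRD subrK.
rewrite -[leRHS]mul1r; apply: ler_pM; rewrite ?nrm_ge0// ?bmp_le1// f0_le//.
Qed.
Lemma g0_near v : (forall k, nrm (v 0 k) <= r0 / 2) -> g0 v = f0 v.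
Proof.
move=> h; have rr : r0 / 2 < r0 by rewrite ltr_pdivrMr// ltr_pMr ?r0_gt0// ltr1n.
have h0 : 0 \in Lam by exact: rpred0.
have hB : Bl 0 r0 (v + 0) by move=> k; rewrite addr0 mxE subr0 (le_lt_trans (h k)).
rewrite /g0 (per_eq Ew disc _ r02 h0 hB) (E0 (Lam := Lam) Ew_neq0 Ew_coc) invr1 mul1r addr0.
rewrite bmp1 ?mul1r ?divr_gt0 ?r0_gt0// => k.
by rewrite mxE subr0.
Qed.
Lemma L0_gt0 : 0 < L0. Proof. by rewrite divr_gt0 ?exprn_gt0 ?divr_gt0 ?r0_gt0. Qed.
Lemma g0_f0 v : nrm (g0 v - f0 v) <= expR (wt v) * (L0 * qs v).
Proof.
have [h|] := pselect (forall k, nrm (v 0 k) <= r0 / 2).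
  by rewrite g0_near// subrr nrm0 mulr_ge0 ?expR_ge0// mulr_ge0 ?qs_ge0 ?(ltW L0_gt0).
move=> /existsNP[k /negP]; rewrite -ltNge => hk.
apply: (@le_trans _ _ (expR (wt v) * 2)).
  by apply: le_trans (nrmBD _ _) _; rewrite mulrDr mulr1 lerD ?g0_le ?f0_le.
have rp : 0 < r0 / 2 by rewrite divr_gt0 ?r0_gt0.
rewrite ler_wpM2l ?expR_ge0// /L0 mulrAC ler_pdivlMr ?exprn_gt0// ler_wpM2l//.
rewrite /qs (bigD1 k)//= -[leLHS]addr0 lerD//; last by apply: sumr_ge0 => i _; exact: sqr_ge0.
by rewrite lerXn2r ?nnegrE ?nrm_ge0 ?(ltW rp)// ltW.
Qed.

Lemma fold_SE l : SE setT (foldr Pk g0 l).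
Proof. by elim: l => [|k l IH]; [exact: g0_SE|exact: SE_Pk]. Qed.
(** All projectors fix f0, so the error itself is projected. By [Pk_bound] its constants evolve by K
    -> 2 K + 8 L / cs and L -> 4 L; the stated powers of 4 majorize this from K = 4 L0 / cs and L =
    L0 on. *)
Lemma fold_bound (cs : R) l : 0 < cs -> (forall k, cs <= `|cw k|) -> forall v,
  nrm (foldr Pk g0 l v - f0 v) <=
    expR (wt v) * (4 ^+ size l * (4 * L0 / cs) + 4 ^+ size l * L0 * qs v).
Proof.
move=> cs0 hc; have L00 := ltW L0_gt0; elim: l => [|k l IH] v.
  rewrite !expr0 !mul1r; apply: le_trans (g0_f0 v) _; rewrite ler_wpM2l ?expR_ge0// lerDr.
  by rewrite divr_ge0 ?(ltW cs0)// mulr_ge0.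
have GF := SE_Gr (fold_SE l); have Gd := GrB GF Gr_f0.
have -> : foldr Pk g0 (k :: l) v - f0 v = Pk k (fun v => foldr Pk g0 l v - f0 v) v.
  rewrite -(Pk_f0 k v) /= /Pk.
  have -> : (fun v => foldr Pk g0 l v - f0 v) = (fun v => foldr Pk g0 l v + -1 * f0 v).
    by apply/funext => w; rewrite mulN1r.
  by rewrite (GkD (c0 k) _ _ GF (GrZ _ Gr_f0)) (GkZ (c0 k) _ _ _ Gr_f0); ring.
set n := size l; rewrite /= -/n in IH *.
have p4 : 0 <= 4 ^+ n :> R by rewrite exprn_ge0.
have A1 : 0 <= 4 ^+ n * L0 by exact: mulr_ge0.
have A0 : 0 <= 4 ^+ n * (4 * L0 / cs).
  by apply: mulr_ge0 => //; rewrite divr_ge0 ?(ltW cs0)// mulr_ge0.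
apply: le_trans (Pk_bound k Gd A0 A1 IH v) _.
rewrite ler_wpM2l ?expR_ge0// exprS.
have : 4 ^+ n * L0 / `|cw k| <= 4 ^+ n * L0 / cs.
  by rewrite ler_wpM2l// lef_pV2 ?posrE ?(lt_le_trans cs0).
set y := 4 ^+ n * L0 => hy.
have -> : 2 * (4 ^+ n * (4 * L0 / cs)) + 8 * y / `|cw k| + 4 * y * qs v =
    8 * (y / cs) + 8 * (y / `|cw k|) + 4 * y * qs v by rewrite /y; ring.
have -> : 4 * 4 ^+ n * (4 * L0 / cs) + 4 * 4 ^+ n * L0 * qs v = 16 * (y / cs) + 4 * y * qs v by rewrite /y; ring.
by move: hy; lra.
Qed.

(** At the origin the error of at most g projectors is bounded by 4^g * 4 * L0 / cs, which is 1/2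
    for the required lower bound cs of the weights, whereas f0 takes the value 1 there. *)
Lemma harm_neq0 : (forall k, 2 * 4 ^+ g.+1 * L0 <= `|cw k|) -> exists F, harm F /\ F 0 != 0.
Proof.
move=> hc; have cs0 : 0 < 2 * 4 ^+ g.+1 * L0.
  by apply: mulr_gt0 L0_gt0; apply: mulr_gt0 => //; exact: exprn_gt0.
have gsP l : uniq l -> {subset l <= P} -> FE l setT (foldr Pk g0 l).
  elim: l => [|k l IH] ul sl /=; first by split=> //; exact: g0_SE.
  have /andP[kl ul'] := ul; have kP : k \in P by apply: sl; rewrite inE eqxx.
  apply: FF_cons; last by move=> v _; exact: DD_Pk (fold_SE l).
  by apply: FE_Pk => //; apply: IH => // j jl; apply: sl; rewrite inE jl orbT.
have [gH AH _] := harm_proj uN (fun _ => id) (gsP P uP (fun _ => id)).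
exists (foldr Pk (foldr Pk g0 P) N); split; first by split=> // k v; exact: AH.
rewrite -foldr_cat; apply: contraTneq (fold_bound (N ++ P) cs0 hc 0) => ->.
have z0 : (0 : V) 0 = fun=> 0 by apply/funext => i; rewrite mxE.
have -> : f0 0 = 1 by rewrite /f0 /Q0 big1 ?ex0// => i _; rewrite mxE im0 rc0 mul0r mulr0.
have -> : wt 0 = 0 by rewrite /wt big1// => i _; rewrite mxE im0 expr0n mulr0.
have -> : qs 0 = 0 by rewrite /qs big1// => i _; rewrite mxE nrm0 expr0n.
rewrite sub0r nrmN nrm1 expR0 mul1r mulr0 addr0 -ltNge.
have sg : (size (N ++ P) <= g)%N.
  have u : uniq (N ++ P).
    rewrite cat_uniq uN uP andbT /=; apply/hasPn => k kP; apply/negP => kN.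
    by have := N_notP kN; rewrite kP.
  by rewrite -(card_uniqP u) -[leqRHS]card_ord max_card.
have e4 : 4 ^+ size (N ++ P) <= 4 ^+ g :> R by rewrite ler_weXn2l// ler1n.
have p4 : 0 < 4 ^+ g :> R by rewrite exprn_gt0.
have -> : 4 * L0 / (2 * 4 ^+ g.+1 * L0) = (2 * 4 ^+ g)^-1 :> R.
  by rewrite exprS; field; rewrite !gt_eqF ?L0_gt0.
by rewrite ltr_pdivrMr ?mulr_gt0// mul1r; lra.
Qed.

Lemma cohomology_basis : (forall k, 2 * 4 ^+ g.+1 * L0 <= `|cw k|) ->
  exists n (b : 'I_n -> V -> C), [/\ (0 < n)%N, forall i, gs (b i),
    forall a : 'I_n -> C, span N (fun v => \sum_i a i * b i v) -> forall i, a i = 0 &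
    forall F, gs F -> exists a : 'I_n -> C, span N (fun v => F v - \sum_i a i * b i v)].
Proof.
move=> hc; have [n [b [hb ind sp]]] := harm_basis.
have hs m (a : 'I_m -> C) (d : 'I_m -> V -> C) : (forall i, harm (d i)) -> harm (fun v => \sum_i a i * d i v).
  move=> hd; elim: m a d hd => [|m IH] a d hd.
    by rewrite (_ : (fun v => _) = fun=> 0); [exact: harm0|apply/funext => v; rewrite big_ord0].
  rewrite (_ : (fun v => _) = fun v => a ord0 * d ord0 v + \sum_i a (lift ord0 i) * d (lift ord0 i) v).
    by apply: harm_lin => //; apply: IH.
  by apply/funext => v; rewrite big_ord_recl.
exists n, b; split.
- case: n b hb ind sp => // b _ _ sp; have [F [hF]] := harm_neq0 hc.
  by have [a ->] := sp F hF; rewrite big_ord0 eqxx.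
- by move=> i; exact: (hb i).1.
- by move=> a sa; apply: ind; exact: (harm_span uN (fun _ => id) (hs _ a b hb) sa).
- move=> F gF; have [gH AH sH] := harm_proj uN (fun _ => id) gF.
  have [a aE] := sp _ (conj gH (fun k v kN => AH k v kN)).
  by exists a; apply: span_ext sH => v; rewrite mulN1r aE.
Qed.
End Spaces.
End Weighted.

(** * The lattice of a totally real field *)

Section NumberField.
Variables (R : realType) (K : fieldExtType rat) (g : nat).
Hypothesis dimK : \dim {:K} = g.
Variable sigma : 'I_g -> {rmorphism K -> R}.
Hypothesis sigmaP : forall tau : {rmorphism K -> R}, exists! i, sigma i =1 tau.
Local Notation integral := (@in_ring_of_integers K).
Implicit Types (x y : K).

Lemma sigma_inj i j : sigma i =1 sigma j -> i = j.
Proof. by move=> ij; have [k [_ ku]] := sigmaP (sigma j); rewrite -(ku i ij) (ku j (fun=> erefl)). Qed.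
Lemma sigmaZ i (q : rat) x : sigma i (q *: x) = ratr q * sigma i x.
Proof. by rewrite -mulr_algl rmorphM /= alg_num_field fmorph_rat. Qed.
(** Dedekind's argument: evaluating the relation at y x and subtracting sigma_i(y) times the
    relation at x removes the term i, and y is chosen to keep the coefficient of j. *)
Lemma dedekind (c : 'I_g -> R) (s : seq 'I_g) : uniq s ->
  (forall x, \sum_(i <- s) c i * sigma i x = 0) -> forall i, i \in s -> c i = 0.
Proof.
elim: s c => [|i s IH] c //= /andP[is_ us] H.
have cs j : j \in s -> c j = 0.
  move=> js; have [y yij] : exists y, sigma j y != sigma i y.
    apply: contrapT => /forallNP h; have ij : i = j.
      by apply: sigma_inj => y; apply/eqP; rewrite eq_sym; apply/negP => /negP /h.
    by rewrite ij js in is_.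
  have := IH (fun k => c k * (sigma k y - sigma i y)) us _ j js.
  move=> /(_ _)/eqP; rewrite mulf_eq0 subr_eq0 (negPf yij) orbF => h; apply/eqP; apply: h => x.
  have h1 := H (y * x); have h2 := H x; rewrite !big_cons in h1 h2.
  have : \sum_(k <- s) c k * sigma k (y * x) - sigma i y * (\sum_(k <- s) c k * sigma k x) = 0.
    move/eqP: h1; rewrite addrC addr_eq0 => /eqP ->; move/eqP: h2; rewrite addrC addr_eq0 => /eqP ->.
    by rewrite rmorphM /=; ring.
  rewrite mulr_sumr -sumrB => E; rewrite -[RHS]E; apply: eq_bigr => k _.
  by rewrite rmorphM /=; ring.
move=> j; rewrite inE => /orP[/eqP ->|]; last exact: cs.
have := H 1; rewrite big_cons rmorph1 mulr1 big_seq big1 ?addr0// => k ks.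
by rewrite cs ?mul0r.
Qed.

Lemma rat_basis : exists e : 'I_g -> K, forall x, exists q : 'I_g -> rat, x = \sum_k q k *: e k.
Proof.
case: g / dimK; exists (fun k => (vbasis {:K})`_k) => x.
by exists (fun k => coord (vbasis {:K}) k x); apply: coord_vbasis; exact: memvf.
Qed.

Section Basis.
Variable e : 'I_g -> K.
Hypothesis eP : forall x, exists q : 'I_g -> rat, x = \sum_k q k *: e k.
Definition Smx : 'M[R]_g := \matrix_(i, k) sigma i (e k).
Lemma Smx_unit : Smx \in unitmx.
Proof.
rewrite -row_free_unit -kermx_eq0; apply/rowV0P => u /sub_kermxP uS.
apply/rowP => i; rewrite mxE; apply: (dedekind (enum_uniq 'I_g)) (mem_enum _ i) => x.
have [q ->] := eP x; rewrite big_enum /=.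
transitivity (\sum_k ratr (q k) * (u *m Smx) 0 k); last first.
  by rewrite uS big1// => k _; rewrite mxE mulr0.
under [RHS]eq_bigr do rewrite mxE mulr_sumr.
rewrite exchange_big /=; apply: eq_bigr => j _; rewrite rmorph_sum mulr_sumr; apply: eq_bigr => k _.
by rewrite /= sigmaZ mxE; ring.
Qed.
Lemma mul_mx x : exists A : 'M[rat]_g, forall l, x * e l = \sum_k A k l *: e k.
Proof.
have /choice[q qP] : forall l, exists q : 'I_g -> rat, x * e l = \sum_k q k *: e k by move=> l; exact: eP.
by exists (\matrix_(k, l) q l k) => l; rewrite qP; apply: eq_bigr => k _; rewrite mxE.
Qed.
(** Multiplication by x has a rational matrix on the basis e, and the invertible matrix [Smx]
    conjugates it to the diagonal of the sigma_i(x). *)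
Lemma trace_rat x : exists q : rat, \sum_i sigma i x = ratr q.
Proof.
have [A AP] := mul_mx x; exists (\tr A).
have E : Smx *m map_mx ratr A = diag_mx (\row_i sigma i x) *m Smx.
  apply/matrixP => i l; rewrite mul_diag_mx !mxE -rmorphM AP rmorph_sum; apply: eq_bigr => k _.
  by rewrite !mxE /= sigmaZ mulrC.
have : \tr (map_mx ratr A : 'M[R]_g) = \sum_i sigma i x.
  rewrite -[map_mx _ _](mulKmx Smx_unit) mxtrace_mulC E -mulmxA mulmxV ?Smx_unit// mulmx1.
  by rewrite mxtrace_diag; apply: eq_bigr => i _; rewrite mxE.
by rewrite trace_map_mx => ->.
Qed.
Lemma e_neq0 : exists k, e k != 0.
Proof.
apply: contrapT => /forallNP h; have [q] := eP 1; rewrite big1 => [/eqP|k _].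
  by rewrite oner_eq0.
by have /negP := h k; rewrite negbK => /eqP ->; rewrite scaler0.
Qed.
(** Once d clears the denominators, d x multiplies the basis by an integer matrix. The vector of the
    e_k is a nonzero eigenvector, so d x is a root of a monic integral characteristic polynomial. *)
Lemma clear_den x : exists2 m : nat, (0 < m)%N & integral (x *+ m).
Proof.
have [A AP] := mul_mx x.
pose d : int := \prod_k \prod_l denq (A k l).
have d0 : 0 < d by apply: prodr_gt0 => k _; apply: prodr_gt0 => l _; exact: denq_gt0.
have /choice[B BP] : forall kl : 'I_g * 'I_g, exists b : int, d%:~R * A kl.1 kl.2 = b%:~R.
  move=> [k l] /=; rewrite /d (bigD1 k)//= (bigD1 l)//= -{2}(divq_num_den (A k l)).
  move: (\prod_(i | _) _) (\prod_(i | _) _) => u w; exists (u * w * numq (A k l)).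
  by rewrite !intrM; field; rewrite intr_eq0 denq_neq0.
pose M : 'M[int]_g := \matrix_(k, l) B (k, l).
exists `|d|%N; first by rewrite absz_gt0 gt_eqF.
exists (char_poly M); first exact: char_poly_monic.
rewrite map_char_poly -eigenvalue_root_char; apply/eigenvalueP.
exists (\row_k e k); last first.
  have [k ek] := e_neq0; apply: contraNneq ek => /rowP/(_ k); by rewrite !mxE => ->.
apply/rowP => l; rewrite !mxE.
have -> : x *+ `|d|%N = d%:~R * x by rewrite -[in RHS](gtz0_abs d0) -pmulrn mulr_natl.
rewrite -mulrA AP mulr_sumr; apply: eq_bigr => k _; rewrite !mxE.
by rewrite [RHS]mulrzl -scaler_int scalerA (BP (k, l)) scaler_int; exact: mulrzr.
Qed.
End Basis.

Lemma integral_sum (I : Type) (r : seq I) (F : I -> K) : (forall i, integral (F i)) -> integral (\sum_(i <- r) F i).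
Proof.
move=> H; pose toK : {rmorphism int -> K} := intr.
elim: r => [|i r IH]; first by rewrite big_nil; exact: (mxpoly.integral0 toK).
by rewrite big_cons; exact: (integral_add (RtoK := toK) (H i) IH).
Qed.
Lemma integral_prod x y : integral x -> integral y -> integral (x * y).
Proof. pose toK : {rmorphism int -> K} := intr; exact: (integral_mul (RtoK := toK)). Qed.
Lemma integral_int (n : int) : integral n%:~R.
Proof. pose toK : {rmorphism int -> K} := intr; exact: (integral_id toK n). Qed.
Lemma integral_opp x : integral x -> integral (- x).
Proof. pose toK : {rmorphism int -> K} := intr; exact: (integral_opp (RtoK := toK)). Qed.

Lemma int_basis : exists e : 'I_g -> K, (forall k, integral (e k)) /\
  forall x, exists q : 'I_g -> rat, x = \sum_k q k *: e k.
Proof.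
have [e eP] := rat_basis.
have /choice[m mP] : forall k, exists m : nat, (0 < m)%N /\ integral (e k *+ m).
  by move=> k; have [m m0 mi] := clear_den eP (e k); exists m.
exists (fun k => e k *+ m k); split=> [k|x]; first exact: (mP k).2.
have [q ->] := eP x; exists (fun k => q k / (m k)%:R); apply: eq_bigr => k _.
rewrite -scaler_nat scalerA divfK// pnatr_eq0 -lt0n; exact: (mP k).1.
Qed.

(** The polynomial is moved to [algC], where rational algebraic integers are known to be
    integers. *)
Lemma rat_integral (q : rat) : integralOver (intr : int -> R) (ratr q) -> exists n : int, q = n%:~R.
Proof.
move=> [p pm]; have E (F : numFieldType) : map_poly (intr : int -> F) p = map_poly ratr (map_poly (intr : int -> rat) p).
  by rewrite -map_poly_comp; apply: eq_map_poly => n; rewrite /= ratr_int.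
rewrite E fmorph_root => rp.
have : ratr q \in Aint.
  apply: (@root_monic_Aint (map_poly intr p)).
  - by rewrite (E algC) fmorph_root.
  - exact: monic_map.
  - by apply/polyOverP => i; rewrite coef_map /= intr_int.
move=> /(Cint_rat_Aint (Crat_rat q))/intrP[n nE]; exists n.
by apply: (fmorph_inj (ratr : {rmorphism rat -> algC})); rewrite /= nE ratr_int.
Qed.
Lemma trace_int x : integral x -> exists n : int, \sum_i sigma i x = n%:~R.
Proof.
move=> ix; have [e eP] := rat_basis; have [q qE] := trace_rat eP x.
have [|n nE] := @rat_integral q; last by exists n; rewrite qE nE ratr_int.
rewrite -qE; pose toR : {rmorphism int -> R} := intr.
apply: (@big_ind _ (integralOver toR)) => [|u w|i _].
- exact: (mxpoly.integral0 toR).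
- exact: (integral_add (RtoK := toR)).
- have [p pm rp] := ix; exists p => //.
  have -> : map_poly toR p = map_poly (sigma i) (map_poly intr p).
    by rewrite -map_poly_comp; apply: eq_map_poly => n; rewrite /= rmorph_int.
  by rewrite fmorph_root.
Qed.

(** If all conjugates of an integral x are small, the traces of the x e_k are integers of absolute
    value below 1, hence 0, and x = 0 because [Smx] is invertible. For density, the real coordinates
    of t on an integral basis are rounded down; T is the resulting error. *)
Lemma lattice_bounds : exists (T ep : R), [/\ 0 <= T, 0 < ep,
  forall x, integral x -> (forall i, `|sigma i x| < ep) -> x = 0 &
  forall t : 'I_g -> R, exists2 x, integral x & forall i, `|sigma i x - t i| <= T].
Proof.
have [e [ei eP]] := int_basis.
pose T : R := \sum_i \sum_k `|sigma i (e k)|.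
have T0 : 0 <= T by apply: sumr_ge0 => i _; apply: sumr_ge0.
have ep0 : 0 < (1 + T)^-1 by rewrite invr_gt0 ltr_pwDl.
exists T, (1 + T)^-1; split=> // [x ix xs|t].
  have [k0 _] := e_neq0 eP.
  have Z k : \sum_i sigma i (x * e k) = 0.
    have [n nE] := trace_int (integral_prod ix (ei k)); rewrite nE.
    have : `|n%:~R : R| < 1.
      rewrite -nE; apply: (@le_lt_trans _ _ ((1 + T)^-1 * T)); last first.
        by rewrite mulrC ltr_pdivrMr ?mul1r ?ltr_pwDl// ltrDr.
      apply: le_trans (ler_norm_sum _ _ _) _; rewrite /T mulr_sumr; apply: ler_sum => i _.
      rewrite rmorphM normrM ler_pM// ?(ltW (xs i))//.
      by rewrite (bigD1 k)//= lerDl; apply: sumr_ge0.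
    by rewrite -intr_norm (ltr_int R _ 1) => h; have -> : n = 0 by lia.
  have : (\row_i sigma i x) *m Smx e = 0.
    by apply/rowP => k; rewrite !mxE -[RHS](Z k); apply: eq_bigr => i _; rewrite !mxE rmorphM.
  move=> /eqP; rewrite mulmx_free_eq0 ?row_free_unit ?Smx_unit// => /eqP/rowP/(_ k0).
  by rewrite !mxE => /eqP; rewrite fmorph_eq0 => /eqP.
pose a := invmx (Smx e) *m \col_i t i.
exists (\sum_k (Num.floor (a k 0))%:~R * e k).
  by apply: integral_sum => k; apply: integral_prod => //; exact: integral_int.
move=> i; have -> : t i = \sum_k a k 0 * sigma i (e k).
  have : Smx e *m a = \col_i t i by rewrite /a mulKVmx// Smx_unit.
  move=> /matrixP/(_ i 0); rewrite !mxE => <-; apply: eq_bigr => k _; by rewrite !mxE mulrC.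
rewrite rmorph_sum -sumrB; apply: le_trans (ler_norm_sum _ _ _) _.
apply: (@le_trans _ _ (\sum_k `|sigma i (e k)|)); last first.
  by rewrite /T [leRHS](bigD1 i)//= lerDl; apply: sumr_ge0 => j _; apply: sumr_ge0.
apply: ler_sum => k _; rewrite rmorphM rmorph_int -mulrBl normrM ler_piMl//.
have /andP[h1 h2] := floor_itv (a k 0); rewrite ler_norml; move: h1 h2; rewrite intrD; lra.
Qed.

(** * The lattice of z, and integers with prescribed signs *)

Section Torus.
Variable z : 'I_g -> Cplx R.
Hypothesis z_upper : forall i, 0 < complex.Im (z i).
Local Notation Lam := (Lambda sigma z).
Local Notation C := (Cplx R).
Local Notation V := 'rV[Cplx R]_g.
Local Notation nrm := (@nrm R).
Local Notation rc := (@rc R).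
Local Notation im := (@im R).
Local Notation re := (@re R).

Lemma LambdaP (v : V) : v \in Lam <-> exists al be : K,
  [/\ integral al, integral be & forall i, v 0 i = z i * rc (sigma i al) + rc (sigma i be)].
Proof.
split=> [/asboolP[al [be [ia ib ->]]]|[al [be [ia ib vE]]]].
  by exists al, be; split=> // i; rewrite mxE.
by apply/asboolP; exists al, be; split=> //; apply/rowP => i; rewrite mxE vE.
Qed.
Lemma Lambda_discrete : exists2 dl : R, 0 < dl &
  forall lam : V, lam \in Lam -> (forall k, nrm (lam 0 k) < dl) -> lam = 0.
Proof.
have [T [ep [T0 ep0 small _]]] := lattice_bounds.
pose m : R := 1 + \sum_i (im (z i))^-1.
have y0 i : 0 < im (z i) by exact: z_upper.
have s0 : 0 <= \sum_i (im (z i))^-1 by apply: sumr_ge0 => i _; rewrite invr_ge0 ltW.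
have m0 : 0 < m by rewrite ltr_pwDl.
exists (ep / m) => [|lam /LambdaP[al [be [ia ib lE]]] ls]; first by rewrite divr_gt0.
have e1 : ep / m <= ep by rewrite ler_pdivrMr// ler_peMr ?(ltW ep0)// lerDl.
have a0 : al = 0.
  apply: small => // i; have := le_lt_trans (im_le _) (ls i); rewrite lE !reimE mulr0 add0r addr0.
  rewrite normrM (gtr0_norm (y0 i)) => h.
  have yi : (im (z i))^-1 <= m.
    rewrite /m (bigD1 i)//= addrCA lerDl addr_ge0//.
    by apply: sumr_ge0 => j _; rewrite invr_ge0 ltW.
  rewrite -(ltr_pM2l (y0 i)); apply: (lt_le_trans h).
  rewrite ler_pdivrMr// mulrAC -{1}[ep]mul1r ler_wpM2r ?(ltW ep0)//.
  by rewrite -(ler_pM2l (y0 i)) in yi; rewrite mulfV ?gt_eqF// in yi.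
have b0 : be = 0.
  apply: small => // i; have := ls i; rewrite lE a0 rmorph0 rc0 mulr0 add0r nrm_rc => h.
  exact: lt_le_trans h e1.
by apply/rowP => i; rewrite lE a0 b0 !rmorph0 mulr0 addr0 mxE.
Qed.
Lemma Lambda_cocompact : exists rho : R, forall v : V, exists2 lam : V, lam \in Lam &
  forall k, nrm ((v + lam) 0 k) <= rho.
Proof.
have [T [ep [T0 ep0 _ round]]] := lattice_bounds.
have y0 i : 0 < im (z i) by exact: z_upper.
exists (T * (1 + \sum_i im (z i))) => v.
have [al ia alT] := round (fun i => - im (v 0 i) / im (z i)).
have [be ib beT] := round (fun i => - (re (v 0 i) + re (z i) * sigma i al)).
exists (Lambda_vec sigma z al be) => [|i]; first by apply/asboolP; exists al, be.
rewrite !mxE; have := alT i; have := beT i; rewrite -!/(rc _).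
move: (sigma i al) (sigma i be) => s u h1 h2; apply: le_trans (nrm_le _) _.
rewrite !reimE !mulr0 subr0 !add0r !addr0 mulrDr mulr1 lerD//.
  by move: h1; rewrite opprK addrC addrA.
have E : im (v 0 i) + im (z i) * s = im (z i) * (s - - im (v 0 i) / im (z i)).
  by field; rewrite gt_eqF ?y0.
rewrite E normrM (gtr0_norm (y0 i)) mulrC ler_pM ?(ltW (y0 i))//.
by rewrite (bigD1 i)//= lerDl; apply: sumr_ge0 => j _; exact: ltW.
Qed.
(** The targets are - 2 m and m: where one of a, b is near - 2 m the other is near m, so the sum is
    near - m, and elsewhere it is near 2 m. The choice m = |D| + 2 T absorbs both rounding
    errors. *)
Lemma sign_elements (p q : nat) (D : R) : exists a b : K, [/\ integral a, integral b,
  forall i : 'I_g, if (i < p)%N then sigma i a <= - D else D <= sigma i a,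
  forall i : 'I_g, if (p <= i < p + q)%N then sigma i b <= - D else D <= sigma i b &
  forall i : 'I_g, if (i < p + q)%N then sigma i (a + b) <= - D else D <= sigma i (a + b)].
Proof.
have [T [ep [T0 ep0 _ round]]] := lattice_bounds.
pose m := `|D| + 2 * T.
have [a ia aT] := round (fun i => if (i < p)%N then - 2 * m else m).
have [b ib bT] := round (fun i => if (p <= i < p + q)%N then - 2 * m else m).
have Dm := ler_norm D; have D0 := normr_ge0 D.
have mE : m = `|D| + 2 * T by []; clearbody m.
exists a, b; split=> // i; have := aT i; have := bT i; rewrite ?rmorphD /= !ler_norml => /andP[b1 b2] /andP[a1 a2].
- by case: ifP a1 a2 => _ a1 a2; lra.
- by case: ifP b1 b2 => _ b1 b2; lra.
case: (ltnP i p) a1 a2 b1 b2 => ip /= a1 a2 b1 b2; first by rewrite ltn_addr//; lra.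
by case: ifP b1 b2 => _ b1 b2; lra.
Qed.
End Torus.
End NumberField.

(** * Line bundles from factors of automorphy *)

Section Transport.
Variables (R : realType) (g : nat) (Lam : zmodClosed 'rV[Cplx R]_g).
Local Notation C := (Cplx R).
Local Notation V := 'rV[Cplx R]_g.
Local Notation X := (torus Lam).
Local Notation pr := (@torus_proj R g Lam).
Local Notation Dg := (@Dg R g).
Variable E : V -> V -> C.

(* [T i] trivializes the line bundle C^g x C / Lam with factor of automorphy [E]. *)
Definition presents (L : line_bundle Lam) (T : lb_index L -> V -> C) : Prop :=
  [/\ forall (i : lb_index L) v, lb_open i (pr v) -> T i v != 0,
      forall (i : lb_index L) v, lb_open i (pr v) -> differentiable (T i) v,
      forall (i : lb_index L) v mu, mu \in Lam -> lb_open i (pr v) -> T i (v + mu) * E mu v = T i v &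
      forall (i j : lb_index L) v, lb_open i (pr v) -> lb_open j (pr v) -> lb_trans i j (pr v) = T i v / T j v].

Hypothesis E_sm : forall lam, @sm R g setT (E lam).
Hypothesis E_neq0 : forall lam v, E lam v != 0.
Hypothesis E_hol : forall k lam v, Dg ci k (E lam) v = 0.
Variables (P N : seq 'I_g).
Hypothesis NP : forall k, k \in N ++ P.
Local Notation DD := (Dg ci).
Local Notation SE := (@SS R g Lam E).
Local Notation FX := (FF pr DD SE (N ++ P)).
Local Notation gs := (FF pr DD SE P setT).
Local Notation span := (span pr DD SE P).
Local Notation nulc := (nulc pr DD SE P).
Local Notation rep := (rep pr DD SE P).
Local Notation SE_sh := (@SS_sheaf R g Lam E).
Local Notation fDloc := (@DS_loc R g Lam).
Local Notation fDD := (@DS_add R g Lam E).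
Local Notation fDZ := (@DS_scale R g Lam E).
Local Notation Sh := (FF_sheaf SE_sh fDloc fDD fDZ (N ++ P)).

Variables (L : line_bundle Lam) (T : lb_index L -> V -> C).
Hypothesis LT : presents T.
Local Notation lo := (@lb_open R g Lam L).

Lemma T_neq0 i v : lo i (pr v) -> T i v != 0. Proof. by case: LT => h _ _ _; exact: h. Qed.
Lemma T_diff i v : lo i (pr v) -> differentiable (T i) v. Proof. by case: LT => _ h _ _; exact: h. Qed.
Lemma T_shift i v mu : mu \in Lam -> lo i (pr v) -> T i (v + mu) * E mu v = T i v.
Proof. by case: LT => _ _ h _; exact: h. Qed.
Lemma T_trans i j v : lo i (pr v) -> lo j (pr v) -> lb_trans i j (pr v) = T i v / T j v.
Proof. by case: LT => _ _ _; exact. Qed.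

Definition idx (x : X) : lb_index L := projT1 (cid (lb_cover L x)).
Lemma idxP x : lo (idx x) x. Proof. exact: projT2 (cid (lb_cover L x)). Qed.
(** Dividing by the trivialization turns a section given in charts into a quasi-periodic function on
    C^g. The chart is chosen point by point; [toF_at] shows that for a section the choice does not
    matter. *)
Definition toF (s : lb_index L -> X -> C) (v : V) : C := s (idx (pr v)) (pr v) / T (idx (pr v)) v.
Definition fromF (F : V -> C) (i : lb_index L) (x : X) : C := T i (repr x) * F (repr x).
Lemma pr_repr (x : X) : pr (repr x) = x. Proof. exact: reprK. Qed.
Lemma repr_pr v : exists2 mu : V, mu \in Lam & repr (pr v) = v + mu.
Proof.
have h : pr (repr (pr v)) = pr v by exact: pr_repr.
by exists (repr (pr v) - v); [exact/prE|rewrite addrC subrK].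
Qed.

Lemma toF_at W s i v : is_section W s -> W (pr v) -> lo i (pr v) -> toF s v = s i (pr v) / T i v.
Proof.
move=> [_ sc] Wv iv; have jv := idxP (pr v); have Ti := T_neq0 iv; have Tj := T_neq0 jv.
by rewrite /toF (sc _ _ _ Wv jv iv) (T_trans jv iv); field; rewrite Ti Tj.
Qed.
Lemma fromF_at W F i v : SE W F -> W (pr v) -> lo i (pr v) -> fromF F i (pr v) = T i v * F v.
Proof.
move=> [_ qF] Wv iv; rewrite /fromF; have [mu hm ->] := repr_pr v.
by rewrite (qF v mu hm Wv) mulrA (T_shift hm iv).
Qed.
Lemma sepholo_div (A : set V) (f h : V -> C) : sepholo A f -> sepholo A h -> (forall v, A v -> h v != 0) ->
  sepholo A (fun v => f v / h v).
Proof.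
move=> hf hh h0 v Av; have [cf xf] := hf v Av; have [ch xh] := hh v Av; split.
  by apply: c_mul cf _; exact: c_inv (h0 v Av) ch.
move=> k; have [l hl] := xf k; have [m hm] := xh k.
have hn : h (sl k v 0) != 0 by rewrite sl0; exact: h0.
by eexists; exact: (xderM hl (xder_comp hm (xderV hn))).
Qed.
Lemma toF_FF W s : open W -> is_section W s -> FX W (toF s).
Proof.
move=> oW sS; apply: (sh_loc Sh) => x Wx; set i := idx x; pose W' := W `&` lo i.
have oW' : open W' by apply: openI oW _; exact: lb_open_open.
exists W'; split=> //; first by split=> //; exact: idxP.
pose A := pr @^-1` W'; have oA : open A by exact: oW'.
have sf : sepholo A (s i \o pr) by apply: differentiable_sepholo => v Av; exact: sS.1.
have sT : sepholo A (T i) by apply: differentiable_sepholo => v Av; apply: T_diff; exact: Av.2.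
have hq := sepholo_div sf sT (fun v Av => T_neq0 (proj2 Av)).
have [sq Dq] := sepholo_sm oA hq.
have eq v : A v -> s i (pr v) / T i v = toF s v by move=> Av; rewrite (toF_at sS Av.1 Av.2).
split; last first.
  move=> k _ v Av; rewrite -(@Dg_ext _ _ A ci k _ _ v oA eq Av); exact: Dq.
split; first exact: sm_ext oA eq sq.
move=> v lam hl Av; have Av' : A (v + lam) by rewrite /A /= pr_lam.
rewrite -!eq// pr_lam// -[in RHS](T_shift hl Av.2); have := E_neq0 lam v; have := T_neq0 (proj2 Av').
by move=> T0 E0; field; rewrite T0 E0.
Qed.
Lemma fromF_section W F : open W -> FX W F -> is_section W (fromF F).
Proof.
move=> oW [SF DF]; split=> [i v [Wv iv]|i j x Wx ix jx]; last first.
  have rx := pr_repr x; rewrite -rx in Wx ix jx *.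
  rewrite !(fromF_at SF)// (T_trans ix jx); have := T_neq0 jx => T0.
  by field; rewrite T0.
have oA : open (pr @^-1` W) by exact: oW.
apply: (@differentiable_near _ _ _ (fun w => T i w * F w)).
  have oA' : open (pr @^-1` (W `&` lo i)) by apply: openI oW _; exact: lb_open_open.
  apply: filterS (open_near oA' (Logic.conj Wv iv : (pr @^-1` (W `&` lo i)) v)) => w [Ww iw].
  by rewrite /= (fromF_at SF).
apply: differentiableM; first exact: T_diff.
by apply: (sm_differentiable oA Wv SF.1) => w k Ww; exact: DF.
Qed.
Lemma toF_eq W s s' : (forall i x, W x -> lo i x -> s i x = s' i x) -> on pr W (toF s) (toF s').
Proof. by move=> h v Wv; rewrite /toF h//; exact: idxP. Qed.
Lemma fromK W F : SE W F -> on pr W (toF (fromF F)) F.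
Proof.
move=> SF v Wv; have jv := idxP (pr v); rewrite /toF (fromF_at SF Wv jv) mulrAC mulfV ?mul1r//.
exact: T_neq0.
Qed.
Lemma toK W s i x : is_section W s -> W x -> lo i x -> fromF (toF s) i x = s i x.
Proof.
move=> sS Wx ix; have rx := pr_repr x; rewrite -rx in Wx ix *.
rewrite /fromF pr_repr (toF_at sS Wx ix) mulrCA mulfV ?mulr1 ?pr_repr//; exact: (T_neq0 ix).
Qed.

Definition toC p (c : cochain L p) : cch X V C p.+1 := fun s => toF (c s).
Definition fromC p (c : cch X V C p.+1) : cochain L p := fun s => fromF (c s).
Lemma toC_d p (c : cochain L p) s v : cd (toC c) s v = toC (cech_d c) s v.
Proof. by rewrite /toC /toF mulr_suml; apply: eq_bigr => k _; rewrite mulrA. Qed.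
Lemma fromC_d p (c : cch X V C p.+1) s i x : cech_d (fromC c) s i x = fromC (cd c) s i x.
Proof. by rewrite /fromC /fromF mulr_sumr; apply: eq_bigr => k _; rewrite mulrCA. Qed.
Lemma toC_isc p U (c : cochain L p) : cov U -> is_cochain U c -> isc FX U (toC c).
Proof. by move=> cU hc s; apply: toF_FF; [exact: (@ov_open _ _ U s cU)|exact: hc]. Qed.
Lemma fromC_isc p U (c : cch X V C p.+1) : cov U -> isc FX U c -> is_cochain U (fromC c).
Proof. by move=> cU hc s; apply: fromF_section; [exact: (@ov_open _ _ U s cU)|exact: hc]. Qed.
Lemma toC_eq p U (b c : cochain L p) : cochain_eq U b c -> ceq pr U (toC b) (toC c).
Proof. by move=> h s; apply: toF_eq => i x; exact: h. Qed.
Lemma fromC_eq p U (b c : cch X V C p.+1) : ceq pr U b c -> cochain_eq U (fromC b) (fromC c).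
Proof. by move=> h s i x sx ix; rewrite /fromC /fromF h//= ?pr_repr. Qed.
Lemma toC0 p s v : toC (@cochain0 _ _ _ L p) s v = 0.
Proof. by rewrite /toC /toF mul0r. Qed.
Lemma toC_cocycle p U (c : cochain L p) : cov U -> is_cocycle U c ->
  isc FX U (toC c) /\ ceq pr U (cd (toC c)) (@c0 X V C p.+2).
Proof.
move=> cU [hc dc]; split; first exact: toC_isc.
by move=> s v sv; rewrite toC_d (toC_eq dc sv) toC0.
Qed.
Lemma fromC_cocycle p U (c : cch X V C p.+1) : cov U -> isc FX U c ->
  ceq pr U (cd c) (@c0 X V C p.+2) -> is_cocycle U (fromC c).
Proof.
move=> cU hc dc; split; first exact: fromC_isc.
by move=> s i x sx ix; rewrite fromC_d (fromC_eq dc sx ix) /fromC /fromF mulr0.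
Qed.
Lemma is_cochain_ref p U U' (c : cochain L p) : refn U' U -> is_cochain U c -> is_cochain U' c.
Proof.
move=> r hc s; have [h1 h2] := hc s; have sub := @ov_sub X _ U' U s r; split.
  by move=> i v [sv iv]; apply: h1; split=> //; exact: sub.
by move=> i j x sx; apply: h2; exact: sub.
Qed.
Lemma null_classP p U (c : cochain L p) : cov U -> is_cochain U c ->
  null_class U c <-> nulc N U (toC c).
Proof.
move=> cU hc; split=> [[U' [cU' r h]]|[U' [cU' r h]]]; exists U'; split=> //.
  case: p c hc h => [|p] c hc h; first by move=> s v sv; rewrite (toC_eq h sv) toC0.
  have [b hb cb] := h; exists (toC b); first exact: toC_isc.
  by move=> s v sv; rewrite toC_d (toC_eq cb sv).
have K s i x : ov U' s x -> lo i x -> c s i x = fromC (toC c) s i x.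
  move=> sx ix; rewrite /fromC /toC (toK (hc s) _ ix)//; exact: (@ov_sub X _ U' U s r).
case: p c hc h K => [|p] c hc h K.
  by move=> s i x sx ix; rewrite K// (fromC_eq h sx ix) /fromC /fromF mulr0.
have [b hb cb] := h; exists (fromC b); first exact: fromC_isc.
by move=> s i x sx ix; rewrite K// (fromC_eq cb sx ix) fromC_d.
Qed.

Hypothesis coh : cohomology_spec pr DD SE P N.
Variables (n : nat) (b : 'I_n -> V -> C).
Hypothesis n0 : (0 < n)%N.
Hypothesis bG : forall i, gs (b i).
Hypothesis b_ind : forall a : 'I_n -> C, span N (fun v => \sum_i a i * b i v) -> forall i, a i = 0.
Hypothesis b_span : forall F, gs F -> exists a : 'I_n -> C, span N (fun v => F v - \sum_i a i * b i v).
Local Notation d := (size N).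

Lemma toC_fromC p U (c : cch X V C p.+1) : isc FX U c -> ceq pr U (toC (fromC c)) c.
Proof. by move=> hc s; apply: fromK; exact: (hc s).1. Qed.

Lemma rep0 l U : cov U -> rep (l := l) U (@c0 X V C (size l).+1) (fun=> 0).
Proof.
move=> cU; elim: l => [|k l IH] /=; first by [].
exists U, (@c0 X V C (size l).+1); split=> //.
- exact: refn_refl.
- by move=> s; apply: (sh_zero (FF_sheaf SE_sh fDloc fDD fDZ _)); exact: (@ov_open _ _ U s cU).
- by move=> s v _; rewrite cd0.
- by apply: (rep_eq (c := @c0 X V C _)) IH; apply: ceq_sym; exact: (cmap0 SE_sh fDZ).
Qed.
Lemma rep_sum m (a : 'I_m -> C) l U (c : 'I_m -> cch X V C (size l).+1) (F : 'I_m -> V -> C) : cov U ->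
  (forall k, rep U (c k) (F k)) ->
  rep U (fun s v => \sum_k a k * c k s v) (fun v => \sum_k a k * F k v).
Proof.
move=> cU; elim: m a c F => [|m IH] a c F H.
  apply: (rep_eq (c := @c0 X V C _)); first by move=> s v _; rewrite big_ord0.
  apply: rep_Fext (rep0 l cU) => v; by rewrite big_ord0.
have := rep_lin SE_sh fDloc fDD fDZ (a ord_max) cU (IH (fun k => a (widen_ord (leqnSn m) k)) _ _ (fun k => H (widen_ord (leqnSn m) k))) (H ord_max).
move=> h; apply: (rep_eq _ (rep_Fext _ h)) => [s v _|v]; by rewrite ?/cadd ?/cscale big_ord_recr.
Qed.
Lemma gs_sum m (a : 'I_m -> C) (F : 'I_m -> V -> C) : (forall k, gs (F k)) -> gs (fun v => \sum_k a k * F k v).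
Proof.
move=> H; have Sh0 := FF_sheaf SE_sh fDloc fDD fDZ P.
apply: (sh_sum Sh0 _ openT) => k; exact: (sh_scale Sh0 _ openT).
Qed.
Lemma isc_sum m (a : 'I_m -> C) p U (c : 'I_m -> cch X V C p) : cov U -> (forall k, isc FX U (c k)) ->
  isc FX U (fun s v => \sum_k a k * c k s v).
Proof.
move=> cU H s; have oo := @ov_open _ _ U s cU.
apply: (sh_sum Sh _ oo) => k; apply: (sh_scale Sh _ oo); exact: H.
Qed.

Lemma H_neq0_unique p : H_neq0 L p -> p = d.
Proof.
move=> [U [c [cU cc nc]]]; apply: contrapT => pd; apply: nc.
have [_ _ _ _ C3] := coh; have [hc dc] := toC_cocycle cU cc.
by apply/(null_classP cU cc.1); exact: C3.
Qed.
Lemma delta_sum m (F : 'I_m -> V -> C) k v : \sum_i (i == k)%:R * F i v = F k v.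
Proof. by rewrite (bigD1 k)//= eqxx mul1r big1 ?addr0// => i /negPf ->; rewrite mul0r. Qed.
Lemma H_neq0_d : H_neq0 L d.
Proof.
have [_ B C1 _ _] := coh; pose k0 := Ordinal n0.
have [U [c [cU hc dc rc_]]] := B _ (bG k0).
have hf := fromC_isc cU hc; exists U, (fromC c); split=> //; first exact: fromC_cocycle.
move=> /(null_classP cU hf) nl; have nl' := nulc_eq (toC_fromC hc) nl.
have := C1 _ _ _ cU (bG k0) hc rc_ nl' => sp.
have : span N (fun v => \sum_i (i == k0)%:R * b i v) by apply: span_ext sp => v; rewrite delta_sum.
by move=> /b_ind/(_ k0)/eqP; rewrite eqxx oner_eq0.
Qed.

Lemma H_dim_other p : p <> d -> H_dim L p 0.
Proof.
move=> pd; exists (fun=> setT), (fun _ => @cochain0 _ _ _ L p); split.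
- exact: covT.
- by case.
- by move=> a _ [].
- move=> U c cU cc; exists (fun=> 0).
  have cU' : cov (fun x => setT `&` U x) by apply: cov_cap => //; exact: covT.
  have r : refn (fun x => setT `&` U x) U by move=> x y [].
  have hc' : is_cochain (fun x => setT `&` U x) (fun s i x => c s i x - lincomb (fun=> 0) (fun _ : 'I_0 => @cochain0 _ _ _ L p) s i x).
    rewrite (_ : (fun s i x => _) = c); first exact: is_cochain_ref r cc.1.
    by apply/funext => s; apply/funext => i; apply/funext => x; rewrite /lincomb big_ord0 subr0.
  apply/(null_classP cU' hc'); have [_ _ _ _ C3] := coh; have [hc dc] := toC_cocycle cU cc.
  have := nulc_ref SE_sh fDloc fDD fDZ cU' r (C3 _ _ _ pd cU hc dc).
  by apply: nulc_eq => s v _; rewrite /toC /toF /lincomb big_ord0 subr0.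
Qed.

Lemma H_dim_d : H_dim L d n.
Proof.
have [A B C1 C2 _] := coh.
have /choice[U0 U0P] : forall k : 'I_n, exists U, exists c : cch X V C d.+1,
    [/\ cov U, isc FX U c, ceq pr U (cd c) (@c0 X V C d.+2) & rep U c (b k)] by move=> k; exact: B (bG k).
have /choice[c0_ cP] := U0P.
(* The n cocycles come with their own coverings, and [H_dim] wants a common one: a finite
   intersection. *)
pose U x : set X := [set y | forall k, U0 k x y].
have cU : cov U.
  move=> x; split; last by move=> k; have [h _ _ _] := cP k; exact: (h x).2.
  rewrite openE => y Uy; have : \forall w \near nbhs y, forall k, U0 k x w.
    apply: filter_forall => k; have [h _ _ _] := cP k; have [oo _] := h x.
    by move: oo; rewrite openE => /(_ y (Uy k)).
  by [].
have r k : refn U (U0 k) by move=> x y; apply.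
have hc k : isc FX U (c0_ k) by have [_ h _ _] := cP k; exact: (isc_ref Sh (r k) h).
have dc k : ceq pr U (cd (c0_ k)) (@c0 X V C d.+2) by have [_ _ h _] := cP k; exact: ceq_ref (r k) h.
have rc_ k : rep U (c0_ k) (b k) by have [_ _ _ h] := cP k; exact: (rep_ref SE_sh fDloc fDD fDZ cU (r k) h).
have lcE (a : 'I_n -> C) (W : X -> set X) : refn W U ->
    ceq pr W (toC (lincomb a (fun k => fromC (c0_ k)))) (fun s v => \sum_k a k * c0_ k s v).
  move=> rW s v sv; rewrite /toC /toF /lincomb mulr_suml; apply: eq_bigr => k _.
  rewrite -mulrA; congr (_ * _); exact: (ceq_ref rW (toC_fromC (hc k)) sv).
have lcc (a : 'I_n -> C) : is_cochain U (lincomb a (fun k => fromC (c0_ k))).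
  have h := fromC_isc cU (isc_sum a cU hc).
  rewrite (_ : lincomb _ _ = fromC (fun s v => \sum_k a k * c0_ k s v))//.
  apply/funext => s; apply/funext => i; apply/funext => x.
  by rewrite /fromC /fromF mulr_sumr; apply: eq_bigr => k _; rewrite mulrCA.
exists U, (fun k => fromC (c0_ k)); split=> //.
- by move=> k; exact: fromC_cocycle.
- move=> a /(null_classP cU (lcc a)) nl; apply: b_ind.
  have nl' := nulc_eq (lcE a U (@refn_refl _ U)) nl.
  exact: (C1 _ _ _ cU (gs_sum a bG) (isc_sum a cU hc) (rep_sum a cU rc_) nl').
- move=> W c cW cc; have [hcc dcc] := toC_cocycle cW cc.
  have [F [W' [gF cW' rW' rF]]] := A _ _ cW hcc dcc.
  have [a sa] := b_span gF; exists a.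
  set UW := fun x => U x `&` W x; have cUW : cov UW by exact: cov_cap.
  have rU : refn UW U by move=> x y [].
  have rW : refn UW W by move=> x y [].
  have h1 := is_cochain_ref rW cc.1; have h2 := is_cochain_ref rU (lcc a).
  have hd : is_cochain UW (fun s i x => c s i x - lincomb a (fun k => fromC (c0_ k)) s i x).
    move=> s; have [k1 k2] := h1 s; have [k3 k4] := h2 s; split=> [i v iv|i j x sx ix jx].
      by apply: differentiableB; [exact: k1|exact: k3].
    by rewrite (k2 i j x sx ix jx) (k4 i j x sx ix jx) mulrBr.
  apply/(null_classP cUW hd).
  pose UW' := capU U W'; have cUW' : cov UW' by exact: cov_cap.
  have rr : refn UW' UW by move=> x y [hU hW]; split=> //; exact: rW'.
  have rr1 : refn UW' W' by move=> x y [].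
  have rr2 : refn UW' U by move=> x y [].
  apply: (nulc_unref rr).
  have e1 : ceq pr UW' (toC (fun s i x => c s i x - lincomb a (fun k => fromC (c0_ k)) s i x))
     (cadd (toC c) (cscale (-1) (fun s v => \sum_k a k * c0_ k s v))).
    move=> s v sv; rewrite /cadd /cscale mulN1r -(lcE a UW' rr2 s v sv) /toC /toF mulrBl//.
  have R1 := rep_ref SE_sh fDloc fDD fDZ cUW' rr1 rF.
  have R2 := rep_ref SE_sh fDloc fDD fDZ cUW' rr2 (rep_sum a cU rc_).
  have RR := rep_lin SE_sh fDloc fDD fDZ (-1) cUW' R1 R2.
  have h3 := isc_ref Sh (refn_trans rr rW) hcc.
  have h4 := isc_ref Sh rr2 (isc_sum a cU hc).
  have h34 := iscD Sh cUW' h3 (iscZ Sh (-1) cUW' h4).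
  apply: (nulc_eq (ceq_sym e1)).
  apply: (C2 _ _ _ cUW' _ h34 RR).
    apply: (sh_add (FF_sheaf SE_sh fDloc fDD fDZ P) openT gF).
    exact: (sh_scale (FF_sheaf SE_sh fDloc fDD fDZ P) (-1) openT (gs_sum a bG)).
  by apply: span_ext sa => v; rewrite mulN1r.
Qed.

Lemma index_of_presented : has_index L d.
Proof. by split; [exact: H_neq0_d|move=> p /H_neq0_unique]. Qed.
Lemma non_degenerate_of_presented : non_degenerate L.
Proof.
exists ((-1) ^+ d * n%:Z); last by rewrite mulf_neq0 ?signr_eq0// -lt0n.
exists (fun j => if j == d then n else 0%N), d.+1; split.
- by move=> j; case: eqP => [->|/H_dim_other//]; exact: H_dim_d.
- by move=> j dj; rewrite gtn_eqF.
- rewrite big_ord_recr /= eqxx big1 ?add0r// => i _.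
  by rewrite ltn_eqF// mulr0.
Qed.
End Transport.

(** * The line bundle of a factor of automorphy *)

Section Bundle.
Variables (R : realType) (g : nat) (Lam : zmodClosed 'rV[Cplx R]_g).
Local Notation C := (Cplx R).
Local Notation V := 'rV[Cplx R]_g.
Local Notation X := (torus Lam).
Local Notation pr := (@torus_proj R g Lam).
Local Notation nrm := (@nrm R).
Variable E : V -> V -> C.
Hypothesis E_sm : forall lam, @sm R g setT (E lam).
Hypothesis E_neq0 : forall lam v, E lam v != 0.
Hypothesis E_coc : forall lam mu v, lam \in Lam -> mu \in Lam -> E (lam + mu) v = E lam (v + mu) * E mu v.
Hypothesis E_hol : forall k lam v, Dg ci k (E lam) v = 0.
Variable dl : R.
Hypothesis dl0 : 0 < dl.
Hypothesis disc : forall lam : V, lam \in Lam -> (forall k, nrm (lam 0 k) < dl) -> lam = 0.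
Implicit Types (v w lam mu : V).

(** On the orbit of a small ball around w the trivialization is the factor at the unique lam that
    brings v into the ball; the cocycle identity gives its behaviour under the lattice. Outside the
    orbit it is still a value of E and hence nonzero. *)
Definition bundle_triv w v : C := E (lamof Lam w (r0 dl) v) v.
Lemma bundle_triv_at w v lam : lam \in Lam -> Bl w (r0 dl) (v + lam) -> bundle_triv w v = E lam v.
Proof. by move=> hl hB; rewrite /bundle_triv (lamofE disc (r02 dl) hl hB). Qed.
Lemma bundle_triv_shift w v mu : mu \in Lam -> @PB R g Lam w (r0 dl) (pr v) -> bundle_triv w (v + mu) * E mu v = bundle_triv w v.
Proof.
move=> hm /PBE[lam hl hB]; have hlm : lam - mu \in Lam by exact: rpredB.
have vE : v + mu + (lam - mu) = v + lam by rewrite [lam - mu]addrC addrA addrK.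
rewrite (bundle_triv_at hl hB) (@bundle_triv_at w (v + mu) (lam - mu))//; last by rewrite vE.
by rewrite -E_coc// subrK.
Qed.
Lemma bundle_triv_diff w v : @PB R g Lam w (r0 dl) (pr v) -> differentiable (bundle_triv w) v.
Proof.
move=> /PBE[lam hl hB]; apply: (@differentiable_near _ _ _ (E lam)); last first.
  exact: (sm_differentiable openT I (E_sm lam) (fun x k _ => E_hol k lam x)).
apply: filterS (open_near (open_trans (lam := lam) (@Bl_open R g w (r0 dl))) hB) => u uB.
by rewrite (bundle_triv_at hl uB).
Qed.
Definition bundle_trans w w' (x : X) : C := bundle_triv w (repr x) / bundle_triv w' (repr x).
Lemma bundle_trans_pr w w' v : @PB R g Lam w (r0 dl) (pr v) -> @PB R g Lam w' (r0 dl) (pr v) ->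
  bundle_trans w w' (pr v) = bundle_triv w v / bundle_triv w' v.
Proof.
move=> hw hw'; rewrite /bundle_trans; have [mu hm ->] := repr_pr Lam v.
rewrite -(bundle_triv_shift hm hw) -(bundle_triv_shift hm hw'); have := E_neq0 mu v => n0.
have n1 : bundle_triv w' (v + mu) != 0 by exact: E_neq0.
by field; rewrite n0 n1.
Qed.
Fact bundle_holo w w' : holomorphic_on (@PB R g Lam w (r0 dl) `&` @PB R g Lam w' (r0 dl)) (bundle_trans w w').
Proof.
move=> v [vw vw']; pose A : set V := pr @^-1` (@PB R g Lam w (r0 dl) `&` @PB R g Lam w' (r0 dl)).
have oA : open A by apply: openI; exact: PB_open.
have Av : A v by [].
apply: (@differentiable_near _ _ _ (fun u => bundle_triv w u / bundle_triv w' u)).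
  apply: filterS (open_near oA Av) => u [uw uw']; by rewrite /= bundle_trans_pr.
have s1 : sepholo A (bundle_triv w) by apply: differentiable_sepholo => u Au; exact: bundle_triv_diff Au.1.
have s2 : sepholo A (bundle_triv w') by apply: differentiable_sepholo => u Au; exact: bundle_triv_diff Au.2.
have [sq Dq] := sepholo_sm oA (sepholo_div s1 s2 (fun u _ => E_neq0 _ _)).
exact: (sm_differentiable oA Av sq (fun x k Ax => Dq k x Ax)).
Qed.
Fact bundle_open w : open (@PB R g Lam w (r0 dl)). Proof. exact: PB_open. Qed.
Fact bundle_cover (x : X) : exists w, @PB R g Lam w (r0 dl) x.
Proof.
exists (repr x); exists (repr x); last exact: pr_repr.
by apply: Bl_center; exact: r0_gt0.
Qed.
Fact bundle_neq0 w w' (x : X) : @PB R g Lam w (r0 dl) x -> @PB R g Lam w' (r0 dl) x -> bundle_trans w w' x != 0.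
Proof. by move=> _ _; rewrite mulf_neq0// ?invr_neq0//; exact: E_neq0. Qed.
Fact bundle_cocycle w w' w'' (x : X) : @PB R g Lam w (r0 dl) x -> @PB R g Lam w' (r0 dl) x ->
  @PB R g Lam w'' (r0 dl) x -> bundle_trans w w'' x = bundle_trans w w' x * bundle_trans w' w'' x.
Proof.
move=> _ _ _; rewrite /bundle_trans; have n1 : bundle_triv w' (repr x) != 0 by exact: E_neq0.
have n2 : bundle_triv w'' (repr x) != 0 by exact: E_neq0.
by field; rewrite n1 n2.
Qed.
Definition bundle : line_bundle Lam :=
  LineBundle bundle_open bundle_cover bundle_holo bundle_neq0 bundle_cocycle.
Lemma bundle_presents : presents E (L := bundle) bundle_triv.
Proof.
split.
- by move=> i v _; exact: E_neq0.
- by move=> i v; exact: bundle_triv_diff.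
- by move=> i v mu hm; exact: bundle_triv_shift.
- by move=> i j v; exact: bundle_trans_pr.
Qed.
End Bundle.

(** The tensor product has pairs as chart indices and is not literally the bundle built from the
    product factor. The cohomology is computed for any presented bundle, so no isomorphism between
    the two has to be constructed. *)
Lemma tensor_presents (R : realType) (g : nat) (Lam : zmodClosed 'rV[Cplx R]_g)
    (E E' : 'rV[Cplx R]_g -> 'rV[Cplx R]_g -> Cplx R) (L M : line_bundle Lam) T T' :
  presents E (L := L) T -> presents E' (L := M) T' ->
  presents (fun lam v => E lam v * E' lam v) (L := tensor L M) (fun a v => T a.1 v * T' a.2 v).
Proof.
move=> [a1 a2 a3 a4] [b1 b2 b3 b4]; split.
- by move=> i v [iv jv]; rewrite mulf_neq0 ?a1 ?b1.
- by move=> i v [iv jv]; apply: differentiableM; [exact: a2|exact: b2].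
- by move=> i v mu hm [iv jv]; rewrite mulrACA a3// b3.
- move=> i j v [iv iv'] [jv jv']; transitivity (T i.1 v / T j.1 v * (T' i.2 v / T' j.2 v)).
    by rewrite -a4// -b4.
  by rewrite invfM mulrACA.
Qed.

(** * The factors of automorphy of algebraic integers *)

Section Main.
Variables (R : realType) (K : fieldExtType rat) (g : nat).
Hypothesis dimK : \dim {:K} = g.
Variable sigma : 'I_g -> {rmorphism K -> R}.
Hypothesis sigmaP : forall tau : {rmorphism K -> R}, exists! i, sigma i =1 tau.
Variable z : 'I_g -> Cplx R.
Hypothesis z_upper : forall i, 0 < complex.Im (z i).
Local Notation Lam := (Lambda sigma z).
Local Notation C := (Cplx R).
Local Notation V := 'rV[Cplx R]_g.
Local Notation nrm := (@nrm R).
Local Notation rc := (@rc R).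
Local Notation im := (@im R).
Local Notation re := (@re R).
Local Notation integral := (@in_ring_of_integers K).
Implicit Types (a : K) (v lam mu : V).

Definition place_weight a i : R := pi * sigma i a / im (z i).
Definition place_factor a lam : C :=
  ex (- (ci * \sum_i rc (place_weight a i) * rc (im (lam 0 i)) ^+ 2 * (z i * rc (im (z i))^-1))).
Local Notation Ea a := (Ew (place_weight a) (place_factor a)).
Lemma y0 i : im (z i) != 0.
Proof. by rewrite gt_eqF// z_upper. Qed.
Definition expo a lam v (i : 'I_g) : C :=
  - ci * (rc (place_weight a i) * rc (im (lam 0 i)) ^+ 2 * (z i * rc (im (z i))^-1)
    + 2 * (rc (place_weight a i) * rc (im (lam 0 i)) * v 0 i)).
Lemma EaE a lam v : Ea a lam v = ex (\sum_i expo a lam v i).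
Proof.
rewrite /Ew /place_factor -exD; congr ex; rewrite -mulr_sumr big_split /= -[in RHS]mulr_sumr; ring.
Qed.
Lemma place_factor_neq0 a lam : place_factor a lam != 0. Proof. exact: ex_neq0. Qed.
Lemma ex_period (n : int) : ex (2 * ci * rc pi * rc n%:~R) = 1 :> C.
Proof.
have e1 : ex (2 * ci * rc pi) = 1 :> C.
  rewrite -[RHS](un1 R) un.unlock; congr ex; rewrite mulr1 rcM rc_nat; ring.
have en (m : nat) : ex (2 * ci * rc pi * rc m%:R) = 1 :> C.
  elim: m => [|m IH]; first by rewrite rc0 mulr0 ex0.
  have -> : rc m.+1%:R = rc m%:R + 1 by rewrite -natr1 rcD rc1.
  by rewrite (mulrDr (2 * ci * rc pi)) exD IH mulr1 e1 mulr1.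
case: n => n; first exact: en.
by rewrite NegzE mulrNz rcN mulrN exN en invr1.
Qed.
(** For lam given by (alpha, beta) and mu by (alpha', beta'), the exponents of the two sides differ
    by 2 pi i times the trace of a alpha beta', which is an integer. *)
Lemma Ea_coc a lam mu v : integral a -> lam \in Lam -> mu \in Lam ->
  Ea a (lam + mu) v = Ea a lam (v + mu) * Ea a mu v.
Proof.
move=> ia /LambdaP[al [be [ial ibe lE]]] /LambdaP[al' [be' [ial' ibe' mE]]].
have [n nE] := trace_int dimK sigmaP (integral_prod (integral_prod ia ial) ibe').
rewrite !EaE -exD -[RHS]mul1r -(ex_period n) -exD; congr ex.
have -> : rc n%:~R = \sum_i rc (sigma i (a * al * be')) by rewrite -nE raddf_sum.
rewrite mulr_sumr -!big_split /=; apply: eq_bigr => i _.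
rewrite /expo !mxE lE mE !rmorphM /= !reimE !mulr0 !add0r !addr0 /place_weight !(rcM, rcV, rcD).
have := y0 i; rewrite -(rc_eq0 (im (z i))); move: (rc (im (z i))) => Y Y0.
by field.
Qed.
Lemma re_sum (I : Type) (r : seq I) (F : I -> C) : re (\sum_(i <- r) F i) = \sum_(i <- r) re (F i).
Proof. exact: (big_morph re (@reD R) (@re0 R)). Qed.
Lemma nrm_Ea a lam v : nrm (Ea a lam v) = expR (wt (place_weight a) (v + lam) - wt (place_weight a) v).
Proof.
rewrite EaE nrm_ex re_sum /wt -sumrB; congr expR; apply: eq_bigr => i _.
rewrite /expo !mxE imD -!rcX -!rcM !reimE; have := y0 i; move: (im (z i)) (place_weight a i) => Y c Y0.
by field.
Qed.
Lemma Ea_add a b lam v : Ea (a + b) lam v = Ea a lam v * Ea b lam v.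
Proof.
rewrite !EaE -exD; congr ex; rewrite -big_split; apply: eq_bigr => i _ /=.
by rewrite /expo /place_weight rmorphD /= !(rcM, rcD); ring.
Qed.

Lemma size_interval lo hi : (lo <= hi <= g)%N -> size [seq i : 'I_g <- enum 'I_g | (lo <= i < hi)%N] = (hi - lo)%N.
Proof.
move=> /andP[lh hg]; rewrite size_filter.
rewrite (_ : count _ _ = count (fun n => lo <= n < hi)%N (map val (enum 'I_g))); last by rewrite count_map.
rewrite val_enum_ord -[g in iota 0 g](subnK hg) addnC iotaD add0n -[hi in iota 0 hi](subnK lh) addnC iotaD add0n !count_cat.
rewrite (eq_in_count (a2 := pred0)) => [|m]; last first.
  by rewrite mem_iota add0n => /andP[_ ml] /=; rewrite leqNgt ml.
rewrite (eq_in_count (a2 := predT) (s := iota lo _)) => [|m]; last first.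
  by rewrite mem_iota subnKC// => ->.
rewrite (eq_in_count (a2 := pred0) (s := iota hi _)) => [|m]; last first.
  by rewrite mem_iota => /andP[hm _] /=; rewrite [(m < hi)%N]ltnNge hm andbF.
by rewrite !count_pred0 count_predT size_iota addn0.
Qed.

Section Index.
Variable dl : R.
Hypothesis dl0 : 0 < dl.
Hypothesis disc : forall lam, lam \in Lam -> (forall k, nrm (lam 0 k) < dl) -> lam = 0.
Definition min_weight : R := 2 * 4 ^+ g.+1 * L0 dl.
Lemma min_weight_gt0 : 0 < min_weight.
Proof. by apply: mulr_gt0 (L0_gt0 dl0); apply: mulr_gt0 => //; exact: exprn_gt0. Qed.
(** The sum bounds every Im z_i, and pi >= 1, so conjugates of a of this size give weights of size
    [min_weight]. *)
Definition threshold : R := min_weight * (1 + \sum_i im (z i)).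
Lemma threshold_weight a i : threshold <= `|sigma i a| -> min_weight <= `|place_weight a i|.
Proof.
have yp j : 0 < im (z j) by exact: z_upper.
move=> h; rewrite /place_weight !normrM normfV (gtr0_norm (yp i)) ger0_norm ?pi_ge0// ler_pdivlMr//.
apply: (@le_trans _ _ threshold); last by apply: (le_trans h); rewrite ler_peMl// (le_trans _ (pi_ge2 R))// ler1n.
rewrite /threshold ler_wpM2l ?(ltW min_weight_gt0)// (bigD1 i)//= addrCA lerDl addr_ge0//.
by apply: sumr_ge0 => j _; exact: ltW.
Qed.

(** The negative places are allowed to form any interval [lo, hi), so that one lemma serves L with
    [0, p), M with [p, p + q) and the tensor product with [0, p + q). *)
Lemma bundle_index a lo hi (L : line_bundle Lam) T : integral a -> (lo <= hi <= g)%N ->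
  (forall i : 'I_g, if (lo <= i < hi)%N then sigma i a <= - threshold else threshold <= sigma i a) ->
  presents (Ea a) (L := L) T -> non_degenerate L /\ has_index L (hi - lo).
Proof.
move=> ia lh sg LT; have yp j : 0 < im (z j) by exact: z_upper.
have t0 : 0 < threshold.
  by rewrite mulr_gt0 ?min_weight_gt0// ltr_pwDl//; apply: sumr_ge0 => j _; exact: ltW.
pose N := [seq i : 'I_g <- enum 'I_g | (lo <= i < hi)%N]; pose P := [seq i : 'I_g <- enum 'I_g | ~~ (lo <= i < hi)%N].
have mN k : (k \in N) = (lo <= k < hi)%N by rewrite mem_filter mem_enum andbT.
have mP k : (k \in P) = ~~ (lo <= k < hi)%N by rewrite mem_filter mem_enum andbT.
have hb k : min_weight <= `|place_weight a k|.
  apply: threshold_weight; have := sg k; case: ifP => _ h.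
    by rewrite ler0_norm; [rewrite lerNr|rewrite (le_trans h)// oppr_le0 ltW].
  exact: le_trans h (ler_norm _).
have c0 k : place_weight a k != 0 by rewrite -normr_gt0 (lt_le_trans min_weight_gt0).
have cP k : k \in P -> 0 < place_weight a k.
  rewrite mP => kP; have := sg k; rewrite (negPf kP) => h.
  by rewrite divr_gt0// mulr_gt0 ?pi_gt0// (lt_le_trans t0).
have cN k : k \in N -> place_weight a k < 0.
  rewrite mN => kN; have := sg k; rewrite kN => h.
  rewrite /place_weight pmulr_llt0 ?invr_gt0// pmulr_rlt0 ?pi_gt0//.
  by apply: (le_lt_trans h); rewrite oppr_lt0.
have uN : uniq N by rewrite filter_uniq// enum_uniq.
have uP : uniq P by rewrite filter_uniq// enum_uniq.
have PN k : (k \in P) || (k \in N) by rewrite mP mN orNb.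
have NP k : k \in N ++ P by rewrite mem_cat orbC.
have [rho cocpt] := Lambda_cocompact dimK sigmaP z_upper.
have coc := fun lam mu v => @Ea_coc a lam mu v ia.
have nE := fun lam v (_ : lam \in Lam) => nrm_Ea a lam v.
have coh := torus_cohomology c0 (place_factor_neq0 a) dl0 disc cocpt coc nE uP uN cP cN.
have [n [b [n0 bG bi bs]]] := cohomology_basis c0 (place_factor_neq0 a) dl0 disc cocpt coc nE uP uN cP cN PN hb.
have E0 := @Ew_neq0 R g (place_weight a) (place_factor a) (place_factor_neq0 a).
rewrite -(size_interval lh); split.
  exact: (non_degenerate_of_presented E0 NP LT coh n0 bG bi bs).
exact: (index_of_presented E0 NP LT coh n0 bG bi).
Qed.
End Index.
End Main.

Theorem theorem2p2 (R : realType) (K : fieldExtType rat) (g : nat)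
  (dimK : \dim {:K} = g)
  (K_totally_real : totally_real R K)
  (sigma : 'I_g -> {rmorphism K -> R})
  (sigmaP : forall tau : {rmorphism K -> R}, exists! i, sigma i =1 tau)
  (p q : nat) (le_pq_g : (p + q <= g)%N)
  (z : 'I_g -> Cplx R) (z_upper : forall i, 0 < complex.Im (z i)) :
  exists L M : line_bundle (Lambda sigma z),
    [/\ [/\ non_degenerate L, non_degenerate M & non_degenerate (tensor L M)],
        has_index L p, has_index M q & has_index (tensor L M) (p + q)].
Proof.
have [dl dl0 disc] := Lambda_discrete dimK sigmaP z_upper.
have [a [b [ia ib sa sb sab]]] := sign_elements dimK sigmaP p q (threshold z dl).
have iab : in_ring_of_integers (a + b).
  by pose toK : {rmorphism int -> K} := intr; exact: (integral_add (RtoK := toK) ia ib).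
have pq : (p <= g)%N by exact: leq_trans (leq_addr _ _) le_pq_g.
pose E c := Ew (place_weight sigma z c) (place_factor sigma z c).
have E0 c := @Ew_neq0 R g (place_weight sigma z c) (place_factor sigma z c) (place_factor_neq0 sigma z c).
pose B c (ic : in_ring_of_integers c) := @bundle R g (Lambda sigma z) (E c) (@Ew_sm _ _ _ _)
  (E0 c) (fun lam mu v => @Ea_coc R K g dimK sigma sigmaP z z_upper c lam mu v ic) (@Ew_hol _ _ _ _) dl dl0 disc.
have BP c ic : presents (E c) (L := B c ic) _ := bundle_presents _ _ _ _ _ _.
exists (B a ia), (B b ib).
have [nL iL] : non_degenerate (B a ia) /\ has_index (B a ia) p.
  rewrite -{1}[p]subn0; apply: (bundle_index dimK sigmaP z_upper dl0 disc ia) (BP a ia) => //.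
have [nM iM] : non_degenerate (B b ib) /\ has_index (B b ib) q.
  rewrite -{1}[q](addKn p); apply: (bundle_index dimK sigmaP z_upper dl0 disc ib) (BP b ib) => //.
  by rewrite leq_addr.
have ET : (fun lam v => E a lam v * E b lam v) = E (a + b).
  by apply/funext => lam; apply/funext => v; rewrite /E Ea_add.
have TP := tensor_presents (BP a ia) (BP b ib); rewrite ET in TP.
have [nT iT] : non_degenerate (tensor (B a ia) (B b ib)) /\ has_index (tensor (B a ia) (B b ib)) (p + q).
  rewrite -[(p + q)%N]subn0; apply: (bundle_index dimK sigmaP z_upper dl0 disc iab) TP => //.
by split.
Qed.
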